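(* Let $g$ satisfy (KPP$_g$) and $f$ satisfy (KPP$_f$). Then for every $i\in\{1,\ldots,N-1\}$ and every non-negative, continuous, bounded, compactly supported initial datum $(u_0,v_0)\not\equiv(0,0)$, the solution $(u,v)$ of (H) satisfies: (i) for all $c>c^*_\infty$, $\lim_{t\to\infty}\sup_{|x_i|\geq ct}(u,v)=(0,0)$, uniformly in $x_j$ for all $j\neq i$; (ii) for all $0<c<c^*_\infty$, $\lim_{t\to\infty}\sup_{|x_i|\leq ct}|(u,v)-(U,V)|=0$, locally uniformly in $x_j$ for all $j\neq i$, where $(U,V)$ is the unique positive bounded steady state of (H) depending only on $x_N$.
   Context: Problem (H) ($N\geq2$, $D,d,\mu,\nu>0$): $u_t-D\Delta u=g(u)$ in $\{x_N<0\}\times(0,\infty)$, $v_t-d\Delta v=f(v)$ in $\{x_N>0\}\times(0,\infty)$, $D\partial_{x_N}u=\nu v-\mu u$, $-d\partial_{x_N}v=\mu u-\nu v$ on $\{x_N=0\}\times(0,\infty)$. (KPP$_g$): $g$ locally Lipschitz, differentiable at $0$, $g(0)=g(1)=0$, $0<g(s)\leq g'(0)s$ on $(0,1)$, $g(s)<0$ for $s>1$. (KPP$_f$): for some $S>0$, $f$ locally Lipschitz, differentiable at $0$, $f(0)=f(S)=0$, $0<f(s)\leq f'(0)s$ on $(0,S)$, $f(s)<0$ for $s>S$. $c_f:=2\sqrt{df'(0)}$, $c_g:=2\sqrt{Dg'(0)}$, and $c^*_\infty:=c_f$ if $\frac{D}{d}\leq2-\frac{g'(0)}{f'(0)}$;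 $c^*_\infty:=c_g$ if $\frac{d}{D}\leq 2-\frac{f'(0)}{g'(0)}$; $c^*_\infty:=c_a:=\frac{|Df'(0)-dg'(0)|}{\sqrt{(D-d)(f'(0)-g'(0))}}$ otherwise. *)

(* Defs.v *)
From Stdlib Require Import Reals Lra Arith.
Open Scope R_scope.

(* A point of R^N is written (y, z) with y = (x_1,...,x_{N-1}) the tangential
   coordinates, indexed by k = 0..N-2 (coordinate x_{k+1}), and z = x_N. *)
Definition tang (N : nat) : Type := {k : nat | (k < N - 1)%nat}.

Definition coord {N : nat} (y : tang N -> R) (k : nat) : R :=
  match lt_dec k (N - 1) with
  | left h => y (exist _ k h)
  | right _ => 0
  end.

Definition upd {N : nat} (y : tang N -> R) (k : nat) (s : R) : tang N -> R :=
  fun j => if Nat.eq_dec (proj1_sig j) k then s else y j.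

Definition loc_lipschitz (h : R -> R) : Prop :=
  forall M, 0 < M -> exists L, forall a b, Rabs a <= M -> Rabs b <= M ->
    Rabs (h a - h b) <= L * Rabs (a - b).

Definition KPP_g (g : R -> R) (g1 : R) : Prop :=
  loc_lipschitz g /\ derivable_pt_lim g 0 g1 /\ g 0 = 0 /\ g 1 = 0 /\
  (forall s, 0 < s < 1 -> 0 < g s <= g1 * s) /\
  (forall s, 1 < s -> g s < 0).

Definition KPP_f (f : R -> R) (f1 S : R) : Prop :=
  0 < S /\ loc_lipschitz f /\ derivable_pt_lim f 0 f1 /\ f 0 = 0 /\ f S = 0 /\
  (forall s, 0 < s < S -> 0 < f s <= f1 * s) /\
  (forall s, S < s -> f s < 0).

Definition c_f (d f1 : R) : R := 2 * sqrt (d * f1).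
Definition c_g (D g1 : R) : R := 2 * sqrt (D * g1).
Definition c_a (D d f1 g1 : R) : R :=
  Rabs (D * f1 - d * g1) / sqrt ((D - d) * (f1 - g1)).

Definition c_star_inf (D d f1 g1 : R) : R :=
  if Rle_dec (D / d) (2 - g1 / f1) then c_f d f1
  else if Rle_dec (d / D) (2 - f1 / g1) then c_g D g1
  else c_a D d f1 g1.

Definition has_left_deriv (h : R -> R) (a l : R) : Prop :=
  forall eps, 0 < eps -> exists delta, 0 < delta /\
    forall x, - delta < x < 0 -> Rabs ((h (a + x) - h a) / x - l) < eps.
Definition has_right_deriv (h : R -> R) (a l : R) : Prop :=
  forall eps, 0 < eps -> exists delta, 0 < delta /\
    forall x, 0 < x < delta -> Rabs ((h (a + x) - h a) / x - l) < eps.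

Definition cont_on2 {N : nat} (P : R -> Prop) (w : (tang N -> R) -> R -> R) : Prop :=
  forall y z, P z -> forall eps, 0 < eps -> exists delta, 0 < delta /\
    forall y' z', P z' -> (forall j, Rabs (y' j - y j) < delta) ->
      Rabs (z' - z) < delta -> Rabs (w y' z' - w y z) < eps.

Definition cont_on3 {N : nat} (P : R -> Prop) (w : (tang N -> R) -> R -> R -> R) : Prop :=
  forall y z t, P z -> 0 <= t -> forall eps, 0 < eps -> exists delta, 0 < delta /\
    forall y' z' t', P z' -> 0 <= t' -> (forall j, Rabs (y' j - y j) < delta) ->
      Rabs (z' - z) < delta -> Rabs (t' - t) < delta ->
      Rabs (w y' z' t' - w y z t) < eps.

Definition classical_eq (N : nat) (P : R -> Prop) (Dc : R) (h : R -> R)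
  (w : (tang N -> R) -> R -> R -> R) : Prop :=
  exists wt wz wzz : (tang N -> R) -> R -> R -> R,
  exists wy wyy : nat -> (tang N -> R) -> R -> R -> R,
  forall y z t, P z -> 0 < t ->
    derivable_pt_lim (fun s => w y z s) t (wt y z t) /\
    derivable_pt_lim (fun s => w y s t) z (wz y z t) /\
    derivable_pt_lim (fun s => wz y s t) z (wzz y z t) /\
    (forall k, (k < N - 1)%nat ->
       derivable_pt_lim (fun s => w (upd y k s) z t) (coord y k) (wy k y z t) /\
       derivable_pt_lim (fun s => wy k (upd y k s) z t) (coord y k) (wyy k y z t)) /\
    wt y z t = Dc * (sum_f_R0 (fun k => wyy k y z t) (N - 2) + wzz y z t) + h (w y z t).

Definition solves_H (N : nat) (D d mu nu : R) (g f : R -> R)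
  (u0 v0 : (tang N -> R) -> R -> R) (u v : (tang N -> R) -> R -> R -> R) : Prop :=
  classical_eq N (fun z => z < 0) D g u /\
  classical_eq N (fun z => 0 < z) d f v /\
  cont_on3 (fun z => z <= 0) u /\
  cont_on3 (fun z => 0 <= z) v /\
  (forall y t, 0 < t -> exists du dv,
     has_left_deriv (fun s => u y s t) 0 du /\
     has_right_deriv (fun s => v y s t) 0 dv /\
     D * du = nu * v y 0 t - mu * u y 0 t /\
     - d * dv = mu * u y 0 t - nu * v y 0 t) /\
  (forall y z, z <= 0 -> u y z 0 = u0 y z) /\
  (forall y z, 0 <= z -> v y z 0 = v0 y z) /\
  (forall T, 0 < T -> exists M, forall y z t, 0 <= t <= T ->
     (z <= 0 -> Rabs (u y z t) <= M) /\ (0 <= z -> Rabs (v y z t) <= M)).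

Definition admissible_data {N : nat} (u0 v0 : (tang N -> R) -> R -> R) : Prop :=
  (forall y z, z <= 0 -> 0 <= u0 y z) /\
  (forall y z, 0 <= z -> 0 <= v0 y z) /\
  cont_on2 (fun z => z <= 0) u0 /\
  cont_on2 (fun z => 0 <= z) v0 /\
  (exists M, forall y z, (z <= 0 -> Rabs (u0 y z) <= M) /\ (0 <= z -> Rabs (v0 y z) <= M)) /\
  (exists R0, 0 < R0 /\ forall y z, (R0 < Rabs z \/ exists j, R0 < Rabs (y j)) ->
      (z <= 0 -> u0 y z = 0) /\ (0 <= z -> v0 y z = 0)) /\
  ~ ((forall y z, z <= 0 -> u0 y z = 0) /\ (forall y z, 0 <= z -> v0 y z = 0)).

Definition steady_xN (D d mu nu : R) (g f : R -> R) (U V : R -> R) : Prop :=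
  (exists U1 U2 V1 V2 : R -> R,
     (forall z, z < 0 -> derivable_pt_lim U z (U1 z) /\
        derivable_pt_lim U1 z (U2 z) /\ D * U2 z + g (U z) = 0) /\
     (forall z, 0 < z -> derivable_pt_lim V z (V1 z) /\
        derivable_pt_lim V1 z (V2 z) /\ d * V2 z + f (V z) = 0)) /\
  (exists dU dV, has_left_deriv U 0 dU /\ has_right_deriv V 0 dV /\
     D * dU = nu * V 0 - mu * U 0 /\ - d * dV = mu * U 0 - nu * V 0) /\
  (forall z, z <= 0 -> 0 < U z) /\ (forall z, 0 <= z -> 0 < V z) /\
  (exists M, forall z, (z <= 0 -> U z <= M) /\ (0 <= z -> V z <= M)).

(* Main.v *)
(* Idea. With w_1 = mu u (reflected to z > 0) and w_2 = nu v the problem becomes symmetric: two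
   KPP equations on the half-space z > 0 coupled by -a_k d_z w_k = w_{3-k} - w_k at z = 0. Everything
   is obtained from comparison at a first touching point with explicit barriers, so neither
   existence nor regularity theory for parabolic equations is needed.
   Upper speed: exp(-al (x_i - c t)), constant in z, is a supersolution when D_k al^2 + l_k <= c al
   for both k, and c*_oo = min over al of max over k of (D_k al^2 + l_k) / al.
   Lower speed: at the optimal al there are fractions th_k of time, th_1 + th_2 = 1, such that
   travelling in medium k at speed 2 D_k al for a fraction th_k of the time gives the mean speed
   c*_oo and total growth exactly 0. At slightly smaller speeds a bump moved alternately in the two
   media gains more in a long period than it loses by crossing the interface.
   Convergence: once w is bounded below, paraboloids give crude bounds, and translates of heteroclinic
   orbits of D_k Q'' + phi(Q) = 0, phi close to F_k, turn bounds of one species at the interface into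
   bounds of the other. The resulting inequalities between the lower and upper limits at z = 0 force
   them to coincide. Applied to a steady state, this also yields uniqueness. *)

Require Import Defs.
From Stdlib Require Import Reals Ranalysis5 Lra Lia Psatz Arith Classical ClassicalEpsilon FunctionalExtensionality.
From Coquelicot Require Import Coquelicot.
Open Scope R_scope.

(** * One-dimensional tests at a minimum *)

(** The half-spaces are unbounded and the solution is only continuous up to the interface, with a
    one-sided normal derivative there. Touching points are therefore sought in compact boxes: a
    barrier must lie strictly below the solution on the initial and lateral sides of the box, and
    its differential inequalities must be strict at contact, so that neither a Hopf lemma nor a
    strong maximum principle enters. This dictates the shapes used: bumps that are negative outside
    a ball, paraboloids, penalised exponentials, orbits whose translation parameter grows away from
    a point. A crossing of the interface costs a factor independent of the length of the period,
    which is why any positive mean growth wins over long periods. Limits are lower and upper limits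
    along an abstract filter of events, not limits of translated solutions. They coincide because of
    opposite monotonicities: in the medium with the larger saturation level the slope of a profile
    at the interface decreases with its trace, in the other medium it increases. *)

Definition has_deriv2 (F : R -> R) (x h : R) : Prop :=
  exists G, locally x (fun s => is_derive F s (G s)) /\ is_derive G x h.

Lemma locally_R_iff (x : R) (P : R -> Prop) :
  locally x P <-> exists e, 0 < e /\ forall s, Rabs (s - x) < e -> P s.
Proof.
  split.
  - intros [e He]. exists e; split; [apply cond_pos|].
    intros s Hs. apply He. exact Hs.
  - intros [e [He H]]. exists (mkposreal e He). intros s Hs. apply H. exact Hs.
Qed.

Lemma is_derive_quotient (F : R -> R) (x l eps : R) :
  is_derive F x l -> 0 < eps ->
  exists e, 0 < e /\ forall s, s <> 0 -> Rabs s < e -> Rabs ((F (x + s) - F x) / s - l) < eps.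
Proof.
  intros H He. apply is_derive_Reals in H. destruct (H eps He) as [e Hd].
  exists e; split; [apply cond_pos|exact Hd].
Qed.

Lemma is_derive_min_eq0 (F : R -> R) (x l : R) :
  is_derive F x l -> locally x (fun s => F x <= F s) -> l = 0.
Proof.
  intros H Hm. apply locally_R_iff in Hm. destruct Hm as [e [He Hm]].
  destruct (Req_dec l 0) as [|Hl]; [assumption|exfalso].
  destruct (is_derive_quotient F x l (Rabs l) H) as [e2 [He2 Hq]].
  { now apply Rabs_pos_lt. }
  set (s := Rmin e e2 / 2).
  assert (Hs : 0 < s) by (unfold s; pose proof (Rmin_glb_lt e e2 0 He He2); lra).
  assert (Hs1 : s < e) by (unfold s; pose proof (Rmin_l e e2); lra).
  assert (Hs2 : s < e2) by (unfold s; pose proof (Rmin_r e e2); lra).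
  destruct (Rle_dec 0 l) as [Hp|Hn].
  - assert (Hq' := Hq (- s) ltac:(lra) ltac:(rewrite Rabs_Ropp, Rabs_pos_eq; lra)).
    assert (Hmm := Hm (x + - s) ltac:(replace (x + - s - x) with (- s) by ring; rewrite Rabs_Ropp, Rabs_pos_eq; lra)).
    rewrite (Rabs_pos_eq l) in Hq' by lra.
    assert (Hn : (F (x + - s) - F x) / - s <= 0).
    { replace ((F (x + - s) - F x) / - s) with (- ((F (x + - s) - F x) / s)) by (field; lra).
      assert (0 <= (F (x + - s) - F x) / s) by (apply Rdiv_le_0_compat; lra). lra. }
    apply Rabs_def2 in Hq'. lra.
  - assert (Hq' := Hq s ltac:(lra) ltac:(rewrite Rabs_pos_eq; lra)).
    assert (Hmm := Hm (x + s) ltac:(replace (x + s - x) with s by ring; rewrite Rabs_pos_eq; lra)).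
    rewrite (Rabs_left l) in Hq' by lra.
    assert (Hp : 0 <= (F (x + s) - F x) / s) by (apply Rdiv_le_0_compat; lra).
    apply Rabs_def2 in Hq'. lra.
Qed.

(** If [h < 0], the first derivative [G], which vanishes at [x], is negative just to the right of
    [x], and the mean value theorem makes [F] decrease there. *)
Lemma has_deriv2_min (F : R -> R) (x h : R) :
  has_deriv2 F x h -> locally x (fun s => F x <= F s) -> 0 <= h.
Proof.
  intros [G [HF HG]] Hm.
  assert (G0 : G x = 0) by (apply is_derive_min_eq0 with F x; [exact (locally_singleton _ _ HF)|exact Hm]).
  destruct (Rle_dec 0 h) as [|Hh]; [assumption|exfalso].
  apply locally_R_iff in HF. destruct HF as [e1 [He1 HF]].
  apply locally_R_iff in Hm. destruct Hm as [e2 [He2 Hm]].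
  destruct (is_derive_quotient G x h (- h) HG ltac:(lra)) as [e3 [He3 HG']].
  set (s := Rmin (Rmin e1 e2) e3 / 2).
  assert (Hs : 0 < s) by (unfold s; pose proof (Rmin_glb_lt _ _ 0 (Rmin_glb_lt e1 e2 0 He1 He2) He3); lra).
  assert (Hs1 : s < e1) by (unfold s in *; pose proof (Rmin_l (Rmin e1 e2) e3); pose proof (Rmin_l e1 e2); lra).
  assert (Hs2 : s < e2) by (unfold s in *; pose proof (Rmin_l (Rmin e1 e2) e3); pose proof (Rmin_r e1 e2); lra).
  assert (Hs3 : s < e3) by (unfold s in *; pose proof (Rmin_r (Rmin e1 e2) e3); lra).
  destruct (MVT_cor2 F G x (x + s) ltac:(lra)) as [c [Hc Hcx]].
  { intros c Hc. apply is_derive_Reals, HF. rewrite Rabs_pos_eq; lra. }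
  assert (Hmm := Hm (x + s) ltac:(replace (x + s - x) with s by ring; rewrite Rabs_pos_eq; lra)).
  assert (Hq := HG' (c - x) ltac:(lra) ltac:(rewrite Rabs_pos_eq; lra)).
  replace (x + (c - x)) with c in Hq by ring. rewrite G0 in Hq.
  apply Rabs_def2 in Hq. destruct Hq as [Hq _].
  assert (Hneg : (G c - 0) / (c - x) < 0) by lra.
  assert (G c < 0).
  { apply Rmult_lt_reg_r with (/ (c - x)); [apply Rinv_0_lt_compat; lra|].
    unfold Rdiv in Hneg. lra. }
  nra.
Qed.

Lemma has_deriv2_minus (F1 F2 : R -> R) (x h1 h2 : R) :
  has_deriv2 F1 x h1 -> has_deriv2 F2 x h2 -> has_deriv2 (fun s => F1 s - F2 s) x (h1 - h2).
Proof.
  intros [G1 [H1 H1']] [G2 [H2 H2']]. exists (fun s => G1 s - G2 s). split.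
  - apply filter_imp with (2 := filter_and _ _ H1 H2). intros s [Ha Hb].
    apply (is_derive_minus F1 F2 s); assumption.
  - apply (is_derive_minus G1 G2 x); assumption.
Qed.

Lemma has_deriv2_global (F G : R -> R) (x h : R) :
  (forall s, is_derive F s (G s)) -> is_derive G x h -> has_deriv2 F x h.
Proof.
  intros H1 H2. exists G. split; [apply filter_forall; exact H1|exact H2].
Qed.

Lemma has_deriv2_ext (F1 F2 : R -> R) (x h : R) :
  (forall s, F1 s = F2 s) -> has_deriv2 F1 x h -> has_deriv2 F2 x h.
Proof.
  intros He. replace F2 with F1; [easy|]. now apply functional_extensionality.
Qed.

(** Only the past is compared, because at a first touching time nothing is known about later times;
    this gives a sign instead of a zero derivative. *)
Lemma is_derive_past_min (F : R -> R) (x l e : R) :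
  is_derive F x l -> 0 < e -> (forall s, x - e < s < x -> F x <= F s) -> l <= 0.
Proof.
  intros H He Hm. destruct (Rle_dec l 0) as [|Hl]; [assumption|exfalso].
  destruct (is_derive_quotient F x l l H ltac:(lra)) as [e2 [He2 Hq]].
  set (s := Rmin e e2 / 2).
  assert (Hs : 0 < s) by (unfold s; pose proof (Rmin_glb_lt e e2 0 He He2); lra).
  assert (Hs1 : s < e) by (unfold s; pose proof (Rmin_l e e2); lra).
  assert (Hs2 : s < e2) by (unfold s; pose proof (Rmin_r e e2); lra).
  assert (Hq' := Hq (- s) ltac:(lra) ltac:(rewrite Rabs_Ropp, Rabs_pos_eq; lra)).
  assert (Hmm := Hm (x + - s) ltac:(lra)).
  assert (Hn : (F (x + - s) - F x) / - s <= 0).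
  { replace ((F (x + - s) - F x) / - s) with (- ((F (x + - s) - F x) / s)) by (field; lra).
    assert (0 <= (F (x + - s) - F x) / s) by (apply Rdiv_le_0_compat; lra). lra. }
  apply Rabs_def2 in Hq'. lra.
Qed.

Lemma has_right_deriv_min (F : R -> R) (a l e : R) :
  has_right_deriv F a l -> 0 < e -> (forall x, 0 < x < e -> F a <= F (a + x)) -> 0 <= l.
Proof.
  intros H He Hm. destruct (Rle_dec 0 l) as [|Hl]; [assumption|exfalso].
  destruct (H (- l) ltac:(lra)) as [e2 [He2 Hq]].
  set (s := Rmin e e2 / 2).
  assert (Hs : 0 < s) by (unfold s; pose proof (Rmin_glb_lt e e2 0 He He2); lra).
  assert (Hs1 : s < e) by (unfold s; pose proof (Rmin_l e e2); lra).
  assert (Hs2 : s < e2) by (unfold s; pose proof (Rmin_r e e2); lra).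
  assert (Hq' := Hq s ltac:(lra)). assert (Hmm := Hm s ltac:(lra)).
  assert (Hp : 0 <= (F (a + s) - F a) / s) by (apply Rdiv_le_0_compat; lra).
  apply Rabs_def2 in Hq'. lra.
Qed.

Lemma has_right_deriv_minus (F1 F2 : R -> R) (a l1 l2 : R) :
  has_right_deriv F1 a l1 -> has_right_deriv F2 a l2 ->
  has_right_deriv (fun s => F1 s - F2 s) a (l1 - l2).
Proof.
  intros H1 H2 eps He.
  destruct (H1 (eps / 2) ltac:(lra)) as [e1 [He1 Hq1]].
  destruct (H2 (eps / 2) ltac:(lra)) as [e2 [He2 Hq2]].
  exists (Rmin e1 e2). split; [apply Rmin_glb_lt; lra|].
  intros x Hx. pose proof (Rmin_l e1 e2). pose proof (Rmin_r e1 e2).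
  specialize (Hq1 x ltac:(lra)). specialize (Hq2 x ltac:(lra)).
  replace ((F1 (a + x) - F2 (a + x) - (F1 a - F2 a)) / x - (l1 - l2)) with
    (((F1 (a + x) - F1 a) / x - l1) - ((F2 (a + x) - F2 a) / x - l2)) by (field; lra).
  apply Rabs_def2 in Hq1. apply Rabs_def2 in Hq2. apply Rabs_def1; lra.
Qed.

Lemma has_right_deriv_scal (F : R -> R) (a l k : R) :
  has_right_deriv F a l -> has_right_deriv (fun s => k * F s) a (k * l).
Proof.
  intros H eps He.
  destruct (H (eps / (Rabs k + 1))) as [e [He' Hq]].
  { apply Rdiv_lt_0_compat; [lra|]. pose proof (Rabs_pos k). lra. }
  exists e. split; [assumption|]. intros x Hx. specialize (Hq x Hx).
  replace ((k * F (a + x) - k * F a) / x - k * l) with (k * ((F (a + x) - F a) / x - l)) by (field; lra).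
  rewrite Rabs_mult. pose proof (Rabs_pos k).
  apply Rle_lt_trans with (Rabs k * (eps / (Rabs k + 1))).
  - apply Rmult_le_compat_l; lra.
  - apply Rmult_lt_reg_r with (Rabs k + 1); [lra|]. field_simplify; [|lra]. nra.
Qed.

Lemma is_derive_right (F : R -> R) (a l : R) :
  is_derive F a l -> has_right_deriv F a l.
Proof.
  intros H eps He. destruct (is_derive_quotient F a l eps H He) as [e [He' Hq]].
  exists e. split; [assumption|]. intros x Hx. apply Hq; [lra|rewrite Rabs_pos_eq; lra].
Qed.

Lemma sum_f_R0_nonneg (A : nat -> R) (n : nat) :
  (forall k, (k <= n)%nat -> 0 <= A k) -> 0 <= sum_f_R0 A n.
Proof.
  induction n as [|n IH]; intros H; simpl; [apply H; lia|].
  apply Rplus_le_le_0_compat; [apply IH; intros; apply H; lia|apply H; lia].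
Qed.

(** * Pointwise heat operator *)

(** Values at a single point of the time derivative and of the Laplacian. The solution and the
    explicit barriers share this form, so their difference can be tested at one minimum. *)
Definition heat_at {N : nat} (w : (tang N -> R) -> R -> R -> R) (y : tang N -> R)
  (z t wt lap : R) : Prop :=
  is_derive (fun s => w y z s) t wt /\
  exists wzz wyy, has_deriv2 (fun s => w y s t) z wzz /\
    (forall k, (k < N - 1)%nat -> has_deriv2 (fun s => w (upd y k s) z t) (coord y k) (wyy k)) /\
    lap = sum_f_R0 wyy (N - 2) + wzz.

Lemma coord_lt {N : nat} (y : tang N -> R) (k : nat) (h : (k < N - 1)%nat) :
  coord y k = y (exist _ k h).
Proof.
  unfold coord. destruct (lt_dec k (N - 1)) as [h'|h']; [|contradiction].
  f_equal. f_equal. apply Peano_dec.le_unique.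
Qed.

Lemma coord_proj {N : nat} (y : tang N -> R) (j : tang N) : coord y (proj1_sig j) = y j.
Proof. destruct j as [k h]. apply coord_lt. Qed.

Lemma upd_coord {N : nat} (y : tang N -> R) (k : nat) : upd y k (coord y k) = y.
Proof.
  apply functional_extensionality. intros j. unfold upd.
  destruct (Nat.eq_dec (proj1_sig j) k) as [<-|]; [apply coord_proj|reflexivity].
Qed.

Lemma coord_upd_same {N : nat} (y : tang N -> R) (k : nat) (s : R) :
  (k < N - 1)%nat -> coord (upd y k s) k = s.
Proof.
  intros h. rewrite (coord_lt _ k h). unfold upd. simpl.
  destruct (Nat.eq_dec k k); [reflexivity|contradiction].
Qed.

Lemma coord_upd_other {N : nat} (y : tang N -> R) (k l : nat) (s : R) :
  k <> l -> coord (upd y k s) l = coord y l.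
Proof.
  intros Hn. unfold coord. destruct (lt_dec l (N - 1)); [|reflexivity].
  unfold upd. simpl. destruct (Nat.eq_dec l k); [congruence|reflexivity].
Qed.

Lemma upd_upd {N : nat} (y : tang N -> R) (k : nat) (s r : R) : upd (upd y k s) k r = upd y k r.
Proof.
  apply functional_extensionality. intros j. unfold upd.
  destruct (Nat.eq_dec (proj1_sig j) k); reflexivity.
Qed.

Lemma classical_eq_heat_at (N : nat) (D : R) (h : R -> R) (w : (tang N -> R) -> R -> R -> R) :
  classical_eq N (fun z => 0 < z) D h w ->
  forall y z t, 0 < z -> 0 < t ->
  exists wt lap, heat_at w y z t wt lap /\ wt = D * lap + h (w y z t).
Proof.
  intros (wt & wz & wzz & wy & wyy & H) y z t Hz Ht.
  exists (wt y z t), (sum_f_R0 (fun k => wyy k y z t) (N - 2) + wzz y z t).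
  destruct (H y z t Hz Ht) as (H1 & H2 & H3 & H4 & H5).
  split; [|exact H5]. split; [now apply is_derive_Reals|].
  exists (wzz y z t), (fun k => wyy k y z t). split; [|split; [|reflexivity]].
  - exists (fun s => wz y s t). split; [|now apply is_derive_Reals].
    apply locally_R_iff. exists z. split; [assumption|]. intros s Hs.
    apply is_derive_Reals. apply H; [|assumption]. apply Rabs_def2 in Hs. lra.
  - intros k Hk. destruct (H4 k Hk) as [Ha Hb].
    exists (fun s => wy k (upd y k s) z t). split; [|now apply is_derive_Reals].
    (* The equation differentiates only at the current coordinate; applied at the moved point
       [upd y k s] it gives the derivative along the whole line. *)
    apply filter_forall. intros s. apply is_derive_Reals.
    destruct (H (upd y k s) z t Hz Ht) as (_ & _ & _ & H6 & _).
    destruct (H6 k Hk) as [H7 _]. rewrite (coord_upd_same y k s Hk) in H7.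
    replace (fun r => w (upd y k r) z t) with (fun r => w (upd (upd y k s) k r) z t); [exact H7|].
    apply functional_extensionality. intros r. now rewrite upd_upd.
Qed.

Lemma heat_at_minus {N : nat} (w b : (tang N -> R) -> R -> R -> R) y z t wt wl bt bl :
  heat_at w y z t wt wl -> heat_at b y z t bt bl ->
  heat_at (fun y z t => w y z t - b y z t) y z t (wt - bt) (wl - bl).
Proof.
  intros [H1 (a1 & a2 & H2 & H3 & H4)] [K1 (b1 & b2 & K2 & K3 & K4)].
  split; [apply (is_derive_minus (fun s => w y z s) (fun s => b y z s)); assumption|].
  exists (a1 - b1), (fun k => a2 k - b2 k). split; [|split].
  - apply (has_deriv2_minus (fun s => w y s t) (fun s => b y s t)); assumption.
  - intros k Hk. apply (has_deriv2_minus (fun s => w (upd y k s) z t) (fun s => b (upd y k s) z t)); auto.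
  - rewrite H4, K4, minus_sum. ring.
Qed.

Lemma heat_at_min {N : nat} (w : (tang N -> R) -> R -> R -> R) y z t wt wl r :
  heat_at w y z t wt wl -> 0 < r ->
  (forall y' z', (forall j, Rabs (y' j - y j) < r) -> Rabs (z' - z) < r -> w y z t <= w y' z' t) ->
  (forall s, t - r < s < t -> w y z t <= w y z s) ->
  (2 <= N)%nat -> wt <= 0 /\ 0 <= wl.
Proof.
  intros [H1 (a1 & a2 & H2 & H3 & H4)] Hr Hsp Hti HN. split.
  - now apply is_derive_past_min with (fun s => w y z s) t r.
  - rewrite H4. apply Rplus_le_le_0_compat.
    + apply sum_f_R0_nonneg. intros k Hk.
      apply has_deriv2_min with (fun s => w (upd y k s) z t) (coord y k).
      * apply H3. lia.
      * apply locally_R_iff. exists r. split; [assumption|]. intros s Hs.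
        rewrite upd_coord. apply Hsp.
        -- intros j. unfold upd. destruct (Nat.eq_dec (proj1_sig j) k) as [<-|].
           ++ now rewrite <- coord_proj.
           ++ replace (y j - y j) with 0 by ring. now rewrite Rabs_R0.
        -- replace (z - z) with 0 by ring. now rewrite Rabs_R0.
    + apply has_deriv2_min with (fun s => w y s t) z; [assumption|].
      apply locally_R_iff. exists r. split; [assumption|]. intros s Hs. apply Hsp; [|assumption].
      intros j. replace (y j - y j) with 0 by ring. now rewrite Rabs_R0.
Qed.

(** * Compactness of boxes and the first touching point *)

Lemma bounded_subsequence (x : nat -> R) (M : R) :
  (forall n, Rabs (x n) <= M) ->
  exists (phi : nat -> nat) (l : R), (forall n, (phi n < phi (S n))%nat) /\
    is_lim_seq (fun n => x (phi n)) l.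
Proof.
  intros Hb.
  destruct (Bolzano_Weierstrass x (fun c => - M <= c <= M) (compact_P3 (- M) M)) as [l Hl].
  { intros n. specialize (Hb n). now apply Rabs_le_between in Hb. }
  assert (H : forall nN : nat * nat, exists p, (snd nN <= p)%nat /\ Rabs (x p - l) < / (INR (fst nN) + 1)).
  { intros [n K]. simpl.
    assert (Hp : 0 < / (INR n + 1)) by (apply Rinv_0_lt_compat; pose proof (pos_INR n); lra).
    destruct (Hl (disc l (mkposreal _ Hp)) K) as [p [Hp1 Hp2]].
    - exists (mkposreal _ Hp). intros y Hy. exact Hy.
    - exists p. split; [exact Hp1|exact Hp2]. }
  apply choice in H. destruct H as [f Hf].
  (* Passing the rank [S (phi m)] to the selection function makes the extraction strictly
     increasing, while [n] controls the distance to [l]. *)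
  set (phi := fix phi n := match n with O => f (O, O) | S m => f (S m, S (phi m)) end).
  exists phi, l. split.
  - intros n. simpl. destruct (Hf (S n, S (phi n))) as [H _]. simpl in H. lia.
  - apply is_lim_seq_Reals. intros eps He.
    destruct (archimed_cor1 eps He) as [K [HK1 HK2]].
    exists K. intros n Hn. unfold Rdist.
    assert (Hx : Rabs (x (phi n) - l) < / (INR n + 1)).
    { destruct n; [exact (proj2 (Hf (O, O)))|exact (proj2 (Hf (S n, S (phi n))))]. }
    apply Rlt_trans with (1 := Hx). apply Rle_lt_trans with (2 := HK1).
    apply Rinv_le_contravar; [apply lt_0_INR; lia|]. apply le_INR in Hn. lra.
Qed.

Lemma bounded_multi_subsequence (K : nat) (x : nat -> nat -> R) (M : R) :
  (forall n k, (k < K)%nat -> Rabs (x n k) <= M) ->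
  exists phi : nat -> nat, (forall n, (phi n < phi (S n))%nat) /\
    exists l : nat -> R, forall k, (k < K)%nat -> is_lim_seq (fun n => x (phi n) k) (l k).
Proof.
  induction K as [|K IH]; intros Hb.
  - exists (fun n => n). split; [lia|]. exists (fun _ => 0). lia.
  - destruct IH as [phi [Hphi [l Hl]]]; [intros; apply Hb; lia|].
    destruct (bounded_subsequence (fun n => x (phi n) K) M) as [chi [c [Hchi Hc]]].
    { intros n. apply Hb. lia. }
    exists (fun n => phi (chi n)). split.
    + assert (Hmono : forall a b, (a < b)%nat -> (phi a < phi b)%nat).
      { intros a b Hab. induction Hab; [apply Hphi|]. specialize (Hphi m). lia. }
      intros n. apply Hmono, Hchi.
    + exists (fun k => if Nat.eq_dec k K then c else l k). intros k Hk.
      destruct (Nat.eq_dec k K) as [->|Hn]; [exact Hc|].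
      apply (is_lim_seq_subseq (fun n => x (phi n) k) (l k) chi); [now apply eventually_subseq|].
      apply Hl. lia.
Qed.

Lemma eventually_forall_lt (K : nat) (P : nat -> nat -> Prop) :
  (forall k, (k < K)%nat -> eventually (P k)) -> eventually (fun n => forall k, (k < K)%nat -> P k n).
Proof.
  induction K as [|K IH]; intros H.
  - exists O. lia.
  - destruct IH as [n1 H1]; [intros; apply H; lia|]. destruct (H K ltac:(lia)) as [n2 H2].
    exists (Nat.max n1 n2). intros n Hn k Hk.
    destruct (Nat.eq_dec k K) as [->|]; [apply H2; lia|apply H1; lia].
Qed.

Definition in_box {N : nat} (y0 : tang N -> R) (R0 L t0 t1 : R) (y : tang N -> R) (z t : R) : Prop :=
  (forall j, Rabs (y j - y0 j) <= R0) /\ 0 <= z <= L /\ t0 <= t <= t1.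

Definition near_pt {N : nat} (e : R) (y : tang N -> R) (z t : R) (y' : tang N -> R) (z' t' : R) : Prop :=
  (forall j, Rabs (y' j - y j) < e) /\ Rabs (z' - z) < e /\ Rabs (t' - t) < e.

Definition cont_box {N : nat} (y0 : tang N -> R) (R0 L t0 t1 : R) (w : (tang N -> R) -> R -> R -> R) : Prop :=
  forall y z t, in_box y0 R0 L t0 t1 y z t -> forall eps, 0 < eps ->
  exists delta, 0 < delta /\ forall y' z' t', in_box y0 R0 L t0 t1 y' z' t' ->
    near_pt delta y z t y' z' t' -> Rabs (w y' z' t' - w y z t) < eps.

Lemma box_compact {N : nat} (y0 : tang N -> R) (R0 L t0 t1 : R)
  (yn : nat -> tang N -> R) (zn tn : nat -> R) :
  (forall n, in_box y0 R0 L t0 t1 (yn n) (zn n) (tn n)) ->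
  exists phi, (forall n, (phi n < phi (S n))%nat) /\
  exists y z t, in_box y0 R0 L t0 t1 y z t /\
    forall eps, 0 < eps -> eventually (fun n => near_pt eps y z t (yn (phi n)) (zn (phi n)) (tn (phi n))).
Proof.
  intros Hb.
  (* All coordinates in one family, shifted so that the size of the box bounds them: index 0 is [z],
     index 1 is time, index [k + 2] is the tangential coordinate [k]. *)
  set (x := fun n k => match k with O => zn n | S O => tn n - t0 | S (S k) => coord (yn n) k - coord y0 k end).
  destruct (bounded_multi_subsequence (S (S (N - 1))) x (Rabs R0 + Rabs L + Rabs (t1 - t0)))
    as [phi [Hphi [l Hl]]].
  { intros n k Hk. destruct (Hb n) as [H1 [H2 H3]].
    pose proof (Rabs_pos R0). pose proof (Rabs_pos L). pose proof (Rabs_pos (t1 - t0)).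
    pose proof (Rle_abs R0). pose proof (Rle_abs L). pose proof (Rle_abs (t1 - t0)).
    destruct k as [|[|k]]; simpl.
    - rewrite Rabs_pos_eq; lra.
    - rewrite Rabs_pos_eq; lra.
    - assert (h : (k < N - 1)%nat) by lia. rewrite (coord_lt _ k h), (coord_lt y0 k h).
      specialize (H1 (exist _ k h)). lra. }
  exists phi. split; [exact Hphi|].
  set (y := fun j : tang N => y0 j + l (S (S (proj1_sig j)))).
  exists y, (l O), (t0 + l (S O)).
  assert (Hc : forall eps, 0 < eps ->
    eventually (fun n => near_pt eps y (l O) (t0 + l (S O)) (yn (phi n)) (zn (phi n)) (tn (phi n)))).
  { intros eps He.
    assert (Hall : eventually (fun n => forall k, (k < S (S (N - 1)))%nat -> Rabs (x (phi n) k - l k) < eps)).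
    { apply eventually_forall_lt. intros k Hk.
      destruct (proj2 (is_lim_seq_spec _ _) (Hl k Hk) (mkposreal eps He)) as [K HK].
      exists K. exact HK. }
    destruct Hall as [K HK]. exists K. intros n Hn. specialize (HK n Hn).
    split; [|split].
    - intros [k h]. specialize (HK (S (S k)) ltac:(lia)). simpl in HK.
      rewrite (coord_lt _ k h), (coord_lt y0 k h) in HK. unfold y. simpl.
      replace (yn (phi n) (exist _ k h) - (y0 (exist _ k h) + l (S (S k)))) with
        (yn (phi n) (exist _ k h) - y0 (exist _ k h) - l (S (S k))) by ring. exact HK.
    - exact (HK O ltac:(lia)).
    - specialize (HK 1%nat ltac:(lia)). simpl in HK.
      replace (tn (phi n) - (t0 + l 1%nat)) with (tn (phi n) - t0 - l 1%nat) by ring. exact HK. }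
  split; [|exact Hc].
  assert (Hlim : forall (c : R) (u : R), (forall eps, 0 < eps -> u <= c + eps) -> u <= c).
  { intros c u H. apply le_epsilon. exact H. }
  repeat split.
  - intros j. apply Hlim. intros eps He. destruct (Hc eps He) as [K HK].
    destruct (HK K (Nat.le_refl _)) as [H1 _]. specialize (H1 j).
    destruct (Hb (phi K)) as [H2 _]. specialize (H2 j).
    replace (y j - y0 j) with ((yn (phi K) j - y0 j) - (yn (phi K) j - y j)) by ring.
    eapply Rle_trans; [apply Rabs_triang|]. rewrite Rabs_Ropp. lra.
  - apply Hlim. intros eps He. destruct (Hc eps He) as [K HK].
    destruct (HK K (Nat.le_refl _)) as [_ [H1 _]]. apply Rabs_def2 in H1.
    destruct (Hb (phi K)) as [_ [H2 _]]. lra.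
  - apply Hlim. intros eps He. destruct (Hc eps He) as [K HK].
    destruct (HK K (Nat.le_refl _)) as [_ [H1 _]]. apply Rabs_def2 in H1.
    destruct (Hb (phi K)) as [_ [H2 _]]. lra.
  - apply Hlim. intros eps He. destruct (Hc eps He) as [K HK].
    destruct (HK K (Nat.le_refl _)) as [_ [_ H1]]. apply Rabs_def2 in H1.
    destruct (Hb (phi K)) as [_ [_ H2]]. lra.
  - apply Hlim. intros eps He. destruct (Hc eps He) as [K HK].
    destruct (HK K (Nat.le_refl _)) as [_ [_ H1]]. apply Rabs_def2 in H1.
    destruct (Hb (phi K)) as [_ [_ H2]]. lra.
Qed.

(** If some component were non-positive somewhere, compactness of the box would make the infimum of
    the bad times attained, at a zero of one component. Before that time both components are
    positive, hence both are non-negative at it by continuity: this is the configuration that the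
    third hypothesis excludes. The two components are treated together because at the interface the
    test of one uses the sign of the other. *)
Lemma positive_if_no_first_touch (N : nat) (y0 : tang N -> R) (R0 L t0 t1 : R)
  (psi : bool -> (tang N -> R) -> R -> R -> R) :
  (forall k, cont_box y0 R0 L t0 t1 (psi k)) ->
  (forall k y z, in_box y0 R0 L t0 t1 y z t0 -> 0 < psi k y z t0) ->
  (forall k y z t, in_box y0 R0 L t0 t1 y z t -> t0 < t -> psi k y z t = 0 ->
     (forall k' y' z', in_box y0 R0 L t0 t1 y' z' t -> 0 <= psi k' y' z' t) ->
     (forall s, t0 <= s < t -> 0 < psi k y z s) -> False) ->
  forall k y z t, in_box y0 R0 L t0 t1 y z t -> 0 < psi k y z t.
Proof.
  intros Hcont Hinit Htouch k0 y1 z1 s1 Hb1. apply Rnot_le_lt. intros Hbad.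
  set (bad := fun k s => exists y z, in_box y0 R0 L t0 t1 y z s /\ psi k y z s <= 0).
  (* [completeness] produces suprema, so the times are negated to obtain the infimum [tau]. *)
  destruct (completeness (fun r => exists k, bad k (- r))) as [r [Hub Hlub]].
  { exists (- t0). intros r [k [y [z [[_ [_ Ht]] _]]]]. lra. }
  { exists (- s1), k0. rewrite Ropp_involutive. exists y1, z1. auto. }
  set (tau := - r).
  assert (Hinf : forall k s, bad k s -> tau <= s).
  { intros k s Hs. assert (- s <= r); [apply Hub; exists k; now rewrite Ropp_involutive|unfold tau; lra]. }
  assert (Happ : forall eps, 0 < eps -> exists k s, bad k s /\ s < tau + eps).
  { intros eps He. apply NNPP. intros Hn.
    assert (r <= r - eps); [|lra]. apply Hlub. intros x [k Hk].
    apply Rnot_lt_le. intros Hx. apply Hn. exists k, (- x). split; [exact Hk|unfold tau; lra]. }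
  (* One of the two components has bad times arbitrarily close to [tau]; the minimising sequence is
     taken from that component. *)
  assert (Hpigeon : exists k, forall eps, 0 < eps -> exists s, bad k s /\ s < tau + eps).
  { apply NNPP. intros Hn.
    assert (Hf := not_ex_all_not _ _ Hn).
    destruct (not_all_ex_not _ _ (Hf true)) as [e1 H1]. destruct (not_all_ex_not _ _ (Hf false)) as [e2 H2].
    apply imply_to_and in H1. apply imply_to_and in H2. destruct H1 as [He1 H1]. destruct H2 as [He2 H2].
    destruct (Happ (Rmin e1 e2)) as [k [s [Hs1 Hs2]]]; [now apply Rmin_glb_lt|].
    pose proof (Rmin_l e1 e2). pose proof (Rmin_r e1 e2).
    destruct k; [apply H1|apply H2]; exists s; split; try assumption; lra. }
  destruct Hpigeon as [k Hk].
  assert (Hseq : forall n, exists p : (tang N -> R) * R * R,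
    in_box y0 R0 L t0 t1 (fst (fst p)) (snd (fst p)) (snd p) /\
    psi k (fst (fst p)) (snd (fst p)) (snd p) <= 0 /\ snd p < tau + / (INR n + 1)).
  { intros n. destruct (Hk (/ (INR n + 1))) as [s [[y [z [Hy Hz]]] Hs]].
    - apply Rinv_0_lt_compat. pose proof (pos_INR n). lra.
    - exists (y, z, s). simpl. auto. }
  apply choice in Hseq. destruct Hseq as [p Hp].
  destruct (box_compact y0 R0 L t0 t1 (fun n => fst (fst (p n))) (fun n => snd (fst (p n)))
    (fun n => snd (p n))) as [phi [Hphi [y [z [t [Hb Hconv]]]]]].
  { intros n. apply Hp. }
  assert (Hge : forall n, (n <= phi n)%nat).
  { induction n as [|n IH]; [lia|]. specialize (Hphi n). lia. }
  assert (Ht : t <= tau).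
  { apply le_epsilon. intros eps He.
    destruct (archimed_cor1 (eps / 2) ltac:(lra)) as [K [HK1 HK2]].
    destruct (Hconv (eps / 2) ltac:(lra)) as [K' HK'].
    set (n := Nat.max K K'). destruct (HK' n ltac:(unfold n; lia)) as [_ [_ H1]].
    apply Rabs_def2 in H1. destruct (Hp (phi n)) as [_ [_ H2]].
    assert (/ (INR (phi n) + 1) <= / INR K).
    { apply Rinv_le_contravar; [apply lt_0_INR; lia|].
      assert (INR K <= INR (phi n)) by (apply le_INR; specialize (Hge n); unfold n in *; lia). lra. }
    lra. }
  assert (Hle : psi k y z t <= 0).
  { apply le_epsilon. intros eps He. destruct (Hcont k y z t Hb eps He) as [dl [Hd H1]].
    destruct (Hconv dl Hd) as [K HK]. specialize (HK K (Nat.le_refl _)).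
    destruct (Hp (phi K)) as [H2 [H3 _]].
    specialize (H1 _ _ _ H2 HK). apply Rabs_def2 in H1. lra. }
  assert (Etau : t = tau).
  { apply Rle_antisym; [exact Ht|]. apply Hinf with k. exists y, z. auto. }
  assert (Ht0 : t0 < t).
  { destruct Hb as [Hb1' [Hb2 Hb3]]. destruct (Req_dec t t0) as [E|E]; [|lra].
    exfalso. rewrite E in *. specialize (Hinit k y z ltac:(split; [|split]; auto)). lra. }
  assert (Hpast : forall k' y' z' s, in_box y0 R0 L t0 t1 y' z' s -> s < t -> 0 < psi k' y' z' s).
  { intros k' y' z' s Hs Hst. apply Rnot_le_lt. intros Hn.
    assert (tau <= s); [|lra]. apply Hinf with k'. exists y', z'. auto. }
  assert (Hnow : forall k' y' z', in_box y0 R0 L t0 t1 y' z' t -> 0 <= psi k' y' z' t).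
  { intros k' y' z' Hbx. apply Rnot_lt_le. intros Hneg.
    destruct (Hcont k' y' z' t Hbx (- psi k' y' z' t) ltac:(lra)) as [dl [Hd H1]].
    (* An earlier time of the box within the modulus of continuity, where positivity is already
       known. *)
    set (s := Rmax t0 (t - dl / 2)).
    assert (Hs1 : t0 <= s) by apply Rmax_l. assert (Hs2 : t - dl / 2 <= s) by apply Rmax_r.
    assert (Hs3 : s < t) by (unfold s; apply Rmax_lub_lt; lra).
    assert (Hbs : in_box y0 R0 L t0 t1 y' z' s).
    { destruct Hbx as [A1 [A2 A3]]. split; [|split]; auto. lra. }
    specialize (H1 y' z' s Hbs). specialize (Hpast k' y' z' s Hbs Hs3).
    assert (Hnear : near_pt dl y' z' t y' z' s).
    { split; [|split].
      - intros j. replace (y' j - y' j) with 0 by ring. now rewrite Rabs_R0.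
      - replace (z' - z') with 0 by ring. now rewrite Rabs_R0.
      - apply Rabs_def1; lra. }
    specialize (H1 Hnear). apply Rabs_def2 in H1. lra. }
  apply (Htouch k y z t Hb Ht0).
  - apply Rle_antisym; [exact Hle|now apply Hnow].
  - exact Hnow.
  - intros s Hs. apply Hpast; [|lra]. destruct Hb as [A1 [A2 A3]]. split; [|split]; auto. lra.
Qed.

(** * The coupled system and lower barriers *)

Definition coupled (N : nat) (D a : bool -> R) (F : bool -> R -> R)
  (w : bool -> (tang N -> R) -> R -> R -> R) : Prop :=
  (forall k, classical_eq N (fun z => 0 < z) (D k) (F k) (w k)) /\
  (forall k, cont_on3 (fun z => 0 <= z) (w k)) /\
  (forall k y t, 0 < t -> exists p, has_right_deriv (fun s => w k y s t) 0 p /\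
     - a k * p = w (negb k) y 0 t - w k y 0 t).

(** The uniform structure on [tang N -> R] is that of uniform closeness in all coordinates, which
    agrees with [near_pt]. Asking for continuity on the whole space lets it be proved by
    composition. *)
Definition cont_everywhere {N : nat} (b : (tang N -> R) -> R -> R -> R) : Prop :=
  forall p : (tang N -> R) * R * R, continuous (fun p => b (fst (fst p)) (snd (fst p)) (snd p)) p.

Lemma cont_everywhere_eps {N : nat} (b : (tang N -> R) -> R -> R -> R) y z t eps :
  cont_everywhere b -> 0 < eps ->
  exists delta, 0 < delta /\ forall y' z' t', near_pt delta y z t y' z' t' ->
    Rabs (b y' z' t' - b y z t) < eps.
Proof.
  intros Hc He.
  destruct (proj1 (filterlim_locally _ _) (Hc (y, z, t)) (mkposreal eps He)) as [dl H].
  exists dl. split; [apply cond_pos|]. intros y' z' t' [H1 [H2 H3]].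
  apply (H (y', z', t')). split; [split|]; simpl.
  - intros j. apply H1.
  - exact H2.
  - exact H3.
Qed.

(** Finitely many strict inequalities leave a common margin, obtained by induction on the number of
    coordinates. *)
Lemma in_box_radius {N : nat} (y0 y : tang N -> R) (R0 : R) :
  (forall j, Rabs (y j - y0 j) < R0) -> 0 < R0 ->
  exists r, 0 < r /\ forall y', (forall j, Rabs (y' j - y j) < r) -> forall j, Rabs (y' j - y0 j) <= R0.
Proof.
  intros H HR.
  assert (HK : forall K, exists r, 0 < r /\ forall k, (k < K)%nat -> Rabs (coord y k - coord y0 k) + r <= R0).
  { induction K as [|K [r [Hr IH]]]; [exists 1; split; [lra|lia]|].
    assert (HKK : Rabs (coord y K - coord y0 K) < R0).
    { unfold coord. destruct (lt_dec K (N - 1)); [apply H|]. replace (0 - 0) with 0 by ring. now rewrite Rabs_R0. }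
    exists (Rmin r (R0 - Rabs (coord y K - coord y0 K))). split; [apply Rmin_glb_lt; lra|].
    intros k Hk. destruct (Nat.eq_dec k K) as [->|Hn].
    - pose proof (Rmin_r r (R0 - Rabs (coord y K - coord y0 K))). lra.
    - specialize (IH k ltac:(lia)). pose proof (Rmin_l r (R0 - Rabs (coord y K - coord y0 K))). lra. }
  destruct (HK (N - 1)%nat) as [r [Hr Hrr]]. exists r. split; [assumption|].
  intros y' Hy' j. destruct j as [k h]. specialize (Hrr k h). rewrite !(coord_lt _ k h) in Hrr.
  specialize (Hy' (exist _ k h)).
  replace (y' (exist _ k h) - y0 (exist _ k h)) with
    ((y' (exist _ k h) - y (exist _ k h)) + (y (exist _ k h) - y0 (exist _ k h))) by ring.
  eapply Rle_trans; [apply Rabs_triang|lra].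
Qed.

(** At a first contact with [0 < z], the difference [w - b] has a spatial minimum and a minimum over
    the past, which contradicts the strict subsolution inequality; at a contact with [z = 0] its
    right derivative is non-negative, which contradicts the strict exchange inequality. [act]
    selects the species under comparison: the interface test may use the order of the other species
    only if that one is active. The inequalities on [b] are required at contact points only, so a
    barrier may fail to be a subsolution elsewhere. *)
Lemma lower_barrier (N : nat) (D a : bool -> R) (F : bool -> R -> R)
  (w b : bool -> (tang N -> R) -> R -> R -> R) (act : bool -> bool)
  (y0 : tang N -> R) (R0 L t0 t1 : R) :
  (2 <= N)%nat -> (forall k, 0 < D k) -> (forall k, 0 < a k) ->
  coupled N D a F w -> 0 < R0 -> 0 < L -> 0 <= t0 ->
  (forall k, act k = true -> cont_everywhere (b k)) ->
  (forall k y z t, act k = true -> in_box y0 R0 L t0 t1 y z t ->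
     t = t0 \/ z = L \/ (exists j, Rabs (y j - y0 j) = R0) -> b k y z t < w k y z t) ->
  (forall k y z t, act k = true -> in_box y0 R0 L t0 t1 y z t -> t0 < t -> 0 < z ->
     w k y z t = b k y z t ->
     exists bt bl, heat_at (b k) y z t bt bl /\ bt < D k * bl + F k (b k y z t)) ->
  (forall k y t, act k = true -> in_box y0 R0 L t0 t1 y 0 t -> t0 < t ->
     w k y 0 t = b k y 0 t ->
     (act (negb k) = true -> b (negb k) y 0 t <= w (negb k) y 0 t) ->
     exists p, has_right_deriv (fun s => b k y s t) 0 p /\
       - a k * p < w (negb k) y 0 t - w k y 0 t) ->
  forall k y z t, act k = true -> in_box y0 R0 L t0 t1 y z t -> b k y z t < w k y z t.
Proof.
  intros HN HD Ha [Heq [Hcw Hrob]] HR HL Ht0 Hcb Hbd Hint Hiface.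
  (* The constant 1 makes an inactive species harmless in the touching argument. *)
  set (psi := fun k y z t => if act k then w k y z t - b k y z t else 1).
  assert (Hpos : forall k y z t, in_box y0 R0 L t0 t1 y z t -> 0 < psi k y z t).
  { apply (positive_if_no_first_touch N y0 R0 L t0 t1 psi).
    - intros k y z t Hb eps He. unfold psi. destruct (act k) eqn:Hk.
      + destruct Hb as [Hb1 [Hb2 Hb3]].
        destruct (Hcw k y z t ltac:(lra) ltac:(lra) (eps / 2) ltac:(lra)) as [d1 [Hd1 H1]].
        destruct (cont_everywhere_eps (b k) y z t (eps / 2) (Hcb k Hk) ltac:(lra)) as [d2 [Hd2 H2]].
        exists (Rmin d1 d2). split; [now apply Rmin_glb_lt|].
        intros y' z' t' [B1 [B2 B3]] [N1 [N2 N3]].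
        pose proof (Rmin_l d1 d2). pose proof (Rmin_r d1 d2).
        assert (E1 : Rabs (w k y' z' t' - w k y z t) < eps / 2).
        { apply H1; try lra. intros j. specialize (N1 j). lra. }
        assert (E2 : Rabs (b k y' z' t' - b k y z t) < eps / 2).
        { apply H2. split; [|split]; try lra. intros j. specialize (N1 j). lra. }
        apply Rabs_def2 in E1. apply Rabs_def2 in E2. apply Rabs_def1; lra.
      + exists 1. split; [lra|]. intros. replace (1 - 1) with 0 by ring. now rewrite Rabs_R0.
    - intros k y z Hb. unfold psi. destruct (act k) eqn:Hk; [|lra].
      specialize (Hbd k y z t0 Hk Hb (or_introl eq_refl)). lra.
    - intros k y z t Hb Ht Hz Hsp Hpast. unfold psi in Hz.
      destruct (act k) eqn:Hk; [|lra].
      assert (Hbd' : ~ (t = t0 \/ z = L \/ exists j, Rabs (y j - y0 j) = R0)).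
      { intros Hn. specialize (Hbd k y z t Hk Hb Hn). lra. }
      destruct Hb as [Hb1 [Hb2 Hb3]].
      assert (HzL : z < L) by (destruct (Req_dec z L); [exfalso; tauto|lra]).
      assert (HyR : forall j, Rabs (y j - y0 j) < R0).
      { intros j. destruct (Rle_lt_or_eq_dec _ _ (Hb1 j)) as [|E]; [assumption|].
        exfalso. apply Hbd'. right; right. now exists j. }
      destruct (Rle_lt_or_eq_dec _ _ (proj1 Hb2)) as [Hzp|Hz0].
      + destruct (in_box_radius y0 y R0 HyR HR) as [r [Hr Hyr]].
        destruct (Hint k y z t Hk ltac:(split; [|split]; auto) Ht Hzp ltac:(lra)) as [bt [bl [Hbh Hbs]]].
        destruct (classical_eq_heat_at N (D k) (F k) (w k) (Heq k) y z t Hzp ltac:(lra)) as [wt [wl [Hwh Hwe]]].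
        set (r' := Rmin (Rmin r (t - t0)) (Rmin z (L - z))).
        assert (Hr' : 0 < r') by (unfold r'; repeat apply Rmin_glb_lt; lra).
        assert (Hr1 : r' <= r) by (unfold r'; eapply Rle_trans; [apply Rmin_l|apply Rmin_l]).
        assert (Hr2 : r' <= t - t0) by (unfold r'; eapply Rle_trans; [apply Rmin_l|apply Rmin_r]).
        assert (Hr3 : r' <= z) by (unfold r'; eapply Rle_trans; [apply Rmin_r|apply Rmin_l]).
        assert (Hr4 : r' <= L - z) by (unfold r'; eapply Rle_trans; [apply Rmin_r|apply Rmin_r]).
        destruct (heat_at_min _ y z t _ _ r' (heat_at_minus _ _ y z t _ _ _ _ Hwh Hbh) Hr') as [Hm1 Hm2].
        * intros y' z' Hy' Hz'. rewrite Hz. apply Rabs_def2 in Hz'.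
          specialize (Hsp k y' z'). unfold psi in Hsp. rewrite Hk in Hsp. apply Hsp.
          split; [|split; lra]. apply Hyr. intros j. specialize (Hy' j). lra.
        * intros s Hs. rewrite Hz. specialize (Hpast s). unfold psi in Hpast. rewrite Hk in Hpast.
          specialize (Hpast ltac:(lra)). lra.
        * exact HN.
        * specialize (HD k). assert (0 <= D k * (wl - bl)) by (apply Rmult_le_pos; lra).
          replace (w k y z t) with (b k y z t) in Hwe by lra. nra.
      + subst z. destruct (Hrob k y t ltac:(lra)) as [p [Hp1 Hp2]].
        destruct (Hiface k y t Hk ltac:(split; [|split]; auto) Ht ltac:(lra)) as [q [Hq1 Hq2]].
        { intros Hk'. specialize (Hsp (negb k) y 0). unfold psi in Hsp. rewrite Hk' in Hsp.
          specialize (Hsp ltac:(split; [|split]; auto)). lra. }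
        assert (Hpq : 0 <= p - q).
        { apply (has_right_deriv_min (fun s => w k y s t - b k y s t) 0 (p - q) L).
          - now apply has_right_deriv_minus.
          - exact HL.
          - intros x Hx. rewrite Rplus_0_l, Hz. specialize (Hsp k y x). unfold psi in Hsp. rewrite Hk in Hsp.
            apply Hsp. split; [|split]; auto. lra. }
        specialize (Ha k). nra. }
  intros k y z t Hk Hb. specialize (Hpos k y z t Hb). unfold psi in Hpos. rewrite Hk in Hpos. lra.
Qed.

(** * Tangential square distance *)

Definition sqd {N : nat} (y y0 : tang N -> R) : R :=
  sum_f_R0 (fun k => (coord y k - coord y0 k) ^ 2) (N - 2).

Lemma sum_f_R0_replace (A B : nat -> R) (n k : nat) :
  (k <= n)%nat -> (forall l, l <> k -> A l = B l) ->
  sum_f_R0 B n = sum_f_R0 A n - A k + B k.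
Proof.
  induction n as [|n IH]; intros Hk H.
  - replace k with O by lia. simpl. ring.
  - simpl. destruct (Nat.eq_dec k (S n)) as [->|Hn].
    + assert (E : sum_f_R0 A n = sum_f_R0 B n).
      { apply sum_eq. intros l Hl. apply H. lia. }
      rewrite E. ring.
    + rewrite (IH ltac:(lia) H), (H (S n) ltac:(lia)). ring.
Qed.

Lemma sqd_nonneg {N : nat} (y y0 : tang N -> R) : 0 <= sqd y y0.
Proof. apply sum_f_R0_nonneg. intros. apply pow2_ge_0. Qed.

Lemma sqd_self {N : nat} (y : tang N -> R) : sqd y y = 0.
Proof.
  unfold sqd. rewrite <- (Rmult_0_l (INR (S (N - 2)))), <- sum_cte.
  apply sum_eq. intros. ring.
Qed.

Lemma sqd_upd {N : nat} (y y0 : tang N -> R) (k : nat) (s : R) : (2 <= N)%nat -> (k < N - 1)%nat ->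
  sqd (upd y k s) y0 = sqd y y0 - (coord y k - coord y0 k) ^ 2 + (s - coord y0 k) ^ 2.
Proof.
  intros HN Hk. unfold sqd.
  rewrite (sum_f_R0_replace (fun k => (coord y k - coord y0 k) ^ 2)
    (fun l => (coord (upd y k s) l - coord y0 l) ^ 2) (N - 2) k ltac:(lia)).
  - now rewrite coord_upd_same.
  - intros l Hl. now rewrite coord_upd_other by auto.
Qed.

Lemma sqd_sym {N : nat} (y y0 : tang N -> R) : sqd y y0 = sqd y0 y.
Proof. unfold sqd. apply sum_eq. intros. ring. Qed.

Lemma sqd_upd_r {N : nat} (y y0 : tang N -> R) (k : nat) (s : R) : (2 <= N)%nat -> (k < N - 1)%nat ->
  sqd y (upd y0 k s) = sqd y y0 - (coord y k - coord y0 k) ^ 2 + (coord y k - s) ^ 2.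
Proof.
  intros HN Hk. rewrite sqd_sym, sqd_upd, (sqd_sym y0 y) by assumption. ring.
Qed.

Lemma sum_f_R0_ge_term (A : nat -> R) (n k : nat) :
  (forall l, 0 <= A l) -> (k <= n)%nat -> A k <= sum_f_R0 A n.
Proof.
  intros HA. induction n as [|n IH]; intros Hk; simpl.
  - replace k with O by lia. apply Rle_refl.
  - destruct (Nat.eq_dec k (S n)) as [->|Hn].
    + assert (0 <= sum_f_R0 A n) by (apply sum_f_R0_nonneg; auto). lra.
    + specialize (IH ltac:(lia)). pose proof (HA (S n)). lra.
Qed.

Lemma sqd_ge_coord {N : nat} (y y0 : tang N -> R) (j : tang N) : (y j - y0 j) ^ 2 <= sqd y y0.
Proof.
  destruct j as [k h]. rewrite <- (coord_lt y k h), <- (coord_lt y0 k h).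
  apply (sum_f_R0_ge_term (fun k => (coord y k - coord y0 k) ^ 2)); [intros; apply pow2_ge_0|lia].
Qed.

Lemma sqd_lt_coord {N : nat} (y y0 : tang N -> R) (r : R) :
  0 <= r -> sqd y y0 < r ^ 2 -> forall j, Rabs (y j - y0 j) < r.
Proof.
  intros Hr H j. pose proof (sqd_ge_coord y y0 j).
  rewrite <- (Rabs_pos_eq r) by assumption. apply Rsqr_lt_abs_0. rewrite !Rsqr_pow2. lra.
Qed.

Lemma sqd_le_box {N : nat} (y y0 : tang N -> R) (r : R) : (2 <= N)%nat ->
  (forall j, Rabs (y j - y0 j) <= r) -> sqd y y0 <= INR (N - 1) * r ^ 2.
Proof.
  intros HN H. unfold sqd. replace (N - 1)%nat with (S (N - 2)) by lia.
  rewrite Rmult_comm, <- sum_cte. apply sum_Rle. intros k Hk.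
  assert (h : (k < N - 1)%nat) by lia. rewrite (coord_lt y k h), (coord_lt y0 k h).
  specialize (H (exist _ k h)). rewrite <- (pow2_abs (y _ - _)).
  apply pow_incr. split; [apply Rabs_pos|exact H].
Qed.

(** * Continuity of explicit functions of space and time *)

Lemma continuous_coord {N : nat} (k : nat) (p : (tang N -> R) * R * R) :
  continuous (fun p => coord (fst (fst p)) k) p.
Proof.
  unfold coord. destruct (lt_dec k (N - 1)) as [h|h]; [|apply continuous_const].
  apply filterlim_locally. intros eps. exists eps. intros q [[H _] _]. apply H.
Qed.

Lemma continuous_snd_fst {N : nat} (p : (tang N -> R) * R * R) :
  continuous (fun p => snd (fst p)) p.
Proof. apply continuous_comp; [apply continuous_fst|apply continuous_snd]. Qed.

Lemma continuous_last {N : nat} (p : (tang N -> R) * R * R) : continuous (fun p => snd p) p.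
Proof. apply continuous_snd. Qed.

Lemma continuous_real_comp {T : UniformSpace} (f : T -> R) (g : R -> R) (p : T) :
  continuous f p -> continuous g (f p) -> continuous (fun p => g (f p)) p.
Proof. intros. now apply continuous_comp. Qed.

Lemma continuous_pow {T : UniformSpace} (f : T -> R) (n : nat) (p : T) :
  continuous f p -> continuous (fun p => f p ^ n) p.
Proof.
  intros H. induction n as [|n IH]; simpl.
  - apply continuous_const.
  - apply (continuous_mult f (fun p => f p ^ n)); assumption.
Qed.

Lemma continuous_sum_f {T : UniformSpace} (f : nat -> T -> R) (n : nat) (p : T) :
  (forall k, continuous (f k) p) -> continuous (fun p => sum_f_R0 (fun k => f k p) n) p.
Proof.
  intros H. induction n as [|n IH]; simpl; [apply H|].
  apply (continuous_plus (fun p => sum_f_R0 (fun k => f k p) n) (f (S n))); auto.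
Qed.

Lemma continuous_exp_comp {T : UniformSpace} (f : T -> R) (p : T) :
  continuous f p -> continuous (fun p => exp (f p)) p.
Proof.
  intros H. apply (continuous_real_comp f exp); [exact H|]. apply (ex_derive_continuous exp).
  exists (exp (f p)). apply is_derive_exp.
Qed.

Ltac cont_tac := repeat
  match goal with
  | |- continuous (fun _ => ?c) _ => apply continuous_const
  | |- continuous (fun p => coord (fst (fst p)) _) _ => apply continuous_coord
  | |- continuous (fun p => snd (fst p)) _ => apply continuous_snd_fst
  | |- continuous (fun p => snd p) _ => apply continuous_last
  | |- continuous (fun p => exp (@?f p)) _ => apply (continuous_exp_comp f)
  | |- continuous (fun p => @?f p ^ ?n) _ => apply (continuous_pow f n)
  | |- continuous (fun p => @?f p + @?g p) _ => apply (continuous_plus f g)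
  | |- continuous (fun p => @?f p - @?g p) _ => apply (continuous_minus f g)
  | |- continuous (fun p => @?f p * @?g p) _ => apply (continuous_mult f g)
  | |- continuous (fun p => @?f p / ?c) _ => apply (continuous_mult f (fun _ => / c))
  | |- continuous (fun p => - @?f p) _ => apply (continuous_opp f)
  end.

Lemma continuous_sqd {N : nat} (y0 : tang N -> R) (p : (tang N -> R) * R * R) :
  continuous (fun p => sqd (fst (fst p)) y0) p.
Proof. unfold sqd. apply continuous_sum_f. intros k. cont_tac. Qed.

(** * Paraboloid and exponential barriers *)

Lemma has_deriv2_exp_parab (A u v k0 k1 x0 x : R) :
  has_deriv2 (fun s => A * exp (u + v * s) + k0 + k1 * (s - x0) ^ 2) x
    (A * v ^ 2 * exp (u + v * x) + 2 * k1).
Proof.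
  apply has_deriv2_global with (fun s => A * v * exp (u + v * s) + 2 * k1 * (s - x0)).
  - intros s. auto_derive; [auto|ring].
  - auto_derive; [auto|ring].
Qed.

Lemma sum_f_R0_const_plus_at (n i : nat) (x e : R) : (i <= n)%nat ->
  sum_f_R0 (fun k => x + if Nat.eq_dec k i then e else 0) n = x * INR (S n) + e.
Proof.
  intros Hi. rewrite (sum_f_R0_replace (fun _ => x) _ n i Hi).
  - rewrite sum_cte. destruct (Nat.eq_dec i i); [ring|contradiction].
  - intros l Hl. destruct (Nat.eq_dec l i); [contradiction|ring].
Qed.

(* The term in [A] is the travelling exponential [A e^{v (x_i - c t)}] with [v] of either sign,
   the growing paraboloid [e^{Lam t}(k0 + k1 |x - x0|^2)] is the penalisation. *)
Lemma heat_at_exp_parab (N i : nat) (A v c Lam k0 k1 k2 z0 t1 : R) (y0 y : tang N -> R) (z t : R) :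
  (2 <= N)%nat -> (i < N - 1)%nat ->
  heat_at (fun y z t => A * exp (v * (coord y i - c * t)) +
      exp (Lam * t) * (k0 + k1 * (sqd y y0 + (z - z0) ^ 2)) + k2 * (t1 - t)) y z t
    (- c * v * (A * exp (v * (coord y i - c * t))) +
      Lam * (exp (Lam * t) * (k0 + k1 * (sqd y y0 + (z - z0) ^ 2))) - k2)
    (v ^ 2 * (A * exp (v * (coord y i - c * t))) + 2 * INR N * k1 * exp (Lam * t)).
Proof.
  intros HN Hi. split.
  - auto_derive; [auto|unfold Rminus; ring].
  - exists (2 * (k1 * exp (Lam * t))),
      (fun k => 2 * (k1 * exp (Lam * t)) + if Nat.eq_dec k i then A * v ^ 2 * exp (v * (coord y i - c * t)) else 0).
    split; [|split].
    + assert (H := has_deriv2_exp_parab 0 0 0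
        (A * exp (v * (coord y i - c * t)) + exp (Lam * t) * (k0 + k1 * sqd y y0) + k2 * (t1 - t))
        (k1 * exp (Lam * t)) z0 z).
      replace (2 * (k1 * exp (Lam * t))) with (0 * 0 ^ 2 * exp (0 + 0 * z) + 2 * (k1 * exp (Lam * t))) by ring.
      eapply has_deriv2_ext; [|exact H]. intros s. simpl. ring.
    + intros k Hk. set (Sk := sqd y y0 - (coord y k - coord y0 k) ^ 2).
      destruct (Nat.eq_dec k i) as [->|Hki].
      * assert (H := has_deriv2_exp_parab A (- v * c * t) v
          (exp (Lam * t) * (k0 + k1 * (Sk + (z - z0) ^ 2)) + k2 * (t1 - t))
          (k1 * exp (Lam * t)) (coord y0 i) (coord y i)).
        replace (2 * (k1 * exp (Lam * t)) + A * v ^ 2 * exp (v * (coord y i - c * t))) with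
          (A * v ^ 2 * exp (- v * c * t + v * coord y i) + 2 * (k1 * exp (Lam * t)))
          by (replace (- v * c * t + v * coord y i) with (v * (coord y i - c * t)) by ring; ring).
        eapply has_deriv2_ext; [|exact H]. intros s. cbv beta.
        rewrite sqd_upd, coord_upd_same by assumption. fold Sk.
        replace (- v * c * t + v * s) with (v * (s - c * t)) by ring. ring.
      * assert (H := has_deriv2_exp_parab 0 0 0
          (A * exp (v * (coord y i - c * t)) + exp (Lam * t) * (k0 + k1 * (Sk + (z - z0) ^ 2)) + k2 * (t1 - t))
          (k1 * exp (Lam * t)) (coord y0 k) (coord y k)).
        replace (2 * (k1 * exp (Lam * t)) + 0) with
          (0 * 0 ^ 2 * exp (0 + 0 * coord y k) + 2 * (k1 * exp (Lam * t))) by ring.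
        eapply has_deriv2_ext; [|exact H]. intros s. cbv beta.
        rewrite sqd_upd, coord_upd_other by assumption. fold Sk. ring.
    + rewrite (sum_f_R0_const_plus_at (N - 2) i) by lia.
      replace (S (N - 2)) with (N - 1)%nat by lia. rewrite minus_INR by lia. simpl INR. ring.
Qed.

Lemma cont_everywhere_exp_parab (N i : nat) (A v c Lam k0 k1 k2 z0 t1 : R) (y0 : tang N -> R) :
  cont_everywhere (fun y z t => A * exp (v * (coord y i - c * t)) +
      exp (Lam * t) * (k0 + k1 * (sqd y y0 + (z - z0) ^ 2)) + k2 * (t1 - t)).
Proof. intros p. cont_tac. apply continuous_sqd. Qed.

Lemma right_deriv_exp_parab (N i : nat) (A v c Lam k0 k1 k2 z0 t1 : R) (y0 y : tang N -> R) (t : R) :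
  has_right_deriv (fun z => A * exp (v * (coord y i - c * t)) +
      exp (Lam * t) * (k0 + k1 * (sqd y y0 + (z - z0) ^ 2)) + k2 * (t1 - t)) 0
    (- 2 * k1 * z0 * exp (Lam * t)).
Proof. apply is_derive_right. auto_derive; [auto|ring]. Qed.

Lemma box_lateral {N : nat} (y0 y : tang N -> R) (R0 z0 z : R) :
  (z = z0 + R0 \/ exists j, Rabs (y j - y0 j) = R0) -> R0 ^ 2 <= sqd y y0 + (z - z0) ^ 2.
Proof.
  intros [->|[j Hj]].
  - pose proof (sqd_nonneg y y0). replace (z0 + R0 - z0) with R0 by ring. lra.
  - pose proof (sqd_ge_coord y y0 j). rewrite <- pow2_abs, Hj in H. pose proof (pow2_ge_0 (z - z0)). lra.
Qed.

(** The barrier [s - K / R0^2 * |x - x0|^2 - K' / T * (t1 - t)] equals [s] at the vertex [(y0, z0)]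
    at time [t1], is at most [s - K <= m] on the lateral sides and at most [s - K'] initially. Its
    range at contact is [[m, s]], where the reaction is at least [c0], so the smallness condition
    makes it a strict subsolution. At the interface there are two ways out: if both species are
    active they share the same barrier, which increases in [z] there since [0 < z0]; otherwise the
    vertex is so deep that the barrier is below [m] at [z = 0] and no contact occurs. *)
Lemma paraboloid_lower (N : nat) (D a : bool -> R) (F : bool -> R -> R)
  (w : bool -> (tang N -> R) -> R -> R -> R) (act : bool -> bool)
  (y0 : tang N -> R) (z0 R0 T t1 s m c0 K K' : R) :
  (2 <= N)%nat -> (forall k, 0 < D k) -> (forall k, 0 < a k) ->
  coupled N D a F w -> 0 < R0 -> 0 < z0 -> 0 < T <= t1 -> 0 < K -> 0 <= K' -> s - K <= m ->
  (forall k y z t, act k = true -> (forall j, Rabs (y j - y0 j) <= R0) -> 0 <= z <= z0 + R0 ->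
     t1 - T <= t <= t1 -> m < w k y z t) ->
  (forall k y z, act k = true -> (forall j, Rabs (y j - y0 j) <= R0) -> 0 <= z <= z0 + R0 ->
     s - K' < w k y z (t1 - T)) ->
  (forall k x, act k = true -> m <= x <= s -> c0 <= F k x) ->
  (forall k, act k = true -> K' / T + 2 * INR N * (D k * (K / R0 ^ 2)) < c0) ->
  (forall k, act k = true -> act (negb k) = true \/ s - m <= K * z0 ^ 2 / R0 ^ 2) ->
  forall k, act k = true -> s < w k y0 z0 t1.
Proof.
  intros HN HD Ha Hw HR Hz0 HT HK HK' Hm Hwin Hini HF Hc Hif k Hk.
  set (b := fun (_ : bool) (y : tang N -> R) z t => 0 * exp (0 * (coord y 0 - 0 * t)) +
      exp (0 * t) * (s + (- (K / R0 ^ 2)) * (sqd y y0 + (z - z0) ^ 2)) + (- (K' / T)) * (t1 - t)).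
  assert (HR2 : 0 < R0 ^ 2) by (apply pow_lt; lra).
  assert (HKR : 0 < K / R0 ^ 2) by (apply Rdiv_lt_0_compat; lra).
  assert (HKT : 0 <= K' / T) by (apply Rdiv_le_0_compat; lra).
  assert (Eb : forall k y z t, b k y z t = s - K / R0 ^ 2 * (sqd y y0 + (z - z0) ^ 2) - K' / T * (t1 - t)).
  { intros. unfold b. rewrite !Rmult_0_l, exp_0. ring. }
  assert (Hbs : forall k y z t, t <= t1 -> b k y z t <= s).
  { intros. rewrite Eb. pose proof (sqd_nonneg y y0). pose proof (pow2_ge_0 (z - z0)).
    assert (0 <= K / R0 ^ 2 * (sqd y y0 + (z - z0) ^ 2)) by (apply Rmult_le_pos; lra).
    assert (0 <= K' / T * (t1 - t)) by (apply Rmult_le_pos; lra). lra. }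
  replace s with (b k y0 z0 t1) by (rewrite Eb, sqd_self; ring).
  apply (lower_barrier N D a F w b act y0 R0 (z0 + R0) (t1 - T) t1); try assumption; try lra.
  - intros k' _. unfold b. apply cont_everywhere_exp_parab.
  - intros k' y z t Hk' [B1 [B2 B3]] [Et|Hlat].
    + subst t. specialize (Hini k' y z Hk' B1 B2). rewrite Eb.
      pose proof (sqd_nonneg y y0). pose proof (pow2_ge_0 (z - z0)).
      assert (0 <= K / R0 ^ 2 * (sqd y y0 + (z - z0) ^ 2)) by (apply Rmult_le_pos; lra).
      replace (t1 - (t1 - T)) with T by ring. replace (K' / T * T) with K' by (field; lra). lra.
    + specialize (Hwin k' y z t Hk' B1 B2 B3). apply box_lateral in Hlat. rewrite Eb.
      assert (0 <= K' / T * (t1 - t)) by (apply Rmult_le_pos; lra).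
      assert (K / R0 ^ 2 * R0 ^ 2 <= K / R0 ^ 2 * (sqd y y0 + (z - z0) ^ 2)) by (apply Rmult_le_compat_l; lra).
      replace (K / R0 ^ 2 * R0 ^ 2) with K in H0 by (field; lra). lra.
  - intros k' y z t Hk' [B1 [B2 B3]] Ht Hz Hwb.
    eexists; eexists; split; [apply heat_at_exp_parab; [exact HN|lia]|].
    rewrite !Rmult_0_l, exp_0. specialize (Hwin k' y z t Hk' B1 B2 B3).
    specialize (HF k' (b k' y z t) Hk' ltac:(split; [lra|apply Hbs; lra])).
    specialize (Hc k' Hk'). lra.
  - intros k' y t Hk' [B1 [B2 B3]] Ht Hwb Hnb.
    eexists; split; [apply right_deriv_exp_parab|]. rewrite Rmult_0_l, exp_0.
    destruct (Hif k' Hk') as [Hb2|Hb2].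
    + specialize (Hnb Hb2). specialize (Ha k'). rewrite Eb in Hnb, Hwb.
      assert (0 < a k' * (- 2 * - (K / R0 ^ 2) * z0 * 1)).
      { apply Rmult_lt_0_compat; [lra|]. replace (- 2 * - (K / R0 ^ 2) * z0 * 1) with (2 * (K / R0 ^ 2) * z0) by ring.
        apply Rmult_lt_0_compat; lra. }
      lra.
    + exfalso. specialize (Hwin k' y 0 t Hk' B1 ltac:(lra) B3). rewrite Hwb, Eb in Hwin.
      pose proof (sqd_nonneg y y0).
      assert (0 <= K / R0 ^ 2 * sqd y y0) by (apply Rmult_le_pos; lra).
      assert (0 <= K' / T * (t1 - t)) by (apply Rmult_le_pos; lra).
      replace (K * z0 ^ 2 / R0 ^ 2) with (K / R0 ^ 2 * (0 - z0) ^ 2) in Hb2 by (field; lra). lra.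
  - split; [|split].
    + intros j. replace (y0 j - y0 j) with 0 by ring. rewrite Rabs_R0. lra.
    + lra.
    + lra.
Qed.

(** Upper bounds for [w] are lower bounds for [- w], so [lower_barrier] serves for both. *)
Lemma coupled_opp (N : nat) (D a : bool -> R) (F : bool -> R -> R) (w : bool -> (tang N -> R) -> R -> R -> R) :
  coupled N D a F w -> coupled N D a (fun k s => - F k (- s)) (fun k y z t => - w k y z t).
Proof.
  intros [H1 [H2 H3]]. split; [|split].
  - intros k. destruct (H1 k) as (wt & wz & wzz & wy & wyy & H).
    exists (fun y z t => - wt y z t), (fun y z t => - wz y z t), (fun y z t => - wzz y z t),
      (fun l y z t => - wy l y z t), (fun l y z t => - wyy l y z t).
    intros y z t Hz Ht. destruct (H y z t Hz Ht) as (A1 & A2 & A3 & A4 & A5).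
    split; [|split; [|split; [|split]]].
    + now apply (derivable_pt_lim_opp (fun s => w k y z s)).
    + now apply (derivable_pt_lim_opp (fun s => w k y s t)).
    + now apply (derivable_pt_lim_opp (fun s => wz y s t)).
    + intros l Hl. destruct (A4 l Hl) as [A6 A7]. split.
      * now apply (derivable_pt_lim_opp (fun s => w k (upd y l s) z t)).
      * now apply (derivable_pt_lim_opp (fun s => wy l (upd y l s) z t)).
    + rewrite A5, Ropp_involutive.
      assert (E : sum_f_R0 (fun l => - wyy l y z t) (N - 2) = - sum_f_R0 (fun l => wyy l y z t) (N - 2)).
      { replace (- sum_f_R0 (fun l => wyy l y z t) (N - 2)) with (-1 * sum_f_R0 (fun l => wyy l y z t) (N - 2)) by ring.
        rewrite scal_sum. apply sum_eq. intros. ring. }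
      rewrite E. ring.
  - intros k y z t Hz Ht eps He. destruct (H2 k y z t Hz Ht eps He) as [dl [Hd H]].
    exists dl. split; [assumption|]. intros y' z' t' A1 A2 A3 A4 A5.
    replace (- w k y' z' t' - - w k y z t) with (- (w k y' z' t' - w k y z t)) by ring.
    rewrite Rabs_Ropp. now apply H.
  - intros k y t Ht. destruct (H3 k y t Ht) as [p [Hp1 Hp2]]. exists (-1 * p). split.
    + assert (H := has_right_deriv_scal _ 0 p (-1) Hp1).
      intros eps He. destruct (H eps He) as [dl [Hd Hq]]. exists dl. split; [assumption|].
      intros x Hx. specialize (Hq x Hx).
      replace ((- w k y (0 + x) t - - w k y 0 t) / x) with ((-1 * w k y (0 + x) t - -1 * w k y 0 t) / x) by (field; lra).
      exact Hq.
    + lra.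
Qed.

Lemma large_square (X : R) : 0 <= X -> exists r, 0 < r /\ forall r', r <= r' -> X < r' ^ 2.
Proof.
  intros HX. exists (X + 1). split; [lra|]. intros r Hr. nra.
Qed.

(** The exponential alone cannot be compared in a bounded box. It is corrected by
    [e^{Lam t} (eps + k1 |x - x1|^2)], which exceeds [M] on the lateral sides of a large box, is
    small at the point under study, and whose growth rate [Lam] absorbs the reaction. The value
    [A = 0] is allowed: the conclusion is then that [w] stays non-positive. *)
Lemma exponential_upper (N i : nat) (D a l : bool -> R) (F : bool -> R -> R)
  (w : bool -> (tang N -> R) -> R -> R -> R) (T M A v c : R) :
  (2 <= N)%nat -> (i < N - 1)%nat -> (forall k, 0 < D k) -> (forall k, 0 < a k) ->
  coupled N D a F w -> 0 < T -> 0 <= A ->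
  (forall k y z t, 0 <= z -> 0 <= t <= T -> w k y z t <= M) ->
  (forall k s, 0 < s <= M -> F k s <= l k * s) ->
  (forall k, A * (D k * v ^ 2 + c * v + l k) <= 0) ->
  (forall k y z, 0 <= z -> w k y z 0 <= A * exp (v * coord y i)) ->
  forall k y z t, 0 <= z -> 0 <= t <= T -> w k y z t <= A * exp (v * (coord y i - c * t)).
Proof.
  intros HN Hi HD Ha Hw HT HA HM HF Hal Hini k y0 z0 t0 Hz0 Ht0.
  apply le_epsilon. intros eps0 He0.
  set (Lam := Rabs (l true) + Rabs (l false) + 1).
  assert (HLam : forall k, l k + 1 <= Lam /\ 0 < Lam).
  { intros k'. unfold Lam. pose proof (Rabs_pos (l true)). pose proof (Rabs_pos (l false)).
    pose proof (Rle_abs (l true)). pose proof (Rle_abs (l false)). destruct k'; (split; lra) || lra. }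
  (* At the point under study the correction is at most [exp (Lam * t0) * (2 * eps)], that is
     [eps0]. *)
  set (eps := eps0 / (2 * exp (Lam * t0))).
  assert (Hexp0 : 0 < exp (Lam * t0)) by apply exp_pos.
  assert (Heps : 0 < eps) by (unfold eps; apply Rdiv_lt_0_compat; lra).
  set (M1 := Rabs M + 1). assert (HM1 : 0 < M1) by (unfold M1; pose proof (Rabs_pos M); lra).
  assert (HNR : 0 < INR N) by (apply lt_0_INR; lia).
  set (Dm := D true + D false).
  assert (HDm : 0 < Dm) by (unfold Dm; pose proof (HD true); pose proof (HD false); lra).
  (* With [k1 = M1 / R0^2], this size of [R0] makes both the Laplacian of the penalisation and its
     value at [(y0, z0)] smaller than [eps]. *)
  destruct (large_square ((2 * INR N * Dm * M1 + M1 * (z0 - 1) ^ 2) / eps)) as [r [Hr Hrr]].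
  { apply Rdiv_le_0_compat; [|lra]. pose proof (pow2_ge_0 (z0 - 1)).
    apply Rplus_le_le_0_compat; [repeat apply Rmult_le_pos|apply Rmult_le_pos]; lra. }
  set (R0 := r + z0). specialize (Hrr R0 ltac:(unfold R0; lra)).
  assert (HR0p : 0 < R0) by (unfold R0; lra).
  assert (HR0 : 0 < R0 ^ 2) by (apply pow_lt; unfold R0; lra).
  set (k1 := M1 / R0 ^ 2). assert (Hk1 : 0 < k1) by (unfold k1; apply Rdiv_lt_0_compat; lra).
  assert (Hsum : 2 * INR N * Dm * k1 + k1 * (z0 - 1) ^ 2 < eps).
  { unfold k1. apply Rmult_lt_reg_r with (R0 ^ 2 / eps); [apply Rdiv_lt_0_compat; lra|].
    replace (eps * (R0 ^ 2 / eps)) with (R0 ^ 2) by (field; lra).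
    eapply Rle_lt_trans; [|exact Hrr]. apply Req_le. field. repeat split; lra. }
  (* The penalisation is centred at height 1 and not at [z0], which may be 0: a positive height
     gives the barrier a strictly positive normal derivative at the interface. *)
  set (b := fun (_ : bool) (y : tang N -> R) z t => (- A) * exp (v * (coord y i - c * t)) +
      exp (Lam * t) * (- eps + (- k1) * (sqd y y0 + (z - 1) ^ 2)) + 0 * (0 - t)).
  assert (Hlow : b k y0 z0 t0 < - w k y0 z0 t0).
  { apply (lower_barrier N D a (fun k s => - F k (- s)) (fun k y z t => - w k y z t) b (fun _ => true)
      y0 R0 (1 + R0) 0 t0); try assumption; try (unfold R0; lra).
    - now apply coupled_opp.
    - intros. apply cont_everywhere_exp_parab.
    - intros k' y z t _ [B1 [B2 B3]] Hb. unfold b.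
      assert (Hpos : 0 <= A * exp (v * (coord y i - c * t))).
      { apply Rmult_le_pos; [assumption|apply Rlt_le, exp_pos]. }
      assert (0 <= k1 * (sqd y y0 + (z - 1) ^ 2)).
      { pose proof (sqd_nonneg y y0). pose proof (pow2_ge_0 (z - 1)). apply Rmult_le_pos; lra. }
      destruct Hb as [->|Hb].
      + specialize (Hini k' y z ltac:(lra)). rewrite !Rmult_0_r, exp_0.
        replace (v * (coord y i - 0)) with (v * coord y i) by ring. lra.
      + apply box_lateral in Hb.
        assert (HM' := HM k' y z t ltac:(lra) ltac:(lra)).
        assert (1 <= exp (Lam * t)).
        { rewrite <- exp_0. destruct (proj1 B3) as [H1| <-]; [|rewrite Rmult_0_r; lra].
          apply Rlt_le, exp_increasing. apply Rmult_lt_0_compat; [apply (HLam true)|lra]. }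
        assert (M1 <= k1 * (sqd y y0 + (z - 1) ^ 2)).
        { replace M1 with (k1 * R0 ^ 2) by (unfold k1; field; lra). apply Rmult_le_compat_l; lra. }
        assert (M1 <= exp (Lam * t) * (eps + k1 * (sqd y y0 + (z - 1) ^ 2))) by nra.
        unfold M1 in *. pose proof (Rle_abs M). lra.
    - intros k' y z t _ [B1 [B2 B3]] Ht Hz Hwb.
      eexists; eexists; split; [apply heat_at_exp_parab; assumption|].
      set (X := exp (v * (coord y i - c * t))). set (P := exp (Lam * t)).
      assert (HX : 0 < X) by apply exp_pos. assert (HP : 0 < P) by apply exp_pos.
      set (Y := sqd y y0 + (z - 1) ^ 2).
      assert (HY : 0 <= Y) by (unfold Y; pose proof (sqd_nonneg y y0); pose proof (pow2_ge_0 (z - 1)); lra).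
      assert (Ebb : b k' y z t = - (A * X + P * (eps + k1 * Y))) by (unfold b; fold X P Y; ring).
      rewrite Ebb in *. rewrite Ropp_involutive.
      assert (HPY : 0 < P * (eps + k1 * Y)).
      { apply Rmult_lt_0_compat; [assumption|]. pose proof (Rmult_le_pos k1 Y ltac:(lra) HY). lra. }
      assert (HAX : 0 <= A * X) by (apply Rmult_le_pos; lra).
      assert (HMb := HM k' y z t ltac:(lra) ltac:(lra)).
      specialize (HF k' (A * X + P * (eps + k1 * Y)) ltac:(lra)).
      specialize (Hal k'). destruct (HLam k') as [HL1 HL2].
      assert (E1 : (A * (D k' * v ^ 2 + c * v + l k')) * X <= 0) by nra.
      assert (E2 : l k' * (P * (eps + k1 * Y)) + P * (eps + k1 * Y) <= Lam * (P * (eps + k1 * Y))) by nra.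
      assert (HDk : D k' <= Dm) by (unfold Dm; pose proof (HD true); pose proof (HD false); destruct k'; lra).
      assert (E3 : 2 * INR N * D k' * k1 < eps + k1 * Y).
      { pose proof (Rmult_le_pos k1 Y ltac:(lra) HY). pose proof (pow2_ge_0 (z0 - 1)).
        assert (0 <= k1 * (z0 - 1) ^ 2) by (apply Rmult_le_pos; lra).
        assert (2 * INR N * D k' * k1 <= 2 * INR N * Dm * k1).
        { apply Rmult_le_compat_r; [lra|]. apply Rmult_le_compat_l; lra. }
        lra. }
      assert (E4 : P * (2 * INR N * D k' * k1) < P * (eps + k1 * Y)) by (apply Rmult_lt_compat_l; assumption).
      nra.
    - intros k' y t _ [B1 [B2 B3]] Ht Hwb Hnb. specialize (Hnb eq_refl).
      eexists; split; [apply right_deriv_exp_parab|].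
      assert (0 < a k' * (k1 * exp (Lam * t))).
      { apply Rmult_lt_0_compat; [apply Ha|]. apply Rmult_lt_0_compat; [lra|apply exp_pos]. }
      unfold b in Hwb, Hnb. lra.
    - split; [|split]; [|unfold R0; lra|lra].
      intros j. replace (y0 j - y0 j) with 0 by ring. rewrite Rabs_R0. unfold R0. lra. }
  unfold b in Hlow. rewrite sqd_self in Hlow.
  assert (exp (Lam * t0) * (eps + k1 * (z0 - 1) ^ 2) <= eps0).
  { assert (eps + k1 * (z0 - 1) ^ 2 <= 2 * eps).
    { assert (0 <= 2 * INR N * Dm * k1) by (apply Rmult_le_pos; [apply Rmult_le_pos|]; lra). lra. }
    apply Rle_trans with (exp (Lam * t0) * (2 * eps)); [apply Rmult_le_compat_l; lra|].
    unfold eps. apply Req_le. field. lra. }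
  lra.
Qed.

(** * Moving bumps *)

(** Positive exactly in a ball whose squared radius [r2 + m * (t - t0)] grows linearly and whose
    centre, at height [zeta], moves with speed [c] along the coordinate [i]. *)
Definition bump_q {N : nat} (i : nat) (y0 : tang N -> R) (r2 m c zeta t0 : R) (y : tang N -> R) (z t : R) : R :=
  r2 + m * (t - t0) -
  (sqd y y0 - (coord y i - coord y0 i) ^ 2 + (coord y i - (coord y0 i + c * (t - t0))) ^ 2) - (z - zeta) ^ 2.

(** The amplitude grows at rate [sg]. The tilt [e^{- be xi}] is the change of unknown that removes
    the drift in the moving frame when [be = c / (2 D)]; its price is the rate [c^2 / (4 D)]. *)
Definition bump_E {N : nat} (i : nat) (y0 : tang N -> R) (A sg be c t0 : R) (y : tang N -> R) (t : R) : R :=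
  A * exp (sg * (t - t0) + (- be) * (coord y i - (coord y0 i + c * (t - t0)))).

Lemma bump_q_sqd {N : nat} (i : nat) (y0 : tang N -> R) r2 m c zeta t0 y z t :
  (2 <= N)%nat -> (i < N - 1)%nat ->
  bump_q i y0 r2 m c zeta t0 y z t =
  r2 + m * (t - t0) - sqd y (upd y0 i (coord y0 i + c * (t - t0))) - (z - zeta) ^ 2.
Proof. intros. unfold bump_q. now rewrite sqd_upd_r. Qed.

Lemma has_deriv2_bump (A u v p x0 e3 x : R) :
  has_deriv2 (fun s => A * exp (u + v * s) * ((p - (s - x0) ^ 2) ^ 3 - e3)) x
    (A * exp (u + v * x) * (v ^ 2 * ((p - (x - x0) ^ 2) ^ 3 - e3) -
      12 * v * (x - x0) * (p - (x - x0) ^ 2) ^ 2 - 6 * (p - (x - x0) ^ 2) ^ 2 +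
      24 * (p - (x - x0) ^ 2) * (x - x0) ^ 2)).
Proof.
  apply has_deriv2_global with (fun s => A * exp (u + v * s) *
    (v * ((p - (s - x0) ^ 2) ^ 3 - e3) - 6 * (s - x0) * (p - (s - x0) ^ 2) ^ 2)).
  - intros s. auto_derive; [auto|ring].
  - auto_derive; [auto|ring].
Qed.

(** The squared distance to the centre is eliminated through the definition of [q], which leaves a
    polynomial in [q] and the single coordinate [xi]. The terms in [xi] of the time derivative and
    of the Laplacian cancel once [be = c / (2 D)]. *)
Lemma heat_at_bump (N i : nat) (A sg be c r2 m zeta t0 e3 : R) (y0 y : tang N -> R) (z t : R) :
  (2 <= N)%nat -> (i < N - 1)%nat ->
  let q := bump_q i y0 r2 m c zeta t0 y z t in
  let E := bump_E i y0 A sg be c t0 y t in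
  let xi := coord y i - (coord y0 i + c * (t - t0)) in
  heat_at (fun y z t => bump_E i y0 A sg be c t0 y t * (bump_q i y0 r2 m c zeta t0 y z t ^ 3 - e3)) y z t
    (E * ((sg + c * be) * (q ^ 3 - e3) + 3 * q ^ 2 * (m + 2 * c * xi)))
    (E * (be ^ 2 * (q ^ 3 - e3) + 12 * be * xi * q ^ 2 - 6 * INR N * q ^ 2 + 24 * q * (r2 + m * (t - t0) - q))).
Proof.
  intros HN Hi q E xi.
  set (cc := upd y0 i (coord y0 i + c * (t - t0))).
  assert (Hcc : forall k, (k < N - 1)%nat -> coord cc k = if Nat.eq_dec k i then coord y0 i + c * (t - t0) else coord y0 k).
  { intros k Hk. unfold cc. destruct (Nat.eq_dec k i) as [->|Hn]; [now apply coord_upd_same|].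
    apply coord_upd_other. auto. }
  split.
  - unfold bump_E, bump_q. auto_derive; [auto|]. unfold E, q, xi, bump_E, bump_q.
    replace (sg * (t + - t0) + - be * (coord y i + - (coord y0 i + c * (t + - t0)))) with
      (sg * (t - t0) + - be * (coord y i - (coord y0 i + c * (t - t0)))) by ring. ring.
  - exists (E * (- 6 * q ^ 2 + 24 * q * (z - zeta) ^ 2)),
      (fun k => E * (- 6 * q ^ 2 + 24 * q * (coord y k - coord cc k) ^ 2) +
        if Nat.eq_dec k i then E * (be ^ 2 * (q ^ 3 - e3) + 12 * be * xi * q ^ 2) else 0).
    split; [|split].
    + assert (H := has_deriv2_bump E 0 0 (q + (z - zeta) ^ 2) zeta e3 z).
      rewrite Rmult_0_l, Rplus_0_l, exp_0 in H.
      replace (E * (- 6 * q ^ 2 + 24 * q * (z - zeta) ^ 2)) with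
       (E * 1 *
     (0 ^ 2 * ((q + (z - zeta) ^ 2 - (z - zeta) ^ 2) ^ 3 - e3) -
      12 * 0 * (z - zeta) * (q + (z - zeta) ^ 2 - (z - zeta) ^ 2) ^ 2 -
      6 * (q + (z - zeta) ^ 2 - (z - zeta) ^ 2) ^ 2 +
      24 * (q + (z - zeta) ^ 2 - (z - zeta) ^ 2) * (z - zeta) ^ 2)) by ring.
      eapply has_deriv2_ext; [|exact H]. intros s. cbv beta. fold E.
      rewrite Rmult_0_l, Rplus_0_l, exp_0. unfold q, bump_q. ring.
    + intros k Hk. rewrite (Hcc k Hk).
      set (p := q + (coord y k - coord cc k) ^ 2).
      destruct (Nat.eq_dec k i) as [->|Hki].
      * assert (H := has_deriv2_bump A (sg * (t - t0) + be * (coord y0 i + c * (t - t0))) (- be) p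
          (coord y0 i + c * (t - t0)) e3 (coord y i)).
        assert (Ee : A * exp (sg * (t - t0) + be * (coord y0 i + c * (t - t0)) + - be * coord y i) = E).
        { unfold E, bump_E. f_equal. f_equal. ring. }
        rewrite Ee in H.
        assert (Ep : p - (coord y i - (coord y0 i + c * (t - t0))) ^ 2 = q).
        { unfold p. rewrite (Hcc i Hi). destruct (Nat.eq_dec i i); [ring|contradiction]. }
        rewrite Ep in H. fold xi in H. fold xi.
        replace (E * (- 6 * q ^ 2 + 24 * q * xi ^ 2) + E * (be ^ 2 * (q ^ 3 - e3) + 12 * be * xi * q ^ 2)) with
          (E * ((- be) ^ 2 * (q ^ 3 - e3) - 12 * - be * xi * q ^ 2 - 6 * q ^ 2 + 24 * q * xi ^ 2)) by ring.
        eapply has_deriv2_ext; [|exact H]. intros s. cbv beta. unfold bump_E.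
        rewrite coord_upd_same by assumption.
        replace (sg * (t - t0) + be * (coord y0 i + c * (t - t0)) + - be * s) with
          (sg * (t - t0) + - be * (s - (coord y0 i + c * (t - t0)))) by ring.
        f_equal. f_equal. f_equal. unfold bump_q. rewrite sqd_upd, coord_upd_same by assumption.
        unfold p, q, bump_q. rewrite (Hcc i Hi). destruct (Nat.eq_dec i i); [ring|contradiction].
      * assert (H := has_deriv2_bump E 0 0 p (coord y0 k) e3 (coord y k)).
        rewrite Rmult_0_l, Rplus_0_l, exp_0 in H.
        assert (Ep : p - (coord y k - coord y0 k) ^ 2 = q).
        { unfold p. rewrite (Hcc k Hk). destruct (Nat.eq_dec k i); [contradiction|ring]. }
        rewrite Ep in H.
        replace (E * (- 6 * q ^ 2 + 24 * q * (coord y k - coord y0 k) ^ 2) + 0) with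
          (E * 1 * (0 ^ 2 * (q ^ 3 - e3) - 12 * 0 * (coord y k - coord y0 k) * q ^ 2 - 6 * q ^ 2 +
             24 * q * (coord y k - coord y0 k) ^ 2)) by ring.
        eapply has_deriv2_ext; [|exact H]. intros s. cbv beta.
        rewrite Rmult_0_l, Rplus_0_l, exp_0, Rmult_1_r. unfold bump_E. rewrite coord_upd_other by auto.
        fold (bump_E i y0 A sg be c t0 y t). fold E.
        f_equal. f_equal. f_equal. unfold bump_q. rewrite sqd_upd, coord_upd_other by auto.
        unfold p, q, bump_q. rewrite (Hcc k Hk). destruct (Nat.eq_dec k i); [contradiction|ring].
    + rewrite (sum_f_R0_replace
        (fun k => (coord y k - coord cc k) ^ 2 * (24 * q * E) + (- 6 * q ^ 2 * E)) _ (N - 2) i ltac:(lia)).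
      2:{ intros l Hl. destruct (Nat.eq_dec l i); [contradiction|ring]. }
      rewrite sum_plus, sum_cte.
      rewrite <- (scal_sum (fun k => (coord y k - coord cc k) ^ 2) (N - 2) (24 * q * E)).
      fold (sqd y cc).
      assert (Eq : sqd y cc = r2 + m * (t - t0) - q - (z - zeta) ^ 2).
      { unfold q. rewrite bump_q_sqd by assumption. fold cc. ring. }
      rewrite Eq. destruct (Nat.eq_dec i i); [|contradiction].
      replace (S (N - 2)) with (N - 1)%nat by lia. rewrite minus_INR by lia. simpl INR. ring.
Qed.

Lemma cont_everywhere_bump (N i : nat) (A sg be c r2 m zeta t0 e3 : R) (y0 : tang N -> R) :
  cont_everywhere (fun y z t => bump_E i y0 A sg be c t0 y t * (bump_q i y0 r2 m c zeta t0 y z t ^ 3 - e3)).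
Proof. intros p. unfold bump_E, bump_q. cont_tac. apply continuous_sqd. Qed.

Lemma right_deriv_bump (N i : nat) (A sg be c r2 m zeta t0 e3 : R) (y0 y : tang N -> R) (t : R) :
  has_right_deriv (fun z => bump_E i y0 A sg be c t0 y t * (bump_q i y0 r2 m c zeta t0 y z t ^ 3 - e3)) 0
    (6 * zeta * bump_E i y0 A sg be c t0 y t * bump_q i y0 r2 m c zeta t0 y 0 t ^ 2).
Proof. apply is_derive_right. unfold bump_q. auto_derive; [auto|ring]. Qed.

(* The odd power [q ^ 3] makes the bump negative, hence below [w >= 0], outside its support, so
   the barrier [E (q ^ 3 - e ^ 3)] is globally smooth and can only be touched where [q > 0]. *)
Lemma bump_lower (N i : nat) (D a lam : bool -> R) (F : bool -> R -> R)
  (w : bool -> (tang N -> R) -> R -> R -> R) (act : bool -> bool)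
  (A sg c m r2 zeta s0 t0 tau : R) (y0 : tang N -> R) :
  (2 <= N)%nat -> (i < N - 1)%nat -> (forall k, 0 < D k) -> (forall k, 0 < a k) ->
  coupled N D a F w ->
  (forall k y z t, 0 <= z -> 0 <= t -> 0 <= w k y z t) ->
  0 < A -> 0 <= m -> 0 < r2 -> 0 <= t0 -> 0 <= tau ->
  let q := fun y z t => bump_q i y0 r2 m c zeta t0 y z t in
  let E := fun k y t => bump_E i y0 A sg (c / (2 * D k)) c t0 y t in
  (forall k, act k = true -> 0 < lam k - sg - c ^ 2 / (4 * D k)) ->
  (forall k, act k = true -> (3 * m + (6 * INR N + 24) * D k) ^ 2 <
     96 * D k * r2 * (lam k - sg - c ^ 2 / (4 * D k))) ->
  (forall k s, act k = true -> 0 <= s <= s0 -> lam k * s <= F k s) ->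
  (forall k y z t, act k = true -> 0 <= z -> t0 <= t <= t0 + tau -> 0 < q y z t ->
     E k y t * q y z t ^ 3 <= s0) ->
  (forall k y z, act k = true -> 0 <= z -> 0 < q y z t0 -> E k y t0 * q y z t0 ^ 3 <= w k y z t0) ->
  (forall k y t, act k = true -> t0 <= t <= t0 + tau -> 0 < q y 0 t ->
     (act (negb k) = true /\ c = 0 /\ 0 < zeta) \/
     E k y t * q y 0 t ^ 3 - 6 * a k * zeta * E k y t * q y 0 t ^ 2 <= w (negb k) y 0 t) ->
  forall k y z t, act k = true -> 0 <= z -> t0 <= t <= t0 + tau -> E k y t * q y z t ^ 3 <= w k y z t.
Proof.
  intros HN Hi HD Ha Hw Hnn HA Hm Hr2 Ht0 Htau q E Heta Hdisc HF Hamp Hini Hif k y1 z1 t1 Hk Hz1 Ht1.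
  assert (HE : forall k y t, 0 < E k y t) by (intros; apply Rmult_lt_0_compat; [assumption|apply exp_pos]).
  destruct (Rle_lt_dec (q y1 z1 t1) 0) as [Hq|Hq].
  { apply Rle_trans with 0; [|apply Hnn; lra].
    pose proof (HE k y1 t1). pose proof (pow2_ge_0 (q y1 z1 t1)).
    assert (q y1 z1 t1 ^ 3 <= 0) by (simpl; simpl in H0; nra). nra. }
  apply le_epsilon. intros eps0 He0.
  (* [eta k] is the growth left after the cost of moving and the rate [sg]. Divided by [E * q], the
     subsolution inequality contains a quadratic polynomial in [q]; [g k] is its minimum when the
     radius is the initial one, positive by the discriminant hypothesis. *)
  set (eta := fun k => lam k - sg - c ^ 2 / (4 * D k)).
  set (g := fun k => 24 * D k * r2 - (3 * m + (6 * INR N + 24) * D k) ^ 2 / (4 * eta k)).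
  assert (Hg : forall k, act k = true -> 0 < g k).
  { intros k' Hk'. unfold g. specialize (Heta k' Hk'). specialize (Hdisc k' Hk'). fold (eta k') in Heta, Hdisc.
    apply Rmult_lt_reg_r with (4 * eta k'); [lra|]. field_simplify; [|lra]. simpl in *. lra. }
  assert (Hquad : forall k x, act k = true ->
    g k <= eta k * x ^ 2 - (3 * m + (6 * INR N + 24) * D k) * x + 24 * D k * r2).
  { intros k' x Hk'. specialize (Heta k' Hk'). fold (eta k') in Heta. unfold g.
    set (bb := 3 * m + (6 * INR N + 24) * D k').
    assert (0 <= eta k' * (x - bb / (2 * eta k')) ^ 2) by (apply Rmult_le_pos; [lra|apply pow2_ge_0]).
    replace (eta k' * (x - bb / (2 * eta k')) ^ 2) with (eta k' * x ^ 2 - bb * x + bb ^ 2 / (4 * eta k')) in H by (field; lra).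
    lra. }
  assert (Hexe : exists e, 0 < e /\ E k y1 t1 * e ^ 3 <= eps0 /\
     forall k, act k = true -> e ^ 2 * eta k < g k).
  (* Contact together with [0 <= w] forces [e <= q], so [e^2 * eta < g] suffices to absorb the term
     [eta * e^3] of the lowered bump. Taking [e <= 1] reduces the conditions to linear ones in
     [e]. *)
  { set (gm := fun k => if act k then g k / (Rabs (eta k) + 1) else 1).
    assert (Hgm : forall k, 0 < gm k).
    { intros k'. unfold gm. destruct (act k') eqn:Hk'; [|lra]. apply Rdiv_lt_0_compat; [now apply Hg|].
      pose proof (Rabs_pos (eta k')). lra. }
    set (e := Rmin (Rmin 1 (eps0 / E k y1 t1)) (Rmin (gm true) (gm false) / 2)).
    assert (Hee : 0 < eps0 / E k y1 t1) by (apply Rdiv_lt_0_compat; [lra|apply HE]).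
    assert (Hgg : 0 < Rmin (gm true) (gm false)) by (apply Rmin_glb_lt; apply Hgm).
    assert (He : 0 < e) by (unfold e; repeat apply Rmin_glb_lt; lra).
    assert (He1 : e <= 1) by (unfold e; eapply Rle_trans; [apply Rmin_l|apply Rmin_l]).
    assert (He2 : e <= eps0 / E k y1 t1) by (unfold e; eapply Rle_trans; [apply Rmin_l|apply Rmin_r]).
    assert (He3 : e < Rmin (gm true) (gm false)).
    { apply Rle_lt_trans with (Rmin (gm true) (gm false) / 2); [unfold e; apply Rmin_r|lra]. }
    exists e. split; [assumption|]. split.
    - assert (e ^ 3 <= e) by nra. specialize (HE k y1 t1).
      apply Rle_trans with (E k y1 t1 * (eps0 / E k y1 t1)); [apply Rmult_le_compat_l; lra|].
      apply Req_le. field. lra.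
    - intros k' Hk'. assert (He4 : e < gm k').
      { pose proof (Rmin_l (gm true) (gm false)). pose proof (Rmin_r (gm true) (gm false)). destruct k'; lra. }
      unfold gm in He4. rewrite Hk' in He4. pose proof (Rle_abs (eta k')). pose proof (Rabs_pos (eta k')).
      apply Rmult_lt_compat_r with (r := Rabs (eta k') + 1) in He4; [|lra].
      unfold Rdiv in He4. rewrite Rmult_assoc, Rinv_l, Rmult_1_r in He4 by lra.
      assert (e ^ 2 <= e) by nra. nra. }
  destruct Hexe as [e [He [Hee Heg]]].
  set (b := fun k y z t => E k y t * (q y z t ^ 3 - e ^ 3)).
  (* The added 1 gives [r2 + m * tau < rad^2], so the support stays strictly inside the box of
     comparison. *)
  set (rad := r2 + m * tau + 1).
  assert (Hrad : 1 <= rad) by (unfold rad; pose proof (Rmult_le_pos m tau ltac:(lra) ltac:(lra)); lra).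
  assert (Hqin : forall y z t, t0 <= t <= t0 + tau -> 0 < q y z t ->
    (forall j, Rabs (y j - y0 j) < rad + Rabs c * tau) /\ Rabs (z - zeta) < rad).
  { intros y z t Ht Hqp. unfold q in Hqp. rewrite bump_q_sqd in Hqp by assumption.
    set (cc := upd y0 i (coord y0 i + c * (t - t0))) in *.
    pose proof (sqd_nonneg y cc). pose proof (pow2_ge_0 (z - zeta)).
    assert (Hmt : m * (t - t0) <= m * tau) by (apply Rmult_le_compat_l; lra).
    assert (Hr : r2 + m * (t - t0) < rad ^ 2) by (unfold rad in *; nra).
    split.
    - intros j. assert (Hj : Rabs (y j - cc j) < rad) by (apply sqd_lt_coord; lra).
      assert (Hc : Rabs (cc j - y0 j) <= Rabs c * tau).
      { unfold cc, upd. pose proof (Rabs_pos c). destruct (Nat.eq_dec (proj1_sig j) i) as [<-|].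
        - rewrite coord_proj. replace (y0 j + c * (t - t0) - y0 j) with (c * (t - t0)) by ring.
          rewrite Rabs_mult. apply Rmult_le_compat_l; [assumption|]. rewrite Rabs_pos_eq; lra.
        - replace (y0 j - y0 j) with 0 by ring. rewrite Rabs_R0. apply Rmult_le_pos; lra. }
      replace (y j - y0 j) with ((y j - cc j) + (cc j - y0 j)) by ring.
      eapply Rle_lt_trans; [apply Rabs_triang|lra].
    - rewrite <- (Rabs_pos_eq rad) by lra. apply Rsqr_lt_abs_0. rewrite !Rsqr_pow2. lra. }
  assert (Hct : 0 <= Rabs c * tau) by (apply Rmult_le_pos; [apply Rabs_pos|lra]).
  assert (Hlow : b k y1 z1 t1 < w k y1 z1 t1).
  { apply (lower_barrier N D a F w b act y0 (rad + Rabs c * tau) (Rabs zeta + rad) t0 (t0 + tau)); try assumption.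
    - lra.
    - pose proof (Rabs_pos zeta). lra.
    - intros k' _. apply cont_everywhere_bump.
    - intros k' y z t Hk' [B1 [B2 B3]] Hbd.
      assert (Hnw := Hnn k' y z t ltac:(lra) ltac:(lra)).
      assert (He3 : 0 < e ^ 3) by now apply pow_lt.
      destruct (Rle_lt_dec (q y z t) 0) as [Hq0|Hq0].
      + unfold b. specialize (HE k' y t). pose proof (pow2_ge_0 (q y z t)).
        assert (q y z t ^ 3 <= 0) by (simpl; simpl in H; nra). nra.
      + destruct (Hqin y z t B3 Hq0) as [Q1 Q2]. destruct Hbd as [->|[->|[j Hj]]].
        * specialize (Hini k' y z Hk' ltac:(lra) Hq0). unfold b. specialize (HE k' y t0). nra.
        * exfalso. pose proof (Rle_abs (Rabs zeta + rad - zeta)). pose proof (Rle_abs zeta). lra.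
        * exfalso. specialize (Q1 j). lra.
    - intros k' y z t Hk' [B1 [B2 B3]] Ht Hz Hwb.
      eexists; eexists; split; [apply heat_at_bump; assumption|].
      fold (q y z t). fold (E k' y t).
      set (qq := q y z t) in *. set (EE := E k' y t) in *.
      set (xi := coord y i - (coord y0 i + c * (t - t0))).
      assert (HEE : 0 < EE) by apply HE.
      assert (Hnw := Hnn k' y z t ltac:(lra) ltac:(lra)). rewrite Hwb in Hnw.
      unfold b in Hnw, Hwb. fold qq EE in Hnw, Hwb.
      assert (He3 : 0 < e ^ 3) by now apply pow_lt.
      assert (Hq3 : e ^ 3 <= qq ^ 3) by nra.
      assert (Hqe : e <= qq).
      { apply Rnot_lt_le. intros Hlt. assert (qq ^ 3 < e ^ 3); [|lra].
        destruct (Rle_lt_dec qq 0).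
        - pose proof (pow2_ge_0 qq). simpl in *. nra.
        - assert (qq ^ 2 < e ^ 2) by nra. simpl in *. nra. }
      assert (Hs0 : EE * qq ^ 3 <= s0) by (apply (Hamp k' y z t); try assumption; try lra; fold qq; lra).
      assert (HFF := HF k' (EE * (qq ^ 3 - e ^ 3)) Hk' ltac:(split; nra)).
      unfold b. fold qq EE.
      eapply Rlt_le_trans; [|apply Rplus_le_compat_l; exact HFF].
      specialize (Hquad k' qq Hk'). specialize (Heg k' Hk'). specialize (Hg k' Hk').
      assert (HDk := HD k').
      assert (Hmt : 0 <= m * (t - t0)) by (apply Rmult_le_pos; lra).
      assert (Hgap : eta k' * e ^ 3 < qq * (eta k' * qq ^ 2 - (3 * m + (6 * INR N + 24) * D k') * qq + 24 * D k' * (r2 + m * (t - t0)))).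
      { apply Rlt_le_trans with (e * g k'); [simpl in *; nra|].
        apply Rle_trans with (qq * g k'); [apply Rmult_le_compat_r; lra|].
        apply Rmult_le_compat_l; [lra|].
        assert (0 <= 24 * D k' * (m * (t - t0))) by (apply Rmult_le_pos; lra). lra. }
      apply Rminus_gt_0_lt.
      replace (D k' * (EE * ((c / (2 * D k')) ^ 2 * (qq ^ 3 - e ^ 3) + 12 * (c / (2 * D k')) * xi * qq ^ 2 -
          6 * INR N * qq ^ 2 + 24 * qq * (r2 + m * (t - t0) - qq))) + lam k' * (EE * (qq ^ 3 - e ^ 3)) -
          EE * ((sg + c * (c / (2 * D k'))) * (qq ^ 3 - e ^ 3) + 3 * qq ^ 2 * (m + 2 * c * xi)))
        with (EE * (qq * (eta k' * qq ^ 2 - (3 * m + (6 * INR N + 24) * D k') * qq +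
           24 * D k' * (r2 + m * (t - t0))) - eta k' * e ^ 3)).
      + apply Rmult_lt_0_compat; lra.
      + unfold eta. field. lra.
    - intros k' y t Hk' [B1 [B2 B3]] Ht Hwb Hnb.
      eexists; split; [apply right_deriv_bump|]. fold (E k' y t) (q y 0 t).
      assert (Hnw := Hnn k' y 0 t ltac:(lra) ltac:(lra)). rewrite Hwb in Hnw.
      unfold b in Hnw, Hwb. specialize (HE k' y t) as HEE.
      set (EE := E k' y t) in *. set (qq := q y 0 t) in *.
      assert (He3 : 0 < e ^ 3) by now apply pow_lt.
      assert (Hq3 : 0 < qq ^ 3) by nra.
      assert (Hqp : 0 < qq).
      { apply Rnot_le_lt. intros Hle. pose proof (pow2_ge_0 qq). simpl in *. nra. }
      rewrite Hwb.
      destruct (Hif k' y t Hk' B3 Hqp) as [[Hak [Hc0 Hzp]]|Hlow].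
      + specialize (Hnb Hak). unfold b in Hnb. fold qq in Hnb.
        (* For [c = 0] the tilt disappears and both species carry the same factor [E], although
           their diffusivities differ. *)
        assert (EEk : E (negb k') y t = EE).
        { unfold EE, E, bump_E. rewrite Hc0. unfold Rdiv. rewrite !Rmult_0_l, Ropp_0, !Rmult_0_l. reflexivity. }
        rewrite EEk in Hnb. specialize (Ha k').
        assert (0 < a k' * (6 * zeta * EE * qq ^ 2)).
        { apply Rmult_lt_0_compat; [assumption|]. apply Rmult_lt_0_compat; [|now apply pow_lt].
          apply Rmult_lt_0_compat; lra. }
        lra.
      + fold qq EE in Hlow. assert (0 < EE * e ^ 3) by (apply Rmult_lt_0_compat; lra). lra.
    - destruct (Hqin y1 z1 t1 Ht1 Hq) as [Q1 Q2]. split; [|split]; [|split|]; try lra.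
      + intros j. left. apply Q1.
      + pose proof (Rle_abs (z1 - zeta)). pose proof (Rle_abs zeta). lra. }
  unfold b in Hlow. lra.
Qed.

(** * Propagation of positivity *)

Definition nonneg_solution (N : nat) (D a : bool -> R) (F : bool -> R -> R)
  (w : bool -> (tang N -> R) -> R -> R -> R) : Prop :=
  coupled N D a F w /\ forall k y z t, 0 <= z -> 0 <= t -> 0 <= w k y z t.

Definition ball_ge {N : nat} (w : bool -> (tang N -> R) -> R -> R -> R) (k : bool)
  (y0 : tang N -> R) (zeta r t A : R) : Prop :=
  forall y z, 0 <= z -> sqd y y0 + (z - zeta) ^ 2 < r ^ 2 -> A <= w k y z t.

Lemma bump_q_static {N : nat} (y0 : tang N -> R) r2 m zeta t0 y z t :
  bump_q 0 y0 r2 m 0 zeta t0 y z t = r2 + m * (t - t0) - sqd y y0 - (z - zeta) ^ 2.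
Proof. unfold bump_q. ring. Qed.

Lemma cube_le (x y : R) : 0 <= x -> x <= y -> x ^ 3 <= y ^ 3.
Proof. intros. apply pow_incr. lra. Qed.

(** A bump at rest that neglects the reaction and may decay, so that any radii and any expansion
    rate [m] are allowed; [kap] depends on these only. The interface alternatives are: a pair of
    bumps centred at positive height in both media; a single bump that overlaps the interface so
    little that its own slope compensates for an empty neighbour; a bump centred behind the
    interface and fed by the trace of the other species. *)
Lemma bump_static (N : nat) (D a : bool -> R) (F : bool -> R -> R) (s0 r2 m tau : R) :
  (2 <= N)%nat -> (forall k, 0 < D k) -> (forall k, 0 < a k) ->
  (forall k s, 0 <= s <= s0 -> 0 <= F k s) -> 0 < r2 -> 0 <= m -> 0 <= tau ->
  exists kap, 0 < kap /\
  forall w (act : bool -> bool) y0 zeta t0 A, nonneg_solution N D a F w -> 0 <= t0 -> 0 < A <= s0 ->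
  (forall k y z, act k = true -> 0 <= z -> sqd y y0 + (z - zeta) ^ 2 < r2 -> A <= w k y z t0) ->
  (forall k, act k = true ->
     (act (negb k) = true /\ 0 < zeta) \/
     (0 <= zeta /\ r2 + m * tau - zeta ^ 2 <= 6 * a k * zeta) \/
     (zeta <= 0 /\ forall y t, t0 <= t <= t0 + tau -> sqd y y0 + zeta ^ 2 < r2 + m * (t - t0) ->
        A * (1 + 6 * a k * - zeta / (r2 + m * tau)) <= w (negb k) y 0 t)) ->
  forall k y z t, act k = true -> 0 <= z -> t0 <= t <= t0 + tau ->
    sqd y y0 + (z - zeta) ^ 2 <= r2 + m * (t - t0) ->
    kap * A * (r2 + m * (t - t0) - sqd y y0 - (z - zeta) ^ 2) ^ 3 <= w k y z t.
Proof.
  intros HN HD Ha HF Hr2 Hm Htau.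
  set (P := r2 + m * tau). assert (Hmt := Rmult_le_pos m tau Hm Htau).
  assert (HP : 0 < P) by (unfold P; lra). assert (HP3 : 0 < P ^ 3) by now apply pow_lt.
  (* The decay rate beyond which the discriminant condition of [bump_lower] holds in medium [k]. *)
  set (X := fun k => (3 * m + (6 * INR N + 24) * D k) ^ 2 / (96 * D k * r2)).
  assert (HX : forall k, 0 <= X k).
  { intros k. unfold X. apply Rdiv_le_0_compat; [apply pow2_ge_0|].
    apply Rmult_lt_0_compat; [|assumption]. specialize (HD k). lra. }
  set (Z := X true + X false + 1).
  assert (HZ : forall k, X k < Z) by (intros k; unfold Z; pose proof (HX true); pose proof (HX false); destruct k; lra).
  assert (HZ0 : 0 < Z) by (pose proof (HX true); specialize (HZ true); lra).
  exists (exp (- Z * tau) / P ^ 3). split; [apply Rdiv_lt_0_compat; [apply exp_pos|assumption]|].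
  intros w act y0 zeta t0 A [Hw Hnn] Ht0 HA Hini Hif k y z t Hk Hz Ht Hq.
  assert (HEle : forall t, t0 <= t -> exp (- Z * (t - t0)) <= 1).
  { intros t' Ht'. rewrite <- exp_0. destruct (Req_dec t' t0) as [->|].
    - rewrite Rminus_diag, Rmult_0_r. lra.
    - apply Rlt_le, exp_increasing. nra. }
  assert (HEE : forall k y t, bump_E 0 y0 (A / P ^ 3) (- Z) (0 / (2 * D k)) 0 t0 y t = A / P ^ 3 * exp (- Z * (t - t0))).
  { intros k' y' t'. unfold bump_E. f_equal. f_equal. unfold Rdiv. ring. }
  assert (HAP : 0 < A / P ^ 3) by (apply Rdiv_lt_0_compat; lra).
  assert (HqP : forall y z t, t0 <= t <= t0 + tau -> bump_q 0 y0 r2 m 0 zeta t0 y z t <= P).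
  { intros y' z' t' Ht'. rewrite bump_q_static. pose proof (sqd_nonneg y' y0). pose proof (pow2_ge_0 (z' - zeta)).
    assert (m * (t' - t0) <= m * tau) by (apply Rmult_le_compat_l; lra). unfold P. lra. }
  assert (Hamp : forall y z t, t0 <= t <= t0 + tau -> 0 < bump_q 0 y0 r2 m 0 zeta t0 y z t ->
     A / P ^ 3 * exp (- Z * (t - t0)) * bump_q 0 y0 r2 m 0 zeta t0 y z t ^ 3 <= A).
  { intros y' z' t' Ht' Hq'. specialize (HqP y' z' t' Ht'). specialize (HEle t' ltac:(lra)).
    pose proof (exp_pos (- Z * (t' - t0))).
    assert (bump_q 0 y0 r2 m 0 zeta t0 y' z' t' ^ 3 <= P ^ 3) by (apply cube_le; lra).
    assert (0 < bump_q 0 y0 r2 m 0 zeta t0 y' z' t' ^ 3) by now apply pow_lt.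
    replace A with (A / P ^ 3 * (1 * P ^ 3)) at 2 by (field; lra). rewrite Rmult_assoc.
    apply Rmult_le_compat_l; [lra|]. apply Rmult_le_compat; lra. }
  assert (H := bump_lower N 0 D a (fun _ => 0) F w act (A / P ^ 3) (- Z) 0 m r2 zeta s0 t0 tau y0
    HN ltac:(lia) HD Ha Hw Hnn HAP Hm Hr2 Ht0 Htau).
  cbv zeta in H.
  assert (He : forall k, 0 - - Z - 0 ^ 2 / (4 * D k) = Z).
  { intros k'. specialize (HD k'). field. lra. }
  specialize (H ltac:(intros k' _; rewrite He; lra)).
  specialize (H ltac:(intros k' _; rewrite He; specialize (HZ k'); specialize (HD k'); unfold X in HZ;
    apply Rmult_lt_compat_r with (r := 96 * D k' * r2) in HZ; [|apply Rmult_lt_0_compat; lra];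
    unfold Rdiv in HZ; rewrite Rmult_assoc, Rinv_l, Rmult_1_r in HZ; [lra|];
    apply Rgt_not_eq, Rmult_lt_0_compat; lra)).
  specialize (H ltac:(intros k' s _ Hs; specialize (HF k' s Hs); lra)).
  assert (H1 : forall k y z t, act k = true -> 0 <= z -> t0 <= t <= t0 + tau ->
    bump_E 0 y0 (A / P ^ 3) (- Z) (0 / (2 * D k)) 0 t0 y t * bump_q 0 y0 r2 m 0 zeta t0 y z t ^ 3 <= w k y z t).
  { apply H.
    - intros k' y' z' t' _ Hz' Ht' Hq'. rewrite HEE. specialize (Hamp y' z' t' Ht' Hq'). lra.
    - intros k' y' z' Hk' Hz' Hq'. rewrite HEE. specialize (Hamp y' z' t0 ltac:(lra) Hq').
      rewrite bump_q_static in Hq', Hamp |- *. specialize (Hini k' y' z' Hk' Hz' ltac:(lra)). lra.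
    - intros k' y' t' Hk' Ht' Hq'. destruct (Hif k' Hk') as [[H1 H2]|[[H1 H2]|[H1 H2]]].
      + left. auto.
      + right. rewrite HEE. apply Rle_trans with 0; [|apply Hnn; lra].
        assert (Hq2 : bump_q 0 y0 r2 m 0 zeta t0 y' 0 t' <= 6 * a k' * zeta).
        { rewrite bump_q_static. pose proof (sqd_nonneg y' y0).
          assert (m * (t' - t0) <= m * tau) by (apply Rmult_le_compat_l; lra).
          replace ((0 - zeta) ^ 2) with (zeta ^ 2) by ring. unfold P in *. lra. }
        set (qq := bump_q 0 y0 r2 m 0 zeta t0 y' 0 t') in *.
        assert (0 < A / P ^ 3 * exp (- Z * (t' - t0))) by (apply Rmult_lt_0_compat; [assumption|apply exp_pos]).
        set (EE := A / P ^ 3 * exp (- Z * (t' - t0))) in *.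
        replace (EE * qq ^ 3 - 6 * a k' * zeta * EE * qq ^ 2) with (- (EE * qq ^ 2 * (6 * a k' * zeta - qq))) by ring.
        assert (0 <= EE * qq ^ 2 * (6 * a k' * zeta - qq)).
        { apply Rmult_le_pos; [|lra]. apply Rmult_le_pos; [lra|apply pow2_ge_0]. }
        lra.
      + right. rewrite HEE. specialize (HqP y' 0 t' Ht'). specialize (Hamp y' 0 t' Ht' Hq').
        set (qq := bump_q 0 y0 r2 m 0 zeta t0 y' 0 t') in *.
        assert (Hqs : qq = r2 + m * (t' - t0) - sqd y' y0 - zeta ^ 2).
        { unfold qq. rewrite bump_q_static. ring. }
        specialize (H2 y' t' Ht' ltac:(lra)). eapply Rle_trans; [|exact H2].
        set (EE := A / P ^ 3 * exp (- Z * (t' - t0))) in *.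
        assert (HE2 : EE * qq ^ 2 <= A / P).
        { specialize (HEle t' ltac:(lra)). pose proof (exp_pos (- Z * (t' - t0))).
          replace (A / P) with (A / P ^ 3 * (1 * P ^ 2)) by (field; lra).
          unfold EE. rewrite Rmult_assoc. apply Rmult_le_compat_l; [lra|].
          apply Rmult_le_compat; try lra; [apply pow2_ge_0|apply pow_incr; lra]. }
        replace (A * (1 + 6 * a k' * - zeta / P)) with (A + (6 * a k' * - zeta) * (A / P)) by (field; lra).
        replace (EE * qq ^ 3 - 6 * a k' * zeta * EE * qq ^ 2) with
          (EE * qq ^ 3 + (6 * a k' * - zeta) * (EE * qq ^ 2)) by ring.
        apply Rplus_le_compat; [exact Hamp|]. apply Rmult_le_compat_l; [|exact HE2].
        specialize (Ha k'). apply Rmult_le_pos; lra. }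
  specialize (H1 k y z t Hk Hz Ht). rewrite HEE, bump_q_static in H1.
  eapply Rle_trans; [|exact H1]. apply Rmult_le_compat_r; [apply pow_le; lra|].
  replace (exp (- Z * tau) / P ^ 3 * A) with (A / P ^ 3 * exp (- Z * tau)) by (field; lra).
  apply Rmult_le_compat_l; [lra|].
  destruct (Req_dec (t - t0) tau) as [->|]; [lra|]. apply Rlt_le, exp_increasing. nra.
Qed.

(* Three successive bumps: one in the initial medium reaching the interface, one entering the other
   medium through the exchange term, and one symmetric pair expanding in both media. *)
Lemma spread (N : nat) (D a : bool -> R) (F : bool -> R -> R) (s0 zeta r R2 tau1 tau2 : R) :
  (2 <= N)%nat -> (forall k, 0 < D k) -> (forall k, 0 < a k) -> 0 < s0 ->
  (forall k s, 0 <= s <= s0 -> 0 <= F k s) -> 0 < r <= zeta -> 0 < R2 -> 0 < tau1 <= tau2 ->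
  exists kap, 0 < kap /\
  forall w k y0 t0 A, nonneg_solution N D a F w -> 0 <= t0 -> 0 < A <= s0 ->
  ball_ge w k y0 zeta r t0 A ->
  forall k' y z t, t0 + tau1 <= t <= t0 + tau2 -> (forall j, Rabs (y j - y0 j) <= R2) -> 0 <= z <= R2 ->
    kap * A <= w k' y z t.
Proof.
  intros HN HD Ha Hs0 HF Hr HR2 Htau.
  set (am := Rmin (a true) (a false)).
  assert (Ham : 0 < am) by (apply Rmin_glb_lt; apply Ha).
  assert (Hamk : forall k, am <= a k) by (intros []; [apply Rmin_l|apply Rmin_r]).
  (* The first bump ends with squared radius [zeta^2 + d1]: it crosses the interface, and
     [d1 <= 6 * a k * zeta] is the second alternative of [bump_static]. *)
  set (d1 := Rmin 1 (6 * am * zeta)).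
  assert (Hd1 : 0 < d1) by (apply Rmin_glb_lt; [lra|apply Rmult_lt_0_compat; lra]).
  assert (Hd1' : d1 <= 1 /\ d1 <= 6 * am * zeta) by (split; [apply Rmin_l|apply Rmin_r]).
  set (ta := tau1 / 2). assert (Hta : 0 < ta) by (unfold ta; lra).
  set (m1 := (zeta ^ 2 + d1 - r ^ 2) / ta).
  assert (Hrz : r ^ 2 <= zeta ^ 2) by (apply pow_incr; lra).
  assert (Hr2 : 0 < r ^ 2) by (apply pow_lt; lra).
  assert (Hm1 : 0 < m1) by (unfold m1; apply Rdiv_lt_0_compat; lra).
  (* During the last [h] units of the first stage the squared radius is at least [zeta^2 + d1 / 2],
     which bounds the trace from below where [sqd y y0 < d1 / 4]. *)
  set (h := Rmin ta (d1 / (2 * m1))).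
  assert (Hh : 0 < h) by (apply Rmin_glb_lt; [lra|apply Rdiv_lt_0_compat; lra]).
  assert (Hhta : h <= ta) by apply Rmin_l.
  assert (Hhm : m1 * h <= d1 / 2).
  { apply Rle_trans with (m1 * (d1 / (2 * m1))); [apply Rmult_le_compat_l; [lra|apply Rmin_r]|].
    apply Req_le. field. lra. }
  (* The second bump is centred at height [-1] with squared radius 1, so its support is empty in the
     half-space at the start and nothing is required initially in the new medium; after time [h] the
     squared radius is [1 + d1 / 4]. *)
  set (m2 := d1 / 4 / h). assert (Hm2 : 0 < m2) by (unfold m2; apply Rdiv_lt_0_compat; lra).
  (* In the ball of radius [r3] around height [r3], [sqd y y0 + z^2 + 2 z] is at most
     [9 * r3 = d1 / 8]; both earlier bounds hold there, so the symmetric pair can start. *)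
  set (r3 := d1 / 72). assert (Hr3 : 0 < r3 <= 1) by (unfold r3; lra).
  set (X := INR (N - 1) * R2 ^ 2 + (R2 + 1) ^ 2 + 1).
  assert (HNR : 0 <= INR (N - 1)) by apply pos_INR.
  assert (HXp : 0 < X).
  { unfold X. pose proof (pow2_ge_0 (R2 + 1)). pose proof (Rmult_le_pos _ _ HNR (pow2_ge_0 R2)). lra. }
  set (m3 := X / ta). assert (Hm3 : 0 < m3) by (unfold m3; apply Rdiv_lt_0_compat; lra).
  destruct (bump_static N D a F s0 (r ^ 2) m1 ta HN HD Ha HF Hr2 ltac:(lra) ltac:(lra)) as [k1 [Hk1 H1]].
  destruct (bump_static N D a F s0 1 m2 h HN HD Ha HF ltac:(lra) ltac:(lra) ltac:(lra)) as [k2 [Hk2 H2]].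
  destruct (bump_static N D a F s0 (r3 ^ 2) m3 tau2 HN HD Ha HF (pow_lt _ _ (proj1 Hr3)) ltac:(lra) ltac:(lra)) as [k3 [Hk3 H3]].
  set (Y := 1 + 6 * (a true + a false)).
  assert (HY : forall k, 1 + 6 * a k * - -1 / (1 + m2 * h) <= Y).
  { intros k. unfold Y. pose proof (Ha true). pose proof (Ha false). assert (0 < m2 * h) by (apply Rmult_lt_0_compat; lra).
    assert (6 * a k * - -1 / (1 + m2 * h) <= 6 * a k).
    { apply Rmult_le_reg_r with (1 + m2 * h); [lra|]. field_simplify; [|lra]. specialize (Ha k).
      assert (0 < a k * (m2 * h)) by (apply Rmult_lt_0_compat; lra). lra. }
    destruct k; lra. }
  assert (HY1 : 1 <= Y) by (unfold Y; pose proof (Ha true); pose proof (Ha false); lra).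
  (* Lower bounds transmitted from one stage to the next, as fractions of [A]. *)
  set (e2 := Rmin 1 (k1 * (d1 / 4) ^ 3 / Y)).
  assert (Hd4 : 0 < (d1 / 4) ^ 3) by (apply pow_lt; lra).
  assert (Hd8 : 0 < (d1 / 8) ^ 3) by (apply pow_lt; lra).
  assert (He2 : 0 < e2 <= 1).
  { split; [|apply Rmin_l]. apply Rmin_glb_lt; [lra|]. apply Rdiv_lt_0_compat; [|lra]. apply Rmult_lt_0_compat; lra. }
  assert (He2' : e2 * Y <= k1 * (d1 / 4) ^ 3).
  { apply Rle_trans with (k1 * (d1 / 4) ^ 3 / Y * Y); [apply Rmult_le_compat_r; [lra|apply Rmin_r]|].
    apply Req_le. field. lra. }
  set (e3 := Rmin (Rmin 1 (k1 * (d1 / 8) ^ 3)) (k2 * e2 * (d1 / 8) ^ 3)).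
  assert (He3 : 0 < e3) by (unfold e3; repeat apply Rmin_glb_lt; try lra; repeat apply Rmult_lt_0_compat; lra).
  assert (He31 : e3 <= 1) by (unfold e3; eapply Rle_trans; [apply Rmin_l|apply Rmin_l]).
  assert (He32 : e3 <= k1 * (d1 / 8) ^ 3) by (unfold e3; eapply Rle_trans; [apply Rmin_l|apply Rmin_r]).
  assert (He33 : e3 <= k2 * e2 * (d1 / 8) ^ 3) by apply Rmin_r.
  exists (k3 * e3). split; [apply Rmult_lt_0_compat; lra|].
  intros w k y0 t0 A Hw Ht0 HA Hball.
  assert (S1 : forall y z t, 0 <= z -> t0 <= t <= t0 + ta -> sqd y y0 + (z - zeta) ^ 2 <= r ^ 2 + m1 * (t - t0) ->
     k1 * A * (r ^ 2 + m1 * (t - t0) - sqd y y0 - (z - zeta) ^ 2) ^ 3 <= w k y z t).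
  { intros y z t. apply (H1 w (fun k' => Bool.eqb k' k) y0 zeta t0 A Hw Ht0 HA).
    - intros k' y' z' Hk' Hz' Hd. apply Bool.eqb_prop in Hk'. subst k'. now apply Hball.
    - intros k' _. right. left. split; [lra|].
      replace (m1 * ta) with (zeta ^ 2 + d1 - r ^ 2) by (unfold m1; field; lra).
      specialize (Hamk k'). assert (6 * am * zeta <= 6 * a k' * zeta) by (apply Rmult_le_compat_r; lra). lra.
    - apply Bool.eqb_reflx. }
  assert (Em1 : forall t, r ^ 2 + m1 * (t - t0) = zeta ^ 2 + d1 - m1 * (t0 + ta - t)).
  { intros t. replace (m1 * (t - t0)) with (m1 * ta - m1 * (t0 + ta - t)) by ring.
    replace (m1 * ta) with (zeta ^ 2 + d1 - r ^ 2) by (unfold m1; field; lra). ring. }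
  assert (S1b : forall y t, t0 + ta - h <= t <= t0 + ta -> sqd y y0 < d1 / 4 -> k1 * A * (d1 / 4) ^ 3 <= w k y 0 t).
  { intros y t Ht Hy.
    assert (m1 * (t0 + ta - t) <= m1 * h) by (apply Rmult_le_compat_l; lra).
    assert (Hge : d1 / 4 <= r ^ 2 + m1 * (t - t0) - sqd y y0 - (0 - zeta) ^ 2) by (rewrite Em1; lra).
    specialize (S1 y 0 t ltac:(lra) ltac:(lra) ltac:(lra)). eapply Rle_trans; [|exact S1].
    apply Rmult_le_compat_l; [apply Rmult_le_pos; lra|]. apply cube_le; lra. }
  assert (Emh : m2 * h = d1 / 4) by (unfold m2; field; lra).
  assert (S2 : forall y z, 0 <= z -> sqd y y0 + z ^ 2 + 2 * z <= d1 / 8 -> k2 * (e2 * A) * (d1 / 8) ^ 3 <= w (negb k) y z (t0 + ta)).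
  { intros y z Hz Hd.
    assert (Hge : d1 / 8 <= 1 + m2 * (t0 + ta - (t0 + ta - h)) - sqd y y0 - (z - -1) ^ 2).
    { replace (t0 + ta - (t0 + ta - h)) with h by ring. rewrite Emh. lra. }
    eapply Rle_trans; [|apply (H2 w (fun k' => Bool.eqb k' (negb k)) y0 (-1) (t0 + ta - h) (e2 * A) Hw)].
    - apply Rmult_le_compat_l; [|apply cube_le; [lra|exact Hge]].
      apply Rmult_le_pos; [lra|apply Rmult_le_pos; lra].
    - lra.
    - split; [apply Rmult_lt_0_compat; lra|]. assert (e2 * A <= 1 * A) by (apply Rmult_le_compat_r; lra). lra.
    - intros k' y' z' _ Hz' Hd'. exfalso. pose proof (sqd_nonneg y' y0). nra.
    - intros k' Hk'. apply Bool.eqb_prop in Hk'. subst k'. rewrite Bool.negb_involutive. right. right. split; [lra|].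
      intros y' t' Ht' Hd'.
      assert (Hs : sqd y' y0 < d1 / 4).
      { assert (m2 * (t' - (t0 + ta - h)) <= m2 * h) by (apply Rmult_le_compat_l; lra). lra. }
      eapply Rle_trans; [|apply S1b; [lra|exact Hs]]. specialize (HY (negb k)).
      assert (e2 * A * (1 + 6 * a (negb k) * - -1 / (1 + m2 * h)) <= e2 * A * Y).
      { apply Rmult_le_compat_l; [apply Rmult_le_pos; lra|exact HY]. }
      assert (e2 * Y * A <= k1 * (d1 / 4) ^ 3 * A) by (apply Rmult_le_compat_r; lra). lra.
    - apply Bool.eqb_reflx.
    - exact Hz.
    - lra.
    - lra. }
  intros k' y z t Ht Hy Hz.
  assert (Hge : 1 <= r3 ^ 2 + m3 * (t - (t0 + ta)) - sqd y y0 - (z - r3) ^ 2).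
  { assert (m3 * ta <= m3 * (t - (t0 + ta))) by (apply Rmult_le_compat_l; unfold ta in *; lra).
    assert (m3 * ta = X) by (unfold m3; field; lra).
    pose proof (sqd_le_box y y0 R2 HN Hy). pose proof (pow2_ge_0 r3).
    assert ((z - r3) ^ 2 <= (R2 + 1) ^ 2).
    { rewrite <- (pow2_abs (z - r3)). apply pow_incr. split; [apply Rabs_pos|]. apply Rabs_le. lra. }
    unfold X in *. lra. }
  eapply Rle_trans; [|apply (H3 w (fun _ => true) y0 r3 (t0 + ta) (e3 * A) Hw)].
  - apply Rle_trans with (k3 * (e3 * A) * 1 ^ 3); [apply Req_le; ring|].
    apply Rmult_le_compat_l; [apply Rmult_le_pos; [lra|apply Rmult_le_pos; lra]|]. apply cube_le; [lra|exact Hge].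
  - lra.
  - split; [apply Rmult_lt_0_compat; lra|]. assert (e3 * A <= 1 * A) by (apply Rmult_le_compat_r; lra). lra.
  - intros k'' y' z' _ Hz' Hd'. pose proof (sqd_nonneg y' y0).
    assert (Hz2 : z' < 2 * r3).
    { apply Rnot_le_lt. intros Hn. assert (r3 ^ 2 <= (z' - r3) ^ 2) by (apply pow_incr; lra). lra. }
    pose proof (pow2_ge_0 (z' - r3)).
    assert (Hsmall : sqd y' y0 + z' ^ 2 + 2 * z' <= d1 / 8).
    { assert (r3 ^ 2 <= r3) by nra. assert (z' ^ 2 <= 4 * r3) by nra. unfold r3 in *. lra. }
    destruct (Bool.bool_dec k'' k) as [->|Hne].
    + assert (Hg2 : d1 / 8 <= r ^ 2 + m1 * (t0 + ta - t0) - sqd y' y0 - (z' - zeta) ^ 2).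
      { rewrite Em1. assert (0 <= z' * zeta) by (apply Rmult_le_pos; lra).
        replace (m1 * (t0 + ta - (t0 + ta))) with 0 by ring. lra. }
      eapply Rle_trans; [|apply S1; lra].
      apply Rle_trans with (k1 * A * (d1 / 8) ^ 3).
      * replace (k1 * A * (d1 / 8) ^ 3) with (k1 * (d1 / 8) ^ 3 * A) by ring. apply Rmult_le_compat_r; lra.
      * apply Rmult_le_compat_l; [apply Rmult_le_pos; lra|]. apply cube_le; lra.
    + replace k'' with (negb k) by (clear - Hne; destruct k, k''; simpl; try reflexivity; exfalso; now apply Hne).
      eapply Rle_trans; [|apply S2; assumption].
      replace (k2 * (e2 * A) * (d1 / 8) ^ 3) with (k2 * e2 * (d1 / 8) ^ 3 * A) by ring. apply Rmult_le_compat_r; lra.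
  - intros k'' _. left. split; [reflexivity|lra].
  - reflexivity.
  - lra.
  - unfold ta in *. lra.
  - lra.
Qed.

(** * Cycles alternating between the two media *)

Lemma exp_le_mono (x y : R) : x <= y -> exp x <= exp y.
Proof. intros [H| ->]; [apply Rlt_le, exp_increasing, H|apply Rle_refl]. Qed.

Lemma sqd_ge_coord_nat {N : nat} (y y0 : tang N -> R) (k : nat) :
  (k < N - 1)%nat -> (coord y k - coord y0 k) ^ 2 <= sqd y y0.
Proof. intros h. rewrite (coord_lt y k h), (coord_lt y0 k h). apply sqd_ge_coord. Qed.

Definition shift {N : nat} (i : nat) (y : tang N -> R) (s : R) : tang N -> R := upd y i (coord y i + s).

(** Since [R0 <= zeta], the support never reaches the interface and a single medium matters. The
    essential point is that [kap] depends neither on the duration [s], nor on the amplitude, nor on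
    the speed within [[- V, V]]: only the tilt over one diameter and the passage to half the radius
    are lost. *)
Lemma move (N i : nat) (D a : bool -> R) (F : bool -> R -> R) (s0 lam V sg eta R0 : R) (k : bool) :
  (2 <= N)%nat -> (i < N - 1)%nat -> (forall k, 0 < D k) -> (forall k, 0 < a k) ->
  (forall s, 0 <= s <= s0 -> lam * s <= F k s) -> 0 <= V -> 0 < eta -> 0 < R0 ->
  V ^ 2 / (4 * D k) + sg + eta <= lam ->
  ((6 * INR N + 24) * D k) ^ 2 < 96 * D k * R0 ^ 2 * eta ->
  exists kap, 0 < kap /\
  forall w c y0 zeta t0 A s, nonneg_solution N D a F w -> R0 <= zeta -> Rabs c <= V -> 0 <= t0 -> 0 <= s ->
  0 < A -> A * exp (Rabs sg * s) <= s0 -> ball_ge w k y0 zeta R0 t0 A ->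
  ball_ge w k (shift i y0 (c * s)) zeta (R0 / 2) (t0 + s) (kap * (A * exp (sg * s))).
Proof.
  intros HN Hi HD Ha HF HV Heta HR Hlam Hdisc.
  set (bm := V / (2 * D k)). assert (HDk := HD k).
  assert (Hbm : 0 <= bm) by (unfold bm; apply Rdiv_le_0_compat; lra).
  exists (exp (- (2 * bm * R0)) * (3 / 4) ^ 3).
  split; [apply Rmult_lt_0_compat; [apply exp_pos|lra]|].
  intros w c y0 zeta t0 A s [Hw Hnn] Hze Hc Ht0 Hs HA HAs Hball.
  (* Normalised so that the bump stays below [A * exp (sg * (t - t0))]: the exponential offsets the
     largest tilt on the support and [R0^6] is the largest value of [q^3]. *)
  set (A2 := A * exp (- (bm * R0)) / R0 ^ 6).
  assert (HR6 : 0 < R0 ^ 6) by now apply pow_lt.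
  assert (HR2 : 0 < R0 ^ 2) by now apply pow_lt.
  assert (HA2 : 0 < A2) by (unfold A2; apply Rdiv_lt_0_compat; [apply Rmult_lt_0_compat; [lra|apply exp_pos]|lra]).
  assert (Hxi : forall y z t, 0 < bump_q i y0 (R0 ^ 2) 0 c zeta t0 y z t ->
     Rabs (- (c / (2 * D k)) * (coord y i - (coord y0 i + c * (t - t0)))) <= bm * R0).
  { intros y z t Hq. rewrite bump_q_sqd in Hq by assumption.
    assert (H := sqd_ge_coord_nat y (upd y0 i (coord y0 i + c * (t - t0))) i Hi).
    rewrite coord_upd_same in H by assumption. pose proof (pow2_ge_0 (z - zeta)).
    rewrite Rabs_mult. apply Rmult_le_compat; try apply Rabs_pos.
    - rewrite Rabs_Ropp. unfold Rdiv. rewrite Rabs_mult, (Rabs_pos_eq (/ _)).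
      + unfold bm, Rdiv. apply Rmult_le_compat_r; [|assumption]. apply Rlt_le, Rinv_0_lt_compat; lra.
      + apply Rlt_le, Rinv_0_lt_compat; lra.
    - rewrite <- (Rabs_pos_eq R0) by lra. apply Rsqr_le_abs_0. rewrite !Rsqr_pow2. lra. }
  assert (HE : forall y z t, 0 < bump_q i y0 (R0 ^ 2) 0 c zeta t0 y z t ->
     A * exp (- (2 * bm * R0)) / R0 ^ 6 * exp (sg * (t - t0)) <= bump_E i y0 A2 sg (c / (2 * D k)) c t0 y t
     <= A / R0 ^ 6 * exp (sg * (t - t0))).
  { intros y z t Hq. specialize (Hxi y z t Hq). apply Rabs_le_between in Hxi.
    unfold bump_E, A2. rewrite exp_plus.
    set (X := - (c / (2 * D k)) * (coord y i - (coord y0 i + c * (t - t0)))) in *.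
    replace (A * exp (- (bm * R0)) / R0 ^ 6 * (exp (sg * (t - t0)) * exp X)) with
      (A / R0 ^ 6 * exp (sg * (t - t0)) * exp (- (bm * R0) + X)) by (rewrite exp_plus; field; lra).
    assert (Hp : 0 <= A / R0 ^ 6 * exp (sg * (t - t0))).
    { apply Rmult_le_pos; [apply Rdiv_le_0_compat; lra|apply Rlt_le, exp_pos]. }
    split.
    - replace (A * exp (- (2 * bm * R0)) / R0 ^ 6 * exp (sg * (t - t0))) with
        (A / R0 ^ 6 * exp (sg * (t - t0)) * exp (- (2 * bm * R0))) by (field; lra).
      apply Rmult_le_compat_l; [exact Hp|]. apply exp_le_mono. lra.
    - rewrite <- (Rmult_1_r (A / R0 ^ 6 * exp (sg * (t - t0)))) at 2.
      apply Rmult_le_compat_l; [exact Hp|]. rewrite <- exp_0. apply exp_le_mono. lra. }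
  assert (HqR : forall y z t, bump_q i y0 (R0 ^ 2) 0 c zeta t0 y z t <= R0 ^ 2).
  { intros y z t. rewrite bump_q_sqd by assumption. pose proof (sqd_nonneg y (upd y0 i (coord y0 i + c * (t - t0)))).
    pose proof (pow2_ge_0 (z - zeta)). lra. }
  assert (Hamp : forall y z t, 0 < bump_q i y0 (R0 ^ 2) 0 c zeta t0 y z t ->
    bump_E i y0 A2 sg (c / (2 * D k)) c t0 y t * bump_q i y0 (R0 ^ 2) 0 c zeta t0 y z t ^ 3 <= A * exp (sg * (t - t0))).
  { intros y z t Hq. destruct (HE y z t Hq) as [_ He]. specialize (HqR y z t).
    set (q := bump_q i y0 (R0 ^ 2) 0 c zeta t0 y z t) in *.
    replace (A * exp (sg * (t - t0))) with (A / R0 ^ 6 * exp (sg * (t - t0)) * (R0 ^ 2) ^ 3) by (field; lra).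
    apply Rmult_le_compat; [apply Rlt_le, Rmult_lt_0_compat; [assumption|apply exp_pos]|apply pow_le; lra|exact He|].
    apply cube_le; lra. }
  assert (Hcs : c ^ 2 / (4 * D k) <= V ^ 2 / (4 * D k)).
  { unfold Rdiv. apply Rmult_le_compat_r; [apply Rlt_le, Rinv_0_lt_compat; lra|].
    rewrite <- pow2_abs. apply pow_incr. split; [apply Rabs_pos|assumption]. }
  intros y z Hz Hd.
  assert (Hb := bump_lower N i D a (fun _ => lam) F w (fun k' => Bool.eqb k' k) A2 sg c 0 (R0 ^ 2) zeta s0 t0 s y0
    HN Hi HD Ha Hw Hnn HA2 (Rle_refl 0) HR2 Ht0 Hs).
  cbv zeta in Hb.
  assert (Hb1 : bump_E i y0 A2 sg (c / (2 * D k)) c t0 y (t0 + s) *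
    bump_q i y0 (R0 ^ 2) 0 c zeta t0 y z (t0 + s) ^ 3 <= w k y z (t0 + s)).
  { apply Hb.
    - intros k' Hk'. apply Bool.eqb_prop in Hk'. subst k'. lra.
    - intros k' Hk'. apply Bool.eqb_prop in Hk'. subst k'. rewrite Rmult_0_r, Rplus_0_l.
      eapply Rlt_le_trans; [exact Hdisc|]. apply Rmult_le_compat_l; [|lra].
      apply Rmult_le_pos; lra.
    - intros k' x Hk' Hx. apply Bool.eqb_prop in Hk'. subst k'. now apply HF.
    - intros k' y' z' t' Hk' Hz' Ht' Hq'. apply Bool.eqb_prop in Hk'. subst k'.
      eapply Rle_trans; [apply Hamp; exact Hq'|]. eapply Rle_trans; [|exact HAs].
      apply Rmult_le_compat_l; [lra|]. apply exp_le_mono.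
      pose proof (Rle_abs sg). pose proof (Rabs_pos sg).
      apply Rle_trans with (Rabs sg * (t' - t0)); [apply Rmult_le_compat_r; lra|apply Rmult_le_compat_l; lra].
    - intros k' y' z' Hk' Hz' Hq'. apply Bool.eqb_prop in Hk'. subst k'.
      eapply Rle_trans; [apply Hamp; exact Hq'|]. rewrite Rminus_diag, Rmult_0_r, exp_0, Rmult_1_r.
      apply Hball; [assumption|]. unfold bump_q in Hq'.
      rewrite Rminus_diag, Rmult_0_r in Hq'. replace (coord y' i - (coord y0 i + c * 0)) with (coord y' i - coord y0 i) in Hq' by ring. lra.
    - intros k' y' t' Hk' Ht' Hq'. exfalso. rewrite bump_q_sqd in Hq' by assumption.
      pose proof (sqd_nonneg y' (upd y0 i (coord y0 i + c * (t' - t0)))).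
      assert (R0 ^ 2 <= (0 - zeta) ^ 2) by (replace ((0 - zeta) ^ 2) with (zeta ^ 2) by ring; apply pow_incr; lra). lra.
    - apply Bool.eqb_reflx.
    - assumption.
    - lra. }
  eapply Rle_trans; [|exact Hb1].
  assert (Hq : 3 / 4 * R0 ^ 2 <= bump_q i y0 (R0 ^ 2) 0 c zeta t0 y z (t0 + s)).
  { rewrite bump_q_sqd by assumption. replace (t0 + s - t0) with s by ring. unfold shift in Hd. lra. }
  destruct (HE y z (t0 + s) ltac:(lra)) as [He _]. replace (t0 + s - t0) with s in He by ring.
  replace (exp (- (2 * bm * R0)) * (3 / 4) ^ 3 * (A * exp (sg * s))) with
    (A * exp (- (2 * bm * R0)) / R0 ^ 6 * exp (sg * s) * (3 / 4 * R0 ^ 2) ^ 3) by (field; lra).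
  apply Rmult_le_compat; [|apply pow_le; lra|exact He|apply cube_le; lra].
  apply Rmult_le_pos; [apply Rdiv_le_0_compat; [|lra]|apply Rlt_le, exp_pos].
  apply Rmult_le_pos; [lra|apply Rlt_le, exp_pos].
Qed.

Lemma ball_ge_mono {N : nat} (w : bool -> (tang N -> R) -> R -> R -> R) k y0 zeta r r' t A A' :
  0 <= r' <= r -> A' <= A -> ball_ge w k y0 zeta r t A -> ball_ge w k y0 zeta r' t A'.
Proof.
  intros Hr HA H y z Hz Hd. apply Rle_trans with A; [assumption|]. apply H; [assumption|].
  eapply Rlt_le_trans; [exact Hd|]. apply pow_incr. lra.
Qed.

Lemma ball_ge_of_box {N : nat} (w : bool -> (tang N -> R) -> R -> R -> R) k y0 R0 R2 t A :
  0 < R0 -> 2 * R0 <= R2 ->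
  (forall y z, (forall j, Rabs (y j - y0 j) <= R2) -> 0 <= z <= R2 -> A <= w k y z t) ->
  ball_ge w k y0 R0 R0 t A.
Proof.
  intros HR HR2 H y z Hz Hd. pose proof (sqd_nonneg y y0). pose proof (pow2_ge_0 (z - R0)). apply H.
  - intros j. assert (Rabs (y j - y0 j) < R0); [|lra]. apply sqd_lt_coord; lra.
  - split; [assumption|]. apply Rnot_lt_le. intros Hn. assert (R0 ^ 2 <= (z - R0) ^ 2); [|lra].
    apply pow_incr. lra.
Qed.

Lemma KPP_f_linear_lower (F : R -> R) (l S eta : R) :
  KPP_f F l S -> 0 < eta -> exists s0, 0 < s0 /\ forall s, 0 <= s <= s0 -> (l - eta) * s <= F s.
Proof.
  intros (HS & _ & Hd & H0 & _) He. destruct (Hd eta He) as [dl H].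
  exists (dl / 2). pose proof (cond_pos dl). split; [lra|]. intros s Hs.
  destruct (Req_dec s 0) as [->|Hn]; [rewrite H0; lra|].
  specialize (H s Hn ltac:(rewrite Rabs_pos_eq; lra)). rewrite Rplus_0_l, H0, Rminus_0_r in H.
  apply Rabs_def2 in H. destruct H as [_ H].
  assert (Hs0 : 0 < s) by lra.
  apply Rmult_lt_compat_r with (r := s) in H; [|assumption].
  replace ((F s / s - l) * s) with (F s - l * s) in H by (field; lra). lra.
Qed.

Lemma KPP_f_rate_pos (F : R -> R) (l S : R) : KPP_f F l S -> 0 < l.
Proof.
  intros (HS & _ & _ & _ & _ & H & _). specialize (H (S / 2) ltac:(lra)).
  apply Rmult_lt_reg_r with (S / 2); lra.
Qed.

(** One unit of time after the move restores the full radius [R0], at height [R0] and in the other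
    medium. The loss is again a factor independent of the duration, and the final configuration can
    start a stage in the opposite medium. *)
Lemma stage (N i : nat) (D a : bool -> R) (F : bool -> R -> R) (s0 lam V sg eta R0 : R) (k : bool) :
  (2 <= N)%nat -> (i < N - 1)%nat -> (forall k, 0 < D k) -> (forall k, 0 < a k) -> 0 < s0 ->
  (forall k s, 0 <= s <= s0 -> 0 <= F k s) ->
  (forall s, 0 <= s <= s0 -> lam * s <= F k s) -> 0 <= V -> 0 < eta -> 0 < R0 ->
  V ^ 2 / (4 * D k) + sg + eta <= lam ->
  ((6 * INR N + 24) * D k) ^ 2 < 96 * D k * R0 ^ 2 * eta ->
  exists kap, 0 < kap <= 1 /\
  forall w c y0 t0 A s, nonneg_solution N D a F w -> Rabs c <= V -> 0 <= t0 -> 0 <= s ->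
  0 < A -> A * exp (Rabs sg * s) <= s0 -> ball_ge w k y0 R0 R0 t0 A ->
  ball_ge w (negb k) (shift i y0 (c * s)) R0 R0 (t0 + s + 1) (kap * (A * exp (sg * s))).
Proof.
  intros HN Hi HD Ha Hs0 HF0 HF HV Heta HR Hlam Hdisc.
  destruct (move N i D a F s0 lam V sg eta R0 k HN Hi HD Ha HF HV Heta HR Hlam Hdisc) as [k1 [Hk1 H1]].
  destruct (spread N D a F s0 R0 (R0 / 2) (2 * R0) 1 1 HN HD Ha Hs0 HF0) as [k2 [Hk2 H2]]; try lra.
  (* Factors truncated at 1 keep the amplitude passed to [spread] below [s0]. *)
  set (k1' := Rmin 1 k1). set (k2' := Rmin 1 k2).
  assert (Hk1' : 0 < k1' <= 1) by (split; [apply Rmin_glb_lt; lra|apply Rmin_l]).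
  assert (Hk2' : 0 < k2' <= 1) by (split; [apply Rmin_glb_lt; lra|apply Rmin_l]).
  assert (Hk1k : k1' <= k1) by apply Rmin_r. assert (Hk2k : k2' <= k2) by apply Rmin_r.
  exists (k2' * k1'). split; [split; [apply Rmult_lt_0_compat; lra|nra]|].
  intros w c y0 t0 A s Hw Hc Ht0 Hs HA HAs Hball.
  specialize (H1 w c y0 R0 t0 A s Hw (Rle_refl R0) Hc Ht0 Hs HA HAs Hball).
  set (B := A * exp (sg * s)) in *.
  assert (HB : 0 < B) by (apply Rmult_lt_0_compat; [assumption|apply exp_pos]).
  assert (HBs : B <= s0).
  { eapply Rle_trans; [|exact HAs]. apply Rmult_le_compat_l; [lra|]. apply exp_le_mono.
    apply Rmult_le_compat_r; [assumption|apply Rle_abs]. }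
  apply ball_ge_of_box with (2 * R0); [assumption|lra|]. intros y z Hy Hz.
  apply Rle_trans with (k2 * (k1' * B)).
  - rewrite Rmult_assoc. apply Rmult_le_compat_r; [apply Rmult_le_pos; lra|assumption].
  - apply (H2 w k (shift i y0 (c * s)) (t0 + s) (k1' * B) Hw); try assumption; try lra.
    + split; [apply Rmult_lt_0_compat; lra|]. assert (k1' * B <= 1 * B) by (apply Rmult_le_compat_r; lra). lra.
    + apply ball_ge_mono with (R0 / 2) (k1 * B); try assumption; try lra.
      apply Rmult_le_compat_r; lra.
Qed.

Lemma shift_shift {N : nat} (i : nat) (y : tang N -> R) (s r : R) : (i < N - 1)%nat ->
  shift i (shift i y s) r = shift i y (s + r).
Proof.
  intros Hi. unfold shift. rewrite coord_upd_same, upd_upd by assumption. f_equal. ring.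
Qed.

(** A stage of length [th k * T] in each medium multiplies the amplitude by at least
    [k1 * k2 * exp (SG * T)] with [SG] positive, so a long [T] gives back the initial amplitude. The
    factor [rho] rescales all speeds, which only lowers the cost of moving and allows any
    displacement up to [ell] in either direction. *)
Lemma cycle (N i : nat) (D a l Sk th V : bool -> R) (F : bool -> R -> R) (c : R) :
  (2 <= N)%nat -> (i < N - 1)%nat -> (forall k, 0 < D k) -> (forall k, 0 < a k) ->
  (forall k, KPP_f (F k) (l k) (Sk k)) ->
  (forall k, 0 <= th k) -> (forall k, 0 <= V k) -> th true + th false = 1 ->
  0 < c < th true * V true + th false * V false ->
  0 < th true * (l true - V true ^ 2 / (4 * D true)) + th false * (l false - V false ^ 2 / (4 * D false)) ->
  exists R0 P ell A0, 0 < R0 /\ 0 < P /\ c * P < ell /\ 0 < A0 /\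
  forall w rho y0 t0 A, nonneg_solution N D a F w -> -1 <= rho <= 1 -> 0 <= t0 -> 0 < A <= A0 ->
  ball_ge w true y0 R0 R0 t0 A -> ball_ge w true (shift i y0 (rho * ell)) R0 R0 (t0 + P) A.
Proof.
  intros HN Hi HD Ha HF Hth HV Hth1 Hc Hgr.
  set (G := th true * (l true - V true ^ 2 / (4 * D true)) + th false * (l false - V false ^ 2 / (4 * D false))) in *.
  (* The linearisation and the discriminant margin cost [eta] each, leaving a mean growth of at
     least [G / 2]; [eta <= l k] keeps the reactions non-negative for small values. *)
  set (eta := Rmin (G / 4) (Rmin (l true) (l false))).
  assert (Hl : forall k, 0 < l k) by (intros k; apply (KPP_f_rate_pos _ _ _ (HF k))).
  assert (Heta : 0 < eta) by (unfold eta; repeat apply Rmin_glb_lt; try apply Hl; lra).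
  assert (HetaG : eta <= G / 4) by apply Rmin_l.
  assert (Hetal : forall k, eta <= l k).
  { intros k. unfold eta. eapply Rle_trans; [apply Rmin_r|]. destruct k; [apply Rmin_l|apply Rmin_r]. }
  destruct (KPP_f_linear_lower _ _ _ eta (HF true) Heta) as [s1 [Hs1 HF1]].
  destruct (KPP_f_linear_lower _ _ _ eta (HF false) Heta) as [s2 [Hs2 HF2]].
  set (s0 := Rmin s1 s2). assert (Hs0 : 0 < s0) by now apply Rmin_glb_lt.
  assert (HFl : forall k s, 0 <= s <= s0 -> (l k - eta) * s <= F k s).
  { intros k s Hs. pose proof (Rmin_l s1 s2). pose proof (Rmin_r s1 s2).
    destruct k; [apply HF1|apply HF2]; unfold s0 in Hs; lra. }
  assert (HF0 : forall k s, 0 <= s <= s0 -> 0 <= F k s).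
  { intros k s Hs. eapply Rle_trans; [|apply HFl; exact Hs]. specialize (Hetal k). apply Rmult_le_pos; lra. }
  set (sg := fun k => l k - 2 * eta - V k ^ 2 / (4 * D k)).
  assert (HNR : 0 < INR N) by (apply lt_0_INR; lia).
  destruct (large_square (((6 * INR N + 24) * (D true)) ^ 2 / (96 * D true * eta) + ((6 * INR N + 24) * (D false)) ^ 2 / (96 * D false * eta)))
    as [R0 [HR0 HRR]].
  { apply Rplus_le_le_0_compat; apply Rdiv_le_0_compat; try apply pow2_ge_0;
    apply Rmult_lt_0_compat; try assumption; apply Rmult_lt_0_compat; try apply HD; lra. }
  specialize (HRR R0 (Rle_refl _)).
  assert (Hdisc : forall k, ((6 * INR N + 24) * D k) ^ 2 < 96 * D k * R0 ^ 2 * eta).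
  { intros k. assert (Hp : forall k, 0 < 96 * D k * eta).
    { intros k'. apply Rmult_lt_0_compat; [|assumption]. specialize (HD k'). lra. }
    assert (Hq : forall k, 0 <= ((6 * INR N + 24) * D k) ^ 2 / (96 * D k * eta)).
    { intros k'. apply Rdiv_le_0_compat; [apply pow2_ge_0|apply Hp]. }
    assert (((6 * INR N + 24) * D k) ^ 2 / (96 * D k * eta) < R0 ^ 2).
    { pose proof (Hq true). pose proof (Hq false). destruct k; lra. }
    apply Rmult_lt_compat_r with (r := 96 * D k * eta) in H; [|apply Hp].
    unfold Rdiv in H. rewrite Rmult_assoc, Rinv_l, Rmult_1_r in H; [lra|]. specialize (Hp k). lra. }
  assert (Hst : forall k, exists kap, 0 < kap <= 1 /\
    forall w c y0 t0 A s, nonneg_solution N D a F w -> Rabs c <= V k -> 0 <= t0 -> 0 <= s ->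
    0 < A -> A * exp (Rabs (sg k) * s) <= s0 -> ball_ge w k y0 R0 R0 t0 A ->
    ball_ge w (negb k) (shift i y0 (c * s)) R0 R0 (t0 + s + 1) (kap * (A * exp (sg k * s)))).
  { intros k. apply (stage N i D a F s0 (l k - eta) (V k) (sg k) eta R0 k); try assumption.
    - intros s. apply HFl.
    - apply HV.
    - unfold sg. lra.
    - apply Hdisc. }
  destruct (Hst true) as [k1 [Hk1 H1]]. destruct (Hst false) as [k2 [Hk2 H2]].
  set (SG := th true * sg true + th false * sg false).
  assert (HSG : 0 < SG).
  { unfold SG, sg. unfold G in HetaG, Hgr.
    assert (th true * (2 * eta) + th false * (2 * eta) = 2 * eta) by (rewrite <- Rmult_plus_distr_r, Hth1; ring).
    lra. }
  set (W := th true * V true + th false * V false) in *.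
  assert (Hk12 : 0 < k1 * k2) by (apply Rmult_lt_0_compat; lra).
  (* The first bound pays for the two crossings in amplitude, the second for their two units of
     time: [c * (T + 2) < T * W]. *)
  set (T := Rmax (- ln (k1 * k2) / SG) (2 * c / (W - c) + 1)).
  assert (HT1 : - ln (k1 * k2) / SG <= T) by apply Rmax_l.
  assert (HT2 : 2 * c / (W - c) + 1 <= T) by apply Rmax_r.
  assert (HcW : 0 <= 2 * c / (W - c)) by (apply Rdiv_le_0_compat; lra).
  assert (HT0 : 0 < T) by lra.
  assert (Hgain : 1 <= k1 * k2 * exp (SG * T)).
  { replace (k1 * k2) with (exp (ln (k1 * k2))) by now apply exp_ln.
    rewrite <- exp_plus, <- exp_0. apply exp_le_mono.
    apply Rmult_le_compat_l with (r := SG) in HT1; [|lra].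
    replace (SG * (- ln (k1 * k2) / SG)) with (- ln (k1 * k2)) in HT1 by (field; lra). lra. }
  set (Q := Rabs (sg true) + Rabs (sg false)).
  assert (HQ : 0 <= Q) by (unfold Q; pose proof (Rabs_pos (sg true)); pose proof (Rabs_pos (sg false)); lra).
  assert (Hth2 : forall k, th k <= 1) by (intros k; pose proof (Hth true); pose proof (Hth false); destruct k; lra).
  (* Starting below [s0 * exp (- (Q * T))] keeps the amplitude below [s0], where the linear lower
     bounds on the reactions are valid, during the whole cycle. *)
  exists R0, (T + 2), (T * W), (s0 * exp (- (Q * T))).
  repeat split; try lra.
  - assert (2 * c < (T) * (W - c)).
    { apply Rlt_le_trans with ((2 * c / (W - c) + 1) * (W - c)); [|apply Rmult_le_compat_r; lra].
      rewrite Rmult_plus_distr_r. unfold Rdiv. rewrite Rmult_assoc, Rinv_l; lra. }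
    lra.
  - apply Rmult_lt_0_compat; [assumption|apply exp_pos].
  - intros w rho y0 t0 A Hw Hrho Ht0 HA Hball.
    assert (HAQ : A * exp (Q * T) <= s0).
    { apply Rle_trans with (s0 * exp (- (Q * T)) * exp (Q * T)).
      - apply Rmult_le_compat_r; [apply Rlt_le, exp_pos|lra].
      - rewrite Rmult_assoc, <- exp_plus. replace (- (Q * T) + Q * T) with 0 by ring. rewrite exp_0. lra. }
    assert (HrV : forall k, Rabs (rho * V k) <= V k).
    { intros k. rewrite Rabs_mult, (Rabs_pos_eq (V k)) by apply HV.
      rewrite <- (Rmult_1_l (V k)) at 2. apply Rmult_le_compat_r; [apply HV|apply Rabs_le; lra]. }
    assert (HsT : forall k, 0 <= th k * T <= T).
    { intros k. split; [apply Rmult_le_pos; [apply Hth|lra]|]. specialize (Hth2 k).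
      rewrite <- (Rmult_1_l T) at 2. apply Rmult_le_compat_r; lra. }
    specialize (H1 w (rho * V true) y0 t0 A (th true * T) Hw (HrV true) Ht0 (proj1 (HsT true)) (proj1 HA)).
    assert (Hb1 : ball_ge w false (shift i y0 (rho * V true * (th true * T))) R0 R0 (t0 + th true * T + 1)
      (k1 * (A * exp (sg true * (th true * T))))).
    { apply H1; [|assumption]. eapply Rle_trans; [|exact HAQ]. apply Rmult_le_compat_l; [lra|].
      apply exp_le_mono. apply Rmult_le_compat; try apply Rabs_pos; try apply HsT.
      unfold Q. pose proof (Rabs_pos (sg false)). lra. }
    set (A1 := k1 * (A * exp (sg true * (th true * T)))) in *.
    assert (HA1 : 0 < A1).
    { unfold A1. apply Rmult_lt_0_compat; [lra|]. apply Rmult_lt_0_compat; [lra|apply exp_pos]. }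
    specialize (H2 w (rho * V false) (shift i y0 (rho * V true * (th true * T))) (t0 + th true * T + 1) A1 (th false * T) Hw (HrV false)
      ltac:(pose proof (HsT true); lra) (proj1 (HsT false)) HA1).
    assert (Hb2 := fun h => H2 h Hb1). rewrite shift_shift in Hb2 by assumption. simpl negb in Hb2.
    replace (rho * V true * (th true * T) + rho * V false * (th false * T)) with (rho * (T * W)) in Hb2 by (unfold W; ring).
    replace (t0 + th true * T + 1 + th false * T + 1) with (t0 + (th true + th false) * T + 2) in Hb2 by ring.
    rewrite Hth1, Rmult_1_l in Hb2. replace (t0 + (T + 2)) with (t0 + T + 2) by ring.
    apply ball_ge_mono with R0 (k2 * (A1 * exp (sg false * (th false * T)))); [lra| |apply Hb2].
    + unfold A1. replace (k2 * (k1 * (A * exp (sg true * (th true * T))) * exp (sg false * (th false * T)))) with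
        (A * (k1 * k2 * exp (SG * T))).
      * rewrite <- (Rmult_1_r A) at 1. apply Rmult_le_compat_l; lra.
      * unfold SG. replace ((th true * sg true + th false * sg false) * T) with
          (sg true * (th true * T) + sg false * (th false * T)) by ring. rewrite exp_plus. ring.
    + eapply Rle_trans; [|exact HAQ]. unfold A1.
      replace (k1 * (A * exp (sg true * (th true * T))) * exp (Rabs (sg false) * (th false * T))) with
        (A * (k1 * exp (sg true * (th true * T) + Rabs (sg false) * (th false * T)))) by (rewrite exp_plus; ring).
      apply Rmult_le_compat_l; [lra|]. rewrite <- (Rmult_1_l (exp (Q * T))).
      apply Rmult_le_compat; [lra|apply Rlt_le, exp_pos|lra|]. apply exp_le_mono.
      assert (sg true * (th true * T) <= Rabs (sg true) * T).
      { apply Rle_trans with (Rabs (sg true) * (th true * T)).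
        - apply Rmult_le_compat_r; [apply HsT|apply Rle_abs].
        - apply Rmult_le_compat_l; [apply Rabs_pos|apply HsT]. }
      assert (Rabs (sg false) * (th false * T) <= Rabs (sg false) * T).
      { apply Rmult_le_compat_l; [apply Rabs_pos|apply HsT]. }
      unfold Q. lra.
Qed.

Lemma tang_bounded {N : nat} (y : tang N -> R) : exists Y, 0 < Y /\ forall j, Rabs (y j) <= Y.
Proof.
  assert (H : forall K, exists Y, 0 < Y /\ forall k, (k < K)%nat -> Rabs (coord y k) <= Y).
  { induction K as [|K [Y [HY IH]]]; [exists 1; split; [lra|lia]|].
    exists (Y + Rabs (coord y K)). pose proof (Rabs_pos (coord y K)). split; [lra|].
    intros k Hk. destruct (Nat.eq_dec k K) as [->|Hn]; [lra|]. specialize (IH k ltac:(lia)). lra. }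
  destruct (H (N - 1)%nat) as [Y [HY H1]]. exists Y. split; [assumption|].
  intros [k h]. rewrite <- (coord_lt y k h). now apply H1.
Qed.

Lemma small_amplitude_nonneg (F : bool -> R -> R) (l Sk : bool -> R) :
  (forall k, KPP_f (F k) (l k) (Sk k)) ->
  exists s0, 0 < s0 /\ forall k s, 0 <= s <= s0 -> l k / 2 * s <= F k s /\ 0 <= F k s.
Proof.
  intros HF.
  assert (Hl : forall k, 0 < l k) by (intros k; apply (KPP_f_rate_pos _ _ _ (HF k))).
  destruct (KPP_f_linear_lower _ _ _ (l true / 2) (HF true) ltac:(specialize (Hl true); lra)) as [s1 [Hs1 HF1]].
  destruct (KPP_f_linear_lower _ _ _ (l false / 2) (HF false) ltac:(specialize (Hl false); lra)) as [s2 [Hs2 HF2]].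
  exists (Rmin s1 s2). split; [now apply Rmin_glb_lt|]. intros k s Hs.
  pose proof (Rmin_l s1 s2). pose proof (Rmin_r s1 s2).
  assert (H1 : (l k - l k / 2) * s <= F k s) by (destruct k; [apply HF1|apply HF2]; lra).
  specialize (Hl k). assert (0 <= l k / 2 * s) by (apply Rmult_le_pos; lra). lra.
Qed.

Lemma shift_0 {N : nat} (i : nat) (y : tang N -> R) : shift i y 0 = y.
Proof. unfold shift. rewrite Rplus_0_r. apply upd_coord. Qed.

Lemma shift_coord {N : nat} (i : nat) (y : tang N -> R) (s : R) (j : tang N) :
  shift i y s j = if Nat.eq_dec (proj1_sig j) i then coord y i + s else y j.
Proof. reflexivity. Qed.

(** For a given target the cycles are repeated with a constant [rho] chosen so that after [n] of
    them the ball has exactly the coordinate [i] of the target; the remaining time, between 1 and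
    [1 + P], is spent spreading to the other coordinates and heights. *)
Lemma front_lower_bound (N i : nat) (D a l Sk th V : bool -> R) (F : bool -> R -> R) (c : R)
  (w : bool -> (tang N -> R) -> R -> R -> R) (k0 : bool) (yi : tang N -> R) (zi ri Ai : R) :
  (2 <= N)%nat -> (i < N - 1)%nat -> (forall k, 0 < D k) -> (forall k, 0 < a k) ->
  (forall k, KPP_f (F k) (l k) (Sk k)) ->
  (forall k, 0 <= th k) -> (forall k, 0 <= V k) -> th true + th false = 1 ->
  0 < c < th true * V true + th false * V false ->
  0 < th true * (l true - V true ^ 2 / (4 * D true)) + th false * (l false - V false ^ 2 / (4 * D false)) ->
  nonneg_solution N D a F w -> 0 < ri <= zi -> 0 < Ai -> ball_ge w k0 yi zi ri 0 Ai ->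
  forall R1, 0 < R1 -> exists dl T, 0 < dl /\ forall t y, T < t -> Rabs (coord y i) <= c * t ->
    (forall j, (j < N - 1)%nat -> j <> i -> Rabs (coord y j) <= R1) ->
    forall k z, 0 <= z <= R1 -> dl <= w k y z t.
Proof.
  intros HN Hi HD Ha HF Hth HV Hth1 Hc Hgr Hw Hri HAi Hball R1 HR1.
  destruct (cycle N i D a l Sk th V F c HN Hi HD Ha HF Hth HV Hth1 Hc Hgr)
    as (R0 & P & ell & A0 & HR0 & HP & Hell & HA0 & Hcyc).
  destruct (small_amplitude_nonneg F l Sk HF) as [s0 [Hs0 HF0]].
  destruct (spread N D a F s0 zi ri (2 * R0) 1 1 HN HD Ha Hs0) as [k1 [Hk1 H1]]; try lra.
  { intros k s Hs. now apply HF0. }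
  destruct (tang_bounded yi) as [Y [HY HYb]].
  destruct (spread N D a F s0 R0 R0 (R1 + Y) 1 (1 + P) HN HD Ha Hs0) as [k2 [Hk2 H2]]; try lra.
  { intros k s Hs. now apply HF0. }
  set (Aj := Rmin Ai s0). assert (HAj : 0 < Aj <= s0) by (split; [now apply Rmin_glb_lt|apply Rmin_r]).
  set (A1 := Rmin (Rmin A0 s0) (k1 * Aj)).
  assert (HA1 : 0 < A1).
  { unfold A1. repeat apply Rmin_glb_lt; try lra. apply Rmult_lt_0_compat; lra. }
  assert (HA10 : A1 <= A0) by (unfold A1; eapply Rle_trans; [apply Rmin_l|apply Rmin_l]).
  assert (HA1s : A1 <= s0) by (unfold A1; eapply Rle_trans; [apply Rmin_l|apply Rmin_r]).
  assert (HA1k : A1 <= k1 * Aj) by apply Rmin_r.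
  assert (Hb1 : ball_ge w true yi R0 R0 1 A1).
  { apply ball_ge_of_box with (2 * R0); [assumption|lra|]. intros y z Hy Hz.
    eapply Rle_trans; [exact HA1k|]. apply (H1 w k0 yi 0 Aj Hw); try assumption; try lra.
    apply ball_ge_mono with ri Ai; [lra|apply Rmin_l|assumption]. }
  assert (Hiter : forall rho, -1 <= rho <= 1 -> forall n,
    ball_ge w true (shift i yi (INR n * (rho * ell))) R0 R0 (1 + INR n * P) A1).
  { intros rho Hrho. induction n as [|n IH].
    - simpl INR. rewrite !Rmult_0_l, Rplus_0_r, shift_0. exact Hb1.
    - rewrite S_INR. replace ((INR n + 1) * (rho * ell)) with (INR n * (rho * ell) + rho * ell) by ring.
      rewrite <- shift_shift by assumption.
      replace (1 + (INR n + 1) * P) with (1 + INR n * P + P) by ring.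
      apply Hcyc; try assumption; try lra. pose proof (pos_INR n).
      pose proof (Rmult_le_pos _ _ H (Rlt_le _ _ HP)). lra. }
  assert (Hell0 : 0 < ell) by (pose proof (Rmult_lt_0_compat c P ltac:(lra) HP); lra).
  assert (Hcl : 0 < ell / P - c).
  { assert (c < ell / P); [|lra]. apply Rmult_lt_reg_r with P; [assumption|].
    unfold Rdiv. rewrite Rmult_assoc, Rinv_l; lra. }
  (* The first threshold ensures [c * t + Y <= (t - 2 - P) * (ell / P)], so that [n] cycles can
     reach the target. *)
  exists (k2 * A1), (Rmax ((Y + (2 + P) * (ell / P)) / (ell / P - c)) (2 + P)).
  split; [apply Rmult_lt_0_compat; lra|].
  intros t y Ht Hyi Hyj k z Hz.
  assert (Ht1 := Rle_lt_trans _ _ _ (Rmax_l _ _) Ht). assert (Ht2 := Rle_lt_trans _ _ _ (Rmax_r _ _) Ht).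
  (* One unit of time was used to form the first ball and at least one must remain for the final
     spreading, hence [t - 2]. *)
  destruct (nfloor_ex ((t - 2) / P)) as [n [Hn1 Hn2]]; [apply Rdiv_le_0_compat; lra|].
  assert (Hn1' : INR n * P <= t - 2).
  { apply Rmult_le_compat_r with (r := P) in Hn1; [|lra]. unfold Rdiv in Hn1. rewrite Rmult_assoc, Rinv_l in Hn1; lra. }
  assert (Hn2' : t - 2 < INR n * P + P).
  { apply Rmult_lt_compat_r with (r := P) in Hn2; [|lra]. unfold Rdiv in Hn2. rewrite Rmult_assoc, Rinv_l in Hn2; lra. }
  assert (Hreach : c * t + Y <= INR n * ell).
  { apply Rmult_lt_compat_r with (r := ell / P - c) in Ht1; [|assumption].
    unfold Rdiv at 1 in Ht1. rewrite Rmult_assoc, Rinv_l, Rmult_1_r in Ht1 by lra.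
    assert (H0 : (t - 2 - P) * (ell / P) <= INR n * P * (ell / P)).
    { apply Rmult_le_compat_r; [apply Rdiv_le_0_compat; lra|lra]. }
    replace (INR n * P * (ell / P)) with (INR n * ell) in H0 by (field; lra). lra. }
  assert (Hct : 0 < c * t) by (apply Rmult_lt_0_compat; lra).
  set (rho := (coord y i - coord yi i) / (INR n * ell)).
  assert (HYi : Rabs (coord yi i) <= Y) by (rewrite (coord_lt yi i Hi); apply HYb).
  assert (Hrho : -1 <= rho <= 1).
  { apply Rabs_le_between in Hyi. apply Rabs_le_between in HYi.
    unfold rho. split; apply Rmult_le_reg_r with (INR n * ell); try lra;
    unfold Rdiv; rewrite Rmult_assoc, Rinv_l; lra. }
  specialize (Hiter rho Hrho n).
  assert (Hn0 : INR n <> 0) by (intros E; rewrite E, Rmult_0_l in Hreach; lra).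
  replace (INR n * (rho * ell)) with (coord y i - coord yi i) in Hiter
    by (unfold rho; field; split; [lra|exact Hn0]).
  apply (H2 w true (shift i yi (coord y i - coord yi i)) (1 + INR n * P) A1 Hw); try assumption; try lra.
  - intros j. rewrite shift_coord. destruct (Nat.eq_dec (proj1_sig j) i) as [E|Hj].
    + rewrite <- E, !coord_proj. replace (y j - (yi j + (y j - yi j))) with 0 by ring. rewrite Rabs_R0. lra.
    + specialize (Hyj (proj1_sig j) (proj2_sig j) Hj). rewrite coord_proj in Hyj. specialize (HYb j).
      unfold Rminus. eapply Rle_trans; [apply Rabs_triang|]. rewrite Rabs_Ropp. lra.
Qed.

(* Growing once more at zero speed up to a fixed amplitude makes the lower bound independent of
   the speed and of the tangential radius. *)
Lemma front_uniform_lower_bound (N i : nat) (D a l Sk : bool -> R) (F : bool -> R -> R) (cs : R)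
  (w : bool -> (tang N -> R) -> R -> R -> R) (k0 : bool) (yi : tang N -> R) (zi ri Ai : R) :
  (2 <= N)%nat -> (i < N - 1)%nat -> (forall k, 0 < D k) -> (forall k, 0 < a k) ->
  (forall k, KPP_f (F k) (l k) (Sk k)) ->
  (forall c, 0 < c < cs -> exists th V : bool -> R,
    (forall k, 0 <= th k) /\ (forall k, 0 <= V k) /\ th true + th false = 1 /\
    c < th true * V true + th false * V false /\
    0 < th true * (l true - V true ^ 2 / (4 * D true)) + th false * (l false - V false ^ 2 / (4 * D false))) ->
  nonneg_solution N D a F w -> 0 < ri <= zi -> 0 < Ai -> ball_ge w k0 yi zi ri 0 Ai ->
  forall Rz, 0 < Rz -> exists dl, 0 < dl /\ forall c R1, 0 < c < cs -> 0 < R1 ->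
    exists T, forall t y, T < t -> Rabs (coord y i) <= c * t ->
    (forall j, (j < N - 1)%nat -> j <> i -> Rabs (coord y j) <= R1) ->
    forall k z, 0 <= z <= Rz -> dl <= w k y z t.
Proof.
  intros HN Hi HD Ha HF Hsp Hw Hri HAi Hball Rz HRz.
  destruct (small_amplitude_nonneg F l Sk HF) as [s0 [Hs0 HF0]].
  assert (Hl : 0 < l true) by apply (KPP_f_rate_pos _ _ _ (HF true)).
  (* At speed 0 and with reaction slope [l true / 2], the rate [l true / 8] leaves a margin of the
     same size for the discriminant. *)
  set (sg := l true / 8). assert (Hsg : 0 < sg) by (unfold sg; lra).
  assert (HDt := HD true).
  destruct (large_square (((6 * INR N + 24) * D true) ^ 2 / (96 * D true * sg))) as [R0 [HR0 HRR]].
  { apply Rdiv_le_0_compat; [apply pow2_ge_0|]. repeat apply Rmult_lt_0_compat; lra. }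
  specialize (HRR R0 (Rle_refl _)).
  destruct (move N i D a F s0 (l true / 2) 0 sg sg R0 true HN Hi HD Ha) as [k1 [Hk1 H1]]; try assumption; try lra.
  { intros s Hs. now apply HF0. }
  { replace (0 ^ 2 / (4 * D true)) with 0 by (field; lra). unfold sg. lra. }
  { apply Rmult_lt_compat_r with (r := 96 * D true * sg) in HRR; [|repeat apply Rmult_lt_0_compat; lra].
    unfold Rdiv in HRR. rewrite Rmult_assoc, Rinv_l, Rmult_1_r in HRR; [lra|].
    apply Rgt_not_eq. repeat apply Rmult_lt_0_compat; lra. }
  destruct (spread N D a F s0 R0 (R0 / 2) Rz 1 1 HN HD Ha Hs0) as [k2 [Hk2 H2]]; try lra.
  { intros k s Hs. now apply HF0. }
  set (k1' := Rmin 1 k1). assert (Hk1' : 0 < k1' <= 1) by (split; [apply Rmin_glb_lt; lra|apply Rmin_l]).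
  assert (Hk1k : k1' <= k1) by apply Rmin_r.
  exists (k2 * (k1' * s0)). split; [repeat apply Rmult_lt_0_compat; lra|].
  intros c R1 Hc HR1.
  (* The non-uniform bound is applied at the earlier time [t - 1 - s]; the larger speed [c'] makes
     up for the delay and for the radius [R0] when [t] is large. *)
  set (c' := (c + cs) / 2). assert (Hc' : c < c' < cs) by (unfold c'; lra).
  destruct (Hsp c' ltac:(lra)) as (th & V & Hth & HV & Hth1 & HcV & Hgr).
  destruct (front_lower_bound N i D a l Sk th V F c' w k0 yi zi ri Ai HN Hi HD Ha HF Hth HV Hth1 ltac:(lra) Hgr
    Hw Hri HAi Hball (R1 + 2 * R0) ltac:(lra)) as (dl & T0 & Hdl & HT0).
  set (A := Rmin dl s0). assert (HA : 0 < A <= s0) by (split; [now apply Rmin_glb_lt|apply Rmin_r]).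
  (* The time needed to grow from [A] to [s0] at rate [sg]. Only this time depends on [c] and [R1],
     not the amplitude reached. *)
  set (s := ln (s0 / A) / sg).
  assert (HsA : 1 <= s0 / A).
  { apply Rmult_le_reg_r with A; [lra|]. unfold Rdiv. rewrite Rmult_assoc, Rinv_l; lra. }
  assert (Hs : 0 <= s).
  { unfold s. apply Rdiv_le_0_compat; [|lra]. rewrite <- ln_1. destruct HsA as [H|H].
    - apply Rlt_le, ln_increasing; lra.
    - rewrite <- H. lra. }
  assert (HAe : A * exp (sg * s) = s0).
  { unfold s. replace (sg * (ln (s0 / A) / sg)) with (ln (s0 / A)) by (field; lra).
    rewrite exp_ln by lra. field. lra. }
  exists (Rmax (Rmax T0 0 + 1 + s) ((R0 + c' * (1 + s)) / (c' - c))).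
  intros t y Ht Hyi Hyj k z Hz.
  assert (Ht1 := Rle_lt_trans _ _ _ (Rmax_l _ _) Ht). assert (Ht2 := Rle_lt_trans _ _ _ (Rmax_r _ _) Ht).
  pose proof (Rmax_l T0 0). pose proof (Rmax_r T0 0).
  apply Rmult_lt_compat_r with (r := c' - c) in Ht2; [|lra].
  unfold Rdiv in Ht2. rewrite Rmult_assoc, Rinv_l, Rmult_1_r in Ht2 by lra.
  assert (Hb0 : ball_ge w true y R0 R0 (t - 1 - s) A).
  { apply ball_ge_mono with R0 dl; [lra|apply Rmin_l|]. intros y' z' Hz' Hd.
    pose proof (sqd_nonneg y' y). pose proof (pow2_ge_0 (z' - R0)).
    assert (Hj : forall j, (j < N - 1)%nat -> Rabs (coord y' j) <= Rabs (coord y j) + R0).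
    { intros j Hj. assert (Hd' : Rabs (y' (exist _ j Hj) - y (exist _ j Hj)) < R0) by (apply sqd_lt_coord; lra).
      rewrite (coord_lt y' j Hj), (coord_lt y j Hj).
      replace (y' (exist _ j Hj)) with (y (exist _ j Hj) + (y' (exist _ j Hj) - y (exist _ j Hj))) by ring.
      eapply Rle_trans; [apply Rabs_triang|]. lra. }
    apply HT0.
    - lra.
    - specialize (Hj i Hi). lra.
    - intros j Hj1 Hj2. specialize (Hj j Hj1). specialize (Hyj j Hj1 Hj2). lra.
    - split; [assumption|]. apply Rnot_lt_le. intros Hn. assert (R0 ^ 2 <= (z' - R0) ^ 2); [|lra].
      apply pow_incr. lra. }
  assert (Hb1 := H1 w 0 y R0 (t - 1 - s) A s Hw (Rle_refl R0) ltac:(rewrite Rabs_R0; lra) ltac:(lra) Hs (proj1 HA)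
    ltac:(rewrite (Rabs_pos_eq sg) by lra; lra) Hb0).
  rewrite HAe, Rmult_0_l, shift_0 in Hb1. replace (t - 1 - s + s) with (t - 1) in Hb1 by ring.
  apply (H2 w true y (t - 1) (k1' * s0) Hw); try lra.
  - split; [apply Rmult_lt_0_compat; lra|]. assert (k1' * s0 <= 1 * s0) by (apply Rmult_le_compat_r; lra). lra.
  - apply ball_ge_mono with (R0 / 2) (k1 * s0); [lra| |assumption]. apply Rmult_le_compat_r; lra.
  - intros j. replace (y j - y j) with 0 by ring. rewrite Rabs_R0. lra.
Qed.

(** * Eventual properties stable under bounded space-time windows *)

(** An abstract meaning of eventually: the events form a proper filter, times exceed any bound, and
    an event may be required on a whole bounded window of the past. Convergence is proved for every
    such [Ev], so it applies behind the front and equally to a steady state seen as a solution. *)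
Definition window_filter {N : nat} (Ev : ((tang N -> R) -> R -> Prop) -> Prop) : Prop :=
  (forall P Q : (tang N -> R) -> R -> Prop, (forall y t, P y t -> Q y t) -> Ev P -> Ev Q) /\
  (forall P Q : (tang N -> R) -> R -> Prop, Ev P -> Ev Q -> Ev (fun y t => P y t /\ Q y t)) /\
  ~ Ev (fun _ _ => False) /\
  (forall T, Ev (fun _ t => T < t)) /\
  (forall P r tau, Ev P -> Ev (fun y t => forall y' t', (forall j, Rabs (y' j - y j) <= r) ->
     t - tau <= t' <= t -> P y' t')).

Definition behind_front {N : nat} (i : nat) (cs : R) (P : (tang N -> R) -> R -> Prop) : Prop :=
  forall c R1, 0 < c < cs -> 0 < R1 -> exists T, forall t y, T < t -> Rabs (coord y i) <= c * t ->
    (forall j, (j < N - 1)%nat -> j <> i -> Rabs (coord y j) <= R1) -> P y t.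

(** Only the last property is delicate: a bounded window around a point behind the front of speed
    [c] lies, for large times, behind the front of a larger speed [c'] still below [cs]. This is why
    the event must hold for all speeds below [cs]. *)
Lemma behind_front_filter (N i : nat) (cs : R) : (i < N - 1)%nat -> 0 < cs ->
  window_filter (@behind_front N i cs).
Proof.
  intros Hi Hcs. split; [|split; [|split; [|split]]].
  - intros P Q HPQ HP c R1 Hc HR1. destruct (HP c R1 Hc HR1) as [T HT]. exists T. intros. apply HPQ, HT; auto.
  - intros P Q HP HQ c R1 Hc HR1. destruct (HP c R1 Hc HR1) as [T1 HT1]. destruct (HQ c R1 Hc HR1) as [T2 HT2].
    exists (Rmax T1 T2). intros t y Ht Hy1 Hy2.
    pose proof (Rmax_l T1 T2). pose proof (Rmax_r T1 T2). split; [apply HT1|apply HT2]; auto; lra.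
  - intros H. destruct (H (cs / 2) 1 ltac:(lra) ltac:(lra)) as [T HT].
    pose proof (Rmax_l T 0). pose proof (Rmax_r T 0).
    assert (Hc0 : forall j, coord (fun _ : tang N => 0) j = 0).
    { intros j. unfold coord. destruct (lt_dec j (N - 1)); reflexivity. }
    apply (HT (Rmax T 0 + 1) (fun _ => 0)).
    + lra.
    + rewrite Hc0, Rabs_R0. apply Rmult_le_pos; lra.
    + intros j _ _. rewrite Hc0, Rabs_R0. lra.
  - intros T c R1 Hc HR1. exists T. auto.
  - intros P r tau HP c R1 Hc HR1.
    set (c' := (c + cs) / 2). assert (Hc' : c < c' < cs) by (unfold c'; lra).
    pose proof (Rabs_pos r). pose proof (Rle_abs r).
    destruct (HP c' (R1 + Rabs r) ltac:(lra) ltac:(lra)) as [T HT].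
    exists (Rmax (T + Rabs tau) ((Rabs r + c' * Rabs tau) / (c' - c))).
    intros t y Ht Hyi Hyj y' t' Hy' Ht'.
    assert (Ht1 := Rle_lt_trans _ _ _ (Rmax_l _ _) Ht). assert (Ht2 := Rle_lt_trans _ _ _ (Rmax_r _ _) Ht).
    apply Rmult_lt_compat_r with (r := c' - c) in Ht2; [|lra].
    unfold Rdiv in Ht2. rewrite Rmult_assoc, Rinv_l, Rmult_1_r in Ht2 by lra.
    pose proof (Rle_abs tau).
    assert (Hj : forall j, (j < N - 1)%nat -> Rabs (coord y' j) <= Rabs (coord y j) + Rabs r).
    { intros j Hj. rewrite (coord_lt y' j Hj), (coord_lt y j Hj). specialize (Hy' (exist _ j Hj)).
      replace (y' (exist _ j Hj)) with (y (exist _ j Hj) + (y' (exist _ j Hj) - y (exist _ j Hj))) by ring.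
      eapply Rle_trans; [apply Rabs_triang|]. lra. }
    apply HT.
    + lra.
    + specialize (Hj i Hi). assert (c' * (t - Rabs tau) <= c' * t') by (apply Rmult_le_compat_l; lra). lra.
    + intros j Hj1 Hj2. specialize (Hj j Hj1). specialize (Hyj j Hj1 Hj2). lra.
Qed.

(** * The critical speed *)

(** The number [al] minimises the larger of the two convex functions [(D al^2 + g1) / al] and
    [(d al^2 + f1) / al]. At the minimum some convex combination of the derivatives of the active
    functions vanishes; its weights [tt] and [tf] are the fractions of time, and the vanishing,
    multiplied by [- al^2], is the zero growth condition. In the first two cases one function is
    active, at its own minimum; otherwise [al] is where the two are equal. *)
Lemma critical_speed_decomposition (D d f1 g1 : R) :
  0 < D -> 0 < d -> 0 < f1 -> 0 < g1 ->
  exists al tt tf, 0 < al /\ 0 <= tt /\ 0 <= tf /\ tt + tf = 1 /\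
    tt * (g1 - D * al ^ 2) + tf * (f1 - d * al ^ 2) = 0 /\
    c_star_inf D d f1 g1 = 2 * al * (tt * D + tf * d) /\
    D * al ^ 2 + g1 <= c_star_inf D d f1 g1 * al /\
    d * al ^ 2 + f1 <= c_star_inf D d f1 g1 * al.
Proof.
  intros HD Hd Hf Hg. unfold c_star_inf.
  destruct (Rle_dec (D / d) (2 - g1 / f1)) as [H1|H1].
  { set (al := sqrt (f1 / d)).
    assert (Hal : 0 < al) by (apply sqrt_lt_R0, Rdiv_lt_0_compat; lra).
    assert (Eal : d * al ^ 2 = f1).
    { unfold al. rewrite pow2_sqrt; [field; lra|]. apply Rdiv_le_0_compat; lra. }
    assert (Ec : c_f d f1 = 2 * (d * al)).
    { unfold c_f. f_equal. replace (d * f1) with (Rsqr (d * al)) by (unfold Rsqr; rewrite <- Eal; ring).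
      apply sqrt_Rsqr. apply Rmult_le_pos; lra. }
    exists al, 0, 1. rewrite Ec. repeat split; try lra.
    apply Rmult_le_compat_r with (r := f1) in H1; [|lra].
    replace (D / d * f1) with (D * al ^ 2) in H1 by (rewrite <- Eal; field; lra).
    replace ((2 - g1 / f1) * f1) with (2 * f1 - g1) in H1 by (field; lra). lra. }
  destruct (Rle_dec (d / D) (2 - f1 / g1)) as [H2|H2].
  { set (al := sqrt (g1 / D)).
    assert (Hal : 0 < al) by (apply sqrt_lt_R0, Rdiv_lt_0_compat; lra).
    assert (Eal : D * al ^ 2 = g1).
    { unfold al. rewrite pow2_sqrt; [field; lra|]. apply Rdiv_le_0_compat; lra. }
    assert (Ec : c_g D g1 = 2 * (D * al)).
    { unfold c_g. f_equal. replace (D * g1) with (Rsqr (D * al)) by (unfold Rsqr; rewrite <- Eal; ring).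
      apply sqrt_Rsqr. apply Rmult_le_pos; lra. }
    exists al, 1, 0. rewrite Ec. repeat split; try lra.
    apply Rmult_le_compat_r with (r := g1) in H2; [|lra].
    replace (d / D * g1) with (d * al ^ 2) in H2 by (rewrite <- Eal; field; lra).
    replace ((2 - f1 / g1) * g1) with (2 * g1 - f1) in H2 by (field; lra). lra. }
  apply Rnot_le_lt in H1. apply Rnot_le_lt in H2.
  assert (K1 : 2 * d * f1 < D * f1 + d * g1).
  { apply Rmult_lt_compat_r with (r := d * f1) in H1; [|apply Rmult_lt_0_compat; lra].
    replace ((2 - g1 / f1) * (d * f1)) with (2 * d * f1 - d * g1) in H1 by (field; lra).
    replace (D / d * (d * f1)) with (D * f1) in H1 by (field; lra). lra. }
  assert (K2 : 2 * D * g1 < D * f1 + d * g1).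
  { apply Rmult_lt_compat_r with (r := D * g1) in H2; [|apply Rmult_lt_0_compat; lra].
    replace ((2 - f1 / g1) * (D * g1)) with (2 * D * g1 - D * f1) in H2 by (field; lra).
    replace (d / D * (D * g1)) with (d * g1) in H2 by (field; lra). lra. }
  (* Divided by [D - d], these two inequalities place the crossing point strictly between the
     minimisers of the two functions. *)
  assert (K3 : d * (f1 - g1) < f1 * (D - d)) by lra.
  assert (K4 : g1 * (D - d) < D * (f1 - g1)) by lra.
  assert (HP : 0 < (D - d) * (f1 - g1)).
  { destruct (Rtotal_order D d) as [Hlt|[Heq|Hgt]].
    - assert (f1 < g1) by nra. nra.
    - subst. nra.
    - assert (g1 < f1) by nra. nra. }
  assert (HDd : D - d <> 0) by (intros E; rewrite E in HP; lra).
  (* The square of the crossing point of the two functions. *)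
  set (q := (f1 - g1) / (D - d)).
  assert (Hq : 0 < q).
  { replace q with ((D - d) * (f1 - g1) / (D - d) ^ 2) by (unfold q; field; lra).
    apply Rdiv_lt_0_compat; [assumption|]. apply pow2_gt_0. assumption. }
  assert (Efg : f1 - g1 = q * (D - d)) by (unfold q; field; lra).
  set (al := sqrt q). assert (Hal : 0 < al) by now apply sqrt_lt_R0.
  assert (Eal : al ^ 2 = q) by (unfold al; apply pow2_sqrt; lra).
  assert (Ec : c_a D d f1 g1 * al = d * q + f1).
  { unfold c_a. assert (Es : sqrt ((D - d) * (f1 - g1)) = Rabs (D - d) * al).
    { rewrite Efg. replace ((D - d) * (q * (D - d))) with (Rsqr (Rabs (D - d) * al)).
      - apply sqrt_Rsqr. apply Rmult_le_pos; [apply Rabs_pos|lra].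
      - rewrite Rsqr_mult, <- Rsqr_abs. unfold Rsqr. rewrite <- Eal. ring. }
    rewrite Es. replace (D * f1 - d * g1) with ((D - d) * (d * q + f1)) by (replace g1 with (f1 - q * (D - d)) by lra; ring).
    rewrite Rabs_mult. assert (0 < d * q) by (apply Rmult_lt_0_compat; lra).
    rewrite (Rabs_pos_eq (d * q + f1)) by lra. field. split; [lra|now apply Rabs_no_R0]. }
  set (kk := d * q + f1) in *.
  assert (Ekk : kk = D * q + g1) by (unfold kk; lra).
  set (tf := (2 * D * q - kk) / (2 * (D - d) * q)).
  assert (Etf : tf * (2 * (D - d) * q) = 2 * D * q - kk) by (unfold tf; field; split; lra).
  assert (Htf : 0 <= tf <= 1).
  { destruct (Rlt_dec 0 (D - d)) as [Hp|Hp].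
    - assert (0 < (D - d) * q) by (apply Rmult_lt_0_compat; lra).
      assert (d * q < f1) by (rewrite Efg in K3; nra).
      assert (g1 < D * q) by (rewrite Efg in K4; nra).
      split; apply Rmult_le_reg_r with (2 * (D - d) * q); try lra; unfold kk in *; lra.
    - assert (0 < (d - D) * q) by (apply Rmult_lt_0_compat; lra).
      assert (f1 < d * q) by (rewrite Efg in K3; nra).
      assert (D * q < g1) by (rewrite Efg in K4; nra).
      split; apply Rmult_le_reg_r with (2 * (d - D) * q); try lra; unfold kk in *; lra. }
  assert (Esum : 2 * q * ((1 - tf) * D + tf * d) = kk) by lra.
  exists al, (1 - tf), tf. rewrite Eal.
  assert (Ec2 : c_a D d f1 g1 = 2 * al * ((1 - tf) * D + tf * d)).
  { apply Rmult_eq_reg_r with al; [|lra]. rewrite Ec, <- Esum, <- Eal. ring. }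
  repeat split; try lra.
  - unfold kk in *. nra.
Qed.

(** At speeds [2 * D k * al] the mean growth is 0 and the mean speed critical. Multiplying all
    speeds by [s < 1] multiplies the cost of moving by [s^2], which frees the growth
    [(1 - s^2) * al^2 * M]; [s] is taken halfway between [c / cs] and 1. *)
Lemma mixed_speeds (D l th : bool -> R) (al : R) :
  (forall k, 0 < D k) -> 0 < al -> (forall k, 0 <= th k) -> th true + th false = 1 ->
  th true * (l true - D true * al ^ 2) + th false * (l false - D false * al ^ 2) = 0 ->
  forall c, 0 < c < 2 * al * (th true * D true + th false * D false) ->
  exists V : bool -> R, (forall k, 0 <= V k) /\ c < th true * V true + th false * V false /\
    0 < th true * (l true - V true ^ 2 / (4 * D true)) + th false * (l false - V false ^ 2 / (4 * D false)).
Proof.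
  intros HD Hal Hth Hth1 Hgr c Hc.
  set (M := th true * D true + th false * D false) in *.
  assert (HM : 0 < M) by nra.
  set (cs := 2 * al * M) in *.
  set (s := (c / cs + 1) / 2).
  assert (Hccs : 0 < c / cs < 1).
  { split; [apply Rdiv_lt_0_compat; lra|]. apply Rmult_lt_reg_r with cs; [lra|].
    unfold Rdiv. rewrite Rmult_assoc, Rinv_l; lra. }
  assert (Hs : c / cs < s < 1) by (unfold s; lra).
  exists (fun k => 2 * D k * al * s). split; [|split].
  - intros k. specialize (HD k). repeat apply Rmult_le_pos; lra.
  - replace (th true * (2 * D true * al * s) + th false * (2 * D false * al * s)) with (s * cs) by (unfold cs, M; ring).
    apply Rle_lt_trans with (c / cs * cs); [apply Req_le; field; lra|apply Rmult_lt_compat_r; lra].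
  - assert (E : forall k, (2 * D k * al * s) ^ 2 / (4 * D k) = D k * al ^ 2 * s ^ 2).
    { intros k. specialize (HD k). field. lra. }
    rewrite !E.
    assert (0 < (1 - s ^ 2) * (al ^ 2 * M)).
    { apply Rmult_lt_0_compat; [nra|]. apply Rmult_lt_0_compat; [now apply pow_lt|assumption]. }
    unfold M in H. lra.
Qed.

(** * Monotone orbits of [D Q'' + phi(Q) = 0] *)

(* By conservation of energy, the orbit converging to [S] has slope [slope D phi S q] at level [q]. *)
Definition slope (D : R) (phi : R -> R) (S q : R) : R := sqrt (2 / D * RInt phi q S).

(** The distance in which the orbit climbs from [q0] to [q], since [dx = dQ / slope]. *)
Definition travel (D : R) (phi : R -> R) (S q0 q : R) : R := RInt (fun s => / slope D phi S s) q0 q.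

(** [Q] is the inverse of [travel], frozen at [q0] for [x <= 0]: translates are then defined and
    continuous everywhere, while the differential equation is claimed only for [x > 0]. *)
Definition is_orbit (D : R) (phi : R -> R) (S q0 : R) (Q : R -> R) : Prop :=
  (forall x, x <= 0 -> Q x = q0) /\
  (forall x, 0 <= x -> q0 <= Q x < S /\ travel D phi S q0 (Q x) = x) /\
  (forall q, q0 <= q < S -> 0 <= travel D phi S q0 q /\ Q (travel D phi S q0 q) = q) /\
  (forall x y, x <= y -> Q x <= Q y) /\
  (forall x y, x <= y -> Q y - Q x <= slope D phi S q0 * (y - x)) /\
  (forall x, continuous Q x) /\
  (forall x, 0 < x -> is_derive Q x (slope D phi S (Q x)) /\
     is_derive (fun x => slope D phi S (Q x)) x (- phi (Q x) / D)).

Lemma ex_RInt_cont (phi : R -> R) (x y : R) : (forall s, continuous phi s) -> ex_RInt phi x y.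
Proof. intros H. apply (ex_RInt_continuous phi x y). auto. Qed.

Lemma is_derive_RInt_lower (phi : R -> R) (S q : R) : (forall s, continuous phi s) ->
  is_derive (fun q => RInt phi q S) q (- phi q).
Proof.
  intros H. apply (is_derive_RInt' phi (fun q => RInt phi q S) q S).
  - apply filter_forall. intros x. apply (RInt_correct phi). now apply ex_RInt_cont.
  - apply H.
Qed.

Lemma RInt_decreasing (phi : R -> R) (S x y : R) : (forall s, continuous phi s) -> x < y ->
  (forall s, x < s < y -> 0 < phi s) -> RInt phi y S < RInt phi x S.
Proof.
  intros Hc Hxy Hp.
  assert (E : RInt phi x y + RInt phi y S = RInt phi x S).
  { apply (RInt_Chasles phi x y S); now apply ex_RInt_cont. }
  assert (0 < RInt phi x y) by (apply RInt_gt_0; auto). lra.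
Qed.

Lemma slope_continuous (D : R) (phi : R -> R) (S q : R) :
  (forall s, continuous phi s) -> continuous (slope D phi S) q.
Proof.
  intros H. unfold slope. apply (continuous_real_comp (fun q => 2 / D * RInt phi q S) sqrt).
  - apply (continuous_mult (fun _ => 2 / D) (fun q => RInt phi q S)); [apply continuous_const|].
    apply (ex_derive_continuous (fun q => RInt phi q S)). eexists. now apply is_derive_RInt_lower.
  - apply continuous_sqrt.
Qed.

Lemma slope_top (D : R) (phi : R -> R) (S : R) : slope D phi S S = 0.
Proof. unfold slope. rewrite RInt_point. change (@zero R_AbelianGroup) with 0. rewrite Rmult_0_r. apply sqrt_0. Qed.

Lemma slope_decreasing (D : R) (phi : R -> R) (S x y : R) : 0 < D -> (forall s, continuous phi s) ->
  x < y <= S -> (forall s, x < s < S -> 0 < phi s) -> slope D phi S y < slope D phi S x.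
Proof.
  intros HD Hc Hxy Hp. unfold slope.
  assert (H2 : 0 < 2 / D) by (apply Rdiv_lt_0_compat; lra).
  apply sqrt_lt_1_alt. split.
  - apply Rmult_le_pos; [lra|]. destruct (proj2 Hxy) as [H| ->].
    + left. apply RInt_gt_0; auto. intros s Hs. apply Hp. lra.
    + rewrite RInt_point. apply Rle_refl.
  - apply Rmult_lt_compat_l; [assumption|]. apply RInt_decreasing; [assumption|lra|].
    intros s Hs. apply Hp. lra.
Qed.

Lemma slope_nonneg (D : R) (phi : R -> R) (S x : R) : 0 <= slope D phi S x.
Proof. apply sqrt_pos. Qed.

Lemma slope_pos (D : R) (phi : R -> R) (S x : R) : 0 < D -> (forall s, continuous phi s) ->
  x < S -> (forall s, x < s < S -> 0 < phi s) -> 0 < slope D phi S x.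
Proof.
  intros HD Hc Hx Hp. eapply Rle_lt_trans; [apply (slope_nonneg D phi S S)|].
  apply slope_decreasing; auto. lra.
Qed.

Lemma slope_sqr (D : R) (phi : R -> R) (S x : R) : 0 < D -> (forall s, continuous phi s) ->
  x < S -> (forall s, x < s < S -> 0 < phi s) -> slope D phi S x ^ 2 = 2 / D * RInt phi x S.
Proof.
  intros HD Hc Hx Hp. unfold slope. apply pow2_sqrt. apply Rmult_le_pos.
  - apply Rlt_le, Rdiv_lt_0_compat; lra.
  - left. apply RInt_gt_0; auto.
Qed.

Lemma slope_derive (D : R) (phi : R -> R) (S x : R) : 0 < D -> (forall s, continuous phi s) ->
  x < S -> (forall s, x < s < S -> 0 < phi s) ->
  is_derive (slope D phi S) x (- phi x / (D * slope D phi S x)).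
Proof.
  intros HD Hc Hx Hp.
  assert (Hsp := slope_pos D phi S x HD Hc Hx Hp).
  assert (Hin : 0 < 2 / D * RInt phi x S).
  { rewrite <- slope_sqr by assumption. now apply pow_lt. }
  assert (H1 : is_derive (fun q => 2 / D * RInt phi q S) x (2 / D * - phi x)).
  { apply (is_derive_scal (fun q => RInt phi q S) x (2 / D)). now apply is_derive_RInt_lower. }
  assert (H2 := is_derive_comp sqrt (fun q => 2 / D * RInt phi q S) x _ _
    (is_derive_sqrt (fun r => r) _ 1 (is_derive_id _) Hin) H1).
  unfold scal in H2. simpl in H2. unfold mult in H2. simpl in H2.
  fold (slope D phi S x) in H2.
  replace (- phi x / (D * slope D phi S x)) with (2 / D * - phi x * (1 / (2 * slope D phi S x))); [exact H2|].
  field. lra.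
Qed.

(** The orbit is built by quadrature, as the inverse of [G] with [G' = 1 / slope]. Positivity of
    [phi] below [q0], down to [m], makes [G] differentiable on both sides of [q0]; the linear bound
    of [phi] near [S] makes [G] tend to infinity, so [Q] is defined on the whole half-line and stays
    below [S]. *)
Lemma orbit_exists (D : R) (phi : R -> R) (m q0 S Lam : R) :
  0 < D -> (forall s, continuous phi s) -> m < q0 < S -> 0 < Lam ->
  (forall s, m < s < S -> 0 < phi s) -> (forall s, q0 <= s <= S -> phi s <= Lam * (S - s)) ->
  exists Q, is_orbit D phi S q0 Q.
Proof.
  intros HD Hc Hq0 HLam Hp Hlip.
  set (p := slope D phi S). set (G := travel D phi S q0).
  assert (Hpp : forall q, m < q < S -> 0 < p q).
  { intros q Hq. apply slope_pos; auto; try lra. intros s Hs. apply Hp. lra. }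
  assert (Hpd : forall x y, m < x -> x <= y <= S -> p y <= p x).
  { intros x y Hx [[Hxy| ->] Hy]; [|lra]. left. apply slope_decreasing; auto. intros s Hs. apply Hp. lra. }
  assert (Hpc : forall q, continuous p q) by (intros; now apply slope_continuous).
  assert (HGd : forall q, m < q < S -> is_derive G q (/ p q)).
  { intros q Hq.
    assert (Hcont : forall s, m < s < S -> continuous (fun s => / p s) s).
    { intros s Hs. apply (continuous_real_comp p Rinv); [apply Hpc|].
      apply continuous_Rinv. specialize (Hpp s Hs). lra. }
    apply (is_derive_RInt (fun s => / p s) G q0 q); [|now apply Hcont].
    apply locally_R_iff. exists (Rmin (q - m) (S - q)). split; [apply Rmin_glb_lt; lra|].
    intros s Hs. pose proof (Rmin_l (q - m) (S - q)). pose proof (Rmin_r (q - m) (S - q)).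
    apply Rabs_def2 in Hs. apply (RInt_correct (fun s => / p s)). apply (ex_RInt_continuous (fun s => / p s)).
    intros r Hr. apply Hcont. split.
    - eapply Rlt_le_trans; [|apply Hr]. apply Rmin_glb_lt; lra.
    - eapply Rle_lt_trans; [apply Hr|]. apply Rmax_lub_lt; lra. }
  assert (HG0 : G q0 = 0) by exact (RInt_point q0 (fun s => / p s)).
  assert (HGmvt : forall x y, m < x -> x < y < S -> exists z, x < z < y /\ (G y - G x) * p z = y - x).
  { intros x y Hx Hy. destruct (MVT_cor2 G (fun q => / p q) x y ltac:(lra)) as [z [Hz1 Hz2]].
    - intros q Hq. apply is_derive_Reals, HGd. lra.
    - exists z. split; [assumption|]. rewrite Hz1. specialize (Hpp z ltac:(lra)). field. lra. }
  assert (HGlt : forall x y, m < x -> x < y < S -> G x < G y).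
  { intros x y Hx Hy. destruct (HGmvt x y Hx Hy) as [z [Hz1 Hz2]]. specialize (Hpp z ltac:(lra)). nra. }
  (* The bound on [phi] gives [slope <= sqrt (Lam / D) * (S - q)], so [G] dominates a multiple of
     [- ln (S - q)]; the level [q] below is the one where the logarithmic gain equals [X + 1]. *)
  assert (HGinf : forall X, 0 <= X -> exists q, q0 < q < S /\ X < G q).
  { intros X HX.
    set (kap := / sqrt (Lam / D)).
    assert (Hsq : 0 < sqrt (Lam / D)) by (apply sqrt_lt_R0, Rdiv_lt_0_compat; lra).
    assert (Hkap : 0 < kap) by now apply Rinv_0_lt_compat.
    assert (Hpb : forall q, q0 <= q < S -> p q <= sqrt (Lam / D) * (S - q)).
    { intros q Hq. unfold p, slope.
      rewrite <- (sqrt_Rsqr (S - q)) by lra. rewrite <- sqrt_mult; [|apply Rdiv_le_0_compat; lra|apply Rle_0_sqr].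
      apply sqrt_le_1_alt.
      assert (E : is_RInt (fun s => Lam * (S - s)) q S (Lam * (S - q) ^ 2 / 2)).
      { replace (Lam * (S - q) ^ 2 / 2) with (minus ((fun s => - (Lam * (S - s) ^ 2 / 2)) S) ((fun s => - (Lam * (S - s) ^ 2 / 2)) q)).
        - apply (is_RInt_derive (fun s => - (Lam * (S - s) ^ 2 / 2))).
          + intros s _. auto_derive; [auto|field].
          + intros s _. apply (ex_derive_continuous (fun s => Lam * (S - s))). auto_derive. auto.
        - unfold minus, plus, opp. simpl. field. }
      assert (Hle : RInt phi q S <= Lam * (S - q) ^ 2 / 2).
      { rewrite <- (is_RInt_unique _ _ _ _ E). apply RInt_le; [lra|now apply ex_RInt_cont|eexists; exact E|].
        intros s Hs. apply Hlip. lra. }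
      replace (Lam / D * Rsqr (S - q)) with (2 / D * (Lam * (S - q) ^ 2 / 2)) by (unfold Rsqr; field; lra).
      apply Rmult_le_compat_l; [apply Rdiv_le_0_compat; lra|exact Hle]. }
    set (q := S - (S - q0) * exp (- (X + 1) / kap)).
    assert (He : 0 < exp (- (X + 1) / kap) < 1).
    { split; [apply exp_pos|]. rewrite <- exp_0 at 2. apply exp_increasing.
      unfold Rdiv. assert (0 < (X + 1) * / kap) by (apply Rmult_lt_0_compat; [lra|now apply Rinv_0_lt_compat]). lra. }
    assert (Hq : q0 < q < S) by (unfold q; split; nra).
    exists q. split; [assumption|].
    destruct (MVT_cor2 (fun q => G q + kap * ln (S - q)) (fun q => / p q - kap / (S - q)) q0 q ltac:(lra)) as [z [Hz1 Hz2]].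
    { intros r Hr. apply is_derive_Reals. apply (is_derive_plus G (fun q => kap * ln (S - q))).
      - apply HGd. lra.
      - auto_derive; [lra|]. field. lra. }
    assert (Hnn : 0 <= / p z - kap / (S - z)).
    { specialize (Hpb z ltac:(lra)). specialize (Hpp z ltac:(lra)).
      assert (kap / (S - z) <= / p z); [|lra].
      apply Rle_trans with (/ (sqrt (Lam / D) * (S - z))); [|apply Rinv_le_contravar; assumption].
      unfold kap. apply Req_le. field. split; lra. }
    assert (0 <= (/ p z - kap / (S - z)) * (q - q0)) by (apply Rmult_le_pos; lra).
    rewrite HG0 in Hz1. unfold q in Hz1 at 2. replace (S - (S - (S - q0) * exp (- (X + 1) / kap))) with
      ((S - q0) * exp (- (X + 1) / kap)) in Hz1 by ring.
    rewrite ln_mult, ln_exp in Hz1 by lra.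
    replace (kap * (ln (S - q0) + - (X + 1) / kap)) with (kap * ln (S - q0) - (X + 1)) in Hz1 by (field; lra). lra. }
  assert (Hinv : forall x, exists q, (x <= 0 -> q = q0) /\ (0 <= x -> q0 <= q < S /\ G q = x)).
  { intros x. destruct (Rle_lt_dec x 0) as [Hx|Hx].
    - exists q0. split; [auto|]. intros Hx'. split; [lra|]. rewrite HG0. lra.
    - destruct (HGinf x ltac:(lra)) as [q1 [Hq1 Hq1x]].
      destruct (IVT_interv (fun q => G q - x) q0 q1) as [q [Hq Hqx]].
      + intros q Hq. apply continuity_pt_filterlim.
        apply (ex_derive_continuous (fun q => G q - x)). exists (/ p q - 0).
        apply (is_derive_minus G (fun _ => x)); [apply HGd; lra|apply (is_derive_const x)].
      + lra.
      + rewrite HG0. lra.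
      + lra.
      + exists q. split; [lra|]. intros _. split; lra. }
  apply choice in Hinv. destruct Hinv as [Q HQ].
  assert (HQn : forall x, x <= 0 -> Q x = q0) by (intros; now apply HQ).
  assert (HQp : forall x, 0 <= x -> q0 <= Q x < S /\ G (Q x) = x) by (intros; now apply HQ).
  (* The slope decreases along the orbit, so its values at both ends bracket the difference
     quotient; this yields the derivative of [Q] without an inverse function theorem. *)
  assert (HQmono : forall x y, 0 <= x -> x < y -> p (Q y) * (y - x) <= Q y - Q x <= p (Q x) * (y - x) /\ Q x < Q y).
  { intros x y Hx Hy. destruct (HQp x Hx) as [A1 A2]. destruct (HQp y ltac:(lra)) as [B1 B2].
    assert (Hlt : Q x < Q y).
    { apply Rnot_le_lt. intros [H|H].
      - specialize (HGlt (Q y) (Q x) ltac:(lra) ltac:(lra)). lra.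
      - rewrite H in B2. lra. }
    destruct (HGmvt (Q x) (Q y) ltac:(lra) ltac:(lra)) as [z [Hz1 Hz2]]. rewrite A2, B2 in Hz2.
    pose proof (Hpd (Q x) z ltac:(lra) ltac:(lra)). pose proof (Hpd z (Q y) ltac:(lra) ltac:(lra)).
    split; [|assumption]. nra. }
  assert (HQle : forall x y, x <= y -> Q x <= Q y).
  { intros x y [Hxy| ->]; [|lra]. destruct (Rle_lt_dec y 0).
    - rewrite !HQn by lra. lra.
    - destruct (Rle_lt_dec x 0).
      + rewrite (HQn x) by lra. apply HQp. lra.
      + apply Rlt_le, HQmono; lra. }
  assert (Hpq0 : forall x, 0 <= x -> p (Q x) <= p q0).
  { intros x Hx. destruct (HQp x Hx). apply Hpd; lra. }
  assert (HQlip : forall x y, x <= y -> Q y - Q x <= p q0 * (y - x)).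
  { intros x y Hxy. assert (Hp0 : 0 < p q0) by (apply Hpp; lra).
    destruct (Rle_lt_dec y 0).
    - rewrite !HQn by lra. rewrite Rminus_diag. apply Rmult_le_pos; lra.
    - set (x' := Rmax 0 x). assert (Ex : Q x' = Q x).
      { unfold x'. destruct (Rle_lt_dec x 0); [rewrite Rmax_left, !HQn by lra; auto|rewrite Rmax_right by lra; auto]. }
      assert (Hx0 : 0 <= x') by apply Rmax_l. assert (Hxx : x <= x') by apply Rmax_r.
      assert (Hx1 : x' <= y) by (unfold x'; apply Rmax_lub; lra). rewrite <- Ex.
      destruct Hx1 as [Hx1|Hx1].
      + destruct (HQmono x' y Hx0 Hx1) as [[_ H] _]. specialize (Hpq0 x' Hx0).
        apply Rle_trans with (p q0 * (y - x')); [|apply Rmult_le_compat_l; lra].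
        eapply Rle_trans; [exact H|]. apply Rmult_le_compat_r; lra.
      + rewrite Hx1, Rminus_diag. apply Rmult_le_pos; lra. }
  assert (HQc : forall x, continuous Q x).
  { intros x. assert (Hp0 : 0 < p q0) by (apply Hpp; lra). apply filterlim_locally. intros eps.
    assert (Hd : 0 < eps / p q0) by (apply Rdiv_lt_0_compat; [apply cond_pos|assumption]).
    exists (mkposreal _ Hd). intros y Hy. change (Rabs (Q y - Q x) < eps). change (Rabs (y - x) < eps / p q0) in Hy.
    assert (Hb : Rabs (Q y - Q x) <= p q0 * Rabs (y - x)).
    { destruct (Rle_dec x y) as [H|H].
      - specialize (HQlip x y H). specialize (HQle x y H). rewrite !Rabs_pos_eq; lra.
      - specialize (HQlip y x ltac:(lra)). specialize (HQle y x ltac:(lra)).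
        rewrite (Rabs_left1 (Q y - Q x)), (Rabs_left1 (y - x)); lra. }
    eapply Rle_lt_trans; [exact Hb|]. apply Rmult_lt_compat_l with (r := p q0) in Hy; [|assumption].
    replace (p q0 * (eps / p q0)) with (pos eps) in Hy by (field; lra). exact Hy. }
  assert (HQd : forall x, 0 < x -> is_derive Q x (p (Q x))).
  { intros x Hx. apply is_derive_Reals. intros eps Heps.
    assert (Hcp : continuous (fun x => p (Q x)) x) by (apply (continuous_real_comp Q p); auto).
    destruct (proj1 (filterlim_locally _ _) Hcp (mkposreal eps Heps)) as [dl Hdl].
    assert (Hr : 0 < Rmin dl x) by (apply Rmin_glb_lt; [apply cond_pos|assumption]).
    exists (mkposreal _ Hr). simpl. intros h Hh0 Hh.
    pose proof (Rmin_l dl x). pose proof (Rmin_r dl x).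
    assert (Hball : Rabs (p (Q (x + h)) - p (Q x)) < eps).
    { apply Hdl. change (Rabs (x + h - x) < dl). replace (x + h - x) with h by ring. lra. }
    apply Rabs_def2 in Hh. apply Rabs_def2 in Hball.
    destruct (Rlt_dec 0 h) as [Hp0|Hn0].
    - destruct (HQmono x (x + h) ltac:(lra) ltac:(lra)) as [[H1 H2] _].
      replace (x + h - x) with h in * by ring.
      assert (Hq : p (Q (x + h)) <= (Q (x + h) - Q x) / h <= p (Q x)).
      { split; apply Rmult_le_reg_r with h; try lra; unfold Rdiv; rewrite Rmult_assoc, Rinv_l; lra. }
      apply Rabs_def1; lra.
    - destruct (HQmono (x + h) x ltac:(lra) ltac:(lra)) as [[H1 H2] _].
      replace (x - (x + h)) with (- h) in * by ring.
      assert (Hq : p (Q x) <= (Q (x + h) - Q x) / h <= p (Q (x + h))).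
      { replace ((Q (x + h) - Q x) / h) with ((Q x - Q (x + h)) / - h) by (field; lra).
        split; apply Rmult_le_reg_r with (- h); try lra; unfold Rdiv; rewrite Rmult_assoc, Rinv_l; lra. }
      apply Rabs_def1; lra. }
  exists Q. split; [exact HQn|]. split; [exact HQp|]. split; [|split; [exact HQle|split; [exact HQlip|split; [exact HQc|]]]].
  - intros q Hq.
    assert (HGq : 0 <= G q).
    { destruct (proj1 Hq) as [H| <-]; [|rewrite HG0; lra]. rewrite <- HG0. left. apply HGlt; lra. }
    split; [exact HGq|]. destruct (HQp (G q) HGq) as [A1 A2].
    destruct (Rtotal_order (Q (G q)) q) as [H|[H|H]]; [|exact H|].
    + specialize (HGlt (Q (G q)) q ltac:(lra) ltac:(lra)). unfold G in *. lra.
    + specialize (HGlt q (Q (G q)) ltac:(lra) ltac:(lra)). unfold G in *. lra.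
  - intros x Hx. split; [now apply HQd|]. destruct (HQp x ltac:(lra)) as [A1 _].
    assert (H := is_derive_comp p Q x _ _
      (slope_derive D phi S (Q x) HD Hc ltac:(lra) ltac:(intros s Hs; apply Hp; lra)) (HQd x Hx)).
    unfold scal in H. simpl in H. unfold mult in H. simpl in H. fold p in H.
    specialize (Hpp (Q x) ltac:(lra)).
    replace (- phi (Q x) / D) with (p (Q x) * (- phi (Q x) / (D * p (Q x)))); [exact H|]. field. lra.
Qed.

(** * Perturbed nonlinearities and comparison of their orbits *)

Lemma continuous_continuity_pt (f : R -> R) (x : R) : continuous f x -> continuity_pt f x.
Proof. intros H. now apply continuity_pt_filterlim. Qed.

Lemma positive_min (f : R -> R) (x y : R) : x <= y -> (forall s, continuous f s) ->
  (forall s, x <= s <= y -> 0 < f s) -> exists c, 0 < c /\ forall s, x <= s <= y -> c <= f s.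
Proof.
  intros Hxy Hc Hp. destruct (continuity_ab_min f x y Hxy) as [z [Hz1 Hz2]].
  - intros s _. now apply continuous_continuity_pt.
  - exists (f z). split; [now apply Hp|assumption].
Qed.

Lemma bounded_above_interval (f : R -> R) (x y : R) : x <= y -> (forall s, continuous f s) ->
  exists M, 0 < M /\ forall s, x <= s <= y -> f s <= M.
Proof.
  intros Hxy Hc. destruct (continuity_ab_maj f x y Hxy) as [z [Hz1 Hz2]].
  - intros s _. now apply continuous_continuity_pt.
  - exists (Rabs (f z) + 1). pose proof (Rabs_pos (f z)). split; [lra|].
    intros s Hs. specialize (Hz1 s Hs). pose proof (Rle_abs (f z)). lra.
Qed.

Lemma continuous_Rmin_comp (f g : R -> R) (x : R) :
  continuous f x -> continuous g x -> continuous (fun s => Rmin (f s) (g s)) x.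
Proof.
  intros Hf Hg.
  apply continuous_ext with (fun s => / 2 * (f s + g s - Rabs (f s - g s))).
  - intros s. unfold Rmin. destruct (Rle_dec (f s) (g s)).
    + rewrite Rabs_left1 by lra. apply Rminus_diag_uniq; field.
    + rewrite Rabs_pos_eq by lra. apply Rminus_diag_uniq; field.
  - apply (continuous_mult (fun _ => / 2)); [apply continuous_const|].
    apply (continuous_minus (fun s => f s + g s) (fun s => Rabs (f s - g s))).
    + now apply (continuous_plus f g).
    + apply (continuous_real_comp (fun s => f s - g s) Rabs); [now apply (continuous_minus f g)|].
      apply continuous_Rabs.
Qed.

Lemma continuous_affine (k x0 x : R) : continuous (fun s => k * (x0 - s)) x.
Proof. apply (ex_derive_continuous (fun s => k * (x0 - s))). auto_derive. auto. Qed.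

Lemma sqrt_le_scaled (x y r : R) : 0 <= y -> 1 <= r -> x <= r * y -> sqrt x <= r * sqrt y.
Proof.
  intros Hy Hr Hx. apply Rle_trans with (sqrt (r ^ 2 * y)).
  - apply sqrt_le_1_alt. apply Rle_trans with (r * y); [assumption|]. apply Rmult_le_compat_r; nra.
  - rewrite sqrt_mult by nra. rewrite sqrt_pow2 by lra. lra.
Qed.

Lemma slope_le_scaled (D : R) (phi1 phi2 : R -> R) (S1 S2 q r : R) : 0 < D -> 1 <= r ->
  0 <= RInt phi2 q S2 -> RInt phi1 q S1 <= r * RInt phi2 q S2 ->
  slope D phi1 S1 q <= r * slope D phi2 S2 q.
Proof.
  intros HD Hr H1 H2. unfold slope. assert (0 < 2 / D) by (apply Rdiv_lt_0_compat; lra).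
  apply sqrt_le_scaled; [apply Rmult_le_pos; lra|assumption|].
  replace (r * (2 / D * RInt phi2 q S2)) with (2 / D * (r * RInt phi2 q S2)) by ring.
  apply Rmult_le_compat_l; lra.
Qed.

Lemma RInt_le_cont (f g : R -> R) (x y : R) : x <= y -> (forall s, continuous f s) -> (forall s, continuous g s) ->
  (forall s, x < s < y -> f s <= g s) -> RInt f x y <= RInt g x y.
Proof. intros. apply RInt_le; auto; now apply ex_RInt_cont. Qed.

Lemma RInt_split (f : R -> R) (x y z : R) : (forall s, continuous f s) ->
  RInt f x z = RInt f x y + RInt f y z.
Proof. intros H. symmetry. apply (RInt_Chasles f x y z); now apply ex_RInt_cont. Qed.

Lemma RInt_const_R (c x y : R) : RInt (fun _ => c) x y = (y - x) * c.
Proof. rewrite (RInt_const x y c). reflexivity. Qed.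

(* A nonlinearity strictly below [f] on [[q0, S']], whose orbit saturates at some [S'] where [f] is
   still positive: translates of that orbit are strict subsolutions up to their limit. *)
Lemma lower_perturbation (D : R) (f : R -> R) (m q0 q1 S eps delta : R) :
  0 < D -> (forall s, continuous f s) -> m < q0 -> q0 <= q1 < S -> (forall s, m < s < S -> 0 < f s) ->
  0 < eps -> 0 < delta ->
  exists phi S' c0 Lam, S - delta < S' < S /\ q1 < S' /\ (forall s, continuous phi s) /\
    (forall s, m < s < S' -> 0 < phi s) /\ 0 < Lam /\ (forall s, q0 <= s <= S' -> phi s <= Lam * (S' - s)) /\
    0 < c0 /\ (forall s, q0 <= s <= S' -> phi s + c0 <= f s) /\
    (forall q, q0 <= q <= q1 -> slope D f S q <= (1 + eps) * slope D phi S' q) /\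
    (forall q, q0 <= q <= S' -> slope D phi S' q <= slope D f S q).
Proof.
  intros HD Hc Hm Hq1 Hp Heps Hdel.
  destruct (bounded_above_interval f q0 S ltac:(lra) Hc) as [M [HM HfM]].
  set (e1 := RInt f q1 S).
  assert (He1 : 0 < e1) by (apply RInt_gt_0; [lra|intros; apply Hp; lra|auto]).
  (* [kap * X] bounds the relative loss of energy at levels up to [q1]: a fraction [kap] from the
     factor [1 - kap], and at most [2 * kap * M] from the levels above [S - 2 kap], compared with
     the energy [e1] still available at [q1]. *)
  set (X := 1 + 2 * M / e1).
  assert (HX : 1 < X) by (unfold X; assert (0 < 2 * M / e1) by (apply Rdiv_lt_0_compat; lra); lra).
  set (kap := Rmin (Rmin (delta / 2) (1 / 2)) (Rmin ((S - q1) / 3) (eps / (1 + eps) / X))).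
  assert (Hee : 0 < eps / (1 + eps)) by (apply Rdiv_lt_0_compat; lra).
  assert (Hk0 : 0 < kap) by (unfold kap; repeat apply Rmin_glb_lt; try lra; apply Rdiv_lt_0_compat; lra).
  assert (Hk1 : kap <= delta / 2) by (unfold kap; eapply Rle_trans; [apply Rmin_l|apply Rmin_l]).
  assert (Hk2 : kap <= 1 / 2) by (unfold kap; eapply Rle_trans; [apply Rmin_l|apply Rmin_r]).
  assert (Hk3 : kap <= (S - q1) / 3) by (unfold kap; eapply Rle_trans; [apply Rmin_r|apply Rmin_l]).
  assert (Hk4 : kap * X <= eps / (1 + eps)).
  { apply Rle_trans with (eps / (1 + eps) / X * X); [|apply Req_le; field; lra].
    apply Rmult_le_compat_r; [lra|]. unfold kap. eapply Rle_trans; [apply Rmin_r|apply Rmin_r]. }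
  set (S' := S - kap).
  (* The factor [1 - kap] provides the strict gap below [f]; the cutoff makes [phi] vanish linearly
     at [S'], as [orbit_exists] requires. *)
  set (phi := fun s => (1 - kap) * f s * Rmin 1 (/ kap * (S' - s))).
  assert (Hki : 0 < / kap) by now apply Rinv_0_lt_compat.
  assert (Hphic : forall s, continuous phi s).
  { intros s. unfold phi. apply (continuous_mult (fun s => (1 - kap) * f s) (fun s => Rmin 1 (/ kap * (S' - s)))).
    - apply (continuous_mult (fun _ => 1 - kap) f); [apply continuous_const|apply Hc].
    - apply (continuous_Rmin_comp (fun _ => 1) (fun s => / kap * (S' - s))); [apply continuous_const|apply continuous_affine]. }
  assert (Hmin : forall s, s <= S' -> 0 <= Rmin 1 (/ kap * (S' - s)) <= 1).
  { intros s Hs. split; [|apply Rmin_l]. apply Rmin_glb; [lra|]. apply Rmult_le_pos; lra. }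
  assert (Hf0 : forall s, q0 <= s <= S' -> 0 < f s) by (intros s Hs; apply Hp; unfold S' in Hs; lra).
  assert (Hphif : forall s, q0 <= s <= S' -> phi s <= (1 - kap) * f s).
  { intros s Hs. unfold phi. rewrite <- (Rmult_1_r ((1 - kap) * f s)) at 2.
    apply Rmult_le_compat_l; [|apply Hmin; lra]. specialize (Hf0 s Hs). apply Rmult_le_pos; lra. }
  assert (Hphi0 : forall s, q0 <= s <= S' -> 0 <= phi s).
  { intros s Hs. specialize (Hf0 s Hs). unfold phi. apply Rmult_le_pos; [apply Rmult_le_pos; lra|apply Hmin; lra]. }
  destruct (positive_min f q0 S' ltac:(unfold S'; lra) Hc Hf0) as [c [Hc0 Hcf]].
  exists phi, S', (kap * c), ((1 - kap) * M * / kap).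
  assert (HEphi : forall q, q0 <= q <= S' -> RInt phi q S' <= RInt f q S).
  { intros q Hq. rewrite (RInt_split f q S' S Hc).
    assert (0 <= RInt f S' S).
    { left. apply RInt_gt_0; [unfold S'; lra|intros s Hs; apply Hp; unfold S' in *; lra|auto]. }
    assert (RInt phi q S' <= RInt f q S').
    { apply RInt_le_cont; auto; [lra|]. intros s Hs. specialize (Hphif s ltac:(lra)). specialize (Hf0 s ltac:(lra)). nra. }
    lra. }
  split; [unfold S'; lra|]. split; [unfold S'; lra|]. split; [exact Hphic|].
  split; [|split; [|split; [|split; [|split; [|split]]]]].
  - intros s Hs. unfold phi. apply Rmult_lt_0_compat; [apply Rmult_lt_0_compat; [lra|apply Hp; unfold S' in Hs; lra]|].
    apply Rmin_glb_lt; [lra|]. apply Rmult_lt_0_compat; lra.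
  - repeat apply Rmult_lt_0_compat; lra.
  - intros s Hs. unfold phi. rewrite (Rmult_assoc ((1 - kap) * M)).
    apply Rmult_le_compat.
    + specialize (Hf0 s Hs). apply Rmult_le_pos; lra.
    + apply Hmin; lra.
    + apply Rmult_le_compat_l; [lra|]. apply HfM. unfold S' in Hs. lra.
    + apply Rmin_r.
  - apply Rmult_lt_0_compat; lra.
  - intros s Hs. specialize (Hphif s Hs). specialize (Hcf s Hs).
    assert (kap * c <= kap * f s) by (apply Rmult_le_compat_l; lra). lra.
  - intros q Hq. assert (HE1 : e1 <= RInt f q S).
    { unfold e1. rewrite (RInt_split f q q1 S Hc). assert (0 <= RInt f q q1); [|lra].
      apply RInt_ge_0; [lra|now apply ex_RInt_cont|]. intros s Hs. left. apply Hp. lra. }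
    assert (HEp : 0 <= RInt phi q S').
    { apply RInt_ge_0; [unfold S'; lra|now apply ex_RInt_cont|]. intros s Hs. apply Hphi0. lra. }
    apply slope_le_scaled; try lra.
    set (r := S' - kap). assert (Hr : q1 <= r) by (unfold r, S'; lra).
    assert (B1 : RInt f q S = RInt f q r + RInt f r S) by now apply RInt_split.
    assert (B2 : RInt f r S <= 2 * kap * M).
    { apply Rle_trans with (RInt (fun _ => M) r S).
      - apply RInt_le_cont; [unfold r, S'; lra|auto|intros; apply continuous_const|].
        intros s Hs. apply HfM. lra.
      - rewrite RInt_const_R. unfold r, S'. apply Req_le. ring. }
    assert (B3 : (1 - kap) * RInt f q r <= RInt phi q S').
    { rewrite (RInt_split phi q r S' Hphic).
      assert (0 <= RInt phi r S').
      { apply RInt_ge_0; [unfold r; lra|now apply ex_RInt_cont|]. intros s Hs. apply Hphi0. lra. }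
      assert (E : (1 - kap) * RInt f q r = RInt (fun s => (1 - kap) * f s) q r).
      { symmetry. apply (RInt_scal f q r (1 - kap)). now apply ex_RInt_cont. }
      rewrite E. assert (RInt (fun s => (1 - kap) * f s) q r <= RInt phi q r); [|lra].
      apply RInt_le_cont; [lra| |auto|].
      - intros s. apply (continuous_mult (fun _ => 1 - kap) f); [apply continuous_const|apply Hc].
      - intros s Hs. unfold phi. rewrite Rmin_left; [lra|].
        apply Rmult_le_reg_l with kap; [lra|]. rewrite <- Rmult_assoc, Rinv_r by lra. unfold r in Hs. lra. }
    set (E := RInt f q S) in *.
    assert (B4 : E * (1 - kap * X) <= RInt phi q S').
    { eapply Rle_trans; [|exact B3].
      assert (2 * kap * M <= E * (kap * (2 * M / e1))).
      { apply Rle_trans with (e1 * (kap * (2 * M / e1))); [apply Req_le; field; lra|].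
        apply Rmult_le_compat_r; [|lra]. apply Rmult_le_pos; [lra|]. apply Rdiv_le_0_compat; lra. }
      assert (0 <= kap * RInt f r S).
      { apply Rmult_le_pos; [lra|]. apply RInt_ge_0; [unfold r, S'; lra|now apply ex_RInt_cont|].
        intros s Hs. left. apply Hp. lra. }
      unfold X. nra. }
    assert (B5 : 1 <= (1 + eps) * (1 - kap * X)).
    { apply Rmult_le_compat_l with (r := 1 + eps) in Hk4; [|lra].
      replace ((1 + eps) * (eps / (1 + eps))) with eps in Hk4 by (field; lra). lra. }
    nra.
  - intros q Hq. rewrite <- (Rmult_1_l (slope D f S q)). apply slope_le_scaled; try lra.
    + apply RInt_ge_0; [unfold S' in *; lra|now apply ex_RInt_cont|]. intros s Hs. left. apply Hp. lra.
    + rewrite Rmult_1_l. now apply HEphi.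
Qed.

(** The counterpart from above: the positive part of [f] plus [kap * (S' - s)]. The added term
    vanishes at the new saturation level [S'], but [f] is negative there, so the gap remains bounded
    below up to [S']. *)
Lemma upper_perturbation (D : R) (f : R -> R) (m q0 q1 S eps delta : R) :
  0 < D -> (forall s, continuous f s) -> m < q0 -> q0 <= q1 < S -> (forall s, m < s < S -> 0 < f s) ->
  (forall s, S < s < S + delta -> f s < 0) -> 0 < eps -> 0 < delta ->
  exists phi S' c0 Lam, S < S' < S + delta /\ (forall s, continuous phi s) /\
    (forall s, m < s < S' -> 0 < phi s) /\ 0 < Lam /\ (forall s, q0 <= s <= S' -> phi s <= Lam * (S' - s)) /\
    0 < c0 /\ (forall s, q0 <= s <= S' -> f s + c0 <= phi s) /\
    (forall q, q0 <= q <= q1 -> slope D phi S' q <= (1 + eps) * slope D f S q) /\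
    (forall q, q0 <= q < S -> slope D f S q <= slope D phi S' q).
Proof.
  intros HD Hc Hm Hq1 Hp Hn Heps Hdel.
  destruct (bounded_above_interval f q0 S ltac:(lra) Hc) as [M [HM HfM]].
  set (e1 := RInt f q1 S).
  assert (He1 : 0 < e1) by (apply RInt_gt_0; [lra|intros; apply Hp; lra|auto]).
  set (W := S + 1 - q0). assert (HW : 1 < W) by (unfold W; lra).
  assert (HWW : 0 < W * W + W) by nra.
  (* [W] bounds the distance between levels, so the energy added is at most [kap * W * W] below [S]
     and [kap * W] above it; both must fit in [eps * e1]. *)
  set (kap := Rmin (Rmin (delta / 2) 1) (eps * e1 / (W * W + W))).
  assert (Hk0 : 0 < kap).
  { unfold kap. repeat apply Rmin_glb_lt; try lra. apply Rdiv_lt_0_compat; [apply Rmult_lt_0_compat; lra|lra]. }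
  assert (Hk1 : kap <= delta / 2) by (unfold kap; eapply Rle_trans; [apply Rmin_l|apply Rmin_l]).
  assert (Hk2 : kap <= 1) by (unfold kap; eapply Rle_trans; [apply Rmin_l|apply Rmin_r]).
  assert (Hk4 : kap * (W * W + W) <= eps * e1).
  { apply Rle_trans with (eps * e1 / (W * W + W) * (W * W + W)); [|apply Req_le; field; lra].
    apply Rmult_le_compat_r; [lra|]. apply Rmin_r. }
  set (S' := S + kap).
  set (fm := fun s => Rmin (- f s) 0).
  set (phi := fun s => - fm s + kap * (S' - s)).
  assert (Hfmc : forall s, continuous fm s).
  { intros s. apply (continuous_Rmin_comp (fun s => - f s) (fun _ => 0)); [apply (continuous_opp f), Hc|apply continuous_const]. }
  assert (Hphic : forall s, continuous phi s).
  { intros s. apply (continuous_plus (fun s => - fm s) (fun s => kap * (S' - s))); [apply (continuous_opp fm), Hfmc|apply continuous_affine]. }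
  assert (Hfm : forall s, f s <= - fm s /\ 0 <= - fm s).
  { intros s. unfold fm. pose proof (Rmin_l (- f s) 0). pose proof (Rmin_r (- f s) 0). lra. }
  assert (Hfm1 : forall s, 0 <= f s -> - fm s = f s) by (intros s Hs; unfold fm; rewrite Rmin_left; lra).
  assert (Hfm2 : forall s, f s <= 0 -> - fm s = 0) by (intros s Hs; unfold fm; rewrite Rmin_right; lra).
  assert (HfS : forall s, S < s <= S' -> f s <= 0) by (intros s Hs; left; apply Hn; unfold S' in Hs; lra).
  assert (Hstrict : forall s, q0 <= s <= S' -> 0 < phi s - f s).
  { intros s Hs. unfold phi. destruct (Hfm s). destruct (proj2 Hs) as [H1|H1].
    - assert (0 < kap * (S' - s)) by (apply Rmult_lt_0_compat; lra). lra.
    - subst s. rewrite Rminus_diag, Rmult_0_r. specialize (Hn S' ltac:(unfold S'; lra)). lra. }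
  destruct (positive_min (fun s => phi s - f s) q0 S' ltac:(unfold S'; lra)) as [c [Hc0 Hcf]].
  { intros s. apply (continuous_minus phi f); auto. }
  { exact Hstrict. }
  exists phi, S', c, (M / kap + kap).
  assert (HSS : S < S') by (unfold S'; lra).
  assert (HMk : 0 < M / kap) by (apply Rdiv_lt_0_compat; lra).
  split; [unfold S'; lra|]. split; [exact Hphic|].
  split; [|split; [|split; [|split; [|split; [|split]]]]].
  - intros s Hs. unfold phi. destruct (Hfm s). assert (0 < kap * (S' - s)) by (apply Rmult_lt_0_compat; lra). lra.
  - lra.
  - intros s Hs. unfold phi. assert (- fm s <= M / kap * (S' - s)); [|lra].
    destruct (Rle_lt_dec s S) as [H1|H1].
    + apply Rle_trans with M.
      * unfold fm. assert (- M <= Rmin (- f s) 0); [|lra]. apply Rmin_glb; [specialize (HfM s ltac:(lra)); lra|lra].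
      * apply Rle_trans with (M / kap * kap); [apply Req_le; field; lra|].
        apply Rmult_le_compat_l; [lra|unfold S'; lra].
    + rewrite Hfm2 by (apply HfS; lra). apply Rmult_le_pos; lra.
  - assumption.
  - intros s Hs. specialize (Hcf s Hs). simpl in Hcf. lra.
  - intros q Hq. assert (HE1 : e1 <= RInt f q S).
    { unfold e1. rewrite (RInt_split f q q1 S Hc). assert (0 <= RInt f q q1); [|lra].
      apply RInt_ge_0; [lra|now apply ex_RInt_cont|]. intros s Hs. left. apply Hp. lra. }
    apply slope_le_scaled; try lra.
    rewrite (RInt_split phi q S S' Hphic).
    assert (B1 : RInt phi q S <= RInt f q S + kap * W * W).
    { apply Rle_trans with (RInt (fun s => f s + kap * W) q S).
      - apply RInt_le_cont; [lra|auto| |].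
        + intros s. apply (continuous_plus f (fun _ => kap * W)); [apply Hc|apply continuous_const].
        + intros s Hs. unfold phi. rewrite Hfm1 by (left; apply Hp; lra).
          apply Rplus_le_compat_l. apply Rmult_le_compat_l; [lra|]. unfold S', W. lra.
      - rewrite (RInt_plus f (fun _ => kap * W)); [|now apply ex_RInt_cont|apply ex_RInt_const].
        rewrite RInt_const_R. unfold plus. simpl. apply Rplus_le_compat_l.
        rewrite (Rmult_comm (S - q)). apply Rmult_le_compat_l; [apply Rmult_le_pos; lra|unfold W; lra]. }
    assert (B2 : RInt phi S S' <= kap * W).
    { apply Rle_trans with (RInt (fun _ => kap * W) S S').
      - apply RInt_le_cont; [lra|auto|intros; apply continuous_const|].
        intros s Hs. unfold phi. rewrite Hfm2 by (apply HfS; lra).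
        rewrite Rplus_0_l. apply Rmult_le_compat_l; [lra|]. unfold S', W. lra.
      - rewrite RInt_const_R. unfold S'. replace (S + kap - S) with kap by ring.
        rewrite <- (Rmult_1_l (kap * W)) at 2. apply Rmult_le_compat_r; [apply Rmult_le_pos; lra|lra]. }
    assert (eps * e1 <= eps * RInt f q S) by (apply Rmult_le_compat_l; lra). lra.
  - intros q Hq. rewrite <- (Rmult_1_l (slope D phi S' q)). apply slope_le_scaled; try lra.
    + apply RInt_ge_0; [lra|now apply ex_RInt_cont|]. intros s Hs. unfold phi. destruct (Hfm s).
      assert (0 <= kap * (S' - s)) by (apply Rmult_le_pos; lra). lra.
    + rewrite Rmult_1_l, (RInt_split phi q S S' Hphic).
      assert (0 <= RInt phi S S').
      { apply RInt_ge_0; [lra|now apply ex_RInt_cont|]. intros s Hs. unfold phi. destruct (Hfm s).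
        assert (0 <= kap * (S' - s)) by (apply Rmult_le_pos; lra). lra. }
      assert (RInt f q S <= RInt phi q S); [|lra].
      apply RInt_le_cont; auto; [lra|]. intros s Hs. specialize (Hstrict s ltac:(lra)). lra.
Qed.

Lemma travel_le_scaled (D : R) (phi1 phi2 : R -> R) (S1 S2 q0 q r : R) :
  0 < D -> 0 < r -> (forall s, continuous phi1 s) -> (forall s, continuous phi2 s) ->
  q0 <= q -> q < S1 -> q < S2 -> (forall s, q0 < s < S1 -> 0 < phi1 s) -> (forall s, q0 < s < S2 -> 0 < phi2 s) ->
  (forall s, q0 <= s <= q -> slope D phi2 S2 s <= r * slope D phi1 S1 s) ->
  travel D phi1 S1 q0 q <= r * travel D phi2 S2 q0 q.
Proof.
  intros HD Hr Hc1 Hc2 Hq Hq1 Hq2 Hp1 Hp2 Hs. unfold travel.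
  assert (P1 : forall s, q0 <= s <= q -> 0 < slope D phi1 S1 s).
  { intros s Hs'. apply slope_pos; auto; [lra|]. intros x Hx. apply Hp1. lra. }
  assert (P2 : forall s, q0 <= s <= q -> 0 < slope D phi2 S2 s).
  { intros s Hs'. apply slope_pos; auto; [lra|]. intros x Hx. apply Hp2. lra. }
  assert (E : forall phi S, (forall s, continuous phi s) -> (forall s, q0 <= s <= q -> 0 < slope D phi S s) ->
     ex_RInt (fun s => / slope D phi S s) q0 q).
  { intros phi S Hc HP. apply (ex_RInt_continuous (fun s => / slope D phi S s)). intros s Hs'.
    rewrite Rmin_left, Rmax_right in Hs' by assumption.
    apply (continuous_real_comp (slope D phi S) Rinv); [now apply slope_continuous|].
    apply continuous_Rinv. specialize (HP s Hs'). lra. }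
  assert (E2 : r * RInt (fun s => / slope D phi2 S2 s) q0 q = RInt (fun s => r * / slope D phi2 S2 s) q0 q).
  { symmetry. apply (RInt_scal (fun s => / slope D phi2 S2 s) q0 q r). now apply E. }
  rewrite E2. apply RInt_le; [assumption|now apply E| |].
  - apply (ex_RInt_scal (fun s => / slope D phi2 S2 s) q0 q r). now apply E.
  - intros s Hs'. specialize (P1 s ltac:(lra)). specialize (P2 s ltac:(lra)). specialize (Hs s ltac:(lra)).
    apply Rmult_le_reg_r with (slope D phi1 S1 s * slope D phi2 S2 s); [now apply Rmult_lt_0_compat|].
    replace (/ slope D phi1 S1 s * (slope D phi1 S1 s * slope D phi2 S2 s)) with (slope D phi2 S2 s) by (field; lra).
    replace (r * / slope D phi2 S2 s * (slope D phi1 S1 s * slope D phi2 S2 s)) with (r * slope D phi1 S1 s) by (field; lra).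
    assumption.
Qed.

Lemma travel_increasing_orbit (D : R) (phi : R -> R) (S q0 : R) (Q : R -> R) (q q' : R) :
  is_orbit D phi S q0 Q -> q0 <= q -> q < q' -> q' < S -> travel D phi S q0 q < travel D phi S q0 q'.
Proof.
  intros (_ & _ & HG & HQm & _) Hq Hqq Hq'. destruct (HG q ltac:(lra)) as [_ E1]. destruct (HG q' ltac:(lra)) as [_ E2].
  apply Rnot_le_lt. intros H. apply HQm in H. lra.
Qed.

(** If at each level the first orbit is at most [r] times as steep as the second, the second reaches
    the level [Q1 x] within distance [r * x]. *)
Lemma orbit_compare (D : R) (phi1 phi2 : R -> R) (S1 S2 q0 r x : R) (Q1 Q2 : R -> R) :
  0 < D -> 0 < r -> (forall s, continuous phi1 s) -> (forall s, continuous phi2 s) ->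
  (forall s, q0 < s < S1 -> 0 < phi1 s) -> (forall s, q0 < s < S2 -> 0 < phi2 s) ->
  is_orbit D phi1 S1 q0 Q1 -> is_orbit D phi2 S2 q0 Q2 -> 0 <= x ->
  Q1 x < S2 ->
  (forall s, q0 <= s <= Q1 x -> slope D phi1 S1 s <= r * slope D phi2 S2 s) -> Q1 x <= Q2 (r * x).
Proof.
  intros HD Hr Hc1 Hc2 Hp1 Hp2 HQ1 HQ2 Hx HxS Hs.
  assert (HO1 := HQ1). destruct HO1 as (_ & HB1 & _).
  assert (HO2 := HQ2). destruct HO2 as (_ & HB2 & _).
  destruct (HB1 x Hx) as [A1 A2]. assert (Hrx : 0 <= r * x) by (apply Rmult_le_pos; lra).
  destruct (HB2 (r * x) Hrx) as [B1 B2].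
  apply Rnot_lt_le. intros Hlt.
  assert (H1 := travel_increasing_orbit D phi2 S2 q0 Q2 _ _ HQ2 (proj1 B1) Hlt HxS).
  assert (H2 := travel_le_scaled D phi2 phi1 S2 S1 q0 (Q1 x) r HD Hr Hc2 Hc1 (proj1 A1) HxS (proj2 A1) Hp2 Hp1 Hs).
  rewrite A2, B2 in *. lra.
Qed.

(** Variant for a first orbit whose saturation level may exceed [S2]: slopes are compared only up to
    the level [Q2 (r * x)], which lies below [S2]. *)
Lemma orbit_compare_target (D : R) (phi1 phi2 : R -> R) (S1 S2 q0 r x : R) (Q1 Q2 : R -> R) :
  0 < D -> 0 < r -> (forall s, continuous phi1 s) -> (forall s, continuous phi2 s) ->
  (forall s, q0 < s < S1 -> 0 < phi1 s) -> (forall s, q0 < s < S2 -> 0 < phi2 s) ->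
  is_orbit D phi1 S1 q0 Q1 -> is_orbit D phi2 S2 q0 Q2 -> 0 <= x ->
  (forall s, q0 <= s <= Q2 (r * x) -> slope D phi1 S1 s <= r * slope D phi2 S2 s) -> Q1 x <= Q2 (r * x).
Proof.
  intros HD Hr Hc1 Hc2 Hp1 Hp2 HQ1 HQ2 Hx Hs.
  assert (HO1 := HQ1). destruct HO1 as (_ & HB1 & _).
  assert (HO2 := HQ2). destruct HO2 as (_ & HB2 & _).
  destruct (HB1 x Hx) as [A1 A2]. assert (Hrx : 0 <= r * x) by (apply Rmult_le_pos; lra).
  destruct (HB2 (r * x) Hrx) as [B1 B2].
  apply Rnot_lt_le. intros Hlt.
  assert (H1 := travel_increasing_orbit D phi1 S1 q0 Q1 _ _ HQ1 (proj1 B1) Hlt (proj2 A1)).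
  assert (H2 := travel_le_scaled D phi2 phi1 S2 S1 q0 (Q2 (r * x)) r HD Hr Hc2 Hc1 (proj1 B1) (proj2 B1) ltac:(lra) Hp2 Hp1 Hs).
  rewrite A2, B2 in *. assert (r * travel D phi1 S1 q0 (Q2 (r * x)) < r * x) by (apply Rmult_lt_compat_l; lra). lra.
Qed.

(** * Barriers made of modulated translates of an orbit *)

Lemma coupled_sign (N : nat) (D a : bool -> R) (F : bool -> R -> R) (w : bool -> (tang N -> R) -> R -> R -> R) (sg : R) :
  (sg = 1 \/ sg = -1) -> coupled N D a F w ->
  coupled N D a (fun k s => sg * F k (sg * s)) (fun k y z t => sg * w k y z t).
Proof.
  intros [->| ->] Hw.
  - replace (fun k s => 1 * F k (1 * s)) with F.
    + replace (fun k (y : tang N -> R) z t => 1 * w k y z t) with w; [assumption|].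
      repeat (apply functional_extensionality; intros). ring.
    + repeat (apply functional_extensionality; intros). now rewrite !Rmult_1_l.
  - apply coupled_opp in Hw.
    replace (fun k s => -1 * F k (-1 * s)) with (fun k s => - F k (- s)).
    + replace (fun k (y : tang N -> R) z t => -1 * w k y z t) with (fun k (y : tang N -> R) z t => - w k y z t); [assumption|].
      repeat (apply functional_extensionality; intros). ring.
    + repeat (apply functional_extensionality; intros). replace (-1 * x0) with (- x0) by ring. ring.
Qed.

Lemma has_deriv2_orbit_parab (D : R) (phi : R -> R) (S q0 : R) (Q : R -> R) (sg X c x0 x : R) :
  is_orbit D phi S q0 Q -> 0 < X + c * (x - x0) ^ 2 ->
  has_deriv2 (fun s => sg * Q (X + c * (s - x0) ^ 2)) x
    (sg * (- phi (Q (X + c * (x - x0) ^ 2)) / D * (2 * c * (x - x0)) ^ 2 +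
      slope D phi S (Q (X + c * (x - x0) ^ 2)) * (2 * c))).
Proof.
  intros (_ & _ & _ & _ & _ & _ & HQd) Hx.
  set (u := fun s => X + c * (s - x0) ^ 2).
  assert (Hu : forall s, is_derive u s (2 * c * (s - x0))).
  { intros s. unfold u. auto_derive; [auto|ring]. }
  exists (fun s => sg * (slope D phi S (Q (u s)) * (2 * c * (s - x0)))). split.
  - assert (Hloc : locally x (fun s => 0 < u s)).
    { apply (filter_imp (fun s => Rabs (u s - u x) < u x)).
      - intros s Hs. apply Rabs_def2 in Hs. lra.
      - assert (Hcu : continuous u x) by (apply (ex_derive_continuous u); eexists; apply Hu).
        apply (proj1 (filterlim_locally _ _) Hcu (mkposreal _ Hx)). }
    apply filter_imp with (2 := Hloc). intros s Hs.
    apply (is_derive_scal (fun s => Q (u s)) s sg).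
    assert (H := is_derive_comp Q u s _ _ (proj1 (HQd (u s) Hs)) (Hu s)).
    unfold scal in H. simpl in H. unfold mult in H. simpl in H. rewrite Rmult_comm. exact H.
  - apply (is_derive_scal (fun s => slope D phi S (Q (u s)) * (2 * c * (s - x0))) x sg).
    assert (H := is_derive_comp (fun x => slope D phi S (Q x)) u x _ _ (proj2 (HQd (u x) Hx)) (Hu x)).
    unfold scal in H. simpl in H. unfold mult in H. simpl in H.
    assert (H2 : is_derive (fun s => 2 * c * (s - x0)) x (2 * c)) by (auto_derive; [auto|ring]).
    assert (H3 := is_derive_mult (fun s => slope D phi S (Q (u s))) (fun s => 2 * c * (s - x0)) x _ _ H H2 Rmult_comm).
    unfold plus, mult in H3. simpl in H3. unfold u in H3 at 1.
    eapply is_derive_ext_loc; [apply filter_forall; intros s; reflexivity|].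
    replace (- phi (Q (X + c * (x - x0) ^ 2)) / D * (2 * c * (x - x0)) ^ 2 +
      slope D phi S (Q (X + c * (x - x0) ^ 2)) * (2 * c)) with
      (2 * c * (x - x0) * (- phi (Q (u x)) / D) * (2 * c * (x - x0)) + slope D phi S (Q (u x)) * (2 * c))
      by (unfold u, Rdiv; ring).
    exact H3.
Qed.

(* [sg = 1] gives lower barriers and [sg = -1] upper ones. The translation parameter vanishes at
   [(y0, t1)] and grows to [h0] at the lateral and initial boundary of the window. *)
Lemma orbit_barrier (N : nat) (D a : bool -> R) (F : bool -> R -> R)
  (w : bool -> (tang N -> R) -> R -> R -> R) (k : bool) (phi Q : R -> R)
  (sg S q0 zeta h0 L R0 T t1 Ar c0 M : R) (y0 : tang N -> R) :
  (2 <= N)%nat -> (forall k, 0 < D k) -> (forall k, 0 < a k) -> coupled N D a F w ->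
  (sg = 1 \/ sg = -1) -> (forall s, continuous phi s) -> (forall s, q0 <= s < S -> 0 < phi s) ->
  is_orbit (D k) phi S q0 Q ->
  0 < zeta -> 0 < L -> 0 < R0 -> 0 < T <= t1 -> 0 < h0 ->
  (forall s, q0 <= s < S -> phi s <= M) ->
  (forall s, q0 <= s < S -> sg * (phi s - F k s) <= - c0) ->
  (h0 / T + D k * (2 * INR N * h0 / R0 ^ 2)) * slope (D k) phi S q0 + 4 * h0 ^ 2 * INR N / R0 ^ 2 * M < c0 ->
  sg * (Q zeta - a k * slope (D k) phi S (Q zeta)) < sg * Ar ->
  (forall y t, (forall j, Rabs (y j - y0 j) <= R0) -> t1 - T <= t <= t1 -> sg * Ar <= sg * w (negb k) y 0 t) ->
  (forall y z t h, (forall j, Rabs (y j - y0 j) <= R0) -> 0 <= z <= L -> t1 - T <= t <= t1 -> h0 <= h ->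
     sg * Q (z - sg * h + zeta) < sg * w k y z t) ->
  (forall y t h, (forall j, Rabs (y j - y0 j) <= R0) -> t1 - T <= t <= t1 -> 0 <= h ->
     sg * Q (L - sg * h + zeta) < sg * w k y L t) ->
  (sg = -1 \/ forall y z t, (forall j, Rabs (y j - y0 j) <= R0) -> 0 <= z <= L -> t1 - T <= t <= t1 -> q0 < w k y z t) ->
  forall z, 0 <= z <= L -> sg * Q (z + zeta) < sg * w k y0 z t1.
Proof.
  intros HN HD Ha Hw Hsg Hc Hp HQ Hzeta HL HR HT Hh0 HM Hstrict Hsize Hrob HAr Hlat Htop Hlow z1 Hz1.
  set (kR := h0 / R0 ^ 2). assert (HR2 : 0 < R0 ^ 2) by (apply pow_lt; lra).
  assert (HkR : 0 < kR) by (apply Rdiv_lt_0_compat; lra).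
  set (kT := h0 / T). assert (HkT : 0 < kT) by (apply Rdiv_lt_0_compat; lra).
  set (hh := fun (y : tang N -> R) t => kR * sqd y y0 + kT * (t1 - t)).
  assert (Hss : sg * sg = 1) by (destruct Hsg; subst; ring).
  assert (Hhh : forall y t, t <= t1 -> 0 <= hh y t).
  { intros y t Ht. unfold hh. pose proof (sqd_nonneg y y0).
    apply Rplus_le_le_0_compat; apply Rmult_le_pos; lra. }
  assert (HO := HQ). destruct HO as (HQ0 & HQ1 & _ & HQm & _ & HQc & HQd).
  set (b := fun (_ : bool) (y : tang N -> R) z t => sg * Q (z - sg * hh y t + zeta)).
  assert (Hlowx : forall y z t, (forall j, Rabs (y j - y0 j) <= R0) -> 0 <= z <= L -> t1 - T <= t <= t1 ->
     sg * w k y z t = b k y z t -> 0 < z - sg * hh y t + zeta).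
  { intros y z t B1 B2 B3 Hwb. specialize (Hhh y t ltac:(lra)). destruct Hlow as [E|Hlow].
    - rewrite E. lra.
    - apply Rnot_le_lt. intros Hn. unfold b in Hwb. rewrite HQ0 in Hwb by assumption.
      specialize (Hlow y z t B1 B2 B3). destruct Hsg as [->| ->]; [lra|]. lra. }
  replace (sg * Q (z1 + zeta)) with (b k y0 z1 t1).
  2:{ unfold b, hh. rewrite sqd_self. do 2 f_equal. ring. }
  apply (lower_barrier N D a (fun k s => sg * F k (sg * s)) (fun k y z t => sg * w k y z t) b
    (fun k' => Bool.eqb k' k) y0 R0 L (t1 - T) t1); try assumption; try lra.
  - now apply coupled_sign.
  - intros k' _ p. unfold b.
    apply (continuous_mult (fun _ => sg) (fun p : (tang N -> R) * R * R =>
       Q (snd (fst p) - sg * hh (fst (fst p)) (snd p) + zeta))); [apply continuous_const|].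
    apply (continuous_real_comp (fun p : (tang N -> R) * R * R => snd (fst p) - sg * hh (fst (fst p)) (snd p) + zeta) Q);
      [|apply HQc].
    unfold hh. cont_tac. apply continuous_sqd.
  - intros k' y z t Hk' [B1 [B2 B3]] Hbd. apply Bool.eqb_prop in Hk'. subst k'. unfold b.
    assert (Hhh' := Hhh y t ltac:(lra)).
    assert (HS1 : 0 <= kR * sqd y y0) by (apply Rmult_le_pos; [lra|apply sqd_nonneg]).
    assert (HS2 : 0 <= kT * (t1 - t)) by (apply Rmult_le_pos; lra).
    destruct Hbd as [->|[->|[j Hj]]].
    + apply Hlat; auto. unfold hh. replace (kT * (t1 - (t1 - T))) with h0 by (unfold kT; field; lra). lra.
    + apply Htop; auto.
    + apply Hlat; auto. unfold hh.
      assert (kR * R0 ^ 2 <= kR * sqd y y0).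
      { apply Rmult_le_compat_l; [lra|]. rewrite <- Hj. rewrite pow2_abs. apply sqd_ge_coord. }
      replace (kR * R0 ^ 2) with h0 in H by (unfold kR; field; lra). lra.
  - intros k' y z t Hk' [B1 [B2 B3]] Ht Hz Hwb. apply Bool.eqb_prop in Hk'. subst k'.
    assert (Hx := Hlowx y z t B1 B2 B3 Hwb).
    set (x := z - sg * hh y t + zeta) in *.
    destruct (HQ1 x ltac:(lra)) as [Hqx _].
    set (q := Q x) in *. set (P := slope (D k) phi S q).
    exists (kT * P).
    (* The factor [1 + 4 kR^2 sqd] is the squared gradient of the argument of [Q]; the last term
       comes from the Laplacian of the modulation. *)
    exists (sg * (- phi q / D k) * (1 + 4 * kR ^ 2 * sqd y y0) - 2 * kR * INR (N - 1) * P).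
    assert (HDk := HD k).
    split.
    + split.
      * unfold b, hh.
        assert (H := is_derive_comp Q (fun s => z - sg * (kR * sqd y y0 + kT * (t1 - s)) + zeta) t
          (slope (D k) phi S (Q x)) (sg * kT) (proj1 (HQd x Hx))).
        assert (H2 : is_derive (fun s => z - sg * (kR * sqd y y0 + kT * (t1 - s)) + zeta) t (sg * kT))
          by (auto_derive; [auto|ring]).
        specialize (H H2). apply (is_derive_scal _ _ sg) in H.
        unfold scal in H. simpl in H. unfold mult in H. simpl in H. fold q P in H.
        replace (kT * P) with (sg * (sg * kT * P)); [exact H|].
        transitivity (sg * sg * (kT * P)); [ring|]. rewrite Hss. ring.
      * exists (sg * (- phi q / D k)), (fun l => sg * (- phi q / D k) * (4 * kR ^ 2) * (coord y l - coord y0 l) ^ 2 + - (2 * kR * P)).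
        split; [|split].
        -- assert (H := HQd). exists (fun s => sg * slope (D k) phi S (Q (s - sg * hh y t + zeta))). split.
           ++ apply locally_R_iff. exists x. split; [assumption|]. intros s Hs.
              assert (Hs0 : 0 < s - sg * hh y t + zeta).
              { apply Rabs_def2 in Hs. unfold x in Hs. lra. }
              apply (is_derive_scal (fun s => Q (s - sg * hh y t + zeta)) s sg).
              assert (H3 := is_derive_comp Q (fun s => s - sg * hh y t + zeta) s _ 1 (proj1 (HQd _ Hs0))
                ltac:(auto_derive; [auto|ring])).
              unfold scal in H3. simpl in H3. unfold mult in H3. simpl in H3. rewrite Rmult_1_l in H3. exact H3.
           ++ apply (is_derive_scal (fun s => slope (D k) phi S (Q (s - sg * hh y t + zeta))) z sg).
              assert (H3 := is_derive_comp (fun x => slope (D k) phi S (Q x)) (fun s => s - sg * hh y t + zeta) z _ 1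
                (proj2 (HQd x Hx)) ltac:(auto_derive; [auto|ring])).
              unfold scal in H3. simpl in H3. unfold mult in H3. simpl in H3. rewrite Rmult_1_l in H3. exact H3.
        -- intros l Hl. set (Sl := sqd y y0 - (coord y l - coord y0 l) ^ 2).
           set (X := z - sg * (kR * Sl + kT * (t1 - t)) + zeta).
           assert (EX : X + (- (sg * kR)) * (coord y l - coord y0 l) ^ 2 = x) by (unfold X, x, Sl, hh; ring).
           assert (H := has_deriv2_orbit_parab (D k) phi S q0 Q sg X (- (sg * kR)) (coord y0 l) (coord y l) HQ
             ltac:(rewrite EX; exact Hx)).
           rewrite EX in H. fold q in H. fold P in H.
           replace (sg * (- phi q / D k) * (4 * kR ^ 2) * (coord y l - coord y0 l) ^ 2 + - (2 * kR * P)) with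
             (sg * (- phi q / D k * (2 * - (sg * kR) * (coord y l - coord y0 l)) ^ 2 + P * (2 * - (sg * kR)))).
           2:{ transitivity (sg * (- phi q / D k) * (4 * kR ^ 2) * (coord y l - coord y0 l) ^ 2 * (sg * sg) - (sg * sg) * (2 * kR * P)); [ring|].
               rewrite Hss. ring. }
           eapply has_deriv2_ext; [|exact H]. intros s. cbv beta. unfold b, hh.
           rewrite sqd_upd by assumption. do 2 f_equal. unfold X, Sl. ring.
        -- rewrite sum_plus, sum_cte.
           rewrite (sum_eq _ (fun l => (coord y l - coord y0 l) ^ 2 * (sg * (- phi q / D k) * (4 * kR ^ 2)))) by (intros; ring).
           rewrite <- (scal_sum (fun l => (coord y l - coord y0 l) ^ 2)). fold (sqd y y0).
           replace (Datatypes.S (N - 2)) with (N - 1)%nat by lia. ring.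
    + unfold b. fold x. fold q.
      replace (sg * (sg * q)) with q by (rewrite <- Rmult_assoc, Hss; ring).
      replace (D k * (sg * (- phi q / D k) * (1 + 4 * kR ^ 2 * sqd y y0) - 2 * kR * INR (N - 1) * P)) with
        (- (sg * phi q) - sg * phi q * (4 * kR ^ 2 * sqd y y0) - D k * (2 * INR (N - 1) * kR * P)) by (field; lra).
      specialize (Hstrict q Hqx). specialize (HM q Hqx). assert (Hpos := Hp). specialize (Hp q Hqx).
      assert (HP0 : 0 <= P) by apply slope_nonneg.
      assert (HPq : P <= slope (D k) phi S q0).
      { unfold P. destruct (proj1 Hqx) as [H|H]; [|rewrite <- H; lra]. left. apply slope_decreasing; auto; [lra|].
        intros s Hs. apply Hpos. lra. }
      assert (HNN : 0 <= INR (N - 1) <= INR N) by (split; [apply pos_INR|apply le_INR; lia]).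
      assert (E1 : sqd y y0 <= INR N * R0 ^ 2).
      { eapply Rle_trans; [apply sqd_le_box; eassumption|]. apply Rmult_le_compat_r; lra. }
      assert (E2 : 4 * kR ^ 2 * sqd y y0 <= 4 * h0 ^ 2 * INR N / R0 ^ 2).
      { apply Rle_trans with (4 * kR ^ 2 * (INR N * R0 ^ 2)).
        - apply Rmult_le_compat_l; [|exact E1]. assert (0 < kR ^ 2) by now apply pow_lt. lra.
        - unfold kR. apply Req_le. field. lra. }
      assert (E0 : 0 <= 4 * kR ^ 2 * sqd y y0).
      { apply Rmult_le_pos; [|apply sqd_nonneg]. assert (0 < kR ^ 2) by now apply pow_lt. lra. }
      assert (E3 : - (sg * phi q * (4 * kR ^ 2 * sqd y y0)) >= - (4 * h0 ^ 2 * INR N / R0 ^ 2 * M)).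
      { assert (phi q * (4 * kR ^ 2 * sqd y y0) <= M * (4 * h0 ^ 2 * INR N / R0 ^ 2)).
        { apply Rmult_le_compat; lra. }
        assert (0 <= phi q * (4 * kR ^ 2 * sqd y y0)) by (apply Rmult_le_pos; lra).
        destruct Hsg as [->| ->]; lra. }
      assert (E4 : D k * (2 * INR (N - 1) * kR * P) <= D k * (2 * INR N * h0 / R0 ^ 2) * slope (D k) phi S q0).
      { rewrite (Rmult_assoc (D k) (2 * INR N * h0 / R0 ^ 2)). apply Rmult_le_compat_l; [lra|].
        replace (2 * INR N * h0 / R0 ^ 2) with (2 * INR N * kR) by (unfold kR; field; lra).
        apply Rmult_le_compat; [apply Rmult_le_pos; lra|lra|apply Rmult_le_compat_r; lra|lra]. }
      assert (E5 : kT * P <= h0 / T * slope (D k) phi S q0) by (fold kT; apply Rmult_le_compat_l; [apply Rlt_le, HkT|exact HPq]).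
      lra.
  - intros k' y t Hk' [B1 [B2 B3]] Ht Hwb _. apply Bool.eqb_prop in Hk'. subst k'.
    assert (Hx := Hlowx y 0 t B1 ltac:(lra) B3 Hwb).
    set (x := 0 - sg * hh y t + zeta) in *.
    destruct (HQ1 x ltac:(lra)) as [Hqx _].
    exists (sg * slope (D k) phi S (Q x)). split.
    + apply is_derive_right. unfold b.
      apply (is_derive_scal (fun s => Q (s - sg * hh y t + zeta)) 0 sg).
      assert (H3 := is_derive_comp Q (fun s => s - sg * hh y t + zeta) 0 _ 1 (proj1 (HQd x Hx))
        ltac:(auto_derive; [auto|ring])).
      unfold scal in H3. simpl in H3. unfold mult in H3. simpl in H3. rewrite Rmult_1_l in H3. exact H3.
    + rewrite Hwb. unfold b. fold x.
      specialize (HAr y t B1 B3). assert (Hhh' := Hhh y t ltac:(lra)). specialize (Ha k).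
      destruct (HQ1 zeta ltac:(lra)) as [Hqz _].
      (* The exchange value [q - a k * slope q] increases with the level. Modulation lowers [sg * Q]
         at the interface, so the strict exchange inequality at [zeta] extends to all modulated
         translates. *)
      assert (Hmono : forall p q, q0 <= p -> p <= q -> q < S ->
        p - a k * slope (D k) phi S p <= q - a k * slope (D k) phi S q).
      { intros p q Hp0 [Hpq| ->] HqS; [|lra].
        assert (slope (D k) phi S q < slope (D k) phi S p).
        { apply slope_decreasing; auto; [lra|]. intros s Hs. apply Hp. lra. }
        nra. }
      assert (Hfin : sg * (Q x - a k * slope (D k) phi S (Q x)) <= sg * (Q zeta - a k * slope (D k) phi S (Q zeta))).
      { destruct Hsg as [E|E]; subst sg.
        - assert (Q x <= Q zeta) by (apply HQm; unfold x; lra).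
          specialize (Hmono (Q x) (Q zeta) ltac:(lra) H ltac:(lra)). lra.
        - assert (Q zeta <= Q x) by (apply HQm; unfold x; lra).
          specialize (Hmono (Q zeta) (Q x) ltac:(lra) H ltac:(lra)). lra. }
      lra.
  - apply Bool.eqb_reflx.
  - split; [|split]; [|exact Hz1|lra].
    intros j. replace (y0 j - y0 j) with 0 by ring. rewrite Rabs_R0. lra.
Qed.

(** * Eventual bounds *)

(* Away from the interface a bump grows to a fixed amplitude whatever its initial size, so the lower
   bound can be taken independent of the depth [L]. *)
Lemma ev_uniform_depth (N : nat) (D a l Sk : bool -> R) (F : bool -> R -> R)
  (w : bool -> (tang N -> R) -> R -> R -> R) (Ev : ((tang N -> R) -> R -> Prop) -> Prop) :
  (2 <= N)%nat -> (forall k, 0 < D k) -> (forall k, 0 < a k) ->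
  (forall k, KPP_f (F k) (l k) (Sk k)) -> nonneg_solution N D a F w -> window_filter Ev ->
  (forall L, 0 < L -> exists dl, 0 < dl /\ Ev (fun y t => forall k z, 0 <= z <= L -> dl <= w k y z t)) ->
  exists dl, 0 < dl /\ forall L, 0 < L -> Ev (fun y t => forall k z, 0 <= z <= L -> dl <= w k y z t).
Proof.
  intros HN HD Ha HF Hw (Hmono & Hand & _ & Htime & Hwin) Hlow.
  destruct (small_amplitude_nonneg F l Sk HF) as [s0 [Hs0 HF0]].
  assert (Hl : forall k, 0 < l k) by (intros k; apply (KPP_f_rate_pos _ _ _ (HF k))).
  set (X := fun k => ((6 * INR N + 24) * D k) ^ 2 / (96 * D k * (l k / 8))).
  assert (Hp : forall k, 0 < 96 * D k * (l k / 8)).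
  { intros k. specialize (HD k). specialize (Hl k). apply Rmult_lt_0_compat; lra. }
  assert (HX : forall k, 0 <= X k) by (intros k; apply Rdiv_le_0_compat; [apply pow2_ge_0|apply Hp]).
  destruct (large_square (X true + X false)) as [R0 [HR0 HRR]].
  { pose proof (HX true). pose proof (HX false). lra. }
  specialize (HRR R0 (Rle_refl _)).
  assert (Hmv : forall k, exists kap, 0 < kap /\
    forall w c y0 zeta t0 A s, nonneg_solution N D a F w -> R0 <= zeta -> Rabs c <= 0 -> 0 <= t0 -> 0 <= s ->
    0 < A -> A * exp (Rabs (l k / 8) * s) <= s0 -> ball_ge w k y0 zeta R0 t0 A ->
    ball_ge w k (shift 0 y0 (c * s)) zeta (R0 / 2) (t0 + s) (kap * (A * exp (l k / 8 * s)))).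
  { intros k. specialize (Hl k). assert (HDk := HD k).
    apply (move N 0 D a F s0 (l k / 2) 0 (l k / 8) (l k / 8) R0 k); try assumption; try lra; try lia.
    - intros s Hs. now apply HF0.
    - assert (H : X k < R0 ^ 2) by (pose proof (HX true); pose proof (HX false); destruct k; lra).
      apply Rmult_lt_compat_r with (r := 96 * D k * (l k / 8)) in H; [|apply Hp].
      unfold X in H. replace (((6 * INR N + 24) * D k) ^ 2 / (96 * D k * (l k / 8)) * (96 * D k * (l k / 8))) with
        (((6 * INR N + 24) * D k) ^ 2) in H by (field; lra). lra. }
  apply choice in Hmv. destruct Hmv as [kap Hkap].
  (* The constant is fixed before [L]: [d1] serves the heights up to [R0], and [kap k * s0] the
     larger ones, where a bump has room to grow to amplitude [s0] during a time that may depend on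
     [L]. *)
  destruct (Hlow R0 HR0) as [d1 [Hd1 He1]].
  exists (Rmin d1 (Rmin (kap true * s0) (kap false * s0))).
  split.
  { repeat apply Rmin_glb_lt; try assumption; apply Rmult_lt_0_compat; try assumption; apply Hkap. }
  intros L HL. destruct (Hlow (L + R0) ltac:(lra)) as [d2 [Hd2 He2]].
  set (A := Rmin d2 s0). assert (HA : 0 < A <= s0) by (split; [now apply Rmin_glb_lt|apply Rmin_r]).
  assert (HsA : 1 <= s0 / A).
  { apply Rmult_le_reg_r with A; [lra|]. unfold Rdiv. rewrite Rmult_assoc, Rinv_l; lra. }
  set (s := fun k => ln (s0 / A) / (l k / 8)).
  assert (Hs : forall k, 0 <= s k).
  { intros k. specialize (Hl k). unfold s. apply Rdiv_le_0_compat; [|lra]. rewrite <- ln_1. destruct HsA as [H|H].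
    - apply Rlt_le, ln_increasing; lra.
    - rewrite <- H. lra. }
  assert (HAe : forall k, A * exp (l k / 8 * s k) = s0).
  { intros k. specialize (Hl k). unfold s. replace (l k / 8 * (ln (s0 / A) / (l k / 8))) with (ln (s0 / A)) by (field; lra).
    rewrite exp_ln by lra. field. lra. }
  eapply Hmono; [|apply (Hand _ _ He1 (Hand _ _ (Hwin _ R0 (s true + s false) He2) (Htime (s true + s false))))].
  intros y t [H1 [H2 H3]] k z Hz. simpl in H2.
  destruct (Rle_lt_dec z R0) as [Hz0|Hz0].
  { apply Rle_trans with d1; [apply Rmin_l|]. apply H1. lra. }
  destruct (Hkap k) as [Hk1 Hk2].
  assert (Hsk : s k <= s true + s false) by (pose proof (Hs true); pose proof (Hs false); destruct k; lra).
  assert (Hb : ball_ge w k y z R0 (t - s k) A).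
  { intros y' z' Hz' Hd. apply Rle_trans with d2; [apply Rmin_l|].
    pose proof (sqd_nonneg y' y). pose proof (pow2_ge_0 (z' - z)).
    apply H2.
    - intros j. left. apply sqd_lt_coord; lra.
    - specialize (Hs k). lra.
    - split; [assumption|]. apply Rnot_lt_le. intros Hn. assert (R0 ^ 2 <= (z' - z) ^ 2); [|lra].
      apply pow_incr. lra. }
  assert (Hlk := Hl k).
  specialize (Hk2 w 0 y z (t - s k) A (s k) Hw ltac:(lra) ltac:(rewrite Rabs_R0; lra) ltac:(lra) (Hs k) (proj1 HA)
    ltac:(rewrite Rabs_pos_eq by lra; rewrite HAe; lra) Hb).
  rewrite HAe, Rmult_0_l, shift_0 in Hk2. replace (t - s k + s k) with t in Hk2 by ring.
  apply Rle_trans with (kap k * s0).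
  - eapply Rle_trans; [apply Rmin_r|]. destruct k; [apply Rmin_l|apply Rmin_r].
  - apply Hk2; [lra|]. rewrite sqd_self, Rminus_diag. assert (0 < (R0 / 2) ^ 2) by (apply pow_lt; lra). lra.
Qed.

(** Both the time term and the diffusion term of the paraboloid are given less than [c0], a third of
    it each, by the choice of [T] and [R0]. With one active species the vertex must be deeper than
    [L1 = R0], so that the paraboloid starts below [m] at the interface; with both species any
    positive height will do. *)
Lemma paraboloid_ev (N : nat) (D a : bool -> R) (F : bool -> R -> R)
  (w : bool -> (tang N -> R) -> R -> R -> R) (Ev : ((tang N -> R) -> R -> Prop) -> Prop)
  (act : bool -> bool) (s m c0 : R) :
  (2 <= N)%nat -> (forall k, 0 < D k) -> (forall k, 0 < a k) ->
  coupled N D a F w -> window_filter Ev -> m < s -> 0 < c0 ->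
  (forall L, 0 < L -> Ev (fun y t => forall k z, act k = true -> 0 <= z <= L -> m < w k y z t)) ->
  (forall k x, act k = true -> m <= x <= s -> c0 <= F k x) ->
  exists L1, 0 < L1 /\ forall L, 0 < L -> Ev (fun y t => forall k z, act k = true ->
    (0 < z /\ forall k, act k = true) \/ L1 <= z -> z <= L -> s < w k y z t).
Proof.
  intros HN HD Ha Hw (Hmono & Hand & _ & Htime & Hwin) Hms Hc0 Hlow HF.
  set (K := s - m). assert (HK : 0 < K) by (unfold K; lra).
  assert (HNR : 0 < INR N) by (apply lt_0_INR; lia).
  set (Dm := D true + D false).
  assert (HDm : 0 < Dm) by (unfold Dm; pose proof (HD true); pose proof (HD false); lra).
  destruct (large_square (6 * INR N * Dm * K / c0)) as [R0 [HR0 HRR]].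
  { apply Rdiv_le_0_compat; [|assumption]. apply Rmult_le_pos; [|lra]. apply Rmult_le_pos; lra. }
  specialize (HRR R0 (Rle_refl _)). assert (HR2 : 0 < R0 ^ 2) by now apply pow_lt.
  set (T := 3 * K / c0). assert (HT : 0 < T) by (apply Rdiv_lt_0_compat; lra).
  exists R0. split; [assumption|]. intros L HL.
  eapply Hmono; [|apply (Hand _ _ (Hwin _ R0 T (Hlow (L + R0) ltac:(lra))) (Htime T))].
  intros y t [H1 H2] k z Hk Hz HzL. simpl in H1.
  assert (Hz0 : 0 < z) by (destruct Hz as [[Hz _]|Hz]; lra).
  apply (paraboloid_lower N D a F w act y z R0 T t s m c0 K K); try assumption; try lra.
  - unfold K. lra.
  - intros k' y' z' t' Hk' Hy' Hz' Ht'. apply H1; auto. lra.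
  - intros k' y' z' Hk' Hy' Hz'. replace (s - K) with m by (unfold K; ring). apply H1; auto; lra.
  - intros k' Hk'. replace (K / T) with (c0 / 3) by (unfold T; field; lra).
    assert (HDk : D k' <= Dm) by (unfold Dm; pose proof (HD true); pose proof (HD false); destruct k'; lra).
    assert (2 * INR N * (D k' * (K / R0 ^ 2)) < c0 / 3); [|lra].
    apply Rle_lt_trans with (2 * INR N * (Dm * (K / R0 ^ 2))).
    + apply Rmult_le_compat_l; [lra|]. apply Rmult_le_compat_r; [apply Rdiv_le_0_compat; lra|assumption].
    + apply Rmult_lt_reg_r with (3 * R0 ^ 2 / c0); [apply Rdiv_lt_0_compat; lra|].
      replace (2 * INR N * (Dm * (K / R0 ^ 2)) * (3 * R0 ^ 2 / c0)) with (6 * INR N * Dm * K / c0) by (field; lra).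
      replace (c0 / 3 * (3 * R0 ^ 2 / c0)) with (R0 ^ 2) by (field; lra). assumption.
  - intros k' Hk'. destruct Hz as [[_ Hz]|Hz]; [left; apply Hz|right].
    apply Rle_trans with (K * R0 ^ 2 / R0 ^ 2); [unfold K; apply Req_le; field; lra|].
    unfold Rdiv. apply Rmult_le_compat_r; [apply Rlt_le, Rinv_0_lt_compat; lra|].
    apply Rmult_le_compat_l; [lra|]. apply pow_incr. lra.
Qed.

(** Paraboloids need a vertex at positive height; their bounds reach the interface by continuity
    only. *)
Lemma ge_at_boundary {N : nat} (w : (tang N -> R) -> R -> R -> R) (y : tang N -> R) (t s : R) :
  cont_on3 (fun z => 0 <= z) w -> 0 <= t -> (forall z, 0 < z <= 1 -> s <= w y z t) -> s <= w y 0 t.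
Proof.
  intros Hc Ht H. apply le_epsilon. intros eps He.
  destruct (Hc y 0 t (Rle_refl 0) Ht eps He) as [dl [Hd Hdl]].
  set (z := Rmin 1 (dl / 2)). assert (Hz : 0 < z <= 1) by (split; [apply Rmin_glb_lt; lra|apply Rmin_l]).
  assert (Hz2 : z <= dl / 2) by apply Rmin_r.
  specialize (H z Hz). specialize (Hdl y z t ltac:(lra) Ht).
  assert (Hd1 : forall j, Rabs (y j - y j) < dl) by (intros j; replace (y j - y j) with 0 by ring; now rewrite Rabs_R0).
  specialize (Hdl Hd1 ltac:(rewrite Rabs_pos_eq; lra) ltac:(rewrite Rminus_diag, Rabs_R0; lra)).
  apply Rabs_def2 in Hdl. lra.
Qed.

(** [lo] is the lower limit of [u] along [Ev], the supremum of the eventual lower bounds; properness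
    of the filter keeps these below [M]. *)
Lemma ev_lower_limit {N : nat} (Ev : ((tang N -> R) -> R -> Prop) -> Prop) (u : (tang N -> R) -> R -> R) (m M : R) :
  window_filter Ev -> Ev (fun y t => m <= u y t) -> Ev (fun y t => u y t <= M) ->
  exists lo, m <= lo <= M /\ (forall eps, 0 < eps -> Ev (fun y t => lo - eps <= u y t)) /\
    (forall s, Ev (fun y t => s <= u y t) -> s <= lo).
Proof.
  intros (Hmono & Hand & Hprop & _) Hm HM.
  assert (Hb : forall s, Ev (fun y t => s <= u y t) -> s <= M).
  { intros s Hs. apply Rnot_lt_le. intros Hn. apply Hprop.
    eapply Hmono; [|apply (Hand _ _ Hs HM)]. intros y t [H1 H2]. lra. }
  destruct (completeness (fun s => Ev (fun y t => s <= u y t))) as [lo [Hlo1 Hlo2]].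
  - exists M. intros s Hs. now apply Hb.
  - now exists m.
  - exists lo. split; [split; [now apply Hlo1|apply Hlo2; intros s Hs; now apply Hb]|]. split.
    + intros eps He. apply NNPP. intros Hn. assert (lo <= lo - eps); [|lra].
      apply Hlo2. intros s Hs. apply Rnot_lt_le. intros Hlt. apply Hn.
      eapply Hmono; [|exact Hs]. intros y t H. lra.
    + intros s Hs. now apply Hlo1.
Qed.

(** * Half-line problems with prescribed boundary exchange *)

Definition orbit_data (D : R) (f : R -> R) (m q0 S : R) (Q : R -> R) : Prop :=
  (forall s, continuous f s) /\ m < q0 < S /\ (forall s, m < s < S -> 0 < f s) /\ is_orbit D f S q0 Q.

(** The amplitude [h0] of the modulation and the gap [c0] are given first; a long and wide enough
    window then makes the modulation as slow as [orbit_barrier] requires. *)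
Lemma modulation_size (N : nat) (Dk h0 p0 c0 M : R) :
  (2 <= N)%nat -> 0 < Dk -> 0 < h0 -> 0 <= p0 -> 0 < c0 -> 0 <= M ->
  exists T R0, 0 < T /\ 0 < R0 /\
    (h0 / T + Dk * (2 * INR N * h0 / R0 ^ 2)) * p0 + 4 * h0 ^ 2 * INR N / R0 ^ 2 * M < c0.
Proof.
  intros HN HD Hh Hp Hc HM.
  assert (HNR : 0 < INR N) by (apply lt_0_INR; lia).
  set (X := 2 * Dk * INR N * h0 * p0 + 4 * h0 ^ 2 * INR N * M).
  assert (HX : 0 <= X).
  { unfold X. assert (0 <= 2 * Dk * INR N * h0 * p0) by (repeat apply Rmult_le_pos; lra).
    assert (0 < h0 ^ 2) by now apply pow_lt.
    assert (0 <= 4 * h0 ^ 2 * INR N * M) by (apply Rmult_le_pos; [apply Rmult_le_pos|]; lra). lra. }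
  destruct (large_square (3 * X / c0)) as [R0 [HR0 HRR]]; [apply Rdiv_le_0_compat; lra|].
  specialize (HRR R0 (Rle_refl _)). assert (HR2 : 0 < R0 ^ 2) by now apply pow_lt.
  set (T := 3 * h0 * (p0 + 1) / c0).
  assert (HT : 0 < T) by (apply Rdiv_lt_0_compat; [repeat apply Rmult_lt_0_compat|]; lra).
  exists T, R0. split; [assumption|]. split; [assumption|].
  assert (E1 : h0 / T * p0 <= c0 / 3).
  { replace (h0 / T * p0) with (c0 / 3 * (p0 / (p0 + 1))) by (unfold T; field; lra).
    rewrite <- (Rmult_1_r (c0 / 3)) at 2. apply Rmult_le_compat_l; [lra|].
    apply Rmult_le_reg_r with (p0 + 1); [lra|]. unfold Rdiv. rewrite Rmult_assoc, Rinv_l; lra. }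
  assert (E2 : X / R0 ^ 2 < c0 / 3).
  { apply Rmult_lt_reg_r with (3 * R0 ^ 2 / c0); [apply Rdiv_lt_0_compat; lra|].
    replace (X / R0 ^ 2 * (3 * R0 ^ 2 / c0)) with (3 * X / c0) by (field; lra).
    replace (c0 / 3 * (3 * R0 ^ 2 / c0)) with (R0 ^ 2) by (field; lra). assumption. }
  replace ((h0 / T + Dk * (2 * INR N * h0 / R0 ^ 2)) * p0 + 4 * h0 ^ 2 * INR N / R0 ^ 2 * M) with
    (h0 / T * p0 + X / R0 ^ 2) by (unfold X; field; lra). lra.
Qed.

Lemma travel_start (D : R) (f : R -> R) (S q0 : R) : travel D f S q0 q0 = 0.
Proof. exact (RInt_point q0 (fun s => / slope D f S s)). Qed.

Lemma orbit_range_interior (D : R) (f : R -> R) (S q0 : R) (Q : R -> R) (x : R) :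
  is_orbit D f S q0 Q -> q0 < S -> 0 < x -> q0 < Q x < S.
Proof.
  intros (HQ0 & HQ1 & HG & _) HqS Hx. destruct (HQ1 x ltac:(lra)) as [[H1 H2] H3]. split; [|assumption].
  destruct H1 as [H1|H1]; [assumption|]. exfalso. rewrite <- H1 in H3.
  rewrite travel_start in H3. lra.
Qed.

Lemma orbit_lt_top (D : R) (f : R -> R) (S q0 : R) (Q : R -> R) (x : R) :
  is_orbit D f S q0 Q -> q0 < S -> Q x < S.
Proof.
  intros (HQ0 & HQ1 & _) HqS. destruct (Rle_lt_dec x 0); [rewrite HQ0; assumption|apply HQ1; lra].
Qed.

Lemma travel_pos (D : R) (f : R -> R) (S q0 q : R) (Q : R -> R) :
  is_orbit D f S q0 Q -> q0 < q < S -> 0 < travel D f S q0 q /\ Q (travel D f S q0 q) = q.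
Proof.
  intros HQ Hq. assert (HO := HQ). destruct HO as (HQ0 & _ & HG & _).
  destruct (HG q ltac:(lra)) as [H1 H2]. split; [|assumption].
  destruct H1 as [H1|H1]; [assumption|]. exfalso. rewrite <- H1, HQ0 in H2; lra.
Qed.

Lemma bounded_phi (phi : R -> R) (q0 S Lam : R) : q0 < S -> 0 < Lam ->
  (forall s, q0 <= s <= S -> phi s <= Lam * (S - s)) -> forall s, q0 <= s < S -> phi s <= Lam * (S - q0).
Proof.
  intros HS HL H s Hs. eapply Rle_trans; [apply H; lra|]. apply Rmult_le_compat_l; lra.
Qed.

(** The translate of [Q] solves the stationary equation exactly and leaves no strictness. It is
    replaced by an orbit [Qk] of a slightly smaller nonlinearity saturating at [S' < S], started so
    as to have the same trace [B]. At the top of the box the paraboloid bound [S' < w] controls it,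
    and on the other sides the modulation pushes it down to [q0], below [w]. The slopes of the two
    orbits are close, so little of the exchange gap and of the profile is lost. *)
Lemma robin_lower (N : nat) (D a : bool -> R) (F : bool -> R -> R)
  (w : bool -> (tang N -> R) -> R -> R -> R) (Ev : ((tang N -> R) -> R -> Prop) -> Prop)
  (k : bool) (m q0 S : R) (Q : R -> R) (Ar zeta : R) :
  (2 <= N)%nat -> (forall k, 0 < D k) -> (forall k, 0 < a k) ->
  coupled N D a F w -> window_filter Ev -> orbit_data (D k) (F k) m q0 S Q ->
  (forall L, 0 < L -> Ev (fun y t => forall z, 0 <= z <= L -> q0 < w k y z t)) ->
  Ev (fun y t => Ar <= w (negb k) y 0 t) ->
  0 < zeta -> Q zeta - a k * slope (D k) (F k) S (Q zeta) < Ar ->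
  forall eps L, 0 < eps -> 0 < L -> Ev (fun y t => forall z, 0 <= z <= L -> Q (z + zeta) - eps <= w k y z t).
Proof.
  intros HN HD Ha Hw Hwf (Hc & Hq0 & Hp & HQ) Hlow HAr Hzeta HB eps L Heps HL.
  assert (HDk := HD k). assert (Hak := Ha k).
  assert (HO := HQ). destruct HO as (HQ0 & HQ1 & HG & HQm & _).
  set (B := Q zeta) in *. set (p := slope (D k) (F k) S) in *.
  assert (HBr : q0 < B < S) by (apply (orbit_range_interior (D k) (F k) S q0 Q); auto; lra).
  assert (HtB : travel (D k) (F k) S q0 B = zeta) by (apply HQ1; lra).
  assert (HpB : 0 < p B) by (apply slope_pos; auto; [lra|intros s Hs; apply Hp; lra]).
  assert (Hp0 : 0 < p q0) by (apply slope_pos; auto; [lra|intros s Hs; apply Hp; lra]).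
  set (gap := Ar - (B - a k * p B)). assert (Hgap : 0 < gap) by (unfold gap; lra).
  (* The first term keeps the exchange inequality strict after the change of slope at [B]; the
     second bounds by [eps] the change of profile on [[0, L]]. *)
  set (ep := Rmin (gap / (a k * p B)) (eps / (p q0 * (L + zeta)))).
  assert (Hap : 0 < a k * p B) by (apply Rmult_lt_0_compat; lra).
  assert (HpL : 0 < p q0 * (L + zeta)) by (apply Rmult_lt_0_compat; lra).
  assert (Hep : 0 < ep) by (unfold ep; apply Rmin_glb_lt; apply Rdiv_lt_0_compat; lra).
  assert (Hep1 : ep * (a k * p B) <= gap).
  { apply Rle_trans with (gap / (a k * p B) * (a k * p B)); [|apply Req_le; field; lra].
    apply Rmult_le_compat_r; [lra|apply Rmin_l]. }
  assert (Hep2 : ep * (p q0 * (L + zeta)) <= eps).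
  { apply Rle_trans with (eps / (p q0 * (L + zeta)) * (p q0 * (L + zeta))); [|apply Req_le; field; lra].
    apply Rmult_le_compat_r; [lra|apply Rmin_r]. }
  set (q1 := Q (L + zeta)).
  assert (Hq1 : B <= q1 < S).
  { split; [apply HQm; lra|]. apply (orbit_lt_top (D k) (F k) S q0 Q); auto; lra. }
  destruct (lower_perturbation (D k) (F k) m q0 q1 S ep 1 HDk Hc ltac:(lra) ltac:(lra) Hp Hep ltac:(lra))
    as (phi & S' & c0 & Lam & HS' & Hq1S & Hphc & Hphp & HLam & Hphl & Hc0 & Hphs & Hsl1 & Hsl2).
  destruct (orbit_exists (D k) phi m q0 S' Lam HDk Hphc ltac:(lra) HLam Hphp Hphl) as [Qk HQk].
  assert (HOk := HQk). destruct HOk as (HQk0 & HQk1 & HGk & HQkm & HQkl & _).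
  destruct (travel_pos (D k) phi S' q0 B Qk HQk ltac:(lra)) as [Hzk HQkB].
  set (zk := travel (D k) phi S' q0 B) in *.
  destruct (positive_min (F k) q0 S' ltac:(lra) Hc) as [c1 [Hc1 HFc1]].
  { intros s Hs. apply Hp. lra. }
  destruct (paraboloid_ev N D a F w Ev (fun k' => Bool.eqb k' k) S' q0 c1 HN HD Ha Hw Hwf ltac:(lra) Hc1) as [L1 [HL1 Hdeep]].
  { intros L' HL'. destruct Hwf as (Hmono & _). eapply Hmono; [|apply (Hlow L' HL')].
    intros y t H k' z Hk' Hz. apply Bool.eqb_prop in Hk'. subst k'. now apply H. }
  { intros k' x Hk' Hx. apply Bool.eqb_prop in Hk'. subst k'. now apply HFc1. }
  set (Lb := Rmax L L1). assert (HLb1 : L <= Lb) by apply Rmax_l. assert (HLb2 : L1 <= Lb) by apply Rmax_r.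
  (* A shift of at least [h0] makes the argument of [Qk] non-positive at all heights up to [Lb], so
     the barrier takes the value [q0]. *)
  set (h0 := zk + Lb).
  destruct (modulation_size N (D k) h0 (slope (D k) phi S' q0) c0 (Lam * (S' - q0)) HN HDk ltac:(unfold h0; lra)
    (slope_nonneg _ _ _ _) Hc0 ltac:(apply Rmult_le_pos; lra)) as (T & R0 & HT & HR0 & Hsize).
  destruct Hwf as (Hmono & Hand & _ & Htime & Hwin).
  eapply Hmono; [|apply (Hand _ _ (Hwin _ R0 T (Hand _ _ (Hlow Lb ltac:(lra)) (Hand _ _ (Hdeep Lb ltac:(lra)) HAr))) (Htime T))].
  intros y t [H1 H2] z Hz. simpl in H1.
  assert (Hbar : 1 * Qk (z + zk) < 1 * w k y z t).
  { apply (orbit_barrier N D a F w k phi Qk 1 S' q0 zk h0 Lb R0 T t Ar c0 (Lam * (S' - q0)) y); auto; try lra.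
    - intros s Hs. apply Hphp. lra.
    - unfold h0. lra.
    - apply (bounded_phi phi q0 S' Lam); auto; lra.
    - intros s Hs. specialize (Hphs s ltac:(lra)). lra.
    - rewrite HQkB. specialize (Hsl1 B ltac:(lra)). fold p in Hsl1.
      set (pk := slope (D k) phi S' B) in *.
      assert (p B <= pk + ep * pk) by lra.
      assert (Hsl2B := Hsl2 B ltac:(lra)). fold p pk in Hsl2B.
      assert (0 <= pk) by apply slope_nonneg.
      assert (Hsp : pk < p B \/ pk = p B) by lra.
      assert (a k * p B - a k * pk <= a k * (ep * pk)) by nra.
      assert (ep * pk <= ep * p B) by (apply Rmult_le_compat_l; lra).
      assert (a k * (ep * pk) <= gap).
      { apply Rle_trans with (a k * (ep * p B)); [apply Rmult_le_compat_l; lra|]. lra. }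
      unfold gap in *. destruct Hsp as [Hsp|Hsp].
      + assert (a k * (ep * pk) < a k * (ep * p B)) by (apply Rmult_lt_compat_l; [lra|]; apply Rmult_lt_compat_l; lra). lra.
      + rewrite Hsp. lra.
    - intros y' t' Hy' Ht'. destruct (H1 y' t' Hy' Ht') as [_ [_ H3]]. lra.
    - intros y' z' t' h Hy' Hz' Ht' Hh. destruct (H1 y' t' Hy' Ht') as [H3 _].
      rewrite HQk0 by (unfold h0 in Hh; lra). specialize (H3 z' Hz'). lra.
    - intros y' t' h Hy' Ht' Hh. destruct (H1 y' t' Hy' Ht') as [_ [H3 _]].
      specialize (H3 k Lb (Bool.eqb_reflx k) (or_intror HLb2) (Rle_refl _)).
      assert (Qk (Lb - 1 * h + zk) < S') by (apply (orbit_lt_top (D k) phi S' q0 Qk); auto; lra). lra.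
    - right. intros y' z' t' Hy' Hz' Ht'. destruct (H1 y' t' Hy' Ht') as [H3 _]. now apply H3. }
  assert (Hcmp : Q (z + zeta) <= Qk ((1 + ep) * (z + zeta))).
  { assert (Q (z + zeta) <= q1) by (apply HQm; lra).
    apply (orbit_compare (D k) (F k) phi S S' q0 (1 + ep) (z + zeta) Q Qk); auto; try lra.
    - intros s Hs. apply Hp. lra.
    - intros s Hs. apply Hphp. lra.
    - intros s Hs. apply Hsl1. lra. }
  (* Smaller slopes mean a longer climb to the common trace [B]. *)
  assert (Hzz : zeta <= zk).
  { rewrite <- HtB. unfold zk.
    assert (H := travel_le_scaled (D k) (F k) phi S S' q0 B 1 HDk ltac:(lra) Hc Hphc ltac:(lra) ltac:(lra) ltac:(lra)
      ltac:(intros s Hs; apply Hp; lra) ltac:(intros s Hs; apply Hphp; lra)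
      ltac:(intros s Hs; rewrite Rmult_1_l; apply Hsl2; lra)). lra. }
  assert (Hmv : Qk ((1 + ep) * (z + zeta)) <= Qk (z + zk) + eps).
  { assert (Hle : (1 + ep) * (z + zeta) <= z + zk + ep * (L + zeta)).
    { assert (ep * (z + zeta) <= ep * (L + zeta)) by (apply Rmult_le_compat_l; lra). lra. }
    assert (0 <= ep * (L + zeta)) by (apply Rmult_le_pos; lra).
    assert (Hl1 := HQkl (z + zk) (z + zk + ep * (L + zeta)) ltac:(lra)).
    apply HQkm in Hle. assert (Hs0 := Hsl2 q0 ltac:(lra)). fold p in Hs0.
    replace (z + zk + ep * (L + zeta) - (z + zk)) with (ep * (L + zeta)) in Hl1 by ring.
    assert (slope (D k) phi S' q0 * (ep * (L + zeta)) <= p q0 * (ep * (L + zeta))) by (apply Rmult_le_compat_r; lra).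
    lra. }
  lra.
Qed.

(** As for the lower bound, with a nonlinearity slightly larger than [F k] and a saturation level
    [S' > S]. The eventual bound by [S + eps] at bounded heights now controls the top and the
    lateral sides. *)
Lemma robin_upper (N : nat) (D a : bool -> R) (F : bool -> R -> R)
  (w : bool -> (tang N -> R) -> R -> R -> R) (Ev : ((tang N -> R) -> R -> Prop) -> Prop)
  (k : bool) (m q0 S d0 : R) (Q : R -> R) (Ar zeta : R) :
  (2 <= N)%nat -> (forall k, 0 < D k) -> (forall k, 0 < a k) ->
  coupled N D a F w -> window_filter Ev -> orbit_data (D k) (F k) m q0 S Q ->
  0 < d0 -> (forall s, S < s < S + d0 -> F k s < 0) ->
  (forall eps L, 0 < eps -> 0 < L -> Ev (fun y t => forall z, 0 <= z <= L -> w k y z t <= S + eps)) ->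
  Ev (fun y t => w (negb k) y 0 t <= Ar) ->
  0 < zeta -> Ar < Q zeta - a k * slope (D k) (F k) S (Q zeta) ->
  forall eps L, 0 < eps -> 0 < L -> Ev (fun y t => forall z, 0 <= z <= L -> w k y z t <= Q (z + zeta) + eps).
Proof.
  intros HN HD Ha Hw Hwf (Hc & Hq0 & Hp & HQ) Hd0 Hneg Hup HAr Hzeta HB eps L Heps HL.
  assert (HDk := HD k). assert (Hak := Ha k).
  assert (HO := HQ). destruct HO as (HQ0 & HQ1 & HG & HQm & HQl & _).
  set (B := Q zeta) in *. set (p := slope (D k) (F k) S) in *.
  assert (HBr : q0 < B < S) by (apply (orbit_range_interior (D k) (F k) S q0 Q); auto; lra).
  assert (HtB : travel (D k) (F k) S q0 B = zeta) by (apply HQ1; lra).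
  assert (HpB : 0 < p B) by (apply slope_pos; auto; [lra|intros s Hs; apply Hp; lra]).
  assert (Hp0 : 0 < p q0) by (apply slope_pos; auto; [lra|intros s Hs; apply Hp; lra]).
  set (gap := (B - a k * p B) - Ar). assert (Hgap : 0 < gap) by (unfold gap; lra).
  set (ep := Rmin (Rmin 1 (gap / 2 / (a k * p B))) (eps / (p q0 * (L + zeta)))).
  assert (Hap : 0 < a k * p B) by (apply Rmult_lt_0_compat; lra).
  assert (HpL : 0 < p q0 * (L + zeta)) by (apply Rmult_lt_0_compat; lra).
  assert (Hep : 0 < ep) by (unfold ep; repeat apply Rmin_glb_lt; try apply Rdiv_lt_0_compat; lra).
  assert (Hep0 : ep <= 1) by (unfold ep; eapply Rle_trans; [apply Rmin_l|apply Rmin_l]).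
  assert (Hep1 : ep * (a k * p B) < gap).
  { apply Rle_lt_trans with (gap / 2 / (a k * p B) * (a k * p B)).
    - apply Rmult_le_compat_r; [lra|]. unfold ep. eapply Rle_trans; [apply Rmin_l|apply Rmin_r].
    - replace (gap / 2 / (a k * p B) * (a k * p B)) with (gap / 2) by (field; lra). lra. }
  assert (Hep2 : ep * (p q0 * (L + zeta)) <= eps).
  { apply Rle_trans with (eps / (p q0 * (L + zeta)) * (p q0 * (L + zeta))); [|apply Req_le; field; lra].
    apply Rmult_le_compat_r; [lra|apply Rmin_r]. }
  (* With [ep <= 1] the stretched argument [(1 + ep) * (z + zk)] stays below [2 * (L + zeta)], so
     slopes need comparing only up to this level. *)
  set (q1 := Q (2 * (L + zeta))).
  assert (Hq1 : B <= q1 < S).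
  { split; [apply HQm; lra|]. apply (orbit_lt_top (D k) (F k) S q0 Q); auto; lra. }
  destruct (upper_perturbation (D k) (F k) m q0 q1 S ep d0 HDk Hc ltac:(lra) ltac:(lra) Hp Hneg Hep Hd0)
    as (phi & S' & c0 & Lam & HS' & Hphc & Hphp & HLam & Hphl & Hc0 & Hphs & Hsl1 & Hsl2).
  destruct (orbit_exists (D k) phi m q0 S' Lam HDk Hphc ltac:(lra) HLam Hphp Hphl) as [Qk HQk].
  assert (HOk := HQk). destruct HOk as (HQk0 & HQk1 & HGk & HQkm & HQkl & _).
  destruct (travel_pos (D k) phi S' q0 B Qk HQk ltac:(lra)) as [Hzk HQkB].
  set (zk := travel (D k) phi S' q0 B) in *.
  (* Eventually [w <= S + del], while [S + 2 * del] is still below [S'] and is reached by [Qk] at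
     distance [h0]. Shifted by [h0], or taken at height at least [h0], the barrier is therefore
     above [w]. *)
  set (del := (S' - S) / 4). assert (Hdel : 0 < del) by (unfold del; lra).
  destruct (travel_pos (D k) phi S' q0 (S + 2 * del) Qk HQk ltac:(unfold del; lra)) as [Hh0 HQh0].
  set (h0 := travel (D k) phi S' q0 (S + 2 * del)) in *.
  set (Lb := Rmax L h0). assert (HLb1 : L <= Lb) by apply Rmax_l. assert (HLb2 : h0 <= Lb) by apply Rmax_r.
  destruct (modulation_size N (D k) h0 (slope (D k) phi S' q0) c0 (Lam * (S' - q0)) HN HDk Hh0
    (slope_nonneg _ _ _ _) Hc0 ltac:(apply Rmult_le_pos; lra)) as (T & R0 & HT & HR0 & Hsize).
  destruct Hwf as (Hmono & Hand & _ & Htime & Hwin).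
  eapply Hmono; [|apply (Hand _ _ (Hwin _ R0 T (Hand _ _ (Hup del Lb Hdel ltac:(lra)) HAr)) (Htime T))].
  intros y t [H1 H2] z Hz. simpl in H1.
  assert (Hbar : -1 * Qk (z + zk) < -1 * w k y z t).
  { apply (orbit_barrier N D a F w k phi Qk (-1) S' q0 zk h0 Lb R0 T t Ar c0 (Lam * (S' - q0)) y); auto; try lra.
    - intros s Hs. apply Hphp. lra.
    - apply (bounded_phi phi q0 S' Lam); auto; lra.
    - intros s Hs. specialize (Hphs s ltac:(lra)). lra.
    - rewrite HQkB. specialize (Hsl1 B ltac:(lra)). fold p in Hsl1.
      set (pk := slope (D k) phi S' B) in *.
      assert (a k * pk <= a k * ((1 + ep) * p B)) by (apply Rmult_le_compat_l; lra).
      unfold gap in *. lra.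
    - intros y' t' Hy' Ht'. destruct (H1 y' t' Hy' Ht') as [_ H3]. lra.
    - intros y' z' t' h Hy' Hz' Ht' Hh. destruct (H1 y' t' Hy' Ht') as [H3 _]. specialize (H3 z' Hz').
      assert (Qk h0 <= Qk (z' - -1 * h + zk)) by (apply HQkm; lra). lra.
    - intros y' t' h Hy' Ht' Hh. destruct (H1 y' t' Hy' Ht') as [H3 _]. specialize (H3 Lb ltac:(lra)).
      assert (Qk h0 <= Qk (Lb - -1 * h + zk)) by (apply HQkm; lra). lra. }
  assert (Hzz : zk <= zeta).
  { rewrite <- HtB. unfold zk.
    assert (H := travel_le_scaled (D k) phi (F k) S' S q0 B 1 HDk ltac:(lra) Hphc Hc ltac:(lra) ltac:(lra) ltac:(lra)
      ltac:(intros s Hs; apply Hphp; lra) ltac:(intros s Hs; apply Hp; lra)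
      ltac:(intros s Hs; rewrite Rmult_1_l; apply Hsl2; lra)). lra. }
  assert (Hcmp : Qk (z + zk) <= Q ((1 + ep) * (z + zk))).
  { assert (Q ((1 + ep) * (z + zk)) <= q1).
    { apply HQm. assert ((1 + ep) * (z + zk) <= 2 * (z + zk)) by (apply Rmult_le_compat_r; lra). lra. }
    apply (orbit_compare_target (D k) phi (F k) S' S q0 (1 + ep) (z + zk) Qk Q); auto; try lra.
    - intros s Hs. apply Hphp. lra.
    - intros s Hs. apply Hp. lra.
    - intros s Hs. apply Hsl1. lra. }
  assert (Hmv : Q ((1 + ep) * (z + zk)) <= Q (z + zeta) + eps).
  { assert (Hle : (1 + ep) * (z + zk) <= z + zeta + ep * (L + zeta)).
    { assert (ep * (z + zk) <= ep * (L + zeta)) by (apply Rmult_le_compat_l; lra). lra. }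
    assert (0 <= ep * (L + zeta)) by (apply Rmult_le_pos; lra).
    assert (Hl1 := HQl (z + zeta) (z + zeta + ep * (L + zeta)) ltac:(lra)). fold p in Hl1.
    apply HQm in Hle.
    replace (z + zeta + ep * (L + zeta) - (z + zeta)) with (ep * (L + zeta)) in Hl1 by ring. lra. }
  lra.
Qed.

Lemma continuous_near (f : R -> R) (x eps : R) : continuous f x -> 0 < eps ->
  exists dl, 0 < dl /\ forall y, Rabs (y - x) < dl -> Rabs (f y - f x) < eps.
Proof.
  intros Hc He. destruct (proj1 (filterlim_locally _ _) Hc (mkposreal eps He)) as [dl H].
  exists dl. split; [apply cond_pos|]. intros y Hy. exact (H y Hy).
Qed.

Lemma exchange_increasing (D a : R) (f : R -> R) (m S x y : R) : 0 < D -> 0 < a ->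
  (forall s, continuous f s) -> (forall s, m < s < S -> 0 < f s) -> m < x -> x < y <= S ->
  x - a * slope D f S x < y - a * slope D f S y.
Proof.
  intros HD Ha Hc Hp Hx Hy.
  assert (slope D f S y < slope D f S x).
  { apply slope_decreasing; auto. intros s Hs. apply Hp. lra. }
  nra.
Qed.

Lemma exchange_continuous (D a : R) (f : R -> R) (S x : R) : (forall s, continuous f s) ->
  continuous (fun b => b - a * slope D f S b) x.
Proof.
  intros Hc. apply (continuous_minus (fun b : R => b) (fun b => a * slope D f S b)); [apply continuous_id|].
  apply (continuous_mult (fun _ => a) (slope D f S)); [apply continuous_const|now apply slope_continuous].
Qed.

(** If the exchange value at [lok] were below [lod], so would be, by continuity, that of a slightly
    higher level [B]; [robin_lower] would then make every number below [B] an eventual lower bound,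
    against the maximality of [lok]. The second inequality is the same argument with
    [robin_upper]. *)
Lemma robin_balance (N : nat) (D a : bool -> R) (F : bool -> R -> R)
  (w : bool -> (tang N -> R) -> R -> R -> R) (Ev : ((tang N -> R) -> R -> Prop) -> Prop)
  (k : bool) (m q0 S d0 : R) (Q : R -> R) (lok hik lod hid : R) :
  (2 <= N)%nat -> (forall k, 0 < D k) -> (forall k, 0 < a k) ->
  coupled N D a F w -> window_filter Ev -> orbit_data (D k) (F k) m q0 S Q ->
  0 < d0 -> (forall s, S < s < S + d0 -> F k s < 0) ->
  (forall L, 0 < L -> Ev (fun y t => forall z, 0 <= z <= L -> q0 < w k y z t)) ->
  (forall eps L, 0 < eps -> 0 < L -> Ev (fun y t => forall z, 0 <= z <= L -> w k y z t <= S + eps)) ->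
  (forall s, Ev (fun y t => s <= w k y 0 t) -> s <= lok) ->
  (forall s, Ev (fun y t => w k y 0 t <= s) -> hik <= s) ->
  (forall eps, 0 < eps -> Ev (fun y t => lod - eps <= w (negb k) y 0 t)) ->
  (forall eps, 0 < eps -> Ev (fun y t => w (negb k) y 0 t <= hid + eps)) ->
  q0 <= lok <= S -> q0 < hik <= S -> lod <= S ->
  lod <= lok - a k * slope (D k) (F k) S lok /\ hik - a k * slope (D k) (F k) S hik <= hid.
Proof.
  intros HN HD Ha Hw Hwf Hod Hd0 Hneg Hlow Hup Hlok Hhik Hlod Hhid Hlor Hhir HlodS.
  assert (Hod' := Hod). destruct Hod' as (Hc & Hq0 & Hp & HQ).
  set (X := fun b => b - a k * slope (D k) (F k) S b).
  assert (HXc : forall b, continuous X b) by (intros; now apply exchange_continuous).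
  assert (Hmono := Hwf). destruct Hmono as (Hmono & _).
  split; apply Rnot_lt_le; intros Hlt.
  - assert (HlS : lok < S).
    { destruct (proj2 Hlor) as [H|H]; [assumption|]. rewrite H, slope_top in Hlt. lra. }
    destruct (continuous_near X lok ((lod - X lok) / 2) (HXc lok) ltac:(unfold X; lra)) as [dl [Hdl Hn]].
    set (B := lok + Rmin dl (S - lok) / 2).
    assert (Hr : 0 < Rmin dl (S - lok)) by (apply Rmin_glb_lt; lra).
    pose proof (Rmin_l dl (S - lok)). pose proof (Rmin_r dl (S - lok)).
    assert (HB : lok < B < S) by (unfold B; lra).
    specialize (Hn B ltac:(unfold B; rewrite Rabs_pos_eq; lra)). apply Rabs_def2 in Hn.
    fold (X lok) in Hlt.
    destruct (travel_pos (D k) (F k) S q0 B Q HQ ltac:(lra)) as [Hz HQz].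
    assert (B <= lok); [|lra]. apply le_epsilon. intros eps He.
    assert (B - eps <= lok); [|lra]. apply Hlok.
    eapply Hmono; [|apply (robin_lower N D a F w Ev k m q0 S Q (lod - (lod - X lok) / 2) (travel (D k) (F k) S q0 B)
      HN HD Ha Hw Hwf Hod Hlow (Hlod ((lod - X lok) / 2) ltac:(lra)) Hz ltac:(rewrite HQz; fold (X B); lra) eps 1 He ltac:(lra))].
    intros y t H1. specialize (H1 0 ltac:(lra)). rewrite Rplus_0_l, HQz in H1. exact H1.
  - fold (X hik) in Hlt.
    destruct (continuous_near X hik ((X hik - hid) / 2) (HXc hik) ltac:(lra)) as [dl [Hdl Hn]].
    set (B := hik - Rmin dl (hik - q0) / 2).
    assert (Hr : 0 < Rmin dl (hik - q0)) by (apply Rmin_glb_lt; lra).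
    pose proof (Rmin_l dl (hik - q0)). pose proof (Rmin_r dl (hik - q0)).
    assert (HB : q0 < B < hik) by (unfold B; lra).
    specialize (Hn B ltac:(unfold B; rewrite Rabs_left1; lra)). apply Rabs_def2 in Hn.
    destruct (travel_pos (D k) (F k) S q0 B Q HQ ltac:(lra)) as [Hz HQz].
    assert (hik <= B); [|lra]. apply le_epsilon. intros eps He. apply Hhik.
    eapply Hmono; [|apply (robin_upper N D a F w Ev k m q0 S d0 Q (hid + (X hik - hid) / 2) (travel (D k) (F k) S q0 B)
      HN HD Ha Hw Hwf Hod Hd0 Hneg Hup (Hhid ((X hik - hid) / 2) ltac:(lra)) Hz ltac:(rewrite HQz; fold (X B); lra) eps 1 He ltac:(lra))].
    intros y t H1. specialize (H1 0 ltac:(lra)). rewrite Rplus_0_l, HQz in H1. exact H1.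
Qed.

(** The exchange value is strictly increasing along the orbit, so the translates by [zeta - r] and
    [zeta + r] satisfy strict exchange inequalities and enclose the solution; the Lipschitz bound on
    [Q] makes them close to each other. *)
Lemma robin_profile (N : nat) (D a : bool -> R) (F : bool -> R -> R)
  (w : bool -> (tang N -> R) -> R -> R -> R) (Ev : ((tang N -> R) -> R -> Prop) -> Prop)
  (k : bool) (m q0 S d0 : R) (Q : R -> R) (Ar zeta : R) :
  (2 <= N)%nat -> (forall k, 0 < D k) -> (forall k, 0 < a k) ->
  coupled N D a F w -> window_filter Ev -> orbit_data (D k) (F k) m q0 S Q ->
  0 < d0 -> (forall s, S < s < S + d0 -> F k s < 0) ->
  (forall L, 0 < L -> Ev (fun y t => forall z, 0 <= z <= L -> q0 < w k y z t)) ->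
  (forall eps L, 0 < eps -> 0 < L -> Ev (fun y t => forall z, 0 <= z <= L -> w k y z t <= S + eps)) ->
  (forall eps, 0 < eps -> Ev (fun y t => Ar - eps <= w (negb k) y 0 t)) ->
  (forall eps, 0 < eps -> Ev (fun y t => w (negb k) y 0 t <= Ar + eps)) ->
  0 < zeta -> Q zeta - a k * slope (D k) (F k) S (Q zeta) = Ar ->
  forall eps L, 0 < eps -> 0 < L -> Ev (fun y t => forall z, 0 <= z <= L -> Rabs (w k y z t - Q (z + zeta)) <= eps).
Proof.
  intros HN HD Ha Hw Hwf Hod Hd0 Hneg Hlow Hup HAl HAu Hzeta HB eps L Heps HL.
  assert (Hod' := Hod). destruct Hod' as (Hc & Hq0 & Hp & HQ).
  assert (HO := HQ). destruct HO as (HQ0 & HQ1 & HG & HQm & HQl & _).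
  assert (Hwf' := Hwf). destruct Hwf' as (Hmono & Hand & _).
  set (p0 := slope (D k) (F k) S q0) in *.
  assert (Hp0 : 0 <= p0) by apply slope_nonneg.
  set (r := Rmin (zeta / 2) (eps / (2 * (p0 + 1)))).
  assert (Hr : 0 < r) by (apply Rmin_glb_lt; [lra|apply Rdiv_lt_0_compat; lra]).
  assert (Hr1 : r <= zeta / 2) by apply Rmin_l.
  assert (Hr2 : p0 * r <= eps / 2).
  { apply Rle_trans with ((p0 + 1) * r); [apply Rmult_le_compat_r; lra|].
    apply Rle_trans with ((p0 + 1) * (eps / (2 * (p0 + 1)))); [|apply Req_le; field; lra].
    apply Rmult_le_compat_l; [lra|apply Rmin_r]. }
  assert (Hstr : forall x y, 0 < x -> x < y -> Q x - a k * slope (D k) (F k) S (Q x) < Q y - a k * slope (D k) (F k) S (Q y)).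
  { intros x y Hx Hy.
    assert (H1 := orbit_range_interior _ _ _ _ _ x HQ ltac:(lra) Hx).
    assert (H2 := orbit_range_interior _ _ _ _ _ y HQ ltac:(lra) ltac:(lra)).
    apply (exchange_increasing (D k) (a k) (F k) m S); auto; [lra|]. split; [|lra].
    destruct (HQm x y ltac:(lra)) as [H|H]; [assumption|]. exfalso.
    destruct (HQ1 x ltac:(lra)) as [_ E1]. destruct (HQ1 y ltac:(lra)) as [_ E2]. rewrite H in E1. lra. }
  set (X := fun x => Q x - a k * slope (D k) (F k) S (Q x)) in *.
  assert (G1 : X (zeta - r) < Ar) by (rewrite <- HB; apply Hstr; lra).
  assert (G2 : Ar < X (zeta + r)) by (rewrite <- HB; apply Hstr; lra).
  assert (E1 := robin_lower N D a F w Ev k m q0 S Q (Ar - (Ar - X (zeta - r)) / 2) (zeta - r)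
    HN HD Ha Hw Hwf Hod Hlow (HAl ((Ar - X (zeta - r)) / 2) ltac:(lra)) ltac:(lra) ltac:(fold (X (zeta - r)); lra) (eps / 2) L ltac:(lra) HL).
  assert (E2 := robin_upper N D a F w Ev k m q0 S d0 Q (Ar + (X (zeta + r) - Ar) / 2) (zeta + r)
    HN HD Ha Hw Hwf Hod Hd0 Hneg Hup (HAu ((X (zeta + r) - Ar) / 2) ltac:(lra)) ltac:(lra) ltac:(fold (X (zeta + r)); lra) (eps / 2) L ltac:(lra) HL).
  eapply Hmono; [|apply (Hand _ _ E1 E2)].
  intros y t [H1 H2] z Hz. specialize (H1 z Hz). specialize (H2 z Hz).
  assert (L1 := HQl (z + (zeta - r)) (z + zeta) ltac:(lra)).
  assert (L2 := HQl (z + zeta) (z + (zeta + r)) ltac:(lra)). fold p0 in L1, L2.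
  replace (z + zeta - (z + (zeta - r))) with r in L1 by ring.
  replace (z + (zeta + r) - (z + zeta)) with r in L2 by ring.
  apply Rabs_le. lra.
Qed.

(** * Steady states and convergence *)

Definition steady_pair (D a : bool -> R) (F : bool -> R -> R) (W : bool -> R -> R) : Prop :=
  forall k,
  (exists W1 W2, forall z, 0 < z -> derivable_pt_lim (W k) z (W1 z) /\ derivable_pt_lim W1 z (W2 z) /\
     D k * W2 z + F k (W k z) = 0) /\
  (exists p, has_right_deriv (W k) 0 p /\ - a k * p = W (negb k) 0 - W k 0) /\
  (forall z, 0 <= z -> 0 < W k z) /\
  (exists M, forall z, 0 <= z -> W k z <= M).

Lemma loc_lipschitz_continuous (f : R -> R) : loc_lipschitz f -> forall s, continuous f s.
Proof.
  intros H s. destruct (H (Rabs s + 1)) as [L HL]; [pose proof (Rabs_pos s); lra|].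
  apply filterlim_locally. intros eps.
  assert (Hd : 0 < Rmin 1 (eps / (Rabs L + 1))).
  { apply Rmin_glb_lt; [lra|]. apply Rdiv_lt_0_compat; [apply cond_pos|pose proof (Rabs_pos L); lra]. }
  exists (mkposreal _ Hd). intros y Hy. change (Rabs (y - s) < Rmin 1 (eps / (Rabs L + 1))) in Hy.
  change (Rabs (f y - f s) < eps).
  pose proof (Rmin_l 1 (eps / (Rabs L + 1))). pose proof (Rmin_r 1 (eps / (Rabs L + 1))).
  assert (Hys : Rabs y <= Rabs s + 1).
  { replace y with (s + (y - s)) by ring. eapply Rle_trans; [apply Rabs_triang|]. lra. }
  specialize (HL y s Hys ltac:(lra)). eapply Rle_lt_trans; [exact HL|].
  pose proof (Rabs_pos (y - s)). pose proof (Rabs_pos L). pose proof (Rle_abs L).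
  apply Rle_lt_trans with ((Rabs L + 1) * Rabs (y - s)); [apply Rmult_le_compat_r; lra|].
  apply Rmult_lt_reg_l with (/ (Rabs L + 1)); [apply Rinv_0_lt_compat; lra|].
  rewrite <- Rmult_assoc, Rinv_l, Rmult_1_l by lra. unfold Rdiv in H1. lra.
Qed.

Lemma loc_lipschitz_flip (f : R -> R) : loc_lipschitz f -> loc_lipschitz (fun s => - f (- s)).
Proof.
  intros H M HM. destruct (H M HM) as [L HL]. exists L. intros x y Hx Hy.
  specialize (HL (- x) (- y) ltac:(now rewrite Rabs_Ropp) ltac:(now rewrite Rabs_Ropp)).
  replace (- f (- x) - - f (- y)) with (- (f (- x) - f (- y))) by ring.
  replace (x - y) with (- (- x - - y)) by ring. now rewrite !Rabs_Ropp.
Qed.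

Lemma orbit_data_exists (D : R) (f : R -> R) (m q0 S : R) :
  0 < D -> loc_lipschitz f -> m < q0 < S -> (forall s, m < s < S -> 0 < f s) -> f S = 0 ->
  exists Q, orbit_data D f m q0 S Q.
Proof.
  intros HD Hl Hq Hp HS. assert (Hc := loc_lipschitz_continuous f Hl).
  destruct (Hl (Rabs q0 + Rabs S + 1)) as [L HL]; [pose proof (Rabs_pos q0); pose proof (Rabs_pos S); lra|].
  destruct (orbit_exists D f m q0 S (Rabs L + 1) HD Hc Hq) as [Q HQ]; auto.
  - pose proof (Rabs_pos L). lra.
  - intros s Hs.
    assert (Hss : Rabs s <= Rabs q0 + Rabs S + 1).
    { pose proof (Rle_abs S). pose proof (Rabs_pos S). pose proof (Rabs_pos q0). pose proof (Rle_abs (- q0)).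
      rewrite Rabs_Ropp in H2. apply Rabs_le. lra. }
    specialize (HL s S Hss ltac:(pose proof (Rabs_pos q0); lra)).
    rewrite HS, Rminus_0_r in HL. rewrite (Rabs_left1 (s - S)) in HL by lra.
    pose proof (Rle_abs (f s)). pose proof (Rle_abs L). pose proof (Rabs_pos L).
    assert (L * - (s - S) <= (Rabs L + 1) * (S - s)).
    { replace (- (s - S)) with (S - s) by ring. apply Rmult_le_compat_r; lra. }
    lra.
  - exists Q. split; [exact Hc|]. auto.
Qed.

Lemma orbit_translate_derivs (D : R) (f : R -> R) (m q0 S zeta : R) (Q : R -> R) (z : R) :
  orbit_data D f m q0 S Q -> 0 < zeta -> 0 <= z ->
  is_derive (fun z => Q (z + zeta)) z (slope D f S (Q (z + zeta))) /\
  is_derive (fun z => slope D f S (Q (z + zeta))) z (- f (Q (z + zeta)) / D).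
Proof.
  intros (_ & _ & _ & (_ & _ & _ & _ & _ & _ & HQd)) Hz Hz0.
  destruct (HQd (z + zeta) ltac:(lra)) as [H1 H2].
  assert (Hd : is_derive (fun z => z + zeta) z 1) by (auto_derive; [auto|ring]).
  split.
  - assert (H := is_derive_comp Q (fun z => z + zeta) z _ 1 H1 Hd).
    unfold scal in H. simpl in H. unfold mult in H. simpl in H. rewrite Rmult_1_l in H. exact H.
  - assert (H := is_derive_comp (fun x => slope D f S (Q x)) (fun z => z + zeta) z _ 1 H2 Hd).
    unfold scal in H. simpl in H. unfold mult in H. simpl in H. rewrite Rmult_1_l in H. exact H.
Qed.

(* The traces [A], [B] at the interface of the steady state; species [j] has the smaller
   saturation level and is described through its opposite. *)
Lemma interface_values (Dj aj Dn an Sj Sn : R) (fj fn : R -> R) :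
  0 < Dj -> 0 < aj -> 0 < Dn -> 0 < an -> 0 < Sj < Sn ->
  (forall s, continuous fj s) -> (forall s, continuous fn s) ->
  (forall s, s < - Sj -> 0 < fj s) -> (forall s, 0 < s < Sn -> 0 < fn s) ->
  exists A B, Sj < A < Sn /\ Sj < B < Sn /\
    B - an * slope Dn fn Sn B = A /\ - A - aj * slope Dj fj (- Sj) (- A) = - B.
Proof.
  intros HDj Haj HDn Han HS Hcj Hcn Hpj Hpn.
  set (pj := fun A => slope Dj fj (- Sj) (- A)).
  (* The exchange condition of species [j] forces [B = A + aj * pj A]; a zero of [H] equates the two
     fluxes. Truncating [B] at [Sn] sets the flux of the other species to 0 when [B] is too large,
     which gives [H] a positive value at [Sn]. *)
  set (H := fun A => aj * pj A - an * slope Dn fn Sn (Rmin (A + aj * pj A) Sn)).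
  assert (Hpjc : forall A, continuous pj A).
  { intros A. apply (continuous_real_comp (fun A => - A) (slope Dj fj (- Sj))).
    - apply (continuous_opp (fun A : R => A) A), continuous_id.
    - now apply slope_continuous. }
  assert (Hapj : forall A, continuous (fun A => aj * pj A) A).
  { intros A. apply (continuous_mult (fun _ => aj) pj); [apply continuous_const|apply Hpjc]. }
  assert (HHc : forall A, continuous H A).
  { intros A. apply (continuous_minus (fun A => aj * pj A) (fun A => an * slope Dn fn Sn (Rmin (A + aj * pj A) Sn))); [apply Hapj|].
    apply (continuous_mult (fun _ => an) (fun A => slope Dn fn Sn (Rmin (A + aj * pj A) Sn))); [apply continuous_const|].
    apply (continuous_real_comp (fun A => Rmin (A + aj * pj A) Sn) (slope Dn fn Sn)); [|now apply slope_continuous].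
    apply (continuous_Rmin_comp (fun A => A + aj * pj A) (fun _ => Sn)); [|apply continuous_const].
    apply (continuous_plus (fun A : R => A) (fun A => aj * pj A)); [apply continuous_id|apply Hapj]. }
  assert (HpjS : pj Sj = 0) by apply slope_top.
  assert (Hpjp : forall A, Sj < A -> 0 < pj A).
  { intros A HA. apply (slope_pos _ _ _ _ HDj Hcj); [lra|]. intros s Hs. apply Hpj. lra. }
  assert (Hpnp : forall B, 0 < B < Sn -> 0 < slope Dn fn Sn B).
  { intros B HB. apply (slope_pos _ _ _ _ HDn Hcn); [lra|]. intros s Hs. apply Hpn. lra. }
  assert (H1 : H Sj < 0).
  { unfold H. rewrite HpjS, Rmult_0_r, Rplus_0_r, Rmin_left by lra.
    pose proof (Rmult_lt_0_compat _ _ Han (Hpnp Sj ltac:(lra))). lra. }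
  assert (H2 : 0 < H Sn).
  { unfold H. specialize (Hpjp Sn ltac:(lra)). pose proof (Rmult_lt_0_compat _ _ Haj Hpjp).
    rewrite Rmin_right by lra. rewrite slope_top, Rmult_0_r. lra. }
  destruct (IVT_interv H Sj Sn) as [A [HA HA0]]; auto; [|lra|].
  { intros A _. apply continuous_continuity_pt, HHc. }
  assert (HAj : Sj < A) by (destruct (proj1 HA) as [E|E]; [assumption|subst; lra]).
  assert (HAn : A < Sn) by (destruct (proj2 HA) as [E|E]; [assumption|subst; lra]).
  specialize (Hpjp A HAj). assert (Hap := Rmult_lt_0_compat _ _ Haj Hpjp).
  set (B := A + aj * pj A) in *. unfold H in HA0. fold B in HA0.
  assert (HB : B < Sn).
  { apply Rnot_le_lt. intros HB. rewrite Rmin_right, slope_top, Rmult_0_r in HA0 by assumption. lra. }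
  rewrite Rmin_left in HA0 by lra.
  exists A, B. fold (pj A). split; [lra|]. split; [unfold B in *; lra|]. unfold B in *. lra.
Qed.

Lemma rough_lower (N : nat) (D a : bool -> R) (F : bool -> R -> R)
  (w : bool -> (tang N -> R) -> R -> R -> R) (Ev : ((tang N -> R) -> R -> Prop) -> Prop) (s m : R) :
  (2 <= N)%nat -> (forall k, 0 < D k) -> (forall k, 0 < a k) ->
  coupled N D a F w -> window_filter Ev -> m < s ->
  (forall L, 0 < L -> Ev (fun y t => forall k z, 0 <= z <= L -> m < w k y z t)) ->
  (forall k x, continuous (F k) x) -> (forall k x, m <= x <= s -> 0 < F k x) ->
  forall L, 0 < L -> Ev (fun y t => forall k z, 0 <= z <= L -> s <= w k y z t).
Proof.
  intros HN HD Ha Hw Hwf Hms Hlow Hc Hp L HL.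
  destruct (positive_min (F true) m s ltac:(lra) (Hc true) (Hp true)) as [c1 [Hc1 H1]].
  destruct (positive_min (F false) m s ltac:(lra) (Hc false) (Hp false)) as [c2 [Hc2 H2]].
  destruct (paraboloid_ev N D a F w Ev (fun _ => true) s m (Rmin c1 c2) HN HD Ha Hw Hwf Hms) as [L1 [HL1 Hev]].
  { now apply Rmin_glb_lt. }
  { intros L' HL'. destruct Hwf as (Hmono & _). eapply Hmono; [|apply (Hlow L' HL')]. intros y t H k z _. apply H. }
  { intros k x _ Hx. pose proof (Rmin_l c1 c2). pose proof (Rmin_r c1 c2).
    specialize (H1 x Hx). specialize (H2 x Hx). destruct k; lra. }
  destruct Hwf as (Hmono & Hand & _ & Htime & _).
  eapply Hmono; [|apply (Hand _ _ (Hev (Rmax L 1) ltac:(pose proof (Rmax_r L 1); lra)) (Htime 0))].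
  intros y t [H3 H4] k z Hz. pose proof (Rmax_l L 1). pose proof (Rmax_r L 1).
  assert (Hpos : forall z, 0 < z <= Rmax L 1 -> s <= w k y z t).
  { intros z' Hz'. left. apply H3; auto; [|lra]. left. split; [lra|auto]. }
  destruct (proj1 Hz) as [Hz0| <-]; [apply Hpos; lra|].
  apply ge_at_boundary; [apply Hw|lra|]. intros z' Hz'. apply Hpos. lra.
Qed.

Lemma ev_le {N : nat} (Ev : ((tang N -> R) -> R -> Prop) -> Prop) (u : (tang N -> R) -> R -> R) (x y : R) :
  window_filter Ev -> Ev (fun p t => x <= u p t) -> Ev (fun p t => u p t <= y) -> x <= y.
Proof.
  intros (Hmono & Hand & Hprop & _) H1 H2. apply Rnot_lt_le. intros Hn. apply Hprop.
  eapply Hmono; [|apply (Hand _ _ H1 H2)]. intros p t [H3 H4]. lra.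
Qed.

(** The upper bound must be uniform in the depth [L], the lower one need not be: [ev_uniform_depth]
    repairs it. *)
Definition trapped {N : nat} (Ev : ((tang N -> R) -> R -> Prop) -> Prop)
  (w : bool -> (tang N -> R) -> R -> R -> R) : Prop :=
  (exists M, forall L, 0 < L -> Ev (fun y t => forall k z, 0 <= z <= L -> w k y z t <= M)) /\
  (forall L, 0 < L -> exists dl, 0 < dl /\ Ev (fun y t => forall k z, 0 <= z <= L -> dl <= w k y z t)).

Definition converges_to {N : nat} (Ev : ((tang N -> R) -> R -> Prop) -> Prop)
  (w : bool -> (tang N -> R) -> R -> R -> R) (W : bool -> R -> R) : Prop :=
  forall eps L, 0 < eps -> 0 < L ->
    Ev (fun y t => forall k z, 0 <= z <= L -> Rabs (w k y z t - W k z) <= eps).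

Lemma between_levels (Sk : bool -> R) (j k : bool) : Sk j <= Sk (negb j) -> Sk j <= Sk k <= Sk (negb j).
Proof. destruct j, k; simpl; lra. Qed.

(** Below the smaller saturation level both reactions are positive and above the larger one both are
    negative. Paraboloids with both species active then push the solution between these levels, up
    to the interface. *)
Lemma rough_bounds (N : nat) (D a l Sk : bool -> R) (F : bool -> R -> R)
  (w : bool -> (tang N -> R) -> R -> R -> R) (Ev : ((tang N -> R) -> R -> Prop) -> Prop) (j : bool) :
  (2 <= N)%nat -> (forall k, 0 < D k) -> (forall k, 0 < a k) ->
  (forall k, KPP_f (F k) (l k) (Sk k)) -> Sk j <= Sk (negb j) ->
  nonneg_solution N D a F w -> window_filter Ev -> trapped Ev w ->
  forall eps L, 0 < eps -> 0 < L ->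
    Ev (fun y t => forall k z, 0 <= z <= L -> Sk j - eps <= w k y z t) /\
    Ev (fun y t => forall k z, 0 <= z <= L -> w k y z t <= Sk (negb j) + eps).
Proof.
  intros HN HD Ha HF Hj Hw Hwf [[M HM] Hlow] eps L Heps HL.
  assert (HS : forall k, 0 < Sk k) by (intros k; apply HF).
  assert (Hc : forall k x, continuous (F k) x) by (intros k; apply loc_lipschitz_continuous; apply HF).
  assert (Hbt := between_levels Sk j).
  assert (Hmono := Hwf). destruct Hmono as (Hmono & _). split.
  - destruct (ev_uniform_depth N D a l Sk F w Ev HN HD Ha HF Hw Hwf Hlow) as [dl [Hdl Hev]].
    set (s := Sk j - Rmin eps (Sk j / 2)).
    assert (Hm1 := Rmin_l eps (Sk j / 2)). assert (Hm2 := Rmin_r eps (Sk j / 2)).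
    assert (Hm0 : 0 < Rmin eps (Sk j / 2)) by (apply Rmin_glb_lt; [lra|specialize (HS j); lra]).
    assert (Hs : 0 < s < Sk j) by (unfold s; specialize (HS j); lra).
    set (m := Rmin dl s / 2).
    assert (Hm3 : 0 < Rmin dl s) by (apply Rmin_glb_lt; lra).
    pose proof (Rmin_l dl s). pose proof (Rmin_r dl s).
    eapply Hmono; [|apply (rough_lower N D a F w Ev s m HN HD Ha (proj1 Hw) Hwf)].
    + intros y t H1 k z Hz. specialize (H1 k z Hz). unfold s in H1. lra.
    + unfold m. lra.
    + intros L' HL'. eapply Hmono; [|apply (Hev L' HL')].
      intros y t H1 k z Hz. specialize (H1 k z Hz). unfold m. lra.
    + exact Hc.
    + intros k x Hx. destruct (HF k) as (_ & _ & _ & _ & _ & Hp & _). apply Hp.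
      specialize (Hbt k Hj). unfold m in Hx. lra.
    + exact HL.
  - set (s := - (Sk (negb j) + eps)). set (m := - (Rmax M (Sk (negb j) + eps) + 1)).
    assert (Hx1 := Rmax_l M (Sk (negb j) + eps)). assert (Hx2 := Rmax_r M (Sk (negb j) + eps)).
    eapply Hmono; [|apply (rough_lower N D a (fun k s => - F k (- s)) (fun k y z t => - w k y z t) Ev s m HN HD Ha
      (coupled_opp _ _ _ _ _ (proj1 Hw)) Hwf)].
    + intros y t H1 k z Hz. specialize (H1 k z Hz). unfold s in H1. lra.
    + unfold m, s. lra.
    + intros L' HL'. eapply Hmono; [|apply (HM L' HL')].
      intros y t H1 k z Hz. specialize (H1 k z Hz). unfold m. lra.
    + intros k. apply loc_lipschitz_continuous, loc_lipschitz_flip, HF.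
    + intros k x Hx. destruct (HF k) as (_ & _ & _ & _ & _ & _ & Hn).
      specialize (Hn (- x)). specialize (Hbt k Hj). unfold s in Hx. specialize (Hn ltac:(lra)). lra.
    + exact HL.
Qed.

Lemma convergence_equal (N : nat) (D a l Sk : bool -> R) (F : bool -> R -> R) :
  (2 <= N)%nat -> (forall k, 0 < D k) -> (forall k, 0 < a k) ->
  (forall k, KPP_f (F k) (l k) (Sk k)) -> Sk true = Sk false ->
  exists W, steady_pair D a F W /\ forall Ev (w : bool -> (tang N -> R) -> R -> R -> R),
    window_filter Ev -> nonneg_solution N D a F w -> trapped Ev w -> converges_to Ev w W.
Proof.
  intros HN HD Ha HF HS. exists (fun k _ => Sk k). split.
  - intros k. destruct (HF k) as (HSk & _ & _ & _ & HFS & _). split; [|split; [|split]].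
    + exists (fun _ => 0), (fun _ => 0). intros z _. split; [|split].
      * apply (derivable_pt_lim_const (Sk k)).
      * apply (derivable_pt_lim_const 0).
      * rewrite HFS. ring.
    + exists 0. split.
      * apply is_derive_right. apply (is_derive_const (Sk k)).
      * destruct k; simpl; lra.
    + auto.
    + exists (Sk k). intros. lra.
  - intros Ev w Hwf Hw Ht eps L Heps HL.
    destruct (rough_bounds N D a l Sk F w Ev true HN HD Ha HF ltac:(simpl; lra) Hw Hwf Ht eps L Heps HL) as [H1 H2].
    destruct Hwf as (Hmono & Hand & _). eapply Hmono; [|apply (Hand _ _ H1 H2)].
    intros y t [H3 H4] k z Hz. specialize (H3 k z Hz). specialize (H4 k z Hz). simpl in H4.
    apply Rabs_le. destruct k; lra.
Qed.

(** Species [n] has an increasing profile tending to its level [Sk n]; species [j] a decreasing one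
    tending to [Sk j], and is replaced by its opposite so that the same half-line results serve
    both. Once the traces converge to [A0] and [B0], [robin_profile] gives the convergence at every
    height. *)
Lemma convergence_strict (N : nat) (D a l Sk : bool -> R) (F : bool -> R -> R) (j : bool) :
  (2 <= N)%nat -> (forall k, 0 < D k) -> (forall k, 0 < a k) ->
  (forall k, KPP_f (F k) (l k) (Sk k)) -> Sk j < Sk (negb j) ->
  exists W, steady_pair D a F W /\ forall Ev (w : bool -> (tang N -> R) -> R -> R -> R),
    window_filter Ev -> nonneg_solution N D a F w -> trapped Ev w -> converges_to Ev w W.
Proof.
  intros HN HD Ha HF HSjn.
  set (n := negb j) in *.
  set (Ft := fun k s => - F k (- s)).
  assert (HS : forall k, 0 < Sk k) by (intros k; apply HF).
  assert (HSj := HS j).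
  assert (Hln : loc_lipschitz (F n)) by apply HF.
  assert (Hlj : loc_lipschitz (Ft j)) by (apply loc_lipschitz_flip; apply HF).
  assert (Hcn := loc_lipschitz_continuous _ Hln). assert (Hcj := loc_lipschitz_continuous _ Hlj).
  assert (Hpn : forall s, 0 < s < Sk n -> 0 < F n s).
  { intros s Hs. destruct (HF n) as (_ & _ & _ & _ & _ & Hp & _). apply Hp. exact Hs. }
  assert (Hnn : forall s, Sk n < s < Sk n + 1 -> F n s < 0).
  { intros s Hs. destruct (HF n) as (_ & _ & _ & _ & _ & _ & Hn). apply Hn. lra. }
  assert (Hpj : forall s, s < - Sk j -> 0 < Ft j s).
  { intros s Hs. destruct (HF j) as (_ & _ & _ & _ & _ & _ & Hn). specialize (Hn (- s) ltac:(lra)). unfold Ft. lra. }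
  assert (Hnj : forall s, - Sk j < s < - Sk j + Sk j -> Ft j s < 0).
  { intros s Hs. destruct (HF j) as (_ & _ & _ & _ & _ & Hp & _). specialize (Hp (- s) ltac:(lra)). unfold Ft. lra. }
  destruct (interface_values (D j) (a j) (D n) (a n) (Sk j) (Sk n) (Ft j) (F n) (HD j) (Ha j) (HD n) (Ha n)
    ltac:(lra) Hcj Hcn Hpj Hpn) as (A0 & B0 & HA0 & HB0 & HBA & HAB).
  (* The orbit for the opposite of species [j] starts below all eventual values, since [w] is
     eventually at most [Sk n + 1 / 2]; [mj] leaves room below the starting level. *)
  set (mj := - (Sk n + 2)). set (q0j := - (Sk n + 1)).
  destruct (orbit_data_exists (D n) (F n) 0 (Sk j / 2) (Sk n) (HD n) Hln ltac:(lra) Hpn ltac:(apply HF)) as [Qn Hodn].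
  destruct (orbit_data_exists (D j) (Ft j) mj q0j (- Sk j) (HD j) Hlj ltac:(unfold mj, q0j; lra)
    ltac:(intros s Hs; apply Hpj; lra)
    ltac:(unfold Ft; rewrite Ropp_involutive; destruct (HF j) as (_ & _ & _ & _ & E & _); rewrite E; ring)) as [Qj Hodj].
  assert (HQn := Hodn). destruct HQn as (_ & _ & _ & HQn). assert (HQj := Hodj). destruct HQj as (_ & _ & _ & HQj).
  destruct (travel_pos _ _ _ _ B0 Qn HQn ltac:(lra)) as [Hzn HQzn]. set (zn := travel (D n) (F n) (Sk n) (Sk j / 2) B0) in *.
  destruct (travel_pos _ _ _ _ (- A0) Qj HQj ltac:(unfold q0j; lra)) as [Hzj HQzj].
  set (zj := travel (D j) (Ft j) (- Sk j) q0j (- A0)) in *.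
  set (W := fun k z => if Bool.eqb k n then Qn (z + zn) else - Qj (z + zj)).
  assert (HWn : forall z, W n z = Qn (z + zn)) by (intros; unfold W; now rewrite Bool.eqb_reflx).
  assert (HWj : forall z, W j z = - Qj (z + zj)) by (intros; unfold W, n; destruct j; reflexivity).
  assert (Hkn : forall k, k = n \/ k = j) by (intros k; unfold n; destruct k, j; auto).
  assert (Hnbn : negb n = j) by (unfold n; apply Bool.negb_involutive).
  exists W. split.
  - assert (Hn : forall z, 0 <= z -> 0 < W n z <= Sk n).
    { intros z Hz. rewrite HWn. assert (H := orbit_range_interior _ _ _ _ _ (z + zn) HQn ltac:(lra) ltac:(lra)). lra. }
    assert (Hj : forall z, 0 <= z -> 0 < W j z <= Sk n + 1).
    { intros z Hz. rewrite HWj. assert (H := orbit_range_interior _ _ _ _ _ (z + zj) HQj ltac:(unfold q0j; lra) ltac:(lra)).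
      unfold q0j in H. lra. }
    assert (EWn : W n = fun z => Qn (z + zn)) by (apply functional_extensionality; exact HWn).
    assert (EWj : W j = fun z => - Qj (z + zj)) by (apply functional_extensionality; exact HWj).
    intros k. destruct (Hkn k) as [->| ->].
    + split; [|split; [|split]].
      * exists (fun z => slope (D n) (F n) (Sk n) (Qn (z + zn))), (fun z => - F n (Qn (z + zn)) / D n).
        intros z Hz. destruct (orbit_translate_derivs _ _ _ _ _ zn _ z Hodn Hzn ltac:(lra)) as [H1 H2].
        rewrite EWn. split; [now apply is_derive_Reals|]. split; [now apply is_derive_Reals|].
        specialize (HD n). field. lra.
      * destruct (orbit_translate_derivs _ _ _ _ _ zn _ 0 Hodn Hzn ltac:(lra)) as [H1 H2].
        exists (slope (D n) (F n) (Sk n) (Qn (0 + zn))). split; [rewrite EWn; now apply is_derive_right|].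
        rewrite Hnbn, HWj, HWn, !Rplus_0_l, HQzn, HQzj. lra.
      * intros z Hz. now apply Hn.
      * exists (Sk n). intros z Hz. now apply Hn.
    + split; [|split; [|split]].
      * exists (fun z => - slope (D j) (Ft j) (- Sk j) (Qj (z + zj))), (fun z => - (- Ft j (Qj (z + zj)) / D j)).
        intros z Hz. destruct (orbit_translate_derivs _ _ _ _ _ zj _ z Hodj Hzj ltac:(lra)) as [H1 H2].
        rewrite EWj. split; [apply is_derive_Reals; now apply (is_derive_opp (fun z => Qj (z + zj)))|].
        split; [apply is_derive_Reals; now apply (is_derive_opp (fun z => slope (D j) (Ft j) (- Sk j) (Qj (z + zj))))|].
        unfold Ft. specialize (HD j). field. lra.
      * destruct (orbit_translate_derivs _ _ _ _ _ zj _ 0 Hodj Hzj ltac:(lra)) as [H1 H2].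
        exists (- slope (D j) (Ft j) (- Sk j) (Qj (0 + zj))).
        split; [rewrite EWj; apply is_derive_right; now apply (is_derive_opp (fun z => Qj (z + zj)))|].
        fold n. rewrite HWj, HWn, !Rplus_0_l, HQzn, HQzj. lra.
      * intros z Hz. now apply Hj.
      * exists (Sk n + 1). intros z Hz. now apply Hj.
  - intros Ev w Hwf Hw Ht.
    assert (Hrb := rough_bounds N D a l Sk F w Ev j HN HD Ha HF ltac:(fold n; lra) Hw Hwf Ht). fold n in Hrb.
    assert (Hwf' := Hwf). destruct Hwf' as (Hmono & Hand & _).
    assert (Hwo := coupled_opp _ _ _ _ _ (proj1 Hw)). fold Ft in Hwo.
    set (nw := fun k y z t => - w k y z t) in *.
    assert (Hlown : forall L, 0 < L -> Ev (fun y t => forall z, 0 <= z <= L -> Sk j / 2 < w n y z t)).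
    { intros L HL. eapply Hmono; [|apply (proj1 (Hrb (Sk j / 4) L ltac:(lra) HL))].
      intros y t H z Hz. specialize (H n z Hz). lra. }
    assert (Hupn : forall eps L, 0 < eps -> 0 < L -> Ev (fun y t => forall z, 0 <= z <= L -> w n y z t <= Sk n + eps)).
    { intros eps L He HL. eapply Hmono; [|apply (proj2 (Hrb eps L He HL))]. intros y t H z Hz. now apply H. }
    assert (Hlowj : forall L, 0 < L -> Ev (fun y t => forall z, 0 <= z <= L -> q0j < nw j y z t)).
    { intros L HL. eapply Hmono; [|apply (proj2 (Hrb (1 / 2) L ltac:(lra) HL))].
      intros y t H z Hz. specialize (H j z Hz). unfold nw, q0j. lra. }
    assert (Hupj : forall eps L, 0 < eps -> 0 < L -> Ev (fun y t => forall z, 0 <= z <= L -> nw j y z t <= - Sk j + eps)).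
    { intros eps L He HL. eapply Hmono; [|apply (proj1 (Hrb eps L He HL))].
      intros y t H z Hz. specialize (H j z Hz). unfold nw. lra. }
    assert (Hb0 : forall k eps, 0 < eps -> Ev (fun y t => Sk j - eps <= w k y 0 t) /\ Ev (fun y t => w k y 0 t <= Sk n + eps)).
    { intros k eps He. destruct (Hrb eps 1 He ltac:(lra)) as [H1 H2]. split.
      - eapply Hmono; [|exact H1]. intros y t H. apply H. lra.
      - eapply Hmono; [|exact H2]. intros y t H. apply H. lra. }
    assert (Hlim : forall k, exists lo hi, Sk j <= lo /\ lo <= hi /\ hi <= Sk n /\
      (forall eps, 0 < eps -> Ev (fun y t => lo - eps <= w k y 0 t)) /\
      (forall s, Ev (fun y t => s <= w k y 0 t) -> s <= lo) /\
      (forall eps, 0 < eps -> Ev (fun y t => w k y 0 t <= hi + eps)) /\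
      (forall s, Ev (fun y t => w k y 0 t <= s) -> hi <= s)).
    { intros k. destruct (Hb0 k 1 ltac:(lra)) as [E1 E2].
      destruct (ev_lower_limit Ev (fun y t => w k y 0 t) _ _ Hwf E1 E2) as (lo & _ & Hlo1 & Hlo2).
      destruct (ev_lower_limit Ev (fun y t => - w k y 0 t) (- (Sk n + 1)) (- (Sk j - 1)) Hwf) as (lo' & _ & Hlo1' & Hlo2').
      { eapply Hmono; [|exact E2]. intros y t H. lra. }
      { eapply Hmono; [|exact E1]. intros y t H. lra. }
      assert (Hu : forall eps, 0 < eps -> Ev (fun y t => w k y 0 t <= - lo' + eps)).
      { intros eps He. eapply Hmono; [|apply (Hlo1' eps He)]. intros y t H. lra. }
      exists lo, (- lo'). split; [|split; [|split; [|split; [|split; [|split]]]]]; auto.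
      - apply le_epsilon. intros eps He. assert (Sk j - eps <= lo); [|lra]. apply Hlo2. apply Hb0. exact He.
      - apply le_epsilon. intros eps He.
        assert (lo - eps / 2 <= - lo' + eps / 2); [|lra].
        apply (ev_le Ev (fun y t => w k y 0 t)); auto; [apply Hlo1|apply Hu]; lra.
      - apply le_epsilon. intros eps He. assert (- (Sk n + eps) <= lo'); [|lra]. apply Hlo2'.
        eapply Hmono; [|apply (proj2 (Hb0 k eps He))]. intros y t H. lra.
      - intros s Hs. assert (- s <= lo'); [|lra]. apply Hlo2'. eapply Hmono; [|exact Hs]. intros y t H. lra. }
    destruct (Hlim j) as (Alo & Ahi & A1 & A2 & A3 & A4 & A5 & A6 & A7).
    destruct (Hlim n) as (Blo & Bhi & B1 & B2 & B3 & B4 & B5 & B6 & B7).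
    destruct (robin_balance N D a F w Ev n 0 (Sk j / 2) (Sk n) 1 Qn Blo Bhi Alo Ahi HN HD Ha (proj1 Hw) Hwf Hodn
      ltac:(lra) Hnn Hlown Hupn B5 B7 ltac:(rewrite Hnbn; exact A4) ltac:(rewrite Hnbn; exact A6)
      ltac:(lra) ltac:(lra) ltac:(lra)) as [C1 C2].
    destruct (robin_balance N D a Ft nw Ev j mj q0j (- Sk j) (Sk j) Qj (- Ahi) (- Alo) (- Bhi) (- Blo) HN HD Ha Hwo Hwf Hodj
      ltac:(lra) Hnj Hlowj Hupj) as [C3 C4]; try (unfold q0j; lra).
    { intros s Hs. assert (Ahi <= - s); [|lra]. apply A7. eapply Hmono; [|exact Hs]. intros y t H. unfold nw in H. lra. }
    { intros s Hs. assert (- s <= Alo); [|lra]. apply A5. eapply Hmono; [|exact Hs]. intros y t H. unfold nw in H. lra. }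
    { intros eps He. fold n. eapply Hmono; [|apply (B6 eps He)]. intros y t H. unfold nw. lra. }
    { intros eps He. fold n. eapply Hmono; [|apply (B4 eps He)]. intros y t H. unfold nw. lra. }
    (* The balances read [a n * pn Blo <= Blo - Alo <= a j * pj (- Alo)] and [a j * pj (- Ahi) <=
       Bhi - Ahi <= a n * pn Bhi]. As [pn] decreases with the trace while [pj (- A)] increases with
       [A], the limits must coincide, and the same monotonicities identify them with [A0] and
       [B0]. *)
    set (pn := slope (D n) (F n) (Sk n)) in *. set (pj := slope (D j) (Ft j) (- Sk j)) in *.
    assert (Mn : forall x y, 0 < x -> x < y <= Sk n -> a n * pn y < a n * pn x).
    { intros x y Hx Hy. apply Rmult_lt_compat_l; [apply Ha|]. apply slope_decreasing; auto.
      intros s Hs. apply Hpn. lra. }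
    assert (Mj : forall x y, Sk j <= x -> x < y -> a j * pj (- x) < a j * pj (- y)).
    { intros x y Hx Hy. apply Rmult_lt_compat_l; [apply Ha|]. apply slope_decreasing; auto; [lra|].
      intros s Hs. apply Hpj. lra. }
    assert (EA : Alo = Ahi).
    { destruct A2 as [H|H]; [exfalso|exact H]. specialize (Mj Alo Ahi A1 H).
      assert (a n * pn Bhi <= a n * pn Blo) by (destruct B2 as [H2| ->]; [left; apply Mn; lra|lra]). lra. }
    assert (EB : Blo = Bhi).
    { destruct B2 as [H|H]; [exfalso|exact H]. specialize (Mn Blo Bhi ltac:(lra) ltac:(lra)). rewrite EA in *. lra. }
    subst Ahi. subst Bhi.
    assert (EA0 : Alo = A0).
    { destruct (Rtotal_order Alo A0) as [H|[H|H]]; [exfalso|exact H|exfalso].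
      - specialize (Mj Alo A0 A1 H). specialize (Mn Blo B0 ltac:(lra) ltac:(lra)). lra.
      - specialize (Mj A0 Alo ltac:(lra) H). specialize (Mn B0 Blo ltac:(lra) ltac:(lra)). lra. }
    assert (EB0 : Blo = B0) by (subst Alo; lra).
    subst Alo. subst Blo.
    intros eps L Heps HL.
    assert (P1 := robin_profile N D a F w Ev n 0 (Sk j / 2) (Sk n) 1 Qn A0 zn HN HD Ha (proj1 Hw) Hwf Hodn
      ltac:(lra) Hnn Hlown Hupn ltac:(rewrite Hnbn; exact A4) ltac:(rewrite Hnbn; exact A6) Hzn
      ltac:(rewrite HQzn; exact HBA) eps L Heps HL).
    assert (P2 : Ev (fun y t => forall z, 0 <= z <= L -> Rabs (nw j y z t - Qj (z + zj)) <= eps)).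
    { apply (robin_profile N D a Ft nw Ev j mj q0j (- Sk j) (Sk j) Qj (- B0) zj HN HD Ha Hwo Hwf Hodj); auto.
      - intros e He. fold n. eapply Hmono; [|apply (B6 e He)]. intros y t H. unfold nw. lra.
      - intros e He. fold n. eapply Hmono; [|apply (B4 e He)]. intros y t H. unfold nw. lra.
      - rewrite HQzj. exact HAB. }
    eapply Hmono; [|apply (Hand _ _ P1 P2)]. intros y t [H1 H2] k z Hz.
    destruct (Hkn k) as [->| ->].
    + rewrite HWn. now apply H1.
    + rewrite HWj. specialize (H2 z Hz). unfold nw in H2.
      replace (w j y z t - - Qj (z + zj)) with (- (- w j y z t - Qj (z + zj))) by ring. now rewrite Rabs_Ropp.
Qed.

Lemma convergence (N : nat) (D a l Sk : bool -> R) (F : bool -> R -> R) :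
  (2 <= N)%nat -> (forall k, 0 < D k) -> (forall k, 0 < a k) ->
  (forall k, KPP_f (F k) (l k) (Sk k)) ->
  exists W, steady_pair D a F W /\ forall Ev (w : bool -> (tang N -> R) -> R -> R -> R),
    window_filter Ev -> nonneg_solution N D a F w -> trapped Ev w -> converges_to Ev w W.
Proof.
  intros HN HD Ha HF. destruct (Rtotal_order (Sk true) (Sk false)) as [H|[H|H]].
  - apply (convergence_strict N D a l Sk F true); auto.
  - apply (convergence_equal N D a l Sk F); auto.
  - apply (convergence_strict N D a l Sk F false); auto.
Qed.

(** * Uniqueness of the steady state *)

(** A steady pair is unconstrained at negative arguments; composition with [Rmax 0] gives a function
    continuous on the whole line. At 0 continuity comes from the right derivative. *)
Lemma steady_continuous (D a : bool -> R) (F : bool -> R -> R) (W : bool -> R -> R) (k : bool) :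
  steady_pair D a F W -> forall x, continuous (fun x => W k (Rmax 0 x)) x.
Proof.
  intros HW x. destruct (HW k) as ((W1 & W2 & Hd) & (p & Hp & _) & _).
  apply filterlim_locally. intros eps.
  assert (Hgoal : exists dl, 0 < dl /\ forall y, Rabs (y - x) < dl -> Rabs (W k (Rmax 0 y) - W k (Rmax 0 x)) < eps).
  { destruct (Rlt_le_dec 0 x) as [Hx|Hx].
    - destruct (Hd x Hx) as [H _]. apply is_derive_Reals in H.
      assert (Hc : continuous (W k) x) by (apply (ex_derive_continuous (W k)); eexists; exact H).
      destruct (continuous_near (W k) x eps Hc (cond_pos eps)) as [dl [Hdl Hn]].
      exists (Rmin dl x). split; [apply Rmin_glb_lt; lra|]. intros y Hy.
      pose proof (Rmin_l dl x). pose proof (Rmin_r dl x).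
      assert (Hy' := Rabs_def2 _ _ Hy). rewrite !Rmax_right by lra. apply Hn. lra.
    - rewrite (Rmax_left 0 x) by lra.
      destruct (Hp 1 ltac:(lra)) as [d1 [Hd1 Hq]].
      set (r := eps / (Rabs p + 2)). assert (Hpp := Rabs_pos p).
      assert (Hr : 0 < r) by (apply Rdiv_lt_0_compat; [apply cond_pos|lra]).
      exists (Rmin d1 r). split; [apply Rmin_glb_lt; lra|]. intros y Hy.
      pose proof (Rmin_l d1 r). pose proof (Rmin_r d1 r). apply Rabs_def2 in Hy.
      destruct (Rle_lt_dec y 0) as [Hy0|Hy0].
      + rewrite Rmax_left, Rminus_diag, Rabs_R0 by lra. apply cond_pos.
      + rewrite Rmax_right by lra. specialize (Hq y ltac:(lra)). rewrite Rplus_0_l in Hq.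
        assert (E : W k y - W k 0 = y * (((W k y - W k 0) / y - p) + p)) by (field; lra).
        rewrite E, Rabs_mult, (Rabs_pos_eq y) by lra.
        assert (Rabs ((W k y - W k 0) / y - p + p) <= 1 + Rabs p) by (eapply Rle_trans; [apply Rabs_triang|lra]).
        apply Rle_lt_trans with (y * (1 + Rabs p)); [apply Rmult_le_compat_l; lra|].
        apply Rlt_le_trans with (r * (Rabs p + 2)); [|unfold r; apply Req_le; field; lra].
        nra. }
  destruct Hgoal as [dl [Hdl H]]. exists (mkposreal dl Hdl). intros y Hy. exact (H y Hy).
Qed.

(** Uniform in [y]: the filter suited to solutions that depend neither on [y] nor on [t]. *)
Definition always_after {N : nat} (P : (tang N -> R) -> R -> Prop) : Prop :=
  exists T, forall t y, T < t -> P y t.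

Lemma always_after_filter (N : nat) : window_filter (@always_after N).
Proof.
  split; [|split; [|split; [|split]]].
  - intros P Q H [T HT]. exists T. auto.
  - intros P Q [T1 H1] [T2 H2]. exists (Rmax T1 T2). intros t y Ht.
    pose proof (Rmax_l T1 T2). pose proof (Rmax_r T1 T2). split; [apply H1|apply H2]; lra.
  - intros [T HT]. apply (HT (T + 1) (fun _ => 0)). lra.
  - intros T. exists T. auto.
  - intros P r tau [T HT]. exists (T + tau). intros t y Ht y' t' _ Ht'. apply HT. lra.
Qed.

Lemma steady_is_solution (N : nat) (D a : bool -> R) (F : bool -> R -> R) (W : bool -> R -> R) :
  steady_pair D a F W -> nonneg_solution N D a F (fun k _ z _ => W k z).
Proof.
  intros HW. split; [split; [|split]|].
  - intros k. destruct (HW k) as ((W1 & W2 & Hd) & _).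
    exists (fun _ _ _ => 0), (fun _ z _ => W1 z), (fun _ z _ => W2 z), (fun _ _ _ _ => 0), (fun _ _ _ _ => 0).
    intros y z t Hz Ht. destruct (Hd z Hz) as (H1 & H2 & H3).
    split; [apply (derivable_pt_lim_const (W k z))|]. split; [exact H1|]. split; [exact H2|]. split.
    + intros l Hl. split; [apply (derivable_pt_lim_const (W k z))|apply (derivable_pt_lim_const 0)].
    + rewrite sum_cte, Rmult_0_l, Rplus_0_l. lra.
  - intros k y z t Hz Ht eps He.
    destruct (continuous_near _ z eps (steady_continuous D a F W k HW z) He) as [dl [Hdl H]].
    exists dl. split; [assumption|]. intros y' z' t' Hz' _ _ Hzz _.
    specialize (H z' Hzz). now rewrite !Rmax_right in H by lra.
  - intros k y t Ht. destruct (HW k) as (_ & H & _). exact H.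
  - intros k y z t Hz Ht. left. now apply HW.
Qed.

(** A steady state is a trapped solution, so it converges to [W] along [always_after]; being
    independent of time it is within every [eps] of [W]. *)
Lemma steady_unique (N : nat) (D a : bool -> R) (F : bool -> R -> R) (W W' : bool -> R -> R) :
  (forall Ev (w : bool -> (tang N -> R) -> R -> R -> R),
    window_filter Ev -> nonneg_solution N D a F w -> trapped Ev w -> converges_to Ev w W) ->
  steady_pair D a F W' -> forall k z, 0 <= z -> W' k z = W k z.
Proof.
  intros Hconv HW' k z Hz.
  assert (Htr : trapped (@always_after N) (fun k _ z _ => W' k z)).
  { split.
    - destruct (HW' true) as (_ & _ & _ & M1 & HM1). destruct (HW' false) as (_ & _ & _ & M2 & HM2).
      exists (Rmax M1 M2). intros L HL. exists 0. intros t y _ k' z' Hz'.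
      pose proof (Rmax_l M1 M2). pose proof (Rmax_r M1 M2).
      destruct k'; [specialize (HM1 z' ltac:(lra))|specialize (HM2 z' ltac:(lra))]; lra.
    - intros L HL.
      assert (Hmin : forall k, exists dl, 0 < dl /\ forall z, 0 <= z <= L -> dl <= W' k z).
      { intros k'. destruct (positive_min (fun x => W' k' (Rmax 0 x)) 0 L ltac:(lra)) as [dl [Hdl H]].
        - now apply (steady_continuous D a F).
        - intros s Hs. rewrite Rmax_right by lra. apply HW'. lra.
        - exists dl. split; [assumption|]. intros z' Hz'. specialize (H z' Hz'). now rewrite Rmax_right in H by lra. }
      destruct (Hmin true) as [d1 [Hd1 H1]]. destruct (Hmin false) as [d2 [Hd2 H2]].
      exists (Rmin d1 d2). split; [now apply Rmin_glb_lt|]. exists 0. intros t y _ k' z' Hz'.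
      pose proof (Rmin_l d1 d2). pose proof (Rmin_r d1 d2).
      destruct k'; [specialize (H1 z' Hz')|specialize (H2 z' Hz')]; lra. }
  specialize (Hconv always_after _ (always_after_filter N) (steady_is_solution N D a F W' HW') Htr).
  apply Rminus_diag_uniq. apply Rabs_eq_0. apply Rle_antisym; [|apply Rabs_pos].
  apply le_epsilon. intros eps He.
  destruct (Hconv eps (z + 1) He ltac:(lra)) as [T HT].
  specialize (HT (T + 1) (fun _ => 0) ltac:(lra) k z ltac:(lra)). lra.
Qed.

(** * Global bounds for solutions *)

Definition locally_bounded {N : nat} (w : bool -> (tang N -> R) -> R -> R -> R) : Prop :=
  forall T, 0 < T -> exists M, forall k y z t, 0 <= z -> 0 <= t <= T -> Rabs (w k y z t) <= M.

(** The case [A = 0] of [exponential_upper] for [- w]; local Lipschitz continuity gives the linear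
    bound on the reaction at negative values, whose sign is not prescribed. *)
Lemma solution_nonneg (N : nat) (D a l Sk : bool -> R) (F : bool -> R -> R)
  (w : bool -> (tang N -> R) -> R -> R -> R) :
  (2 <= N)%nat -> (forall k, 0 < D k) -> (forall k, 0 < a k) -> (forall k, KPP_f (F k) (l k) (Sk k)) ->
  coupled N D a F w -> locally_bounded w -> (forall k y z, 0 <= z -> 0 <= w k y z 0) ->
  nonneg_solution N D a F w.
Proof.
  intros HN HD Ha HF Hw Hb Hini. split; [assumption|]. intros k y z t Hz Ht.
  destruct (Hb (t + 1) ltac:(lra)) as [M HM].
  set (M' := Rabs M + 1). assert (HM' : 0 < M') by (unfold M'; pose proof (Rabs_pos M); lra).
  assert (HLip : forall k, exists L, forall s, 0 < s <= M' -> - F k (- s) <= L * s).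
  { intros k'. destruct (HF k') as (_ & Hl & _ & H0 & _). destruct (Hl M' HM') as [L HL].
    exists L. intros s Hs. specialize (HL (- s) 0 ltac:(rewrite Rabs_Ropp, Rabs_pos_eq; lra) ltac:(rewrite Rabs_R0; lra)).
    rewrite H0, !Rminus_0_r, Rabs_Ropp, (Rabs_pos_eq s) in HL by lra.
    pose proof (Rle_abs (- F k' (- s))). rewrite Rabs_Ropp in H. lra. }
  apply choice in HLip. destruct HLip as [L HL].
  assert (H := exponential_upper N 0 D a L (fun k s => - F k (- s)) (fun k y z t => - w k y z t) (t + 1) M' 0 0 0
    HN ltac:(lia) HD Ha (coupled_opp _ _ _ _ _ Hw) ltac:(lra) (Rle_refl 0)).
  specialize (H ltac:(intros k' y' z' t' Hz' Ht'; specialize (HM k' y' z' t' Hz' Ht');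
    apply Rabs_le_between in HM; unfold M'; pose proof (Rle_abs M); lra)).
  specialize (H ltac:(intros k' s Hs; now apply HL)).
  specialize (H ltac:(intros k'; lra)).
  specialize (H ltac:(intros k' y' z' Hz'; specialize (Hini k' y' z' Hz'); lra)).
  specialize (H k y z t Hz ltac:(lra)). lra.
Qed.

(** Above [Mg] both reactions are negative. With [K' = 0] the paraboloid does not vary in time, so
    the window can be the whole interval [[0, t]]: the local bound on that interval affects the
    radius [R0] only, not the conclusion. *)
Lemma solution_bounded (N : nat) (D a l Sk : bool -> R) (F : bool -> R -> R)
  (w : bool -> (tang N -> R) -> R -> R -> R) :
  (2 <= N)%nat -> (forall k, 0 < D k) -> (forall k, 0 < a k) -> (forall k, KPP_f (F k) (l k) (Sk k)) ->
  coupled N D a F w -> locally_bounded w ->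
  exists M, forall k y z t, 0 <= z -> 0 < t -> w k y z t <= M.
Proof.
  intros HN HD Ha HF Hw Hb. destruct (Hb 1 ltac:(lra)) as [M1 HM1].
  set (Mg := Rmax M1 (Rmax (Sk true) (Sk false)) + 1).
  assert (HMg : M1 < Mg /\ forall k, Sk k < Mg).
  { pose proof (Rmax_l M1 (Rmax (Sk true) (Sk false))). pose proof (Rmax_r M1 (Rmax (Sk true) (Sk false))).
    pose proof (Rmax_l (Sk true) (Sk false)). pose proof (Rmax_r (Sk true) (Sk false)).
    unfold Mg. split; [lra|]. intros []; lra. }
  exists Mg. intros k y z t Hz Ht. destruct (Hb t Ht) as [M HM].
  set (m := - (Rmax M Mg + 1)). set (s := - Mg).
  assert (Hx1 := Rmax_l M Mg). assert (Hx2 := Rmax_r M Mg).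
  assert (Hcl : forall k x, continuous (fun s => - F k (- s)) x).
  { intros k'. apply loc_lipschitz_continuous, loc_lipschitz_flip, HF. }
  assert (Hcp : forall k x, m <= x <= s -> 0 < - F k (- x)).
  { intros k' x Hx. destruct (HF k') as (_ & _ & _ & _ & _ & _ & Hn). destruct HMg as [_ HMg].
    specialize (HMg k'). unfold s in Hx. specialize (Hn (- x) ltac:(lra)). lra. }
  destruct (positive_min _ m s ltac:(unfold m, s; lra) (Hcl true) (Hcp true)) as [c1 [Hc1 H1]].
  destruct (positive_min _ m s ltac:(unfold m, s; lra) (Hcl false) (Hcp false)) as [c2 [Hc2 H2]].
  set (c0 := Rmin c1 c2). assert (Hc0 : 0 < c0) by now apply Rmin_glb_lt.
  set (K := s - m). assert (HK : 0 < K) by (unfold K, s, m; lra).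
  assert (HNR : 0 < INR N) by (apply lt_0_INR; lia).
  set (Dm := D true + D false).
  assert (HDm : 0 < Dm) by (unfold Dm; pose proof (HD true); pose proof (HD false); lra).
  destruct (large_square (2 * INR N * Dm * K / c0)) as [R0 [HR0 HRR]].
  { apply Rdiv_le_0_compat; [|assumption]. apply Rmult_le_pos; [|lra]. apply Rmult_le_pos; lra. }
  specialize (HRR R0 (Rle_refl _)). assert (HR2 : 0 < R0 ^ 2) by now apply pow_lt.
  assert (Hpos : forall z, 0 < z -> s <= - w k y z t).
  { intros z' Hz'. left.
    apply (paraboloid_lower N D a (fun k s => - F k (- s)) (fun k y z t => - w k y z t) (fun _ => true)
      y z' R0 t t s m c0 K 0); auto; try lra.
    - now apply coupled_opp.
    - unfold K. lra.
    - intros k' y' z'' t' _ _ Hz'' Ht'. specialize (HM k' y' z'' t' ltac:(lra) ltac:(lra)).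
      apply Rabs_le_between in HM. unfold m. lra.
    - intros k' y' z'' _ _ Hz''. specialize (HM1 k' y' z'' 0 ltac:(lra) ltac:(lra)).
      apply Rabs_le_between in HM1. rewrite Rminus_diag. unfold s. lra.
    - intros k' x _ Hx. pose proof (Rmin_l c1 c2). pose proof (Rmin_r c1 c2).
      specialize (H1 x Hx). specialize (H2 x Hx). unfold c0. destruct k'; simpl in *; lra.
    - intros k' _. unfold Rdiv at 1. rewrite Rmult_0_l, Rplus_0_l.
      assert (HDk : D k' <= Dm) by (unfold Dm; pose proof (HD true); pose proof (HD false); destruct k'; lra).
      apply Rle_lt_trans with (2 * INR N * (Dm * (K / R0 ^ 2))).
      + apply Rmult_le_compat_l; [lra|]. apply Rmult_le_compat_r; [apply Rdiv_le_0_compat; lra|assumption].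
      + apply Rmult_lt_reg_r with (R0 ^ 2 / c0); [apply Rdiv_lt_0_compat; lra|].
        replace (2 * INR N * (Dm * (K / R0 ^ 2)) * (R0 ^ 2 / c0)) with (2 * INR N * Dm * K / c0) by (field; lra).
        replace (c0 * (R0 ^ 2 / c0)) with (R0 ^ 2) by (field; lra). assumption. }
  assert (s <= - w k y z t); [|unfold s in *; lra].
  destruct Hz as [Hz| <-]; [apply Hpos; lra|].
  apply (ge_at_boundary (fun y z t => - w k y z t)); [|lra|].
  - apply (coupled_opp N D a F w Hw).
  - intros z' Hz'. apply Hpos. lra.
Qed.

(** The centre is moved up by [dl / 2], so that the ball lies above the interface even if positivity
    is only known at [z = 0]. *)
Lemma initial_ball (N : nat) (w : bool -> (tang N -> R) -> R -> R -> R) (k : bool) (y : tang N -> R) (z : R) :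
  cont_on3 (fun z => 0 <= z) (w k) -> 0 <= z -> 0 < w k y z 0 ->
  exists zi ri A, 0 < ri <= zi /\ 0 < A /\ ball_ge w k y zi ri 0 A.
Proof.
  intros Hc Hz Hp. destruct (Hc y z 0 Hz (Rle_refl 0) (w k y z 0 / 2) ltac:(lra)) as [dl [Hdl H]].
  exists (z + dl / 2), (dl / 4), (w k y z 0 / 2). split; [lra|]. split; [lra|].
  intros y' z' Hz' Hd. pose proof (sqd_nonneg y' y). pose proof (pow2_ge_0 (z' - (z + dl / 2))).
  assert (Hzz : Rabs (z' - (z + dl / 2)) < dl / 4).
  { rewrite <- (Rabs_pos_eq (dl / 4)) by lra. apply Rsqr_lt_abs_0. rewrite !Rsqr_pow2. lra. }
  apply Rabs_def2 in Hzz.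
  specialize (H y' z' 0 Hz' (Rle_refl 0)).
  specialize (H ltac:(intros j; assert (Rabs (y' j - y j) < dl / 4) by (apply sqd_lt_coord; lra); lra)
    ltac:(apply Rabs_def1; lra) ltac:(rewrite Rminus_diag, Rabs_R0; lra)).
  apply Rabs_def2 in H. lra.
Qed.

Lemma KPP_f_linear_upper (F : R -> R) (l S s : R) : KPP_f F l S -> 0 < s -> F s <= l * s.
Proof.
  intros H Hs. assert (Hl := KPP_f_rate_pos _ _ _ H). destruct H as (HS & _ & _ & _ & HFS & Hp & Hn).
  assert (0 < l * s) by (apply Rmult_lt_0_compat; lra).
  destruct (Rtotal_order s S) as [H1|[H1|H1]].
  - apply Hp. lra.
  - subst. lra.
  - specialize (Hn s H1). lra.
Qed.

(** Exponentials travelling in both directions are used, one for each sign of the coordinate [i];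
    the factor [exp (al * R0)] in [A] makes both dominate the compactly supported data. *)
Lemma beyond_front (N i : nat) (D a l Sk : bool -> R) (F : bool -> R -> R)
  (w : bool -> (tang N -> R) -> R -> R -> R) (al cs M R0 : R) :
  (2 <= N)%nat -> (i < N - 1)%nat -> (forall k, 0 < D k) -> (forall k, 0 < a k) ->
  (forall k, KPP_f (F k) (l k) (Sk k)) -> coupled N D a F w -> locally_bounded w ->
  0 < al -> (forall k, D k * al ^ 2 + l k <= cs * al) -> 0 < M -> 0 < R0 ->
  (forall k y z, 0 <= z -> w k y z 0 <= M) ->
  (forall k y z, 0 <= z -> R0 < Rabs (coord y i) -> w k y z 0 <= 0) ->
  forall c, cs < c -> forall eps, 0 < eps ->
    exists T, forall t, T < t -> forall k y z, c * t <= Rabs (coord y i) -> 0 <= z -> w k y z t < eps.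
Proof.
  intros HN Hi HD Ha HF Hw Hb Hal Hcs HM HR HiniM Hini0 c Hc eps Heps.
  set (A := M * exp (al * R0)). assert (HA : 0 < A) by (apply Rmult_lt_0_compat; [assumption|apply exp_pos]).
  assert (Hexp : forall sg, sg = 1 \/ sg = -1 -> forall k y z t, 0 <= z -> 0 < t ->
    w k y z t <= A * exp (- (sg * al) * (coord y i - sg * cs * t))).
  { intros sg Hsg k y z t Hz Ht. destruct (Hb t Ht) as [Mt HMt].
    assert (Hss : sg * sg = 1) by (destruct Hsg; subst; ring).
    apply (exponential_upper N i D a l F w t Mt A (- (sg * al)) (sg * cs)); auto; try lra.
    - intros k' y' z' t' Hz' Ht'. specialize (HMt k' y' z' t' Hz' Ht'). apply Rabs_le_between in HMt. lra.
    - intros k' s Hs. apply KPP_f_linear_upper with (Sk k'); auto. lra.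
    - intros k'. specialize (Hcs k').
      replace (D k' * (- (sg * al)) ^ 2 + sg * cs * - (sg * al) + l k') with
        (D k' * (sg * sg) * al ^ 2 - (sg * sg) * cs * al + l k') by ring.
      rewrite Hss. assert (0 <= A * - (D k' * 1 * al ^ 2 - 1 * cs * al + l k')) by (apply Rmult_le_pos; lra). lra.
    - intros k' y' z' Hz'. destruct (Rle_lt_dec (Rabs (coord y' i)) R0) as [Hr|Hr].
      + apply Rle_trans with M; [now apply HiniM|]. unfold A. rewrite Rmult_assoc, <- exp_plus.
        rewrite <- (Rmult_1_r M) at 1. apply Rmult_le_compat_l; [lra|]. rewrite <- exp_0 at 1. apply exp_le_mono.
        apply Rabs_le_between in Hr. destruct Hsg as [->| ->]; nra.
      + apply Rle_trans with 0; [now apply Hini0|]. apply Rmult_le_pos; [lra|apply Rlt_le, exp_pos]. }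
  set (r := al * (c - cs)). assert (Hr : 0 < r) by (apply Rmult_lt_0_compat; lra).
  exists (Rmax 0 (ln (A / eps) / r)). intros t Ht k y z Hy Hz.
  assert (Ht0 := Rle_lt_trans _ _ _ (Rmax_l _ _) Ht). assert (Ht1 := Rle_lt_trans _ _ _ (Rmax_r _ _) Ht).
  assert (Hle : w k y z t <= A * exp (- (r * t))).
  { destruct (Rle_lt_dec 0 (coord y i)) as [Hyp|Hyn].
    - rewrite Rabs_pos_eq in Hy by assumption.
      eapply Rle_trans; [apply (Hexp 1 ltac:(auto) k y z t Hz Ht0)|]. apply Rmult_le_compat_l; [lra|]. apply exp_le_mono.
      assert (al * (c * t) <= al * coord y i) by (apply Rmult_le_compat_l; lra). unfold r. lra.
    - rewrite Rabs_left in Hy by assumption.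
      eapply Rle_trans; [apply (Hexp (-1) ltac:(auto) k y z t Hz Ht0)|]. apply Rmult_le_compat_l; [lra|]. apply exp_le_mono.
      assert (al * (c * t) <= al * - coord y i) by (apply Rmult_le_compat_l; lra). unfold r. lra. }
  eapply Rle_lt_trans; [exact Hle|].
  apply Rmult_lt_compat_r with (r := r) in Ht1; [|assumption].
  replace (ln (A / eps) / r * r) with (ln (A / eps)) in Ht1 by (field; lra).
  apply Rmult_lt_reg_r with (exp (r * t) / eps); [apply Rdiv_lt_0_compat; [apply exp_pos|assumption]|].
  replace (A * exp (- (r * t)) * (exp (r * t) / eps)) with (A / eps * exp (- (r * t) + r * t)) by (rewrite exp_plus; field; lra).
  replace (- (r * t) + r * t) with 0 by ring. rewrite exp_0, Rmult_1_r.
  replace (eps * (exp (r * t) / eps)) with (exp (r * t)) by (field; lra).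
  rewrite <- (exp_ln (A / eps)) by (apply Rdiv_lt_0_compat; lra). apply exp_increasing. lra.
Qed.

(** * Reduction to the symmetric system *)

Lemma KPP_f_scale (f : R -> R) (l S k : R) : 0 < k -> KPP_f f l S -> KPP_f (fun s => k * f (s / k)) l (k * S).
Proof.
  intros Hk (HS & Hl & Hd & H0 & HfS & Hp & Hn).
  assert (Hki : 0 < / k) by now apply Rinv_0_lt_compat.
  split; [now apply Rmult_lt_0_compat|]. split; [|split; [|split; [|split; [|split]]]].
  - intros M HM. destruct (Hl (M / k)) as [L HL]; [now apply Rdiv_lt_0_compat|]. exists L. intros x y Hx Hy.
    assert (E : forall x, Rabs x <= M -> Rabs (x / k) <= M / k).
    { intros s Hs. unfold Rdiv. rewrite Rabs_mult, (Rabs_pos_eq (/ k)) by lra. apply Rmult_le_compat_r; lra. }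
    specialize (HL (x / k) (y / k) (E x Hx) (E y Hy)).
    replace (k * f (x / k) - k * f (y / k)) with (k * (f (x / k) - f (y / k))) by ring.
    rewrite Rabs_mult, (Rabs_pos_eq k) by lra.
    replace (x / k - y / k) with ((x - y) / k) in HL by (field; lra).
    unfold Rdiv in HL at 3. rewrite Rabs_mult, (Rabs_pos_eq (/ k)) in HL by lra.
    apply Rle_trans with (k * (L * (Rabs (x - y) * / k))); [apply Rmult_le_compat_l; lra|].
    apply Req_le. field. lra.
  - intros eps He. destruct (Hd eps He) as [dl H].
    assert (Hdk : 0 < k * dl) by (apply Rmult_lt_0_compat; [assumption|apply cond_pos]).
    exists (mkposreal _ Hdk). simpl. intros h Hh Hhd.
    specialize (H (h / k) ltac:(apply Rmult_integral_contrapositive_currified; lra)).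
    assert (Hd2 : Rabs (h / k) < dl).
    { unfold Rdiv. rewrite Rabs_mult, (Rabs_pos_eq (/ k)) by lra.
      apply Rmult_lt_reg_l with k; [assumption|]. replace (k * (Rabs h * / k)) with (Rabs h) by (field; lra). exact Hhd. }
    specialize (H Hd2).
    replace ((k * f ((0 + h) / k) - k * f (0 / k)) / h) with ((f (0 + h / k) - f 0) / (h / k)); [exact H|].
    replace ((0 + h) / k) with (0 + h / k) by (field; lra). replace (0 / k) with 0 by (field; lra). field. lra.
  - replace (0 / k) with 0 by (field; lra). rewrite H0. ring.
  - replace (k * S / k) with S by (field; lra). rewrite HfS. ring.
  - intros s Hs. assert (Hsk : 0 < s / k < S).
    { split; [apply Rdiv_lt_0_compat; lra|]. apply Rmult_lt_reg_l with k; [assumption|].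
      replace (k * (s / k)) with s by (field; lra). lra. }
    destruct (Hp _ Hsk) as [H1 H2]. split; [apply Rmult_lt_0_compat; lra|].
    apply Rle_trans with (k * (l * (s / k))); [apply Rmult_le_compat_l; lra|]. apply Req_le. field. lra.
  - intros s Hs. assert (Hsk : S < s / k).
    { apply Rmult_lt_reg_l with k; [assumption|]. replace (k * (s / k)) with s by (field; lra). lra. }
    specialize (Hn _ Hsk). assert (0 < k * - f (s / k)) by (apply Rmult_lt_0_compat; lra). lra.
Qed.

Lemma derivable_pt_lim_reflect_scale (f : R -> R) (k x lx : R) :
  derivable_pt_lim f (- x) lx -> derivable_pt_lim (fun s => k * f (- s)) x (k * - lx).
Proof.
  intros H. apply is_derive_Reals. apply is_derive_Reals in H.
  apply (is_derive_scal (fun s => f (- s)) x k).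
  assert (H2 := is_derive_comp f (fun s => - s) x lx (-1) H ltac:(auto_derive; [auto|ring])).
  unfold scal in H2. simpl in H2. unfold mult in H2. simpl in H2.
  replace (- lx) with (-1 * lx) by ring. exact H2.
Qed.

Lemma left_right_deriv (f : R -> R) (lx : R) :
  has_left_deriv f 0 lx <-> has_right_deriv (fun s => f (- s)) 0 (- lx).
Proof.
  split; intros H eps He; destruct (H eps He) as [dl [Hd Hq]]; exists dl; (split; [assumption|]); intros x Hx;
    specialize (Hq (- x) ltac:(lra)).
  - replace (- (0 + x)) with (0 + - x) by ring. rewrite Ropp_0.
    replace ((f (0 + - x) - f 0) / x - - lx) with (- ((f (0 + - x) - f 0) / - x - lx)) by (field; lra).
    now rewrite Rabs_Ropp.
  - replace (- (0 + - x)) with (0 + x) in Hq by ring. rewrite Ropp_0 in Hq.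
    replace ((f (0 + x) - f 0) / x - lx) with (- ((f (0 + x) - f 0) / - x - - lx)) by (field; lra).
    now rewrite Rabs_Ropp.
Qed.

Definition pair_of {T : Type} (x y : T) : bool -> T := fun k => if k then x else y.

Definition reflected {N : nat} (mu nu : R) (u v : (tang N -> R) -> R -> R -> R) :
  bool -> (tang N -> R) -> R -> R -> R :=
  fun k y z t => if k then mu * u y (- z) t else nu * v y z t.

Definition scaled_reaction (mu nu : R) (g f : R -> R) : bool -> R -> R :=
  fun k s => if k then mu * g (s / mu) else nu * f (s / nu).

Lemma classical_eq_scale (N : nat) (Dc k : R) (h : R -> R) (w : (tang N -> R) -> R -> R -> R) : 0 < k ->
  classical_eq N (fun z => 0 < z) Dc h w ->
  classical_eq N (fun z => 0 < z) Dc (fun s => k * h (s / k)) (fun y z t => k * w y z t).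
Proof.
  intros Hk (wt & wz & wzz & wy & wyy & H).
  exists (fun y z t => k * wt y z t), (fun y z t => k * wz y z t), (fun y z t => k * wzz y z t),
    (fun l y z t => k * wy l y z t), (fun l y z t => k * wyy l y z t).
  intros y z t Hz Ht. destruct (H y z t Hz Ht) as (H1 & H2 & H3 & H4 & H5).
  split; [now apply (derivable_pt_lim_scal (fun s => w y z s))|].
  split; [now apply (derivable_pt_lim_scal (fun s => w y s t))|].
  split; [now apply (derivable_pt_lim_scal (fun s => wz y s t))|]. split.
  - intros l Hl. destruct (H4 l Hl) as [A1 A2].
    split; [now apply (derivable_pt_lim_scal (fun s => w (upd y l s) z t))|].
    now apply (derivable_pt_lim_scal (fun s => wy l (upd y l s) z t)).
  - replace (k * w y z t / k) with (w y z t) by (field; lra). rewrite H5.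
    rewrite (sum_eq (fun l => k * wyy l y z t) (fun l => wyy l y z t * k)) by (intros; ring).
    rewrite <- (scal_sum (fun l => wyy l y z t)). ring.
Qed.

Lemma classical_eq_reflect (N : nat) (Dc : R) (h : R -> R) (w : (tang N -> R) -> R -> R -> R) :
  classical_eq N (fun z => z < 0) Dc h w ->
  classical_eq N (fun z => 0 < z) Dc h (fun y z t => w y (- z) t).
Proof.
  intros (wt & wz & wzz & wy & wyy & H).
  exists (fun y z t => wt y (- z) t), (fun y z t => - wz y (- z) t), (fun y z t => wzz y (- z) t),
    (fun l y z t => wy l y (- z) t), (fun l y z t => wyy l y (- z) t).
  intros y z t Hz Ht. destruct (H y (- z) t ltac:(lra) Ht) as (H1 & H2 & H3 & H4 & H5).
  split; [exact H1|]. split; [|split; [|split; [exact H4|exact H5]]].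
  - assert (H6 := derivable_pt_lim_reflect_scale (fun s => w y s t) 1 z _ H2).
    replace (fun s => w y (- s) t) with (fun s => 1 * w y (- s) t) by (apply functional_extensionality; intros; ring).
    replace (- wz y (- z) t) with (1 * - wz y (- z) t) by ring. exact H6.
  - assert (H6 := derivable_pt_lim_reflect_scale (fun s => wz y s t) (-1) z _ H3).
    replace (fun s => - wz y (- s) t) with (fun s => -1 * wz y (- s) t) by (apply functional_extensionality; intros; ring).
    replace (wzz y (- z) t) with (-1 * - wzz y (- z) t) by ring. exact H6.
Qed.

Lemma cont_on3_scale {N : nat} (P : R -> Prop) (k : R) (w : (tang N -> R) -> R -> R -> R) : 0 < k ->
  cont_on3 P w -> cont_on3 P (fun y z t => k * w y z t).
Proof.
  intros Hk H y z t Hz Ht eps He. destruct (H y z t Hz Ht (eps / k) ltac:(apply Rdiv_lt_0_compat; lra)) as [dl [Hd Hq]].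
  exists dl. split; [assumption|]. intros y' z' t' A1 A2 A3 A4 A5. specialize (Hq y' z' t' A1 A2 A3 A4 A5).
  rewrite <- Rmult_minus_distr_l, Rabs_mult, (Rabs_pos_eq k) by lra.
  apply Rmult_lt_compat_l with (r := k) in Hq; [|assumption].
  replace (k * (eps / k)) with eps in Hq by (field; lra). exact Hq.
Qed.

(** Reflection turns the left derivative [du] into the right derivative [- mu * du] of the first
    component, so [D * du] is [- (D / mu)] times it: each coefficient [a k] is a diffusivity divided
    by an exchange rate. *)
Lemma coupled_reflected (N : nat) (D d mu nu : R) (g f : R -> R) u0 v0 u v :
  0 < mu -> 0 < nu -> solves_H N D d mu nu g f u0 v0 u v ->
  coupled N (pair_of D d) (pair_of (D / mu) (d / nu)) (scaled_reaction mu nu g f) (reflected mu nu u v).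
Proof.
  intros Hmu Hnu (Hu & Hv & Hcu & Hcv & Hif & _). split; [|split].
  - intros []; simpl.
    + apply (classical_eq_scale N D mu g (fun y z t => u y (- z) t)); [assumption|]. now apply classical_eq_reflect.
    + now apply (classical_eq_scale N d nu f v).
  - intros []; simpl.
    + apply (cont_on3_scale _ mu (fun y z t => u y (- z) t)); [assumption|].
      intros y z t Hz Ht eps He. destruct (Hcu y (- z) t ltac:(lra) Ht eps He) as [dl [Hd H]].
      exists dl. split; [assumption|]. intros y' z' t' A1 A2 A3 A4 A5. apply H; auto; [lra|].
      replace (- z' - - z) with (- (z' - z)) by ring. now rewrite Rabs_Ropp.
    + now apply (cont_on3_scale _ nu v).
  - intros k y t Ht. destruct (Hif y t Ht) as (du & dv & H1 & H2 & H3 & H4). destruct k; simpl; rewrite Ropp_0.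
    + exists (mu * - du). split.
      * apply (has_right_deriv_scal (fun s => u y (- s) t)).
        now apply (left_right_deriv (fun s => u y s t)).
      * replace (- (D / mu) * (mu * - du)) with (D * du) by (field; lra). exact H3.
    + exists (nu * dv). split; [now apply has_right_deriv_scal|].
      replace (- (d / nu) * (nu * dv)) with (- d * dv) by (field; lra). exact H4.
Qed.

Lemma steady_pair_of_xN (D d mu nu : R) (g f : R -> R) (U V : R -> R) : 0 < mu -> 0 < nu ->
  steady_xN D d mu nu g f U V ->
  steady_pair (pair_of D d) (pair_of (D / mu) (d / nu)) (scaled_reaction mu nu g f)
    (fun k z => if k then mu * U (- z) else nu * V z).
Proof.
  intros Hmu Hnu ((U1 & U2 & V1 & V2 & HU & HV) & (dU & dV & A1 & A2 & A3 & A4) & Up & Vp & (M & HM)).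
  intros []; simpl; (split; [|split; [|split]]).
  - exists (fun z => mu * - U1 (- z)), (fun z => mu * U2 (- z)). intros z Hz.
    destruct (HU (- z) ltac:(lra)) as (H1 & H2 & H3).
    split; [now apply derivable_pt_lim_reflect_scale|]. split.
    + assert (H4 := derivable_pt_lim_reflect_scale U1 (- mu) z _ H2).
      replace (fun z => mu * - U1 (- z)) with (fun z => - mu * U1 (- z)) by (apply functional_extensionality; intros; ring).
      replace (mu * U2 (- z)) with (- mu * - U2 (- z)) by ring. exact H4.
    + replace (mu * U (- z) / mu) with (U (- z)) by (field; lra).
      replace (D * (mu * U2 (- z)) + mu * g (U (- z))) with (mu * (D * U2 (- z) + g (U (- z)))) by ring. rewrite H3. ring.
  - exists (mu * - dU). rewrite Ropp_0. split.
    + apply (has_right_deriv_scal (fun s => U (- s))). now apply (left_right_deriv U).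
    + replace (- (D / mu) * (mu * - dU)) with (D * dU) by (field; lra). exact A3.
  - intros z Hz. apply Rmult_lt_0_compat; [assumption|]. apply Up. lra.
  - exists (mu * M). intros z Hz. apply Rmult_le_compat_l; [lra|]. apply HM. lra.
  - exists (fun z => nu * V1 z), (fun z => nu * V2 z). intros z Hz. destruct (HV z Hz) as (H1 & H2 & H3).
    split; [now apply derivable_pt_lim_scal|]. split; [now apply derivable_pt_lim_scal|].
    replace (nu * V z / nu) with (V z) by (field; lra).
    replace (d * (nu * V2 z) + nu * f (V z)) with (nu * (d * V2 z + f (V z))) by ring. rewrite H3. ring.
  - exists (nu * dV). rewrite Ropp_0. split; [now apply has_right_deriv_scal|].
    replace (- (d / nu) * (nu * dV)) with (- d * dV) by (field; lra). exact A4.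
  - intros z Hz. apply Rmult_lt_0_compat; [assumption|]. now apply Vp.
  - exists (nu * M). intros z Hz. apply Rmult_le_compat_l; [lra|]. now apply HM.
Qed.

Lemma steady_xN_of_pair (D d mu nu : R) (g f : R -> R) (W : bool -> R -> R) : 0 < mu -> 0 < nu ->
  steady_pair (pair_of D d) (pair_of (D / mu) (d / nu)) (scaled_reaction mu nu g f) W ->
  steady_xN D d mu nu g f (fun z => / mu * W true (- z)) (fun z => / nu * W false z).
Proof.
  intros Hmu Hnu HW.
  assert (Hmi : 0 < / mu) by now apply Rinv_0_lt_compat. assert (Hni : 0 < / nu) by now apply Rinv_0_lt_compat.
  destruct (HW true) as ((U1 & U2 & HU) & (pu & Hpu & Epu) & Up & (Mu & HMu)).
  destruct (HW false) as ((V1 & V2 & HV) & (pv & Hpv & Epv) & Vp & (Mv & HMv)).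
  simpl in *. unfold scaled_reaction in *.
  split; [|split; [|split; [|split]]].
  - exists (fun z => / mu * - U1 (- z)), (fun z => / mu * U2 (- z)), (fun z => / nu * V1 z), (fun z => / nu * V2 z). split.
    + intros z Hz. destruct (HU (- z) ltac:(lra)) as (H1 & H2 & H3).
      split; [now apply derivable_pt_lim_reflect_scale|]. split.
      * assert (H4 := derivable_pt_lim_reflect_scale U1 (- / mu) z _ H2).
        replace (fun z => / mu * - U1 (- z)) with (fun z => - / mu * U1 (- z)) by (apply functional_extensionality; intros; ring).
        replace (/ mu * U2 (- z)) with (- / mu * - U2 (- z)) by ring. exact H4.
      * apply Rmult_eq_reg_l with mu; [|lra]. rewrite Rmult_0_r, <- H3.
        replace (/ mu * W true (- z)) with (W true (- z) / mu) by (unfold Rdiv; ring). field. lra.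
    + intros z Hz. destruct (HV z Hz) as (H1 & H2 & H3).
      split; [now apply derivable_pt_lim_scal|]. split; [now apply derivable_pt_lim_scal|].
      apply Rmult_eq_reg_l with nu; [|lra]. rewrite Rmult_0_r, <- H3.
      replace (/ nu * W false z) with (W false z / nu) by (unfold Rdiv; ring). field. lra.
  - exists (- (/ mu * pu)), (/ nu * pv). rewrite Ropp_0. split; [|split; [|split]].
    + apply (left_right_deriv (fun z => / mu * W true (- z))).
      replace (fun s => / mu * W true (- - s)) with (fun s => / mu * W true s)
        by (apply functional_extensionality; intros; now rewrite Ropp_involutive).
      rewrite Ropp_involutive. now apply has_right_deriv_scal.
    + now apply has_right_deriv_scal.
    + replace (nu * (/ nu * W false 0) - mu * (/ mu * W true 0)) with (W false 0 - W true 0) by (field; lra).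
      rewrite <- Epu. field. lra.
    + replace (mu * (/ mu * W true 0) - nu * (/ nu * W false 0)) with (W true 0 - W false 0) by (field; lra).
      rewrite <- Epv. field. lra.
  - intros z Hz. apply Rmult_lt_0_compat; [assumption|]. apply Up. lra.
  - intros z Hz. apply Rmult_lt_0_compat; [assumption|]. now apply Vp.
  - exists (Rmax (/ mu * Mu) (/ nu * Mv)). intros z. split; intros Hz.
    + eapply Rle_trans; [|apply Rmax_l]. apply Rmult_le_compat_l; [lra|]. apply HMu. lra.
    + eapply Rle_trans; [|apply Rmax_r]. apply Rmult_le_compat_l; [lra|]. now apply HMv.
Qed.

Theorem theorem2p8 (N : nat) (D d mu nu : R) (g f : R -> R) (g1 f1 S : R)
  (i : nat) (u0 v0 : (tang N -> R) -> R -> R) (u v : (tang N -> R) -> R -> R -> R) :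
  (2 <= N)%nat -> 0 < D -> 0 < d -> 0 < mu -> 0 < nu ->
  KPP_g g g1 -> KPP_f f f1 S ->
  (1 <= i <= N - 1)%nat ->
  admissible_data u0 v0 ->
  solves_H N D d mu nu g f u0 v0 u v ->
  (* (i) *)
  (forall c, c_star_inf D d f1 g1 < c -> forall eps, 0 < eps ->
     exists T, forall t, T < t -> forall y z, c * t <= Rabs (coord y (i - 1)) ->
       (z <= 0 -> Rabs (u y z t) < eps) /\ (0 <= z -> Rabs (v y z t) < eps)) /\
  (* the x_N-only positive bounded steady state exists *)
  (exists U V, steady_xN D d mu nu g f U V) /\
  (* (ii) *)
  (forall U V, steady_xN D d mu nu g f U V ->
   forall c, 0 < c < c_star_inf D d f1 g1 -> forall R0 eps, 0 < R0 -> 0 < eps ->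
     exists T, forall t, T < t -> forall y z,
       Rabs (coord y (i - 1)) <= c * t ->
       (forall j, (j < N - 1)%nat -> j <> (i - 1)%nat -> Rabs (coord y j) <= R0) ->
       Rabs z <= R0 ->
       (z <= 0 -> Rabs (u y z t - U z) < eps) /\ (0 <= z -> Rabs (v y z t - V z) < eps)).
Proof.
  intros HN HD Hd Hmu Hnu Hg Hf Hi Hdata Hsol.
  assert (Hii : (i - 1 < N - 1)%nat) by lia. set (ii := (i - 1)%nat) in *.
  (* The hypothesis on [g] is the one on [f] with saturation level 1, so the two species can be
     indexed by a boolean. *)
  assert (Hgf : KPP_f g g1 1).
  { destruct Hg as (G1 & G2 & G3 & G4 & G5 & G6). repeat split; auto; try lra; apply G5; assumption. }
  set (Dk := pair_of D d). set (ak := pair_of (D / mu) (d / nu)). set (F := scaled_reaction mu nu g f).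
  set (l := pair_of g1 f1). set (Sk := pair_of (mu * 1) (nu * S)).
  assert (HDk : forall k, 0 < Dk k) by (intros []; assumption).
  assert (Hak : forall k, 0 < ak k) by (intros []; apply Rdiv_lt_0_compat; assumption).
  assert (HF : forall k, KPP_f (F k) (l k) (Sk k)) by (intros []; now apply KPP_f_scale).
  set (w := reflected mu nu u v).
  assert (Hw : coupled N Dk ak F w) by exact (coupled_reflected N D d mu nu g f u0 v0 u v Hmu Hnu Hsol).
  destruct Hsol as (_ & _ & _ & _ & _ & Hu0 & Hv0 & Hbd).
  assert (Hlb : locally_bounded w).
  { intros T HT. destruct (Hbd T HT) as [M HM]. exists (Rmax (mu * M) (nu * M)). intros k y z t Hz Ht.
    destruct k; simpl; rewrite Rabs_mult, (Rabs_pos_eq mu) || rewrite Rabs_mult, (Rabs_pos_eq nu); try lra.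
    - eapply Rle_trans; [|apply Rmax_l]. apply Rmult_le_compat_l; [lra|]. apply (HM y (- z) t Ht). lra.
    - eapply Rle_trans; [|apply Rmax_r]. apply Rmult_le_compat_l; [lra|]. now apply (HM y z t Ht). }
  destruct Hdata as (Hu0p & Hv0p & _ & _ & (M0 & HM0) & (R1 & HR1 & Hsupp) & Hnz).
  assert (Hw0u : forall y z, 0 <= z -> w true y z 0 = mu * u0 y (- z)).
  { intros y z Hz. unfold w, reflected. rewrite Hu0; lra. }
  assert (Hw0v : forall y z, 0 <= z -> w false y z 0 = nu * v0 y z).
  { intros y z Hz. unfold w, reflected. rewrite Hv0; lra. }
  assert (Hw0p : forall k y z, 0 <= z -> 0 <= w k y z 0).
  { intros [] y z Hz; [rewrite Hw0u by lra; apply Rmult_le_pos; [lra|apply Hu0p; lra]|].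
    rewrite Hw0v by lra. apply Rmult_le_pos; [lra|now apply Hv0p]. }
  assert (Hnn := solution_nonneg N Dk ak l Sk F w HN HDk Hak HF Hw Hlb Hw0p).
  assert (Hf1 : 0 < f1) by apply (KPP_f_rate_pos _ _ _ Hf). assert (Hg1 : 0 < g1) by apply (KPP_f_rate_pos _ _ _ Hgf).
  destruct (critical_speed_decomposition D d f1 g1 HD Hd Hf1 Hg1)
    as (al & tt & tf & Hal & Htt & Htf & Ht1 & Hgr & Ecs & Hc1 & Hc2).
  set (cs := c_star_inf D d f1 g1) in *.
  destruct (convergence N Dk ak l Sk F HN HDk Hak HF) as [W [HW Hconv]].
  split; [|split].
  - intros c Hc eps Heps.
    set (M := Rmax (mu * M0) (nu * M0)).
    destruct (beyond_front N ii Dk ak l Sk F w al cs (Rabs M + 1) R1 HN Hii HDk Hak HF Hw Hlb Hal) with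
      (c := c) (eps := Rmin (mu * eps) (nu * eps)) as [T HT]; auto.
    + intros []; simpl; lra.
    + pose proof (Rabs_pos M). lra.
    + intros k y z Hz. pose proof (Rle_abs M).
      pose proof (Rmax_l (mu * M0) (nu * M0)). pose proof (Rmax_r (mu * M0) (nu * M0)). fold M in H0, H1.
      destruct k; [rewrite Hw0u by lra|rewrite Hw0v by lra].
      * destruct (HM0 y (- z)) as [H2 _]. specialize (H2 ltac:(lra)). apply Rabs_le_between in H2.
        assert (mu * u0 y (- z) <= mu * M0) by (apply Rmult_le_compat_l; lra). lra.
      * destruct (HM0 y z) as [_ H2]. specialize (H2 Hz). apply Rabs_le_between in H2.
        assert (nu * v0 y z <= nu * M0) by (apply Rmult_le_compat_l; lra). lra.
    + intros k y z Hz Hy. rewrite (coord_lt y ii Hii) in Hy.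
      destruct k; [rewrite Hw0u by lra|rewrite Hw0v by lra].
      * destruct (Hsupp y (- z)) as [H1 _]; [right; eexists; exact Hy|]. rewrite H1; lra.
      * destruct (Hsupp y z) as [_ H1]; [right; eexists; exact Hy|]. rewrite H1; lra.
    + apply Rmin_glb_lt; apply Rmult_lt_0_compat; lra.
    + exists (Rmax T 0). intros t Ht y z Hy.
      pose proof (Rmax_l T 0). pose proof (Rmax_r T 0).
      pose proof (Rmin_l (mu * eps) (nu * eps)). pose proof (Rmin_r (mu * eps) (nu * eps)).
      split; intros Hz.
      * assert (H3 := HT t ltac:(lra) true y (- z) Hy ltac:(lra)).
        assert (H4 := proj2 Hnn true y (- z) t ltac:(lra) ltac:(lra)).
        unfold w, reflected in H3, H4. rewrite Ropp_involutive in H3, H4.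
        apply Rabs_def1; apply Rmult_lt_reg_l with mu; lra.
      * assert (H3 := HT t ltac:(lra) false y z Hy Hz).
        assert (H4 := proj2 Hnn false y z t Hz ltac:(lra)).
        unfold w, reflected in H3, H4.
        apply Rabs_def1; apply Rmult_lt_reg_l with nu; lra.
  - exists (fun z => / mu * W true (- z)), (fun z => / nu * W false z). now apply steady_xN_of_pair.
  - intros U V HUV c Hc R0 eps HR0 Heps.
    (* The statement concerns an arbitrary steady state [(U, V)]; uniqueness identifies it with the
       constructed limit [W]. *)
    assert (Huniq := steady_unique N Dk ak F W _ Hconv (steady_pair_of_xN D d mu nu g f U V Hmu Hnu HUV)).
    destruct (solution_bounded N Dk ak l Sk F w HN HDk Hak HF Hw Hlb) as [Mg HMg].
    assert (Hball : exists k0 yi zi ri Ai, 0 < ri <= zi /\ 0 < Ai /\ ball_ge w k0 yi zi ri 0 Ai).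
    { assert (Hex : exists k y z, 0 <= z /\ 0 < w k y z 0).
      { apply NNPP. intros Hn. apply Hnz. split; intros y z Hz.
        - apply Rle_antisym; [|now apply Hu0p]. apply Rnot_lt_le. intros Hp. apply Hn. exists true, y, (- z).
          split; [lra|]. rewrite Hw0u, Ropp_involutive by lra. now apply Rmult_lt_0_compat.
        - apply Rle_antisym; [|now apply Hv0p]. apply Rnot_lt_le. intros Hp. apply Hn. exists false, y, z.
          split; [lra|]. rewrite Hw0v by lra. now apply Rmult_lt_0_compat. }
      destruct Hex as (k & y & z & Hz & Hp). exists k, y. apply initial_ball with z; auto. apply Hw. }
    destruct Hball as (k0 & yi & zi & ri & Ai & Hri & HAi & Hball).
    assert (Hspeeds : forall c, 0 < c < cs -> exists th V : bool -> R,
      (forall k, 0 <= th k) /\ (forall k, 0 <= V k) /\ th true + th false = 1 /\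
      c < th true * V true + th false * V false /\
      0 < th true * (l true - V true ^ 2 / (4 * Dk true)) + th false * (l false - V false ^ 2 / (4 * Dk false))).
    { intros c' Hc'. set (th := pair_of tt tf).
      assert (Hth : forall k, 0 <= th k) by (intros []; assumption).
      destruct (mixed_speeds Dk l th al HDk Hal Hth Ht1 Hgr c' ltac:(rewrite Ecs in Hc'; exact Hc')) as (Vs & V1 & V2 & V3).
      exists th, Vs. auto. }
    assert (Htr : trapped (behind_front ii cs) w).
    { split.
      - exists Mg. intros L HL c' R' Hc' HR'. exists 0. intros t y Ht _ _ k z Hz. apply HMg; lra.
      - intros L HL.
        destruct (front_uniform_lower_bound N ii Dk ak l Sk F cs w k0 yi zi ri Ai HN Hii HDk Hak HF Hspeeds Hnn Hri HAi Hball L HL)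
          as [dl [Hdl H]].
        exists dl. split; [assumption|]. exact H. }
    assert (Hmi : 0 < Rmin (mu * eps) (nu * eps)) by (apply Rmin_glb_lt; apply Rmult_lt_0_compat; lra).
    (* The minimum undoes the two scalings, and the half turns the non-strict bound of
       [converges_to] into a strict one. *)
    destruct (Hconv _ w (behind_front_filter N ii cs Hii ltac:(lra)) Hnn Htr (Rmin (mu * eps) (nu * eps) / 2) R0
      ltac:(lra) HR0 c R0 Hc HR0) as [T HT].
    exists T. intros t Ht y z Hy Hyj Hz. specialize (HT t y Ht Hy Hyj).
    pose proof (Rmin_l (mu * eps) (nu * eps)). pose proof (Rmin_r (mu * eps) (nu * eps)).
    apply Rabs_le_between in Hz. split; intros Hz0.
    + assert (H1 := HT true (- z) ltac:(lra)). rewrite <- (Huniq true (- z) ltac:(lra)) in H1.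
      unfold w, reflected in H1. rewrite Ropp_involutive in H1.
      replace (mu * u y z t - mu * U z) with (mu * (u y z t - U z)) in H1 by ring.
      rewrite Rabs_mult, (Rabs_pos_eq mu) in H1 by lra.
      apply Rmult_lt_reg_l with mu; lra.
    + assert (H1 := HT false z ltac:(lra)). rewrite <- (Huniq false z Hz0) in H1.
      unfold w, reflected in H1.
      replace (nu * v y z t - nu * V z) with (nu * (v y z t - V z)) in H1 by ring.
      rewrite Rabs_mult, (Rabs_pos_eq nu) in H1 by lra.
      apply Rmult_lt_reg_l with nu; lra.
Qed.
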